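(* Let $S = O_{12}^+(2) = \Omega^+(12,2)$ and $G = \mathrm{Aut}(S) = S.2 = \mathrm{SO}^+(12,2)$. Let $s \in S$ be of the type $4^- \perp 8^-$ and of order $85$. Then the following hold. (a) $\mathcal{M}(S,s)$ consists of one group of the type $(\Omega^-(4,2) \times \Omega^-(8,2)).2$ and two groups of the type $L_4(4).2^2 = \Omega^+(6,4).2^2$ that are conjugate in $G$ but not conjugate in $S$. (b) $\sigma(S,s) = 7675/1031184$. (c) $\sigma'(G,s) = 73/1008$.
   Context: That $s$ is of type $4^- \perp 8^-$ means that $s$ decomposes the natural $12$-dimensional module over $\mathbb{F}_2$ for $\mathrm{GO}^+(12,2) = S.2$ into an orthogonal sum of two irreducible modules of dimensions $4$ and $8$, respectively (both of minus type). For a finite nonabelian simple group $S$ let $S^\times = S \setminus \{1\}$. For $s \in S^\times$, $\mathcal{M}(S,s)$ is the set of all maximal subgroups of $S$ containing $s$. For $M \le S$, $1_M^S$ is the permutation character of $S$ on the right cosets of $M$. For $g \in S^\times$ set $\sigma(g,s) = \sum_{M \in \mathcal{M}(S,s)} 1_M^S(g)/1_M^S(1)$ and $\sigma(S,s) = \max\{\sigma(g,s) : g \in S^\times\}$. For an almost simple group $H$ with socle $S$ and $[H:S]$ prime, and $s \in S^\times$, let $\mathcal{M}'(H,s)$ be the set of maximal subgroups of $H$ containing $s$, other than $S$; then $\sigma'(H,s)$ is the maximum of $\sum_{M \in \mathcal{M}'(H,s)} 1_M^H(g)/1_M^H(1)$ over all $g \in H \setminus S$ of order $[H:S]$. $A.B$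 denotes an extension with normal subgroup $A$ and quotient $B$; $L_4(4) = \mathrm{PSL}(4,4)$; $2^2$ is the Klein four group; $\mathrm{SO}^+(12,2)$ denotes the full isometry group $\mathrm{GO}^+(12,2)$ of the quadratic form, containing $\Omega^+(12,2)$ with index $2$. *)

(* Defs.v *)
From HB Require Import structures.
From mathcomp Require Import all_boot all_order all_algebra.
From mathcomp Require Import all_fingroup all_solvable all_field all_character.

Set Implicit Arguments.
Unset Strict Implicit.
Unset Printing Implicit Defensive.

Import Order.TTheory GRing.Theory Num.Theory.
Local Open Scope ring_scope.

(* Quadratic forms on F^n are given as functions Q : 'rV[F]_n -> F, and       *)
(* matrices act on row vectors from the right.                                *)

Definition polar (F : fieldType) n (Q : 'rV[F]_n -> F) (u v : 'rV[F]_n) : F :=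
  Q (u + v) - Q u - Q v.

(* The standard form of plus type on F^(2m): v = (x, y) |-> \sum_i x_i y_i.   *)
Definition Qplus (F : fieldType) m (v : 'rV[F]_(m + m)) : F :=
  \sum_(i < m) v 0 (lshift m i) * v 0 (rshift m i).

(* The standard form of minus type on F_2^(2m): the form \sum_i x_i y_i       *)
(* with the hyperbolic plane x_0 y_0 replaced by x_0^2 + x_0 y_0 + y_0^2,     *)
(* which is anisotropic because X^2 + X + 1 is irreducible over F_2.          *)
Definition Qminus m (v : 'rV['F_2]_(m + m)) : 'F_2 :=
  Qplus v + \sum_(i < m | i == 0%N :> nat)
              (v 0 (lshift m i) ^+ 2 + v 0 (rshift m i) ^+ 2).

(* n.-1.+1 is the matrix dimension in {'GL_n[F]}; it is n itself for n > 0.   *)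
Section OrthogonalGroups.

Variables (F : finFieldType) (n : nat) (Q : 'rV[F]_(n.-1.+1) -> F).

Definition GO : {set {'GL_n[F]}} :=
  [set g : {'GL_n[F]} | [forall v, Q (v *m GLval g) == Q v]].

Lemma GO_group_set : group_set GO.
Proof.
apply/group_setP; split=> [|g h].
  by rewrite inE; apply/forallP=> v; rewrite GL_1E mulmx1.
rewrite !inE => /forallP Qg /forallP Qh; apply/forallP=> v.
by rewrite GL_MxE mulmxA (eqP (Qh _)) (eqP (Qg _)).
Qed.

Canonical GO_group := Group GO_group_set.

(* Omega is the commutator subgroup of the full isometry group. For the       *)
(* groups below (q even, nondegenerate, not of type Omega^+(4,2)) this is the *)
(* subgroup of index 2 in GO, the kernel of the Dickson invariant.            *)
Definition Omega : {set {'GL_n[F]}} := GO^`(1)%g.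

Canonical Omega_group := [group of Omega].

End OrthogonalGroups.

Arguments GO {F} n Q.
Arguments Omega {F} n Q.

Definition SL (F : finFieldType) n : {set {'GL_n[F]}} :=
  [set g : {'GL_n[F]} | \det (GLval g) == 1].

Lemma SL_group_set (F : finFieldType) n : group_set (SL F n).
Proof.
apply/group_setP; split=> [|g h]; first by rewrite inE GL_1E det1.
by rewrite !inE GL_MxE det_mulmx => /eqP-> /eqP->; rewrite mulr1.
Qed.

Canonical SL_group (F : finFieldType) n := Group (@SL_group_set F n).

Definition PSL (F : finFieldType) n : {set coset_of 'Z(SL F n)} :=
  (SL F n / 'Z(SL F n))%g.

Definition F4 : finFieldType :=
  s2val (@pPrimePowerField 2 2 isT isT).

Lemma card_F4 : #|F4| = 4%N.
Proof. exact: s2valP' (@pPrimePowerField 2 2 isT isT). Qed.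

Definition GOp12 := GO 12 (@Qplus 'F_2 6).
Definition Op12 := Omega 12 (@Qplus 'F_2 6).
Definition Om4 := Omega 4 (@Qminus 2).
Definition Om8 := Omega 8 (@Qminus 4).
Definition Op6_4 := Omega 6 (@Qplus F4 3).
Definition L4_4 := PSL F4 4.

Section Subspaces.

(* Subspaces of F^n are row spaces of square matrices.                        *)
Variables (F : finFieldType) (n : nat) (Q : 'rV[F]_n -> F).

Definition orthogonal_spaces (U W : 'M[F]_n) : Prop :=
  forall u w : 'rV[F]_n, (u <= U)%MS -> (w <= W)%MS -> polar Q u w = 0.

Definition nondegenerate_on (U : 'M[F]_n) : Prop :=
  forall u : 'rV[F]_n, (u <= U)%MS ->
    (forall w : 'rV[F]_n, (w <= U)%MS -> polar Q u w = 0) -> u = 0.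

Definition totally_singular (X : 'M[F]_n) : bool :=
  [forall v : 'rV[F]_n, (v <= X)%MS ==> (Q v == 0)].

Definition witt_index (U : 'M[F]_n) : nat :=
  \max_(X : 'M[F]_n | (X <= U)%MS && totally_singular X) \rank X.

(* Minus type: nondegenerate of dimension 2m and Witt index m - 1.            *)
Definition minus_type (U : 'M[F]_n) : Prop :=
  nondegenerate_on U /\ \rank U = ((witt_index U).+1).*2.

End Subspaces.

(* The natural module of the full linear group, restricted to <[s]>; note     *)
(* that GLrepr F n is the representation of 'GL_n.+1[F].                      *)
Definition natural_repr (F : finFieldType) n (s : {'GL_n.+1[F]}) :=
  subg_repr (GLrepr F n) (subsetT <[s]>%g).

Definition type_4m_8m (s : {'GL_12['F_2]}) : Prop :=
  exists U W : 'M['F_2]_12,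
    [/\ [/\ \rank U = 4%N, mxsimple (natural_repr s) U
          & minus_type (@Qplus 'F_2 6) U],
        [/\ \rank W = 8%N, mxsimple (natural_repr s) W
          & minus_type (@Qplus 'F_2 6) W],
        orthogonal_spaces (@Qplus 'F_2 6) U W,
        mxdirect (U + W)
      & (U + W :=: 1%:M)%MS].

Section Sigma.

Variable gT : finGroupType.
Implicit Types (S H M : {set gT}) (g s : gT).

(* 1_M^S(g): the number of right cosets of M in S fixed by g.                 *)
Definition permchar S M g : nat := #|'Fix_(rcosets M S | 'Rs)[g]|%g.

Definition maxsubs S s : {set {group gT}} :=
  [set M : {group gT} | maximal M S & s \in M].

(* The maxima below are over nonnegative rationals, so 0 is a harmless        *)
(* default for the empty range.                                               *)
Definition sigma_at S s g : rat :=
  \sum_(M in maxsubs S s) (permchar S M g)%:R / (permchar S M 1%g)%:R.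

Definition sigma S s : rat := \big[Num.max/0]_(g in S^#%g) sigma_at S s g.

(* H is almost simple with socle S of prime index.                            *)
Definition maxsubs' H S s : {set {group gT}} :=
  [set M in maxsubs H s | M :!=: S].

Definition sigma'_at H S s g : rat :=
  \sum_(M in maxsubs' H S s) (permchar H M g)%:R / (permchar H M 1%g)%:R.

Definition sigma' H S s : rat :=
  \big[Num.max/0]_(g in H :\: S | #[g]%g == #|H : S|%g) sigma'_at H S s g.

End Sigma.

(* M has structure (Omega^-(4,2) x Omega^-(8,2)).2.                           *)
Definition type_Om4xOm8_2 (gT : finGroupType) (M : {group gT}) : Prop :=
  exists N : {group gT},
    [/\ (N <| M)%g, (N \isog setX Om4 Om8)%g & #|M / N|%g = 2%N].

(* M has structure L_4(4).2^2 = Omega^+(6,4).2^2.                             *)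
Definition type_L44_2_2 (gT : finGroupType) (M : {group gT}) : Prop :=
  exists N : {group gT},
    [/\ (N <| M)%g, (N \isog L4_4)%g, (N \isog Op6_4)%g
      & (M / N \isog [set: 'Z_2 * 'Z_2])%g].

(* Main.v *)
(* All groups act on V = F_2^12 by row vectors. Write s = x y with y of order *)
(* 5 acting on the 4-space U and x of order 17 acting on the 8-space W; after *)
(* replacing x by a power the pair (x, y) is unique up to isometry, so it may *)
(* be taken to be a fixed pair of integer-coded matrices.                     *)
(*                                                                            *)
(* Maximal subgroups. Let eps be the projection on U along W. If g lies in an *)
(* overgroup H of <s>, then either eps g eps commutes with y + y^-1 up to     *)
(* eps, or a short word in y and y^g is a 3-cycle on the five singular        *)
(* vectors of U permuted by y (a finite check). A 3-cycle t_a t_b in H        *)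
(* spreads, by the relation [t_a t_b in H] on nonsingular vectors, to all of  *)
(* Omega unless H stabilises U. In the other case the commutation sign is     *)
(* multiplicative on H and extends to one of two F_4-structures om = theta +  *)
(* lambda on V, normalised by H.                                              *)
(*                                                                            *)
(* Fixed point ratios. They are |{h in G : h g h^-1 in M}| / |G|. Elements g  *)
(* with rank (g - 1) <= 2 are products of at most two transvections or have a *)
(* totally singular image; their ratios are counted on pairs of vectors, and  *)
(* the maximum is reached at t_a t_b with a, b orthogonal (at t_a outside     *)
(* Omega). For larger rank the conjugates stabilising U are counted by their  *)
(* action on the five singular vectors, and the conjugates of om commuting    *)
(* with g by choosing the images of a basis one at a time.                    *)
From HB Require Import structures.
Require Import Defs.
From mathcomp Require Import all_boot all_order all_algebra.
From mathcomp Require Import all_fingroup all_solvable all_field all_character.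
From mathcomp Require Import ring zify.
From Stdlib Require PeanoNat.

Set Implicit Arguments.
Unset Strict Implicit.
Unset Printing Implicit Defensive.

Import Order.TTheory GRing.Theory Num.Theory.
Local Open Scope ring_scope.

(** Let V = F_2^12 with its form Q of plus type. The element s is a product of an element y of order
    5 acting on the 4-space U and an element x of order 17 acting on the 8-space W. Up to replacing
    x by a power, the pair (x, y) is unique up to isometry ([reduction]), so the problem becomes
    that of the subgroups containing two explicit matrices [gx] and [gy].

    Overgroups ([core]). Let H be a group of isometries containing both, and cut its elements into
    four blocks along V = U + W. If no element of H has a block from U to W, then H stabilises U.
    Otherwise consider the blocks from U to U. The five singular vectors of U are permuted
    cyclically by y; the isometries of U form S_5, with the transvections as transpositions, and
    theta = y + y^-1 generates a copy of F_4 acting on U. If some block is neither linear nor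
    semilinear over theta, a finite check shows that y and a conjugate of y generate a 3-cycle t_a
    t_b ([certs_ok], [covered], [partI]). The relation t_a t_b in H is an equivalence on nonsingular
    vectors, and [allD] shows that there is one class, so that H contains Omega ([Omega_sub]). If
    all blocks are linear or semilinear, this type is multiplicative ([sg_mul]), and the
    irreducibility of W under x carries theta over to W: H normalises one of two F_4-structures
    [om 0], [om 1] ([pure_om]). Explicit elements separate the candidates, which gives the three
    maximal subgroups of S and, apart from S, the single one of G ([maxsubs_model],
    [maxsubs'_model]).

    Their structure comes from V = U + W ([M1_type]), from restriction of scalars from F_4^6
    ([twN_type]), and from the exterior square SL(4,4) -> Omega^+(6,4) ([SL_isog]). An odd isometry
    [gf] of U interchanges the two field-structure groups; these are self-normalising in G and
    contained in S, so they are not conjugate in S ([twN_not_conj]).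

    Ratios. The quotient of character values is the proportion of x in the group with g^(x^-1) in M
    ([permchar_ratio]); the sum for S is (NE g + 2 NW g) / |G|. Passing to a power of g does not
    decrease it, so prime order suffices. If g - 1 has rank 2, then g is t_b t_a with a, b
    nonsingular, or g - 1 has a totally singular image; counting pairs of vectors gives the maximum
    (11318 + 2 2016) / (2016 1023) = 7675 / 1031184 for a, b orthogonal. If the rank is at least 4,
    counting images of the five singular vectors and counting F_4-structures gives less
    ([rank4_bound]). Outside S only the stabiliser of U counts: a transvection gives (10 + 136) /
    2016 = 73 / 1008, and larger odd rank gives no more ([sigma'_bound]). *)

Module QuadraticForms.

(* The general linear group enters only through this interface: unification    *)
(* over the concrete type {'GL_n[F]} keeps unfolding matrix operations.        *)
Record GLmodel (F : finFieldType) (m : nat) := MakeGLmodel {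
  GLsort :> finGroupType;
  gmx : GLsort -> 'M[F]_m.+1;
  gmx1 : gmx 1%g = 1%:M;
  gmxM : forall g h, gmx (g * h)%g = gmx g *m gmx h;
  gmx_inj : injective gmx;
  mkGL : 'M[F]_m.+1 -> GLsort;
  mkGLE : forall A, A \in unitmx -> gmx (mkGL A) = A
}.
Arguments gmx {F m} L g : rename.
Arguments mkGL {F m} L A : rename.

HB.lock Definition app (F : finFieldType) m (L : GLmodel F m) (v : 'rV[F]_m.+1) (g : L) :
  'rV[F]_m.+1 := v *m gmx L g.
Arguments app {F m L} v g.

(** * Groups of invertible matrices acting on row vectors *)

Section LinearAction.

Variables (F : finFieldType) (m : nat) (L : GLmodel F m).
Local Notation V := 'rV[F]_m.+1.
Local Notation gmx := (gmx L).
Implicit Types (u v w : V) (g h : L).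

Lemma appE v g : app v g = v *m gmx g. Proof. by rewrite app.unlock. Qed.

Lemma gmxKV g : gmx g *m gmx g^-1%g = 1%:M.
Proof. by rewrite -gmxM mulgV gmx1. Qed.

Lemma gmxVK g : gmx g^-1%g *m gmx g = 1%:M.
Proof. by rewrite -gmxM mulVg gmx1. Qed.

Lemma gmx_unit g : gmx g \in unitmx.
Proof. exact: (mulmx1_unit (gmxKV g)).1. Qed.

Lemma appM v g h : app v (g * h)%g = app (app v g) h.
Proof. by rewrite !appE gmxM mulmxA. Qed.

Lemma app1 v : app v (1%g : L) = v.
Proof. by rewrite !appE gmx1 mulmx1. Qed.

Lemma appK g : cancel (app^~ g) (app^~ g^-1%g).
Proof. by move=> v; rewrite -appM mulgV app1. Qed.

Lemma appKV g : cancel (app^~ g^-1%g) (app^~ g).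
Proof. by move=> v; rewrite -appM mulVg app1. Qed.

Lemma app_inj g : injective (app^~ g).
Proof. exact: can_inj (appK g). Qed.

Lemma appD u v g : app (u + v) g = app u g + app v g.
Proof. by rewrite !appE mulmxDl. Qed.

Lemma appZ c v g : app (c *: v) g = c *: app v g.
Proof. by rewrite !appE -scalemxAl. Qed.

Lemma app0 g : app 0 g = 0.
Proof. by rewrite !appE mul0mx. Qed.

Lemma gmx_eqP (A B : 'M[F]_m.+1) : (forall v : V, v *m A = v *m B) -> A = B.
Proof. by move=> eqAB; apply/row_matrixP=> i; rewrite !rowE. Qed.

Lemma app_eqP g h : (forall v, app v g = app v h) -> g = h.
Proof. by move=> eq_gh; apply/(@gmx_inj _ _ L)/gmx_eqP=> v; rewrite -!appE. Qed.

End LinearAction.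

Record quad_form (F : finFieldType) (m : nat) (Q : 'rV[F]_m.+1 -> F) : Prop := QuadForm {
  quadZ : forall c v, Q (c *: v) = c ^+ 2 * Q v;
  polarDl : forall u v w, polar Q (u + v) w = polar Q u w + polar Q v w;
  polarZl : forall c u w, polar Q (c *: u) w = c * polar Q u w;
  polar_nd : forall u, (forall w, polar Q u w = 0) -> u = 0
}.

(** In characteristic 2 this is the orthogonal transvection adding (B v a / Q a) a to v. It is
    called a reflection in the code and written t_a in the comments. *)
Definition refl_mx (F : finFieldType) m (Q : 'rV[F]_m.+1 -> F) a : 'M[F]_m.+1 :=
  1%:M + (\col_i (polar Q (delta_mx 0 i) a / Q a)) *m a.

HB.lock Definition refl (F : finFieldType) m (Q : 'rV[F]_m.+1 -> F)
  (L : GLmodel F m) a : L := mkGL L (refl_mx Q a).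
Canonical refl_unlockable := Unlockable refl.unlock.

(** * Quadratic spaces in characteristic 2: transvections and the parity of the rank *)

Section QuadSpace.

Variables (F : finFieldType) (m : nat) (Q : 'rV[F]_m.+1 -> F).
Hypothesis char2 : 2 \in [pchar F].
Hypothesis qQ : quad_form Q.
Variable L : GLmodel F m.
Local Notation V := 'rV[F]_m.+1.
Local Notation gmx := (gmx L).
Local Notation B := (polar Q).
Implicit Types (u v w a b : V) (g h : L).

Lemma addc2 (x : F) : x + x = 0.
Proof. exact: addrr_pchar2. Qed.

Lemma oppc2 (x : F) : - x = x.
Proof. exact: oppr_pchar2. Qed.

Lemma addc2v v : v + v = 0.
Proof. by apply/rowP=> i; rewrite !mxE addc2. Qed.

Lemma oppc2v v : - v = v.
Proof. by apply/rowP=> i; rewrite !mxE oppc2. Qed.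

Lemma quad0 : Q 0 = 0.
Proof. by rewrite -(scale0r 0) (quadZ qQ) expr0n mul0r. Qed.

Lemma polarC u v : B u v = B v u.
Proof. by rewrite /polar [u + v]addrC addrAC. Qed.

Lemma polarDr u v w : B w (u + v) = B w u + B w v.
Proof. by rewrite polarC (polarDl qQ) !(polarC w). Qed.

Lemma polarZr c u w : B w (c *: u) = c * B w u.
Proof. by rewrite polarC (polarZl qQ) !(polarC w). Qed.

Lemma polar0r u : B u 0 = 0.
Proof. by rewrite -(scale0r 0) polarZr mul0r. Qed.

Lemma polar0l u : B 0 u = 0.
Proof. by rewrite polarC polar0r. Qed.

Lemma quadD u v : Q (u + v) = Q u + Q v + B u v.
Proof. rewrite /polar; ring. Qed.

Lemma polarvv v : B v v = 0.
Proof. by rewrite /polar addc2v quad0 sub0r oppc2 addc2. Qed.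

Definition iso_set : {set L} := [set g : L | [forall v, Q (app v g) == Q v]].

Lemma iso_group_set : group_set iso_set.
Proof.
apply/group_setP; split=> [|g h]; first by rewrite inE; apply/forallP=> v; rewrite app1.
rewrite !inE => /forallP Qg /forallP Qh; apply/forallP=> v.
by rewrite appM (eqP (Qh _)) (eqP (Qg _)).
Qed.

Definition iso : {group L} := locked (Group iso_group_set).
Local Notation G := iso.

Lemma GO_P g : reflect (forall v, Q (app v g) = Q v) (g \in G).
Proof.
rewrite /iso -lock inE; apply: (iffP forallP) => [Qg v | Qg v]; first exact/eqP/Qg.
exact/eqP/Qg.
Qed.

Lemma GO_polar g u v : g \in G -> B (app u g) (app v g) = B u v.
Proof. by move/GO_P=> Qg; rewrite /polar -appD !Qg. Qed.

Lemma polar_sum (I : finType) (f : I -> V) w :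
  B (\sum_i f i) w = \sum_i B (f i) w.
Proof.
by elim/big_rec2: _ => [|i y1 y2 _ <-]; rewrite ?polar0l // (polarDl qQ).
Qed.

Local Notation refl_mx := (refl_mx Q).

Lemma mul_refl_mx v a : v *m refl_mx a = v + (B v a / Q a) *: a.
Proof.
rewrite mulmxDr mulmx1 mulmxA; congr (_ + _).
suff -> : v *m \col_i (B (delta_mx 0 i) a / Q a) = (B v a / Q a)%:M.
  by rewrite mul_scalar_mx.
apply/rowP=> i; rewrite !ord1 !mxE eqxx mulr1n {2}[v]row_sum_delta polar_sum.
by rewrite mulr_suml; apply: eq_bigr => j _; rewrite mxE (polarZl qQ) mulrA.
Qed.

Local Notation refl := (refl Q L).

Lemma refl_mxK a : Q a != 0 -> refl_mx a *m refl_mx a = 1%:M.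
Proof.
move=> nza; apply: gmx_eqP => v; rewrite mulmxA mulmx1 !mul_refl_mx.
rewrite (polarDl qQ) (polarZl qQ) polarvv mulr0 addr0.
by rewrite -addrA -scalerDl addc2 scale0r addr0.
Qed.

Lemma app_refl v a : Q a != 0 -> app v (refl a) = v + (B v a / Q a) *: a.
Proof.
move=> nza; rewrite !appE refl.unlock mkGLE ?mul_refl_mx //.
exact: (mulmx1_unit (refl_mxK nza)).1.
Qed.

Lemma gmx_refl a : Q a != 0 -> gmx (refl a) = refl_mx a.
Proof. by move=> nza; apply: gmx_eqP => v; rewrite -appE mul_refl_mx app_refl. Qed.

Lemma reflK a : Q a != 0 -> (refl a * refl a = 1)%g.
Proof. by move=> nza; apply: (@gmx_inj _ _ L); rewrite gmxM gmx1 gmx_refl // refl_mxK. Qed.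

Lemma reflV a : Q a != 0 -> (refl a)^-1%g = refl a.
Proof. by move=> nza; rewrite -[RHS]mulg1 -(mulgV (refl a)) mulgA reflK // mul1g. Qed.

Lemma refl_GO a : Q a != 0 -> refl a \in G.
Proof.
move=> nza; apply/GO_P=> v; rewrite app_refl // quadD (quadZ qQ) polarZr.
rewrite expr2 -!mulrA mulVf // mulr1 -addrA -mulrDr.
by rewrite addc2 mulr0 addr0.
Qed.

Lemma refl_conj a g : g \in G -> Q a != 0 -> (refl a ^ g = refl (app a g))%g.
Proof.
move=> Gg nza; have nzag : Q (app a g) != 0 by rewrite (GO_P _ Gg).
apply: app_eqP => v; rewrite conjgE !appM !app_refl // appD appZ appKV.
by rewrite (GO_P _ Gg) -(GO_polar (app v g^-1%g) a Gg) appKV.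
Qed.

Definition refl_group : {group L} := <<[set refl a | a : V & Q a != 0]>>%G.

Lemma refl_in a : Q a != 0 -> refl a \in refl_group.
Proof. by move=> nza; apply/mem_gen/imset_f; rewrite inE. Qed.

Lemma refl_group_sub : refl_group \subset G.
Proof. by rewrite gen_subG; apply/subsetP=> g /imsetP[a]; rewrite inE => nza ->; apply: refl_GO. Qed.

(** As [Q u = Q v], both [Q (u + v)] and [B u (u + v)] equal [B u v], so the transvection adds
    exactly one copy of [u + v] to [u]. *)
Lemma refl_swap u v : Q u = Q v -> B u v != 0 ->
  Q (u + v) != 0 /\ app u (refl (u + v)) = v.
Proof.
move=> Quv nzB; have Qd : Q (u + v) = B u v by rewrite quadD Quv addc2 add0r.
split; first by rewrite Qd.
rewrite app_refl ?Qd // polarDr polarvv add0r divff // scale1r addrA addc2v.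
by rewrite add0r.
Qed.

Lemma refl_fix a v : Q a != 0 -> B v a = 0 -> app v (refl a) = v.
Proof. by move=> nza Bva; rewrite app_refl // Bva mul0r scale0r addr0. Qed.

Definition rk1 g := \rank (gmx g - 1%:M).

Lemma app_rk1 v g : v *m (gmx g - 1%:M) = app v g - v.
Proof. by rewrite mulmxBr mulmx1 appE. Qed.

Lemma polar_gram : exists2 J : 'M[F]_m.+1, J \in unitmx
  & forall u v, B u v = (u *m J *m v^T) 0 0.
Proof.
pose J : 'M[F]_m.+1 := \matrix_(i, j) B (delta_mx 0 i) (delta_mx 0 j).
have JE u v : B u v = (u *m J *m v^T) 0 0.
  rewrite {1}[u]row_sum_delta polar_sum mxE.
  transitivity (\sum_i \sum_j u 0 i * v 0 j * J i j).
    apply: eq_bigr => i _; rewrite (polarZl qQ) polarC {1}[v]row_sum_delta polar_sum mulr_sumr.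
    by apply: eq_bigr => j _; rewrite (polarZl qQ) mxE polarC mulrA.
  rewrite exchange_big /=; apply: eq_bigr => j _; rewrite !mxE mulr_suml.
  by apply: eq_bigr => i _; rewrite mulrAC.
exists J => //; rewrite -row_free_unit -kermx_eq0; apply/eqP/row_matrixP=> i.
rewrite row0; apply: (polar_nd qQ) => w; rewrite JE.
have /sub_kermxP-> : (row i (kermx J) <= kermx J)%MS by apply: row_sub.
by rewrite mul0mx mxE.
Qed.

(** The image of g - 1 is orthogonal to the fixed space because g is an isometry. The orthogonal
    complement of the fixed space has the same dimension as the image, so the two coincide. *)
Lemma im_perp_ker g a : g \in G ->
  (forall v, app v g = v -> B a v = 0) -> (a <= gmx g - 1%:M)%MS.
Proof.
move=> Gg perp_a; have [J uJ JE] := polar_gram.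
pose N := gmx g - 1%:M; pose K := kermx N; pose P := kermx (J *m K^T).
have fixK i : app (row i K) g = row i K.
  have : row i K *m N = 0 by apply/sub_kermxP; apply: row_sub.
  by rewrite app_rk1 => /eqP; rewrite subr_eq0 => /eqP.
have sNP : (N <= P)%MS.
  apply/row_subP=> i; apply/sub_kermxP/rowP=> j; rewrite !mxE.
  transitivity (B (row i N) (row j K)).
    rewrite JE -mulmxA mxE; apply: eq_bigr => k _; congr (_ * _).
    by rewrite !mxE; apply: eq_bigr => l _; rewrite !mxE.
  rewrite rowE app_rk1 oppc2v (polarDl qQ).
  by rewrite -{1}(fixK j) (GO_polar _ _ Gg) addc2.
have rP : \rank P = \rank N.
  rewrite mxrank_ker -mxrank_tr trmx_mul trmxK mxrankMfree; last first.
    by rewrite row_free_unit unitmx_tr.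
  by rewrite mxrank_ker subKn // rank_leq_row.
have sPN : (P <= N)%MS by rewrite -(geq_leqif (mxrank_leqif_sup sNP)) rP.
apply: submx_trans sPN; apply/sub_kermxP/rowP=> j.
rewrite [RHS]mxE -[RHS](perp_a _ (fixK j)) JE mulmxA !mxE.
by apply: eq_bigr => k _; rewrite !mxE.
Qed.

(** The rank of g - 1 drops by one if [a] lies in the image of g - 1 and grows by one otherwise. Its
    parity is the Dickson invariant. *)
Lemma rk1_refl g a : g \in G -> Q a != 0 ->
  odd (rk1 (g * refl a)%g) = ~~ odd (rk1 g).
Proof.
move=> Gg nza; rewrite /rk1 gmxM gmx_refl //.
set N := gmx g - 1%:M; set N' := _ - 1%:M.
have NE v : v *m N = app v g - v by apply: app_rk1.
have N'E v : v *m N' = v *m N + (B (app v g) a / Q a) *: a.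
  by rewrite NE mulmxBr mulmx1 mulmxA -appE mul_refl_mx addrAC.
have rkE (A : 'M[F]_m.+1) : \rank A = (m.+1 - \rank (kermx A))%N.
  by rewrite mxrank_ker subKn // rank_leq_row.
have sNN' : (N <= N' + a)%MS.
  apply/row_subP=> i; rewrite rowE.
  have -> : delta_mx 0 i *m N = delta_mx 0 i *m N' - (B (app (delta_mx 0 i) g) a / Q a) *: a.
    by rewrite N'E addrK.
  by apply: addmx_sub_adds; rewrite ?submxMl // -scaleNr scalemx_sub.
have sN'N : (N' <= N + a)%MS.
  apply/row_subP=> i; rewrite rowE N'E.
  by apply: addmx_sub_adds; rewrite ?submxMl // scalemx_sub.
have leS (A C : 'M[F]_m.+1) : (A <= C + a)%MS -> (\rank A <= (\rank C).+1)%N.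
  move=> /mxrankS /leq_trans-> //; apply: leq_trans (mxrank_adds_leqif _ _) _.
  by rewrite -[(\rank C).+1]addn1; apply: leq_add => //; apply: rank_leq_row.
have kerP (A : 'M[F]_m.+1) v : (v <= kermx A)%MS = (v *m A == 0).
  exact/sub_kermxP/eqP.
have [aN | aN] := boolP (a <= N)%MS.
  have [w aE] := submxP aN.
  (* This follows from [w g = w + a] and [Q (w g) = Q w]. Hence [w], which [g] moves, is fixed by
     [g * refl a], and the fixed space grows. *)
  have Bwa : B w a = Q a.
    have : Q (app w g) = Q w by apply/GO_P.
    have -> : app w g = w + a by rewrite aE NE addrC subrK.
    rewrite quadD -addrA => /(canRL (addKr _)); rewrite addNr => /eqP.
    by rewrite addr_eq0 oppc2 => /eqP.
  suff lt_rk : (\rank N' < \rank N)%N.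
    have := leS _ _ sNN'; rewrite leq_eqVlt ltnS [(_ <= _)%N]leqNgt lt_rk orbF.
    by move/eqP->; rewrite /= negbK.
  have: (kermx N < kermx N')%MS.
    apply/andP; split.
      apply/row_subP=> i; set v := row i _.
      have vN : v *m N = 0 by apply/eqP; rewrite -kerP row_sub.
      have vg : app v g = v by apply/eqP; rewrite -subr_eq0 -NE vN.
      rewrite kerP N'E vN add0r vg aE NE oppc2v polarDr.
      by rewrite -{1}vg (GO_polar _ _ Gg) addc2 mul0r scale0r.
    apply/negP=> /(submx_trans _) => /(_ _ w); rewrite !kerP -aE N'E -aE.
    have -> : app w g = w + a by rewrite aE NE addrC subrK.
    rewrite (polarDl qQ) polarvv addr0 Bwa divff // scale1r addc2v.
    rewrite eqxx => /(_ isT)/eqP a0.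
    by move: nza; rewrite a0 quad0 eqxx.
  move/rank_ltmx; rewrite (rkE N) (rkE N') => lt_ker.
  by apply: ltn_sub2l => //; apply: leq_trans lt_ker (rank_leq_row _).
suff lt_rk : (\rank N < \rank N')%N.
  have := leS _ _ sN'N; rewrite leq_eqVlt ltnS [(_ <= _)%N]leqNgt lt_rk orbF.
  by move/eqP->.
have: (kermx N' < kermx N)%MS.
  apply/andP; split.
    apply/row_subP=> i; set v := row i _.
    have: v *m N' = 0 by apply/eqP; rewrite -kerP row_sub.
    rewrite N'E kerP => /eqP; rewrite addr_eq0 => /eqP vN.
    have [// | c_nz] := eqVneq (v *m N) 0; case/negP: aN.
    have c0 : B (app v g) a / Q a != 0.
      by apply: contraNneq c_nz => c0; rewrite vN c0 scale0r oppr0.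
    rewrite -(eqmx_scale _ c0) -(eqmx_opp (_ *: _)) -vN; exact: submxMl.
  (* If the fixed spaces were equal, every vector fixed by [g] would be fixed by the transvection
     too, hence be orthogonal to [a]. *)
  apply/negP=> sK; case/negP: aN; apply: im_perp_ker => // v vg.
  have : (v <= kermx N')%MS.
    by apply: submx_trans sK; rewrite kerP NE vg subrr.
  rewrite kerP N'E NE vg subrr add0r scaler_eq0 mulf_eq0 invr_eq0 (negPf nza) orbF.
  case/orP=> [/eqP Bva | /eqP a0]; first by rewrite polarC.
  by rewrite a0 quad0 eqxx in nza.
move/rank_ltmx; rewrite (rkE N) (rkE N') => lt_ker.
by apply: ltn_sub2l => //; apply: leq_trans lt_ker (rank_leq_row _).
Qed.

Lemma rk1_1 : rk1 1%g = 0%N.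
Proof. by rewrite /rk1 gmx1 subrr mxrank0. Qed.

End QuadSpace.

End QuadraticForms.

(** * The derived group as the kernel of the parity, and Witt's theorem by enumeration *)

Module WittFrames.

Import QuadraticForms.

Lemma addb_false b c : false = b (+) c -> c = b.
Proof. by case: b; case: c. Qed.

Lemma addb_conj b c : b (+) (c (+) b) = c.
Proof. by case: b; case: c. Qed.

Canonical app_action (F : finFieldType) (m : nat) (L : GLmodel F m) :=
  TotalAction (@app1 F m L) (@appM F m L).

Section OmegaIndex.

Variables (F : finFieldType) (m : nat) (Q : 'rV[F]_m.+1 -> F).
Hypothesis char2 : 2 \in [pchar F].
Hypothesis qQ : quad_form Q.
Variable L : GLmodel F m.
Local Notation V := 'rV[F]_m.+1.
Local Notation B := (polar Q).
Local Notation G := (iso Q L).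
Implicit Types (u v w a b : V) (g h : L).

Hypothesis genG : G \subset refl_group Q L.

(** The elements [h] against which the parity is additive form a group, and by [rk1_refl] this group
    contains the generating transvections. *)
Lemma rk1M : {in G &, forall g h,
  odd (rk1 (g * h)%g) = odd (rk1 g) (+) odd (rk1 h)}.
Proof.
pose K := [set h in G | [forall (g | g \in G),
  odd (rk1 (g * h)%g) == odd (rk1 g) (+) odd (rk1 h)]].
have KP h : reflect (h \in G /\ {in G, forall g,
    odd (rk1 (g * h)%g) = odd (rk1 g) (+) odd (rk1 h)}) (h \in K).
  rewrite inE; apply: (iffP andP) => [[Gh /forall_inP allh] | [Gh allh]]; split=> //.
    by move=> g /allh/eqP.
  by apply/forall_inP=> g /allh->.
have gK : group_set K.
  apply/group_setP; split.
    by apply/KP; split=> // g _; rewrite mulg1 rk1_1 addbF.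
  move=> h k /KP[Gh allh] /KP[Gk allk]; apply/KP; split; first exact: groupM.
  move=> g Gg; have h1 := allk _ (groupM Gg Gh).
  have h2 := allh _ Gg; have h3 := allk _ Gh.
  by rewrite mulgA h1 h2 h3 addbA.
suff sGK : G \subset Group gK.
  by move=> g h Gg /(subsetP sGK)/KP[_]; apply.
apply: subset_trans genG _; rewrite gen_subG; apply/subsetP=> _ /imsetP[a + ->].
rewrite inE => nza; apply/KP; split=> [|g Gg]; first exact: refl_GO.
rewrite rk1_refl // -[in RHS](mul1g (refl Q L a)) rk1_refl // rk1_1.
by rewrite addbT.
Qed.

Lemma rk1_V : {in G, forall g, odd (rk1 g^-1%g) = odd (rk1 g)}.
Proof.
move=> g Gg; have e1 : odd (rk1 (g * g^-1)%g) = false by rewrite mulgV rk1_1.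
have h1 := rk1M Gg (groupVr Gg).
by have h2 := etrans (esym e1) h1; apply: addb_false h2.
Qed.

Lemma rk1_J : {in G &, forall g h, odd (rk1 (g ^ h)%g) = odd (rk1 g)}.
Proof.
move=> g h Gg Gh; have h1 := rk1M (groupVr Gh) (groupM Gg Gh).
have h2 := rk1M Gg Gh; have h3 := rk1_V Gh.
by rewrite conjgE h1 h2 h3 addb_conj.
Qed.

Lemma rk1_refl1 a : Q a != 0 -> odd (rk1 (refl Q L a)).
Proof. by move=> nza; rewrite -(mul1g (refl Q L a)) rk1_refl // rk1_1. Qed.

Lemma even_group_set : group_set [set g in G | ~~ odd (rk1 g)].
Proof.
apply/group_setP; split=> [|g h]; first by rewrite inE group1 rk1_1.
rewrite !inE => /andP[Gg eg] /andP[Gh eh]; rewrite groupM // rk1M //.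
by rewrite (negPf eg).
Qed.

Lemma der_even : G^`(1)%g \subset [set g in G | ~~ odd (rk1 g)].
Proof.
rewrite derg1 /commutator (gen_subG _ (Group even_group_set)).
apply/subsetP=> _ /imset2P[g h Gg Gh ->].
by rewrite inE groupR //= commgEl rk1M ?groupV ?groupJ // rk1_V // rk1_J // addbb.
Qed.

Variable a0 : V.
Hypothesis nza0 : Q a0 != 0.
Hypothesis conj_refl : forall a, Q a != 0 ->
  exists2 g, g \in G & refl Q L a = (refl Q L a0 ^ g)%g.

(** All transvections are conjugate to [r0], so modulo the derived group G is generated by the
    involution [r0]; an even element involves an even power of [r0], which is trivial. *)
Lemma OmegaE : G^`(1)%g = [set g in G | ~~ odd (rk1 g)].
Proof.
have sOG : G^`(1)%g \subset G by apply: der_sub.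
apply/eqP; rewrite eqEsubset der_even /=.
pose r0 := refl Q L a0; have Gr0 : r0 \in G by apply: refl_GO.
have nO : (<[r0]> \subset 'N(G^`(1)))%g.
  by rewrite cycle_subG derg1 (subsetP (commg_norml _ _)).
have sGE : G \subset (G^`(1) <*> <[r0]>)%g.
  apply: subset_trans genG _.
  rewrite gen_subG; apply/subsetP=> _ /imsetP[a + ->].
  rewrite inE => /conj_refl[g Gg ->]; rewrite conjg_mulR groupM //.
    by rewrite mem_gen // inE cycle_id orbT.
  by rewrite mem_gen // inE derg1 mem_commg.
rewrite norm_joinEr // in sGE.
apply/subsetP=> g; rewrite inE => /andP[Gg even_g].
have /mulsgP[h k Oh /cycleP[i ->] gE] := subsetP sGE _ Gg.
suff even_i : ~~ odd i.
  rewrite gE -(odd_double_half i) (negPf even_i) add0n -mul2n expgM expgS expg1.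
  by rewrite reflK // expg1n mulg1.
have Gh : h \in G by apply: subsetP Oh.
move: even_g; rewrite gE.
have Gr : refl Q L a0 \in G by apply: refl_GO.
rewrite rk1M ?groupX // (_ : odd (rk1 h) = false).
  have -> : odd (rk1 (refl Q L a0 ^+ i)%g) = odd i; last by case: (odd i).
  elim: i {gE} => [|i IHi]; first by rewrite expg0 rk1_1.
  by rewrite expgS rk1M ?groupX // rk1_refl1 // IHi.
by have := subsetP der_even _ Oh; rewrite inE => /andP[_ /negbTE].
Qed.

Lemma Omega_index : #|G : G^`(1)%g|%g = 2.
Proof.
have Gr : refl Q L a0 \in G by apply: refl_GO.
have sOG : G^`(1)%g \subset G by apply: der_sub.
suff : (#|G| = #|G^`(1)%g| * 2)%N.
  by move/eqP; rewrite -(LagrangeI G (G^`(1)%g)) (setIidPr sOG) eqn_pmul2l ?cardG_gt0 // => /eqP.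
rewrite -(cardsID (G^`(1)%g) G) (setIidPr sOG) muln2 -addnn; congr (_ + _)%N.
rewrite -(card_imset (mem (G^`(1)%g)) (mulIg (refl Q L a0))).
apply: eq_card => g; rewrite inE OmegaE inE; apply/andP/imsetP.
  case=> ng Gg; exists (g * refl Q L a0)%g; last by rewrite -mulgA reflK // mulg1.
  rewrite !inE groupM //= rk1_refl // negbK.
  by move: ng; rewrite Gg /= negbK.
case=> h; rewrite !inE => /andP[Gh eh] ->.
have Ghr := groupM Gh Gr; split; last by [].
by rewrite Ghr (rk1_refl char2 qQ Gh nza0) negbK.
Qed.

End OmegaIndex.

(** [all] and [has] with explicit conditionals, so that [vm_compute] stops as soon as the answer is
    known. *)
Fixpoint lall T (p : T -> bool) (s : seq T) : bool :=
  if s is x :: s' then (if p x then lall p s' else false) else true.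
Fixpoint lhas T (p : T -> bool) (s : seq T) : bool :=
  if s is x :: s' then (if p x then true else lhas p s') else false.

Lemma lallE T (p : T -> bool) s : lall p s = all p s.
Proof. by elim: s => //= x s ->; case: (p x). Qed.

Lemma lhasE T (p : T -> bool) s : lhas p s = has p s.
Proof. by elim: s => //= x s ->; case: (p x). Qed.

(** Computable names for the elements of a field: [dc] decodes them, and statements on vectors turn
    into boolean computations on lists of codes. *)
Record coding (F : finFieldType) (T : eqType) (z o : T) (elts : seq T)
    (dc : T -> F) (addT mulT : T -> T -> T) : Prop := Coding {
  dc0 : dc z = 0;
  dc1 : dc o = 1;
  dcD : forall a b, dc (addT a b) = dc a + dc b;
  dcM : forall a b, dc (mulT a b) = dc a * dc b;
  dc_inj : injective dc;
  dc_surj : forall c, exists2 t, t \in elts & dc t = c;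
  dc_uniq : uniq elts
}.

Section Codes.

Variables (F : finFieldType) (T : eqType) (z o : T) (elts : seq T).
Variables (dc : T -> F) (addT mulT : T -> T -> T).
Hypothesis cdT : coding z o elts dc addT mulT.

(** Entries past the end of the list decode to 0, so a short list stands for a vector padded with
    zeros. *)
Definition vec n (l : seq T) : 'rV[F]_n := \row_i dc (nth z l i).

Fixpoint addl (a b : seq T) : seq T :=
  match a, b with
  | [::], _ => b
  | _, [::] => a
  | x :: a', y :: b' => addT x y :: addl a' b'
  end.

Definition scl c (a : seq T) : seq T := map (mulT c) a.

Fixpoint comb (cs : seq T) (fs : seq (seq T)) : seq T :=
  match cs, fs with
  | c :: cs', f :: fs' => addl (scl c f) (comb cs' fs')
  | _, _ => [::]
  end.

Fixpoint allv n : seq (seq T) :=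
  if n is n'.+1 then
    flatten [seq [seq c :: l | l <- allv n'] | c <- elts] else [:: [::]].

Fixpoint spanl n (fs : seq (seq T)) : seq (seq T) :=
  if fs is f :: fs' then
    let s := spanl n fs' in
    flatten [seq [seq addl (scl c f) v | v <- s] | c <- elts]
  else [:: nseq n z].

Lemma vecD n a b : vec n (addl a b) = vec n a + vec n b.
Proof.
apply/rowP=> i; rewrite !mxE; elim: a b (i : nat) => [|x a IHa] [|y b] [|j] //=;
  rewrite ?nth_nil ?(dc0 cdT) ?add0r ?addr0 //; exact: dcD cdT _ _.
Qed.

Lemma vecZ n c a : vec n (scl c a) = dc c *: vec n a.
Proof.
apply/rowP=> i; rewrite !mxE; elim: a (i : nat) => [|x a IHa] [|j] //=;
  rewrite ?nth_nil ?(dc0 cdT) ?mulr0 //; exact: dcM cdT _ _.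
Qed.

Lemma vec_nseq n k : vec n (nseq k z) = 0.
Proof. by apply/rowP=> i; rewrite !mxE nth_nseq if_same (dc0 cdT). Qed.

Lemma vec0 n : vec n [::] = 0.
Proof. by apply/rowP=> i; rewrite !mxE nth_nil (dc0 cdT). Qed.

Lemma mem_allv n l : (l \in allv n) = (size l == n) && all [in elts] l.
Proof.
elim: n l => [|n IHn] [|c l] //=.
  by apply/flatten_mapP=> -[c _ /mapP[]].
rewrite eqSS; apply/flatten_mapP/and3P=> [[d eltd /mapP[l' + [-> ->]]] | [sl ec al]].
  by rewrite IHn => /andP[-> ->].
by exists c => //; apply/mapP; exists l; rewrite // IHn sl.
Qed.

Lemma uniq_allv n : uniq (allv n).
Proof.
elim: n => //= n IHn; elim: elts (dc_uniq cdT) => //= c s IHs /andP[cs us].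
rewrite cat_uniq map_inj_uniq ?IHn ?(IHs us) /= ?andbT => [|l1 l2 []//].
apply/hasPn=> _ /flatten_mapP[d sd /mapP[l _ ->]].
by apply/mapP=> -[l' _ [dc_ _]]; rewrite -dc_ sd in cs.
Qed.

Lemma vec_surj n (v : 'rV[F]_n) : exists2 l, l \in allv n & vec n l = v.
Proof.
pose code c := nth z elts (find (fun t => dc t == c) elts).
have codeP c : code c \in elts /\ dc (code c) = c.
  have [t et dt] := dc_surj cdT c.
  have hs : has (fun t => dc t == c) elts by apply/hasP; exists t => //; apply/eqP.
  by split; [rewrite mem_nth // -has_find | apply/eqP/(nth_find z hs)].
exists [seq code (v 0 i) | i <- enum 'I_n].
  rewrite mem_allv size_map size_enum_ord eqxx /=.
  by apply/allP=> _ /mapP[i _ ->]; case: (codeP (v 0 i)).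
apply/rowP=> i; rewrite mxE (nth_map i) ?size_enum_ord //.
by rewrite nth_ord_enum; case: (codeP (v 0 i)).
Qed.

Lemma vec_inj n : {in allv n &, injective (vec n)}.
Proof.
move=> a b; rewrite !mem_allv => /andP[/eqP sa _] /andP[/eqP sb _] eq_ab.
apply: (@eq_from_nth _ z) => [|i]; first by rewrite sa sb.
rewrite sa => lt_i; apply: dc_inj cdT _ _ _.
by move/rowP/(_ (Ordinal lt_i)): eq_ab; rewrite !mxE.
Qed.

Lemma vec_comb_fix m (L : GLmodel F m) (g : L) fs cs :
    (forall f, f \in fs -> app (vec m.+1 f) g = vec m.+1 f) ->
  app (vec m.+1 (comb cs fs)) g = vec m.+1 (comb cs fs).
Proof.
elim: fs cs => [|f fs IHfs] [|c cs] //= fixg; rewrite ?vec0 ?app0 //.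
rewrite vecD vecZ appD appZ fixg ?mem_head // IHfs // => h hfs.
by rewrite fixg // inE hfs orbT.
Qed.

Definition unitl n := [seq mkseq (fun j => if j == i then o else z) n | i <- iota 0 n].

Section Witt.

Variables (m : nat) (Q : 'rV[F]_m.+1 -> F) (qT : seq T -> T).
Hypothesis char2 : 2 \in [pchar F].
Hypothesis qQ : quad_form Q.
Hypothesis qTE : forall l, Q (vec m.+1 l) = dc (qT l).

Variable L : GLmodel F m.
Local Notation V := 'rV[F]_m.+1.
Local Notation B := (polar Q).
Local Notation G := (iso Q L).
Local Notation vc := (vec m.+1).

Definition bT u v := addT (qT (addl u v)) (addT (qT u) (qT v)).

Lemma bTE u v : dc (bT u v) = B (vc u) (vc v).
Proof.
by rewrite !(dcD cdT) -!qTE vecD /polar !(oppc2 char2) !addrA.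
Qed.

Definition compat pre f u : bool :=
  if qT u == qT f then lall (fun p => bT u p == bT f p) pre else false.

Definition wittX pre f :=
  let s := spanl m.+1 pre in
  [seq u <- allv m.+1 | if compat pre f u then u \notin s else false].

(* Witt's theorem by enumeration: two vectors u, u' with the same products    *)
(* with the vectors chosen so far are exchanged by the reflection in u - u',  *)
(* which fixes those vectors, or by two such steps. The conditionals stand    *)
(* for connectives: vm_compute evaluates both arguments of && and ||.         *)
Fixpoint witt_ok (pre fs : seq (seq T)) : bool :=
  if fs is f :: fs' then
    let X := wittX pre f in
    if f \notin X then false else if lall (fun u => if u == f then true else if bT u f != z then true else
        lhas (fun w => if bT w f != z then bT w u != z else false) X) X
    then witt_ok (f :: pre) fs' else false
  else true.

Fixpoint witt_sizes (pre fs : seq (seq T)) : seq nat :=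
  if fs is f :: fs' then size (wittX pre f) :: witt_sizes (f :: pre) fs' else [::].

Lemma compatP pre f u : reflect
  (Q (vc u) = Q (vc f) /\ {in pre, forall p, B (vc u) (vc p) = B (vc f) (vc p)})
  (compat pre f u).
Proof.
rewrite /compat lallE; apply: (iffP idP) => [|[Quf Bp]].
  case: eqP => // quf /allP Bp; rewrite !qTE quf; split=> // p /Bp/eqP.
  by rewrite -!bTE => ->.
have -> : qT u = qT f by apply: (dc_inj cdT); rewrite -!qTE.
by rewrite eqxx; apply/allP=> p /Bp; rewrite -!bTE => /(dc_inj cdT)->.
Qed.

Lemma bT_neq0 u v : (bT u v != z) = (B (vc u) (vc v) != 0).
Proof. by rewrite -bTE -(inj_eq (dc_inj cdT)) (dc0 cdT). Qed.

Lemma witt_link pre f u : compat pre f u -> bT u f != z ->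
  exists2 g, g \in refl_group Q L &
   {in pre, forall p, app (vc p) g = vc p} /\ app (vc u) g = vc f.
Proof.
case/compatP=> Quf Bp; rewrite bT_neq0 => nzB.
have [nzd sw] := refl_swap char2 qQ L Quf nzB.
exists (refl Q L (vc u + vc f)); first exact: refl_in.
split=> // p /Bp Bpp; apply: refl_fix => //.
by rewrite (polarDr qQ) !(polarC Q (vc p)) Bpp (addc2 char2).
Qed.

Fixpoint inspan (P : seq V) v : bool :=
  if P is p :: P' then [exists c : F, inspan P' (v + c *: p)] else v == 0.

Lemma inspanJ (g : L) P v : inspan (map (fun v => app v g) P) (app v g) = inspan P v.
Proof.
elim: P v => [|p P IHP] v /=; first by rewrite -[in RHS](inj_eq (@app_inj _ _ _ g)) app0.
by apply: eq_existsb => c; rewrite -appZ -appD IHP.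
Qed.

Lemma inspan_fix (g : L) P v : {in P, forall p, app p g = p} -> inspan P v -> app v g = v.
Proof.
elim: P v => [|p P IHP] v fixP /=; first by move/eqP->; rewrite app0.
case/existsP=> c Pc.
have fP : {in P, forall q, app q g = q} by move=> q qP; rewrite fixP // inE qP orbT.
by have := IHP _ fP Pc; rewrite appD appZ (fixP p (mem_head _ _)) => /addIr.
Qed.

Lemma spanl_inspan P l : l \in spanl m.+1 P -> inspan (map vc P) (vc l).
Proof.
elim: P l => [|p P IHP] l /=.
  by rewrite inE => /eqP->; rewrite (vec_nseq _ m.+1).
case/flatten_mapP=> c _ /mapP[v /IHP Pv ->]; apply/existsP; exists (dc c).
by rewrite vecD vecZ addrAC (addc2v char2) add0r.
Qed.

Lemma mem_wittX pre f u : (u \in wittX pre f) =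
  [&& compat pre f u, u \notin spanl m.+1 pre & u \in allv m.+1].
Proof. by rewrite mem_filter; case: (compat _ _ _). Qed.

Lemma witt_head pre f fs u : witt_ok pre (f :: fs) -> u \in wittX pre f ->
  exists2 g, g \in refl_group Q L &
   {in pre, forall p, app (vc p) g = vc p} /\ app (vc u) g = vc f.
Proof.
rewrite /= lallE; case: ifP => // _; case: ifP => // /allP okX _ Xu.
have cu : compat pre f u by move: Xu; rewrite mem_wittX => /and3P[].
have := okX _ Xu; case: eqP => [-> _ | _].
  by exists 1%g; rewrite ?group1 //; split=> [p _|]; rewrite app1.
case: ifP => [nzB _ | _]; first exact: witt_link.
rewrite lhasE => /hasP[w]; rewrite mem_wittX => /and3P[cw _ _].
case: ifP => // Bwf Bwu.
have [g1 Rg1 [fix1 g1E]] := witt_link cw Bwf.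
have cuw : compat pre w u.
  have [[Qu Bu] [Qw Bw]] := (compatP _ _ _ cu, compatP _ _ _ cw).
  by apply/compatP; split=> [|p pp]; rewrite ?Qu ?Qw ?Bu ?Bw.
have Buw : bT u w != z by rewrite bT_neq0 polarC -bT_neq0.
have [g2 Rg2 [fix2 g2E]] := witt_link cuw Buw.
exists (g2 * g1)%g; rewrite ?groupM //; split=> [p pp|]; rewrite appM.
  by rewrite fix2 ?fix1.
by rewrite g2E.
Qed.

Fixpoint indep (P us : seq V) : bool :=
  if us is u :: us' then ~~ inspan P u && indep (u :: P) us' else true.

Lemma indepJ (g : L) P us :
  indep (map (fun v => app v g) P) (map (fun v => app v g) us) = indep P us.
Proof. by elim: us P => //= u us IHus P; rewrite inspanJ -(IHus (u :: P)). Qed.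

Fixpoint same_gram (us fs : seq V) : bool :=
  match us, fs with
  | [::], [::] => true
  | u :: us', f :: fs' =>
    [&& Q u == Q f, map (B u) us' == map (B f) fs' & same_gram us' fs']
  | _, _ => false
  end.

Lemma same_gramJ g us fs : g \in G -> same_gram (map (fun v => app v g) us) fs = same_gram us fs.
Proof.
move=> Gg; elim: us fs => [|u us IHus] [|f fs] //=.
rewrite (GO_P _ _ Gg) IHus -map_comp; congr [&& _, _ == _ & _].
by apply: eq_map => v /=; rewrite (GO_polar _ _ Gg).
Qed.

Lemma same_gram_refl us : same_gram us us.
Proof. by elim: us => //= u us ->; rewrite !eqxx. Qed.

(** The first vector is mapped by [witt_head], the remaining ones are moved along by the same
    isometry, and the argument continues with [f] added to the vectors to be fixed. *)
Lemma witt_tuple pre fs us :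
    witt_ok pre fs -> same_gram us (map vc fs) -> indep (map vc pre) us ->
    {in pre, forall p, map (B (vc p)) us = map (B (vc p)) (map vc fs)} ->
  exists2 g, g \in refl_group Q L &
   {in pre, forall p, app (vc p) g = vc p} /\ map (fun v => app v g) us = map vc fs.
Proof.
elim: fs pre us => [|f fs IHfs] pre [|u us] // ok.
  by exists 1%g; rewrite ?group1 //; split=> // p _; rewrite app1.
move=> /= /and3P[/eqP Quf /eqP Bus sg] /andP[uP iP] Bpre.
have [l al lE] := vec_surj u; have Bpu p : p \in pre -> B (vc p) u = B (vc p) (vc f).
  by move=> /Bpre[].
have Xl : l \in wittX pre f.
  rewrite mem_wittX al andbT; apply/andP; split.
    by apply/compatP; rewrite lE; split=> // p pp; rewrite polarC Bpu // polarC.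
  by apply: contra uP => /spanl_inspan; rewrite lE.
have [g Rg [fixg gE]] := witt_head ok Xl.
have Gg : g \in G by apply: subsetP (refl_group_sub char2 qQ L) _ Rg.
have ok' : witt_ok (f :: pre) fs by move: ok => /=; do 2 case: ifP => //.
have [|||h Rh [fixh hE]] := IHfs (f :: pre) (map (fun v => app v g) us) ok'.
- by rewrite same_gramJ.
- suff -> : map vc (f :: pre) = map (fun v => app v g) (u :: map vc pre) by rewrite indepJ.
  rewrite /= -{1}lE gE -map_comp; congr (_ :: _).
  by apply/eq_in_map => p pp /=; rewrite fixg.
- move=> p; rewrite inE => /predU1P[->|pp].
    rewrite -[RHS]Bus -map_comp; apply: eq_map => v /=.
    by rewrite -gE (GO_polar _ _ Gg) lE.
  rewrite -map_comp; have [_ <-] := Bpre p pp; apply: eq_map => v /=.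
  by rewrite -{1}(fixg p pp) (GO_polar _ _ Gg).
exists (g * h)%g; rewrite ?groupM //; split=> [p pp|].
  by rewrite appM fixg // fixh // inE pp orbT.
rewrite -hE -lE; congr (_ :: _); last first.
  by rewrite -map_comp; apply: eq_map => v /=; rewrite appM.
by rewrite appM gE fixh ?mem_head.
Qed.

Definition fixer (s : seq V) : {set L} := [set g in G | all (fun v => app v g == v) s].

Lemma fixerP s g : reflect (g \in G /\ {in s, forall v, app v g = v}) (g \in fixer s).
Proof.
rewrite inE; apply: (iffP andP) => -[Gg fixg]; split=> //.
  by move=> v sv; apply/eqP/(allP fixg).
by apply/allP=> v /fixg->.
Qed.

Lemma fixer_group_set s : group_set (fixer s).
Proof.
apply/group_setP; split=> [|g h /fixerP[Gg fixg] /fixerP[Gh fixh]].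
  by apply/fixerP; split=> // v _; rewrite app1.
by apply/fixerP; split=> [|v sv]; rewrite ?groupM // appM fixg ?fixh.
Qed.
Canonical fixer_group s := Group (fixer_group_set s).

Lemma fixer_nil : fixer [::] = G.
Proof. by apply/setP=> g; rewrite inE andbT. Qed.

(** Orbit and stabiliser: by [witt_head] the orbit of [f] under the pointwise fixer of [pre] is
    exactly [wittX pre f]. *)
Lemma card_fixer_cons pre f fs : witt_ok pre (f :: fs) -> f \in allv m.+1 ->
  (#|fixer (map vc pre)| = size (wittX pre f) * #|fixer (map vc (f :: pre))|)%N.
Proof.
move=> ok af; set H := fixer _.
have <- := card_orbit_stab (app_action L) (fixer_group (map vc pre)) (vc f).
congr (_ * _)%N; last first.
  apply: eq_card => g; apply/setIP/fixerP=> [[/fixerP[Gg fixg] /astab1P gf]|[Gg fixg]].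
    by split=> // v; rewrite inE => /predU1P[-> //|]; apply: fixg.
  split; last by apply/astab1P/fixg/mem_head.
  by apply/fixerP; split=> // v pv; apply: fixg; rewrite inE pv orbT.
pose X := wittX pre f.
have uX : uniq (map vc X).
  rewrite map_inj_in_uniq ?filter_uniq ?uniq_allv // => a b.
  by rewrite !mem_wittX => /and3P[_ _ aa] /and3P[_ _ ab]; apply: vec_inj.
rewrite -(size_map vc) -(card_uniqP uX); apply: eq_card => v.
apply/orbitP/mapP=> [[g /fixerP[Gg fixg] <-] | [u]]; last first.
  move=> Xu ->; have [g Rg [fixg gE]] := witt_head ok Xu.
  exists g^-1%g => /=; last by rewrite -gE appK.
  rewrite groupV; apply/fixerP; split=> [|_ /mapP[p pp ->]]; last exact: fixg.
  exact: subsetP (refl_group_sub char2 qQ L) _ Rg.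
have [l al lE] := vec_surj (app (vc f) g); exists l => //.
have Xf : f \in wittX pre f by move: ok => /=; case: ifP => // /negbFE.
rewrite mem_wittX al andbT; apply/andP; split.
  apply/compatP; rewrite lE (GO_P _ _ Gg); split=> // p pp.
  by rewrite -{1}(fixg (vc p)) ?(GO_polar _ _ Gg) // map_f.
move: Xf; rewrite mem_wittX => /and3P[_ + _]; apply: contra => ls.
have lfix := inspan_fix fixg (spanl_inspan ls).
have /vec_inj <- // : vc l = vc f by apply: (app_inj (g := g)); rewrite lfix lE.
Qed.

Lemma card_fixer pre fs : witt_ok pre fs -> all [in allv m.+1] fs ->
  (#|fixer (map vc pre)| =
     foldr muln #|fixer (map vc (catrev fs pre))| (witt_sizes pre fs))%N.
Proof.
elim: fs pre => [//|f fs IHfs] pre ok /andP[af afs].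
rewrite (card_fixer_cons ok af) (IHfs (f :: pre)) //.
by move: ok => /=; do 2 case: ifP => //.
Qed.

(** A certificate that [fs] spans the space: [cs] lists the coefficients of the unit vectors. *)
Definition spans_units fs cs := [seq comb c fs | c <- cs] == unitl m.+1.

Lemma spans_fix fs cs (g : L) : spans_units fs cs ->
  {in fs, forall f, app (vc f) g = vc f} -> g = 1%g.
Proof.
move=> /eqP sp fixg; apply: app_eqP => v; rewrite app1.
have fixu i : app (delta_mx 0 i) g = delta_mx 0 i.
  have : mkseq (fun j => if j == i then o else z) m.+1 \in unitl m.+1.
    by apply/mapP; exists (i : nat); rewrite // mem_iota add0n ltn_ord.
  rewrite -sp => /mapP[c _]; set l := mkseq _ _ => lE.
  suff <- : vc l = delta_mx 0 i by rewrite lE vec_comb_fix.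
  apply/rowP=> j; rewrite !mxE nth_mkseq // eqxx /=.
  by rewrite -(inj_eq val_inj); case: eqP => _; rewrite ?(dc1 cdT) ?(dc0 cdT).
by rewrite [v]row_sum_delta appE mulmx_suml; apply: eq_bigr => i _; rewrite -scalemxAl -appE fixu.
Qed.

Lemma mem_allvs n l : (l \in allv n) = (size l == n).
Proof.
rewrite mem_allv; case: eqP => //= _; apply/allP=> t _.
by have [t' et' /(dc_inj cdT) <-] := dc_surj cdT (dc t).
Qed.

Lemma size_addl a b : size (addl a b) = maxn (size a) (size b).
Proof. by elim: a b => [|x a IHa] [|y b] //=; rewrite ?max0n ?maxn0 // IHa maxnSS. Qed.

Fixpoint indepl (pre fs : seq (seq T)) : bool :=
  if fs is f :: fs' then
    if f \in spanl m.+1 pre then false else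
    if size f == m.+1 then indepl (f :: pre) fs' else false
  else true.

Lemma inspan_spanl P l : all (fun p => size p == m.+1) P -> size l = m.+1 ->
  inspan (map vc P) (vc l) -> l \in spanl m.+1 P.
Proof.
elim: P l => [|p P IHP] l /=.
  move=> _ sl /eqP vl; rewrite inE; apply/eqP/(@vec_inj m.+1).
  - by rewrite mem_allvs sl.
  - by rewrite mem_allvs /= size_nseq.
  by rewrite vl; apply: esym; apply: (vec_nseq m.+1 m.+1).
case/andP=> /eqP sp sP sl /existsP[c Pc].
have [t et tE] := dc_surj cdT c; apply/flatten_mapP; exists t => //.
apply/mapP; exists (addl l (scl t p)).
  by apply: IHP; rewrite ?vecD ?vecZ ?tE // size_addl size_map sl sp maxnn.
apply: (@vec_inj m.+1); rewrite ?mem_allvs ?size_addl ?size_map ?sl ?sp ?maxnn //.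
by rewrite !vecD addrCA (addc2v char2) addr0.
Qed.

Lemma indeplP fs : indepl [::] fs -> indep [::] (map vc fs).
Proof.
rewrite -[indep [::] _]/(indep (map vc [::]) (map vc fs)).
have : all (fun p : seq T => size p == m.+1) [::] by [].
elim: fs [::] => //= f fs IHfs pre spre; case: ifP => // fpre; case: ifP => // sf ind.
rewrite (IHfs (f :: pre)) /= ?sf // andbT; apply: contraFN fpre.
by apply: inspan_spanl => //; apply/eqP.
Qed.

(** An isometry carries the frame to an independent tuple with the same Gram data. A product of
    transvections takes this tuple back, and what remains fixes the frame, hence is 1. *)
Lemma GO_refl_gen fs cs : witt_ok [::] fs -> spans_units fs cs ->
  indepl [::] fs -> G \subset refl_group Q L.
Proof.
move=> ok sp /indeplP ind; apply/subsetP=> g Gg.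
have [|||h Rh [_ hE]] := witt_tuple (us := map (fun v => app v g) (map vc fs)) ok; rewrite ?same_gramJ ?same_gram_refl //.
  by rewrite -[map vc [::]]/(map (fun v => app v g) [::]) indepJ.
rewrite -(groupMr _ Rh); suff -> : (g * h = 1)%g by apply: group1.
apply: spans_fix sp _ => f fs_f; rewrite appM.
move: hE; rewrite -!map_comp => /eq_in_map/(_ f fs_f) /=; exact.
Qed.

Lemma card_GO fs cs : witt_ok [::] fs -> all [in allv m.+1] fs -> spans_units fs cs ->
  #|G| = foldr muln 1%N (witt_sizes [::] fs).
Proof.
move=> ok afs sp; rewrite -{1}[G : {set L}]fixer_nil -[[::]]/(map vc [::]) (card_fixer ok afs).
congr foldr; apply/eqP; rewrite -trivg_card1; apply/eqP/trivgP/subsetP=> g /fixerP[_ fixg].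
suff -> : g = 1%g by apply: group1.
apply: (spans_fix sp) => f ff; apply: fixg; apply/map_f.
by rewrite catrevE cats0 mem_rev.
Qed.

(** Scaling [a] does not change its transvection, so [a] may be given the value 1 and then be moved
    to the fixed vector by [witt_tuple]. *)
Lemma refl_conj_all f0 : (forall x : F, x != 0 -> exists c, c ^+ 2 * x = 1) ->
    witt_ok [::] [:: f0] -> Q (vc f0) = 1 -> vc f0 != 0 ->
  forall a : V, Q a != 0 ->
  exists2 g, g \in G & refl Q L a = (refl Q L (vc f0) ^ g)%g.
Proof.
move=> sqF ok Qf0 nzf0 a nza; have [c cE] := sqF _ nza.
have Qca : Q (c *: a) = 1 by rewrite (quadZ qQ).
have nzc : c != 0 by apply: contraTneq isT => c0; have := oner_neq0 F; rewrite -cE c0 expr0n mul0r eqxx.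
have [|||g Rg [_ [gE]]] := @witt_tuple [::] [:: f0] [:: c *: a] ok.
- by rewrite /= Qca Qf0 !eqxx.
- rewrite /= andbT; apply: contraTneq isT => ca0.
  by have := oner_neq0 F; rewrite -Qca ca0 (quad0 qQ) eqxx.
- by [].
have Gg : g \in G by apply: subsetP (refl_group_sub char2 qQ L) _ Rg.
exists g^-1%g; first by rewrite groupV.
have -> : refl Q L a = refl Q L (c *: a).
  apply: app_eqP => v; rewrite !app_refl ?Qca ?oner_neq0 // (polarZr qQ) divr1 scalerA.
  congr (_ + _ *: _); apply: (mulIf nza); rewrite divfK // mulrAC mulrC -mulrA.
  by rewrite !mulrA -expr2 mulrAC cE mul1r.
by rewrite -gE -refl_conj // ?conjgK // Qca oner_neq0.
Qed.

End Witt.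

End Codes.

End WittFrames.

(** * Codes for F_2 and F_4, the standard forms, and the enumerations behind Witt's theorem *)

Module Codings.

Import QuadraticForms WittFrames.

Local Notation F4 := Defs.F4.

Definition b2F (b : bool) : 'F_2 := b%:R.

Lemma F2_cases (x : 'F_2) : x = 0 \/ x = 1.
Proof. by case: x => [[|[|//]] lt]; [left | right]; apply: val_inj. Qed.

Lemma char2_F2 : 2 \in [pchar 'F_2].
Proof. exact: pchar_Fp. Qed.

Lemma codingF2 : coding false true [:: false; true] b2F addb andb.
Proof.
split=> //.
- by do 2 case=> //; apply: val_inj.
- by do 2 case=> //; apply: val_inj.
- by do 2 case.
- by move=> c; case: (F2_cases c) => ->; [exists false | exists true].
Qed.

Lemma F4_omega : exists w : F4, w ^+ 2 + w + 1 = 0.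
Proof.
have /subsetPn[w _ w01] : ~~ ([set: F4] \subset [set 0; 1]).
  apply/negP=> /subset_leq_card; rewrite cardsT card_F4 leqNgt.
  by rewrite (leq_ltn_trans (leq_card_setU _ _)) // !cards1.
exists w; have := expf_card w; rewrite card_F4 => w4; move: w01; rewrite !inE negb_or.
case/andP=> w0 w1; have : w * (w - 1) * (w ^+ 2 + w + 1) = 0.
  by apply: etrans (_ : w ^+ 4 - w = 0); [ring | rewrite w4 subrr].
by move/eqP; rewrite !mulf_eq0 subr_eq0 (negPf w0) (negPf w1) => /eqP.
Qed.

Lemma F4_omega_eqb : exists w : F4, w ^+ 2 + w + 1 == 0.
Proof. by have [w /eqP] := F4_omega; exists w. Qed.

Definition w4 : F4 := xchoose F4_omega_eqb.

Lemma w4_eq : w4 ^+ 2 + w4 + 1 = 0.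
Proof. exact/eqP/(xchooseP F4_omega_eqb). Qed.

Lemma char2_F4 : 2 \in [pchar F4].
Proof. by have [] := @card_finPcharP F4 2 2 card_F4 isT. Qed.

Lemma w4_sqr : w4 ^+ 2 = w4 + 1.
Proof. by apply/eqP; rewrite -subr_eq0 (oppc2 char2_F4) addrA w4_eq. Qed.

(** The pair (a, b) codes a + b w, where w is a root of X^2 + X + 1. *)
Definition d4 (x : bool * bool) : F4 := x.1%:R + x.2%:R * w4.
Definition add4 (x y : bool * bool) := (addb x.1 y.1, addb x.2 y.2).
Definition mul4 (x y : bool * bool) :=
  (addb (x.1 && y.1) (x.2 && y.2), addb (addb (x.1 && y.2) (x.2 && y.1)) (x.2 && y.2)).
Definition elts4 := [:: (false, false); (true, false); (false, true); (true, true)].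

Lemma natb_add4 (a b : bool) : (addb a b)%:R = a%:R + b%:R :> F4.
Proof.
by case: a; case: b; rewrite /= ?addr0 ?add0r // (addc2 char2_F4).
Qed.

Lemma natb_and4 (a b : bool) : (a && b)%:R = a%:R * b%:R :> F4.
Proof. by case: a; case: b; rewrite /= ?mulr0 ?mul0r ?mulr1. Qed.

Lemma d4D x y : d4 (add4 x y) = d4 x + d4 y.
Proof. by rewrite /d4 /= !natb_add4; ring. Qed.

Lemma d4M x y : d4 (mul4 x y) = d4 x * d4 y.
Proof.
rewrite /d4 /= !(natb_add4, natb_and4).
apply: esym; apply: etrans (_ : x.1%:R * y.1%:R + (x.1%:R * y.2%:R + x.2%:R * y.1%:R) * w4 + x.2%:R * y.2%:R * w4 ^+ 2 = _).
  ring.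
rewrite w4_sqr; ring.
Qed.

Lemma d4_inj : injective d4.
Proof.
have d4_0 x : d4 x = 0 -> x = (false, false).
  have w0 : w4 != 0.
    by apply: contraTneq isT => w0; have /eqP := w4_eq; rewrite w0 expr0n /= !add0r oner_eq0.
  have w1 : 1 + w4 != 0.
    apply: contraTneq isT => w1; have /eqP := w4_eq.
    by rewrite -addrA [w4 + 1]addrC w1 addr0 expf_eq0 (negPf w0) andbF.
  case: x => [[] []]; rewrite /d4 /= ?mul0r ?mul1r ?addr0 ?add0r => /eqP //.
  - by rewrite (negPf w1).
  - by rewrite oner_eq0.
  - by rewrite (negPf w0).
move=> x y eq_xy; have := d4_0 (add4 x y).
rewrite d4D eq_xy (addc2 char2_F4) => /(_ erefl).
by case: x {eq_xy} => [[] []]; case: y => [[] []].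
Qed.

Lemma codingF4 : coding (false, false) (true, false) elts4 d4 add4 mul4.
Proof.
split.
- by rewrite /d4 /= mul0r addr0.
- by rewrite /d4 /= mul0r addr0.
- exact: d4D.
- exact: d4M.
- exact: d4_inj.
- have [g d4K gK] : bijective d4.
    by apply: inj_card_bij d4_inj _; rewrite card_F4 card_prod !card_bool.
  by move=> c; exists (g c); [case: (g c) => [[] []] | ].
- by [].
Qed.

Lemma polar_Qplus (F : fieldType) k (u v : 'rV[F]_(k + k)) :
  polar (@Qplus F k) u v =
  \sum_(i < k) (u 0 (lshift k i) * v 0 (rshift k i) + u 0 (rshift k i) * v 0 (lshift k i)).
Proof.
rewrite /polar /Qplus -!sumrB; apply: eq_bigr => i _; rewrite !mxE; ring.
Qed.

Lemma QplusZ (F : fieldType) k c (v : 'rV[F]_(k + k)) : Qplus (c *: v) = c ^+ 2 * Qplus v.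
Proof.
by rewrite /Qplus mulr_sumr; apply: eq_bigr => i _; rewrite !mxE; ring.
Qed.

Lemma polar_QplusDl (F : fieldType) k (u v w : 'rV[F]_(k + k)) :
  polar (@Qplus F k) (u + v) w = polar (@Qplus F k) u w + polar (@Qplus F k) v w.
Proof.
by rewrite !polar_Qplus -big_split; apply: eq_bigr => i _; rewrite !mxE /=; ring.
Qed.

Lemma polar_QplusZl (F : fieldType) k c (u w : 'rV[F]_(k + k)) :
  polar (@Qplus F k) (c *: u) w = c * polar (@Qplus F k) u w.
Proof.
by rewrite !polar_Qplus mulr_sumr; apply: eq_bigr => i _; rewrite !mxE /=; ring.
Qed.

Lemma polar_Qplus_nd (F : fieldType) k (u : 'rV[F]_(k + k)) :
  (forall w, polar (@Qplus F k) u w = 0) -> u = 0.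
Proof.
move=> Bu; apply/rowP=> i; rewrite mxE -(splitK i); case: (split i) => j /=.
  have := Bu (delta_mx 0 (rshift k j)); rewrite polar_Qplus (bigD1 j) //= big1 => [|l lj].
    by rewrite !mxE !eqxx eq_lrshift mulr1 mulr0 !addr0.
  by rewrite !mxE eq_lrshift eq_rshift (negPf lj) !mulr0 addr0.
have := Bu (delta_mx 0 (lshift k j)); rewrite polar_Qplus (bigD1 j) //= big1 => [|l lj].
  by rewrite !mxE !eqxx eq_rlshift mulr1 mulr0 add0r !addr0.
by rewrite !mxE eq_rlshift eq_lshift (negPf lj) !mulr0 addr0.
Qed.

Lemma addF2 (x : 'F_2) : x + x = 0.
Proof. exact: addc2 char2_F2 _. Qed.

Lemma QminusE k (v : 'rV['F_2]_(k.+1 + k.+1)) :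
  Qminus v = Qplus v + (v 0 (lshift k.+1 ord0) ^+ 2 + v 0 (rshift k.+1 ord0) ^+ 2).
Proof. by rewrite /Qminus; congr (_ + _); apply: big_pred1 => i /=; rewrite -val_eqE. Qed.

(** The squares added to [Qplus] are additive in characteristic 2, so they do not contribute to the
    polar form. *)
Lemma polar_Qminus k (u v : 'rV['F_2]_(k.+1 + k.+1)) :
  polar (@Qminus k.+1) u v = polar (@Qplus 'F_2 k.+1) u v.
Proof.
rewrite /polar !QminusE !mxE; set a := u _ _; set b := u _ _; set c := v _ _; set d := v _ _.
rewrite -[RHS]addr0 -(addF2 (a * c + b * d)); ring.
Qed.

Lemma sqrF2 (x : 'F_2) : x ^+ 2 = x.
Proof. by case: (F2_cases x) => ->; rewrite ?expr0n ?expr1n. Qed.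

Lemma QminusZ k c (v : 'rV['F_2]_(k.+1 + k.+1)) : Qminus (c *: v) = c ^+ 2 * Qminus v.
Proof. rewrite !QminusE QplusZ !mxE; ring. Qed.

Lemma quad12 : quad_form (m := 11) (@Qplus 'F_2 6).
Proof.
exact: (QuadForm (@QplusZ _ 6) (@polar_QplusDl _ 6) (@polar_QplusZl _ 6) (@polar_Qplus_nd _ 6)).
Qed.

Lemma quad6 : quad_form (m := 5) (@Qplus F4 3).
Proof.
exact: (QuadForm (@QplusZ _ 3) (@polar_QplusDl _ 3) (@polar_QplusZl _ 3) (@polar_Qplus_nd _ 3)).
Qed.

Lemma Qminus_polar_props k :
  [/\ forall u v w : 'rV['F_2]_(k.+1 + k.+1),
        polar (@Qminus k.+1) (u + v) w = polar (@Qminus k.+1) u w + polar (@Qminus k.+1) v w,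
      forall c (u w : 'rV['F_2]_(k.+1 + k.+1)),
        polar (@Qminus k.+1) (c *: u) w = c * polar (@Qminus k.+1) u w
    & forall u : 'rV['F_2]_(k.+1 + k.+1),
        (forall w, polar (@Qminus k.+1) u w = 0) -> u = 0].
Proof.
split=> [u v w|c u w|u Bu]; rewrite ?polar_Qminus ?polar_QplusDl ?polar_QplusZl //.
by apply: polar_Qplus_nd => w; rewrite -polar_Qminus.
Qed.

Lemma quad8 : quad_form (m := 7) (@Qminus 4).
Proof. by have [h1 h2 h3] := Qminus_polar_props 3; apply: (QuadForm (@QminusZ 3) h1 h2 h3). Qed.

Lemma quad4 : quad_form (m := 3) (@Qminus 2).
Proof. by have [h1 h2 h3] := Qminus_polar_props 1; apply: (QuadForm (@QminusZ 1) h1 h2 h3). Qed.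

Section QuadCodes.

Variables (F : finFieldType) (T : eqType) (z o : T) (elts : seq T).
Variables (dc : T -> F) (addT mulT : T -> T -> T).
Hypothesis cdT : coding z o elts dc addT mulT.

Definition qplus k (l : seq T) : T :=
  foldr (fun i acc => addT (mulT (nth z l i) (nth z l (k + i))) acc) z (iota 0 k).

Lemma qplusE k l : Qplus (vec z dc (k + k) l) = dc (qplus k l).
Proof.
rewrite /Qplus /qplus.
transitivity (\sum_(i < k) dc (mulT (nth z l i) (nth z l (k + i)))).
  by apply: eq_bigr => i _; rewrite !mxE (dcM cdT).
rewrite -(big_mkord xpredT (fun i => dc (mulT (nth z l i) (nth z l (k + i))))).
rewrite /index_iota subn0; elim: (iota 0 k) => [|i s IHs] /=.
  by rewrite big_nil (dc0 cdT).
by rewrite big_cons IHs (dcD cdT).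
Qed.

End QuadCodes.

Definition qp k := qplus false addb andb k.
Definition qm k l := addb (qp k l) (addb (nth false l 0) (nth false l k)).
Definition qp4 k := qplus (false, false) add4 mul4 k.
Notation vcb n := (vec false b2F n).
Notation vc4 n := (vec (false, false) d4 n).

Lemma q12E l : @Qplus 'F_2 6 (vcb 12 l) = b2F (qp 6 l).
Proof. exact: qplusE codingF2 6 l. Qed.

Lemma q6E l : @Qplus F4 3 (vc4 6 l) = d4 (qp4 3 l).
Proof. exact: qplusE codingF4 3 l. Qed.

Lemma qmE k l : Qminus (vcb (k.+1 + k.+1) l) = b2F (qm k.+1 l).
Proof.
rewrite QminusE (qplusE codingF2) !mxE /= addn0 !sqrF2 -!(dcD codingF2).
by [].
Qed.

Definition q8E l : @Qminus 4 (vcb 8 l) = b2F (qm 4 l) := qmE 3 l.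
Definition q4E l : @Qminus 2 (vcb 4 l) = b2F (qm 2 l) := qmE 1 l.

(* The n binary digits of k, least significant first. *)
Fixpoint bl (n k : nat) : seq bool := if n is n'.+1 then odd k :: bl n' k./2 else [::].

Notation wittb m q := (witt_ok false [:: false; true] addb andb m q [::]).
Notation witt_sizesb m q := (witt_sizes false [:: false; true] addb andb m q [::]).
Notation spansb m := (spans_units false true addb andb m).
Notation indepb m := (indepl false [:: false; true] addb andb m [::]).

(** The frame [fr12] consists of four singular vectors spanning the 4-space U, followed by three
    hyperbolic pairs and an anisotropic plane spanning W. The lists ending in i hold the
    coefficients of the unit vectors. *)
Definition fr12 := map (bl 12) [:: 1; 64; 327; 453; 8; 512; 16; 1024; 32; 2048; 260; 134].
Definition fr12i := map (bl 12) [:: 1; 1031; 2060; 16; 64; 256; 2; 1035; 3084; 32; 128; 512].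
Definition fr8 := map (bl 8) [:: 3; 32; 4; 64; 8; 128; 1; 16].
Definition fr8i := map (bl 8) [:: 64; 65; 4; 16; 128; 2; 8; 32].
Definition fr4 := map (bl 4) [:: 1; 2; 4; 8].

(** [vm_cast_no_check] leaves the evaluation to the kernel, so that it is carried out only once, at
    [Qed]. *)
Lemma witt12 : wittb 11 (qp 6) fr12. Proof. vm_cast_no_check (erefl true). Qed.
Lemma sizes12 : witt_sizesb 11 (qp 6) fr12 =
  [:: 2079; 1024; 496; 240; 119; 64; 27; 16; 5; 4; 3; 2]%N.
Proof. apply/eqP; vm_cast_no_check (erefl true). Qed.
Lemma spans12 : spansb 11 fr12 fr12i. Proof. vm_cast_no_check (erefl true). Qed.
Lemma indep12 : indepb 11 fr12. Proof. vm_cast_no_check (erefl true). Qed.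
Lemma witt8 : wittb 7 (qm 4) fr8. Proof. vm_cast_no_check (erefl true). Qed.
Lemma spans8 : spansb 7 fr8 fr8i. Proof. vm_cast_no_check (erefl true). Qed.
Lemma indep8 : indepb 7 fr8. Proof. vm_cast_no_check (erefl true). Qed.
Lemma witt4 : wittb 3 (qm 2) fr4. Proof. vm_cast_no_check (erefl true). Qed.
Lemma spans4 : spansb 3 fr4 fr4. Proof. vm_cast_no_check (erefl true). Qed.
Lemma indep4 : indepb 3 fr4. Proof. vm_cast_no_check (erefl true). Qed.
(** Representatives of the pairs of vectors met for elements of rank 2: nonsingular and orthogonal,
    nonsingular and not orthogonal, and spanning a totally singular plane. *)
Definition pr_perp := map (bl 12) [:: 65; 67].
Definition pr_nperp := map (bl 12) [:: 65; 131].
Definition pr_ts := map (bl 12) [:: 1; 2].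
Lemma witt_perp : wittb 11 (qp 6) pr_perp. Proof. vm_cast_no_check (erefl true). Qed.
Lemma witt_nperp : wittb 11 (qp 6) pr_nperp. Proof. vm_cast_no_check (erefl true). Qed.
Lemma witt_ts : wittb 11 (qp 6) pr_ts. Proof. vm_cast_no_check (erefl true). Qed.
Lemma sizes_perp : witt_sizesb 11 (qp 6) pr_perp = [:: 2016; 1023]%N. Proof. apply/eqP; vm_cast_no_check (erefl true). Qed.
Lemma sizes_nperp : witt_sizesb 11 (qp 6) pr_nperp = [:: 2016; 992]%N. Proof. apply/eqP; vm_cast_no_check (erefl true). Qed.
Lemma sizes_ts : witt_sizesb 11 (qp 6) pr_ts = [:: 2079; 1054]%N. Proof. apply/eqP; vm_cast_no_check (erefl true). Qed.

Definition b4 (l : seq nat) : seq (bool * bool) := map (fun n => (odd n, odd n./2)) l.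
Definition fr6 := map b4 [:: [:: 1;0;0;1;0;0]; [:: 0;1;0;0;0;0]; [:: 0;0;0;0;1;0];
  [:: 0;0;1;0;0;0]; [:: 0;0;0;0;0;1]; [:: 1;0;0;0;0;0]]%N.
Definition fr6i := map b4 [:: [:: 0;0;0;0;0;1]; [:: 0;1;0;0;0;0]; [:: 0;0;0;1;0;0];
  [:: 1;0;0;0;0;1]; [:: 0;0;1;0;0;0]; [:: 0;0;0;0;1;0]]%N.
Lemma witt6 : witt_ok (false,false) elts4 add4 mul4 5 (qp4 3) [::] fr6. Proof. vm_cast_no_check (erefl true). Qed.
Lemma sizes6 : witt_sizes (false,false) elts4 add4 mul4 5 (qp4 3) [::] fr6 = [:: 1008; 255; 64; 15; 4; 2]%N.
Proof. apply/eqP; vm_cast_no_check (erefl true). Qed.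
Lemma spans6 : spans_units (false,false) (true,false) add4 mul4 5 fr6 fr6i. Proof. vm_cast_no_check (erefl true). Qed.
Lemma indep6 : indepl (false,false) elts4 add4 mul4 5 [::] fr6. Proof. vm_cast_no_check (erefl true). Qed.

End Codings.

(** * The isometry groups of dimension 12, 8 and 4 over F_2 and of dimension 6 over F_4 *)

Module IsometryGroups.

Import QuadraticForms WittFrames Codings.

Local Notation F4 := Defs.F4.

Lemma sqF2_ex (x : 'F_2) : x != 0 -> exists c, c ^+ 2 * x = 1.
Proof. by case: (F2_cases x) => ->; rewrite ?eqxx // => _; exists 1; rewrite expr1n mulr1. Qed.

Lemma sqF4_ex (x : F4) : x != 0 -> exists c, c ^+ 2 * x = 1.
Proof.
move=> nzx; exists x; apply: (mulIf nzx); rewrite mul1r -exprSr -exprSr.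
by have := expf_card x; rewrite card_F4.
Qed.

Lemma F2_neq0 (x : 'F_2) : (x != 0) = (x == 1).
Proof. by case: (F2_cases x) => ->. Qed.

HB.lock Definition Q12 : 'rV['F_2]_12 -> 'F_2 := @Qplus 'F_2 6.

Section Isom12.

Variable L : GLmodel 'F_2 11.
Local Notation Q := Q12.
Local Notation B := (polar Q12).
Definition G12 : {group L} := iso Q12 L.

Lemma Q12_plus : Q12 = @Qplus 'F_2 6. Proof. by rewrite Q12.unlock. Qed.
Lemma q12 : quad_form (m := 11) Q12. Proof. by rewrite Q12_plus; exact: quad12. Qed.
Lemma Q12E l : Q12 (vec false b2F 12 l) = b2F (qp 6 l). Proof. by rewrite Q12_plus; exact: q12E. Qed.

Lemma G12_gen : G12 \subset refl_group Q12 L.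
Proof. exact: (GO_refl_gen codingF2 char2_F2 q12 Q12E L witt12 spans12 indep12). Qed.

Lemma all12 : all [in allv [:: false; true] 12] fr12.
Proof. by vm_compute. Qed.

Lemma card_G12 :
  #|G12| = foldr muln 1%N [:: 2079; 1024; 496; 240; 119; 64; 27; 16; 5; 4; 3; 2]%N.
Proof.
have h := card_GO codingF2 char2_F2 q12 Q12E L witt12 all12 spans12.
by rewrite sizes12 in h.
Qed.

Lemma vec12_neq0 l (k := find id l) : (k < 12)%N -> nth false l k -> vec false b2F 12 l != 0.
Proof.
move=> lt_k lk; apply/eqP=> /rowP/(_ (Ordinal lt_k)); rewrite !mxE /= lk.
by move/eqP; rewrite oner_eq0.
Qed.

Lemma refl_conj12 : forall a, Q12 a != 0 ->
  exists2 g, g \in G12 & refl Q12 L a = (refl Q12 L (vec false b2F 12 (bl 12 65)) ^ g)%g.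
Proof.
apply: (refl_conj_all codingF2 char2_F2 q12 Q12E L sqF2_ex (f0 := bl 12 65)).
- by vm_compute.
- by rewrite Q12E.
- exact: vec12_neq0.
Qed.

Lemma der12 : (G12^`(1))%g = [set g in G12 | ~~ odd (rk1 g)].
Proof. by apply: (OmegaE char2_F2 q12 G12_gen _ refl_conj12); rewrite Q12E. Qed.

Lemma index12 : #|G12 : G12^`(1)|%g = 2.
Proof. by apply: (Omega_index char2_F2 q12 G12_gen _ refl_conj12); rewrite Q12E. Qed.

(** Over ['F_2] two vectors are independent as soon as they are nonzero and distinct, so
    [witt_tuple] applies. *)
Lemma G12_pair f1 f2 (u v : 'rV['F_2]_12) :
    witt_ok false [:: false; true] addb andb 11 (qp 6) [::] [:: f1; f2] ->
    Q u = Q (vec false b2F 12 f1) -> Q v = Q (vec false b2F 12 f2) ->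
    B u v = B (vec false b2F 12 f1) (vec false b2F 12 f2) ->
    u != 0 -> v != 0 -> v != u ->
  exists2 g, g \in G12 & app u g = vec false b2F 12 f1 /\ app v g = vec false b2F 12 f2.
Proof.
move=> ok Qu Qv Buv nzu nzv vu.
have [|||g Rg [_ [gu gv]]] := @witt_tuple _ _ _ _ _ _ _ _ codingF2 _ _ _ char2_F2 q12 Q12E L [::] [:: f1; f2] [:: u; v] ok.
- by rewrite /= Qu Qv Buv !eqxx.
- rewrite /= nzu andbT; apply/existsP=> -[c]; case: (F2_cases c) => ->.
    by rewrite scale0r addr0 (negPf nzv).
  by rewrite scale1r addr_eq0 (oppc2v char2_F2) (negPf vu).
- by [].
by exists g => //; apply: subsetP (refl_group_sub char2_F2 q12 L) _ Rg.
Qed.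

End Isom12.

Section Isom8.

Variable L : GLmodel 'F_2 7.
Definition Q8 : 'rV['F_2]_8 -> 'F_2 := @Qminus 4.
Definition G8 : {group L} := iso Q8 L.
Lemma q8 : quad_form (m := 7) Q8. Proof. exact: quad8. Qed.
Lemma Q8E l : Q8 (vec false b2F 8 l) = b2F (qm 4 l). Proof. exact: q8E. Qed.
Lemma G8_gen : G8 \subset refl_group Q8 L.
Proof. exact: (GO_refl_gen codingF2 char2_F2 q8 Q8E L witt8 spans8 indep8). Qed.

Lemma refl_conj8 : forall a, Q8 a != 0 ->
  exists2 g, g \in G8 & refl Q8 L a = (refl Q8 L (vec false b2F 8 (bl 8 3)) ^ g)%g.
Proof.
apply: (refl_conj_all codingF2 char2_F2 q8 Q8E L sqF2_ex (f0 := bl 8 3)).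
- by vm_compute.
- by rewrite Q8E.
- by apply/eqP=> /rowP/(_ ord0)/eqP; rewrite !mxE /= oner_eq0.
Qed.

Lemma der8 : (G8^`(1))%g = [set g in G8 | ~~ odd (rk1 g)].
Proof. by apply: (OmegaE char2_F2 q8 G8_gen _ refl_conj8); rewrite Q8E. Qed.

End Isom8.

Section Isom4.

Variable L : GLmodel 'F_2 3.
Definition Q4 : 'rV['F_2]_4 -> 'F_2 := @Qminus 2.
Definition G4 : {group L} := iso Q4 L.
Lemma q4 : quad_form (m := 3) Q4. Proof. exact: quad4. Qed.
Lemma Q4E l : Q4 (vec false b2F 4 l) = b2F (qm 2 l). Proof. exact: q4E. Qed.
Lemma G4_gen : G4 \subset refl_group Q4 L.
Proof. exact: (GO_refl_gen codingF2 char2_F2 q4 Q4E L witt4 spans4 indep4). Qed.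

Lemma refl_conj4 : forall a, Q4 a != 0 ->
  exists2 g, g \in G4 & refl Q4 L a = (refl Q4 L (vec false b2F 4 (bl 4 1)) ^ g)%g.
Proof.
apply: (refl_conj_all codingF2 char2_F2 q4 Q4E L sqF2_ex (f0 := bl 4 1)).
- by vm_compute.
- by rewrite Q4E.
- by apply/eqP=> /rowP/(_ ord0)/eqP; rewrite !mxE /= oner_eq0.
Qed.

Lemma der4 : (G4^`(1))%g = [set g in G4 | ~~ odd (rk1 g)].
Proof. by apply: (OmegaE char2_F2 q4 G4_gen _ refl_conj4); rewrite Q4E. Qed.

End Isom4.

Section Isom6.

Variable L : GLmodel F4 5.
Definition Q6 : 'rV[F4]_6 -> F4 := @Qplus F4 3.
Definition G6 : {group L} := iso Q6 L.
Lemma q6 : quad_form (m := 5) Q6. Proof. exact: quad6. Qed.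
Lemma Q6E l : Q6 (vec (false, false) d4 6 l) = d4 (qp4 3 l). Proof. exact: q6E. Qed.
Lemma G6_gen : G6 \subset refl_group Q6 L.
Proof. exact: (GO_refl_gen codingF4 char2_F4 q6 Q6E L witt6 spans6 indep6). Qed.

Lemma all6 : all [in allv elts4 6] fr6.
Proof. by vm_compute. Qed.

Lemma card_G6 : #|G6| = foldr muln 1%N [:: 1008; 255; 64; 15; 4; 2]%N.
Proof.
have h := card_GO codingF4 char2_F4 q6 Q6E L witt6 all6 spans6.
by rewrite sizes6 in h.
Qed.

Definition f60 := b4 [:: 1;0;0;1;0;0]%N.

Lemma Q6f60 : Q6 (vec (false, false) d4 6 f60) = 1.
Proof. by rewrite Q6E /= /d4 /= mul0r addr0. Qed.

Lemma refl_conj6 : forall a, Q6 a != 0 ->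
  exists2 g, g \in G6 & refl Q6 L a = (refl Q6 L (vec (false, false) d4 6 f60) ^ g)%g.
Proof.
apply: (refl_conj_all codingF4 char2_F4 q6 Q6E L sqF4_ex (f0 := f60)).
- by vm_compute.
- exact: Q6f60.
- by apply/eqP=> /rowP/(_ ord0)/eqP; rewrite !mxE /d4 /= mul0r addr0 oner_eq0.
Qed.

Lemma index6 : #|G6 : G6^`(1)|%g = 2.
Proof. by apply: (Omega_index char2_F4 q6 G6_gen _ refl_conj6); rewrite Q6f60 oner_neq0. Qed.

End Isom6.

End IsometryGroups.

(** * Computing with boolean matrices; the explicit elements x, y and f *)

Module ModelElements.

Import QuadraticForms WittFrames Codings IsometryGroups.

Notation vcb n := (vec false b2F n).
Notation addb_l := (addl addb).

Lemma b2FD a b : b2F (addb a b) = b2F a + b2F b. Proof. exact: dcD codingF2 a b. Qed.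
Lemma b2F_inj : injective b2F. Proof. exact: dc_inj codingF2. Qed.

Lemma vcbD n a b : vcb n (addb_l a b) = vcb n a + vcb n b.
Proof. exact: vecD codingF2 n a b. Qed.
Lemma vcb0 n : vcb n [::] = 0. Proof. exact: vec0 codingF2 n. Qed.
Lemma vcb_surj n v : exists2 l, size l = n & vcb n l = v.
Proof.
by have [l] := vec_surj codingF2 v; rewrite (mem_allvs codingF2) => /eqP; exists l.
Qed.

Lemma mem_allvb n l : size l = n -> l \in allv [:: false; true] n.
Proof. by move=> sl; rewrite (mem_allvs codingF2) sl. Qed.

Lemma vcb_inj n a b : size a = n -> size b = n -> vcb n a = vcb n b -> a = b.
Proof. by move=> sa sb; apply: (vec_inj codingF2); rewrite (mem_allvs codingF2) ?sa ?sb. Qed.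

Fixpoint lmul (l : seq bool) (A : seq (seq bool)) : seq bool :=
  match l, A with
  | b :: l', r :: A' => if b then addb_l r (lmul l' A') else lmul l' A'
  | _, _ => [::]
  end.
Definition mmul (A C : seq (seq bool)) := [seq lmul r C | r <- A].
Fixpoint madd (A C : seq (seq bool)) : seq (seq bool) :=
  match A, C with
  | [::], _ => C
  | _, [::] => A
  | r :: A', s :: C' => addb_l r s :: madd A' C'
  end.
Definition matr p n (A : seq (seq bool)) : 'M['F_2]_(p, n) := \matrix_i vcb n (nth [::] A i).
Notation mat n := (matr n n).

Lemma row_mat p n A i : row i (matr p n A) = vcb n (nth [::] A i).
Proof. by rewrite rowK. Qed.

Lemma lmulE n p l (A : seq (seq bool)) (C : 'M_(p, n)) : size A = p ->
  (forall i : 'I_p, row i C = vcb n (nth [::] A i)) ->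
  vcb p l *m C = vcb n (lmul l A).
Proof.
move=> sA rC; rewrite mulmx_sum_row.
transitivity (\sum_(i < p) b2F (nth false l i) *: vcb n (nth [::] A i)).
  by apply: eq_bigr => i _; rewrite rC mxE.
elim: p A l sA {C rC} => [|p IHp] [|r A] l //= sA.
  by rewrite big_ord0; case: l => [|b l] /=; rewrite vcb0.
have {}sA : size A = p by case: sA.
rewrite big_ord_recl /=; case: l => [|b l] /=.
  by rewrite scale0r add0r big1 ?vcb0 // => i _; rewrite scale0r.
rewrite (IHp A l sA); case: b => /=; first by rewrite scale1r vcbD.
by rewrite scale0r add0r.
Qed.

Lemma vcb_mat p n l A : size A = p -> vcb p l *m matr p n A = vcb n (lmul l A).
Proof. by move=> sA; apply: lmulE => // i; rewrite row_mat. Qed.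

Lemma lmul_nil A : lmul [::] A = [::]. Proof. by case: A. Qed.

Lemma mat_mul p q n A C : size C = q -> matr p q A *m matr q n C = matr p n (mmul A C).
Proof.
move=> sC; apply/row_matrixP=> i; rewrite row_mul !row_mat vcb_mat //; congr (vcb n _).
elim: A (i : nat) => [|r A IHA] [|j] //=; rewrite ?nth_nil ?lmul_nil //; exact: IHA.
Qed.

Lemma addl_nilr a : addb_l a [::] = a. Proof. by case: a. Qed.

Lemma mat_add p n A C : matr p n A + matr p n C = matr p n (madd A C).
Proof.
apply/row_matrixP=> i; rewrite linearD /= !row_mat -vcbD; congr (vcb n _).
elim: A C (i : nat) => [|r A IHA] [|s C] [|j] //=; rewrite ?nth_nil //.
- exact: addl_nilr.
- exact: addl_nilr.
Qed.

Definition idl n := unitl false true n.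

Lemma mat_id n : mat n (idl n) = 1%:M.
Proof.
apply/row_matrixP=> i; rewrite row_mat row1 /idl /unitl (nth_map 0%N) ?size_iota //.
rewrite nth_iota // add0n; apply/rowP=> j; rewrite !mxE nth_mkseq //= -(inj_eq val_inj) /=.
by case: eqP.
Qed.

Lemma vcb_all n (P : 'rV['F_2]_n -> Prop) (p : seq bool -> bool) :
  (forall l, size l = n -> p l -> P (vcb n l)) ->
  lall p (allv [:: false; true] n) -> forall v, P v.
Proof.
move=> pP; rewrite lallE => /allP allp v; have [l sl <-] := vcb_surj v.
by apply: pP => //; apply: allp; rewrite (mem_allvs codingF2) sl.
Qed.

(** Only the first [n] entries are compared, with missing ones read as zero, so codes of different
    lengths can name the same vector. *)
Definition veq n (a b : seq bool) : bool :=
  lall (fun j => nth false a j == nth false b j) (iota 0 n).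
Definition ceq p n (A C : seq (seq bool)) : bool :=
  lall (fun i => veq n (nth [::] A i) (nth [::] C i)) (iota 0 p).

Lemma veqP n a b : veq n a b -> vcb n a = vcb n b.
Proof.
rewrite /veq lallE => /allP ab; apply/rowP=> j; rewrite !mxE.
by rewrite (eqP (ab j _)) // mem_iota add0n ltn_ord.
Qed.

Lemma ceqP p n A C : ceq p n A C -> matr p n A = matr p n C.
Proof.
rewrite /ceq lallE => /allP AC; apply/row_matrixP=> i; rewrite !row_mat.
by apply: veqP; apply: AC; rewrite mem_iota add0n ltn_ord.
Qed.

Section Model.

Variable L : GLmodel 'F_2 11.
Local Notation G := (G12 L).
Local Notation Q := Q12.
Local Notation B := (polar Q12).

Lemma polar12E a b : B (vcb 12 a) (vcb 12 b) = b2F (bT addb (qp 6) a b).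
Proof. by rewrite (bTE codingF2 char2_F2 Q12E). Qed.

Lemma app_vcb g A l : gmx L g = mat 12 A -> size A = 12%N ->
  app (vcb 12 l) g = vcb 12 (lmul l A).
Proof. by move=> gA sA; rewrite !appE gA vcb_mat. Qed.

(** The matrix [C] certifies that [A] is invertible; the form is compared on all 4096 vectors. *)
Definition isom_ok (A C : seq (seq bool)) : bool :=
  if size A == 12 then if size C == 12 then
    if mmul A C == idl 12 then
      lall (fun l => qp 6 (lmul l A) == qp 6 l) (allv [:: false; true] 12)
    else false else false else false.

Lemma isom_okP A C : isom_ok A C ->
  [/\ size A = 12%N, gmx L (mkGL L (mat 12 A)) = mat 12 A & mkGL L (mat 12 A) \in G].
Proof.
rewrite /isom_ok; case: eqP => // sA; case: eqP => // sC; case: eqP => // AC ok.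
have uA : mat 12 A \in unitmx.
  by apply: (@mulmx1_unit _ _ _ (mat 12 C) _).1; rewrite mat_mul // AC mat_id.
have gA := mkGLE L uA; split=> //.
apply/GO_P; apply: vcb_all ok => l sl /eqP ql.
by rewrite (app_vcb _ gA) // !Q12E ql.
Qed.

End Model.

(* Rows of 12 x 12 matrices, each read as a binary number; a final i marks an *)
(* inverse. Xr, Yr: the elements x and y; Fr: an odd isometry of U exchanging *)
(* the two F_4-structures; El: the orbit under y of a singular vector of U;   *)
(* epsr: the projection on U along W; thr = y + y^4 on U; etar =              *)
(* x^3 + x^5 + x^12 + x^14 on W; BMr: a basis adapted to U + W; H12r, Sr: an  *)
(* F_4-hyperbolic basis and a semilinear involution.                          *)
Definition Xr := map (bl 12) [:: 1; 384; 398; 16; 32; 670; 64; 258; 264; 1032; 2048; 8].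
Definition Xi := map (bl 12) [:: 1; 2432; 390; 2048; 8; 16; 64; 2306; 2304; 2348; 2560; 1024].
Definition Yr := map (bl 12) [:: 64; 454; 384; 8; 16; 32; 327; 192; 132; 512; 1024; 2048].
Definition Yi := map (bl 12) [:: 195; 390; 385; 8; 16; 32; 1; 129; 133; 512; 1024; 2048].
Definition Fr := map (bl 12) [:: 1; 129; 5; 8; 16; 32; 327; 2; 257; 512; 1024; 2048].
Definition Fi := map (bl 12) [:: 1; 128; 5; 8; 16; 32; 453; 3; 257; 512; 1024; 2048].
Definition Sr := map (bl 12) [:: 1; 2; 4; 8; 16; 32; 74; 129; 312; 533; 1036; 2052].
Definition El := map (bl 12) [:: 1; 64; 327; 453; 195].
Definition epsr := map (bl 12) [:: 1; 262; 130; 0; 0; 0; 64; 388; 130; 0; 0; 0].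
Definition thr := map (bl 12) [:: 131; 64; 1; 0; 0; 0; 326; 65; 1; 0; 0; 0].
Definition etar := map (bl 12) [:: 0; 3080; 2072; 3120; 2742; 1970; 0; 3080; 1040; 418; 3876; 3608].
Definition BMr := map (bl 12) [:: 65; 453; 326; 195; 260; 8; 16; 32; 134; 512; 1024; 2048].
Definition BMi := map (bl 12) [:: 15; 26; 265; 32; 64; 128; 14; 19; 281; 512; 1024; 2048].
Definition H12r := map (bl 12) [:: 2; 4; 12; 3; 37; 25; 3144; 2073; 1065; 3275; 3880; 1541].
Definition H12i := map (bl 12) [:: 9; 1; 2; 6; 47; 27; 498; 584; 3254; 2335; 276; 160].

End ModelElements.

(** * Certificates for 3-cycles in the group generated by y and y^h *)

Module PurityCertificates.

Import QuadraticForms WittFrames Codings IsometryGroups ModelElements.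

Notation vcb n := (vec false b2F n).
Notation addb_l := (addl addb).
Notation mat n := (matr n n).

Definition code := seq (seq bool).

Definition blockc (A B C D : code) : code :=
  [seq p.1 ++ p.2 | p <- zip A B] ++ [seq p.1 ++ p.2 | p <- zip C D].

Definition okc m (A : code) := (size A == m) && all (fun r => size r == m) A.

Lemma okc_row m A i : okc m A -> (i < m)%N -> size (nth [::] A i) = m.
Proof. by case/andP=> /eqP sA /allP rA lt_i; apply/eqP/rA/mem_nth; rewrite sA. Qed.

Lemma mat_block m A B C D : okc m A -> okc m B -> okc m C -> okc m D ->
  matr (m + m) (m + m) (blockc A B C D) = block_mx (mat m A) (mat m B) (mat m C) (mat m D).
Proof.
move=> oA oB oC oD; have sz X : okc m X -> size X = m by case/andP=> /eqP.
have half (X Y : code) : okc m X -> okc m Y -> forall i : 'I_m,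
    vcb (m + m) (nth [::] [seq p.1 ++ p.2 | p <- zip X Y] i) =
    row_mx (vcb m (nth [::] X i)) (vcb m (nth [::] Y i)).
  move=> oX oY i; rewrite (nth_map ([::], [::])) ?size_zip ?(sz X) ?(sz Y) ?minnn //.
  rewrite nth_zip ?(sz X) ?(sz Y) //=; apply/rowP=> j; rewrite mxE -(splitK j).
  case: (split j) => k /=; rewrite nth_cat (okc_row oX) //.
    by rewrite row_mxEl mxE ltn_ord.
  by rewrite row_mxEr mxE ltnNge leq_addr /= addKn.
have szz X Y : okc m X -> okc m Y -> size [seq p.1 ++ p.2 | p <- zip X Y] = m.
  by move=> oX oY; rewrite size_map size_zip (sz X) // (sz Y) // minnn.
apply/row_matrixP=> i; rewrite row_mat /blockc nth_cat szz // -(splitK i).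
case: (split i) => k /=.
  by rewrite ltn_ord half // rowKu -!row_mat row_row_mx.
by rewrite ltnNge leq_addr /= addKn half // rowKd -!row_mat row_row_mx.
Qed.

(* With G the Gram matrix of the vectors f_0, ..., f_7 = e_i, e_i h (i < 4),  *)
(* the matrix K stands for v |-> v + \sum_(i, j) B v f_i K_ij f_j, and        *)
(* compK G is composition.                                                    *)
Definition compK (G K K' : code) : code :=
  madd (madd K K') (mmul (mmul K G) K').

(** [KU] stands for y on U, [K01] and [K12] for the transvections in e_0 + e_1 and e_1 + e_2, and
    [K3] for their product, a 3-cycle on the singular vectors. [Ky] and [Kz] put y and y^h in the
    two halves of the frame; [J4] is the Gram matrix of e_0, ..., e_3. *)
Definition KU : code := map (bl 4) [:: 13; 8; 2; 9].
Definition Z4 : code := nseq 4 (nseq 4 false).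
Definition J4 : code := map (bl 4) [:: 14; 13; 11; 7].
Definition Ky : code := blockc KU Z4 Z4 Z4.
Definition Kz : code := blockc Z4 Z4 Z4 KU.
Definition Kid : code := nseq 8 (nseq 8 false).
Definition outer (a : seq bool) : code := [seq if b then a else nseq 4 false | b <- a].
Definition K01 : code := outer [:: true; true; false; false].
Definition K12 : code := outer [:: false; true; true; false].
Definition K3 : code := madd (madd K01 K12) (mmul (mmul K01 J4) K12).

Definition powK G K n := iter n (compK G K) Kid.
Definition evalK G (P : nat -> code) (w : seq nat) :=
  foldl (fun acc k => compK G acc (P k)) Kid w.

Definition gramc (C : code) : code :=
  let C4 := [seq take 4 r | r <- take 4 C] in
  let Ct := [seq [seq nth false r j | r <- C4] | j <- iota 0 4] in
  blockc J4 C4 Ct J4.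

Definition letters G : seq code :=
  [seq powK G Ky k | k <- iota 0 5] ++ [seq powK G Kz k | k <- iota 0 5].

(** The letters 0 and 5 are trivial powers: 0 is sent to 5, and 5 to 10, which is out of range and
    is read as the default [Kid]. *)
Definition invl (k : nat) : nat := if (k < 5)%N then (5 - k)%N else (15 - k)%N.

Definition cert_ok (C : code) (c : seq nat * nat * seq nat) : bool :=
  let G := gramc C in
  let ls := letters G in
  let P k := nth Kid ls k in
  let: (w, n, cj) := c in
  compK G (compK G (evalK G P (rev (map invl cj))) (powK G (evalK G P w) n)) (evalK G P cj)
  == blockc K3 Z4 Z4 Z4.

Definition xors (s : seq bool) := foldr addb false s.
Definition rowx (r : seq bool) := rcons r (xors r).
(** The fifth singular vector is the sum of the other four, so the 4 x 4 matrix of products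
    determines the last row and the last column. *)
Definition full (R : code) : code :=
  map rowx (rcons R (foldr addb_l (nseq 4 false) R)).
Definition rows4 (l : seq bool) : code :=
  [:: take 4 l; take 4 (drop 4 l); take 4 (drop 8 l); take 4 (drop 12 l)].

Definition e5 (C : code) i j := nth false (nth [::] C (i %% 5)) (j %% 5).

(** The commutation of the block of h with theta = y + y^-1, up to [c] times the block, expressed by
    products of singular vectors; [i + 4] is i - 1 modulo 5. *)
Definition pureb (c : bool) (C : code) : bool :=
  lall (fun i => lall (fun j =>
    addb (addb (e5 C i.+1 j) (e5 C (i + 4) j)) (addb (e5 C i j.+1) (e5 C i (j + 4)))
    == (if c then e5 C i j else false)) (iota 0 5)) (iota 0 5).

(** [perm2] doubles the index modulo 5. [T1] and [T3] act on columns, [T2] and [T4] on rows; each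
    pair generates the affine group of Z/5. *)
Definition perm2 T (x : T) (r : seq T) := [seq nth x r i | i <- [:: 0; 2; 4; 1; 3]%N].
Definition T1 (C : code) : code := map (seq.rot 1%N) C.
Definition T2 (C : code) : code := seq.rot 1%N C.
Definition T3 (C : code) : code := map (perm2 false) C.
Definition T4 (C : code) : code := perm2 [::] C.

(** A binary tree of flattened matrices, which makes the 2^16 membership tests of [covered] fast. *)
Inductive trie := Lf | Nd of trie & trie.
Fixpoint tins (k : seq bool) (t : trie) : trie :=
  match k with
  | [::] => Nd Lf Lf
  | b :: k' =>
    let: (l, r) := if t is Nd l r then (l, r) else (Lf, Lf) in
    if b then Nd l (tins k' r) else Nd (tins k' l) r
  end.
Fixpoint tmem (k : seq bool) (t : trie) : bool :=
  match k with
  | [::] => if t is Nd _ _ then true else false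
  | b :: k' => if t is Nd l r then tmem k' (if b then r else l) else false
  end.

Lemma tmem_ins k k' t : size k = size k' -> tmem k (tins k' t) -> k = k' \/ tmem k t.
Proof.
elim: k k' t => [|b k IHk] [|b' k'] t //=; first by left.
case=> sk; case: t => [|l r]; case: b'; case: b => //=.
- by case/(IHk _ _ sk) => [->|]; [left | case: (k)].
- by case: (k).
- by case: (k).
- by case/(IHk _ _ sk) => [->|]; [left | case: (k)].
- by case/(IHk _ _ sk) => [->|]; [left | right].
- by right.
- by right.
- by case/(IHk _ _ sk) => [->|]; [left | right].
Qed.

Fixpoint orb (T : code -> code) n (C : code) : seq code :=
  if n is n'.+1 then C :: orb T n' (T C) else [::].
Definition imgs (C : code) : seq code :=
  flatten [seq flatten [seq flatten [seq orb T1 5 C2 | C2 <- orb T2 5 C1]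
    | C1 <- orb T3 4 C0] | C0 <- orb T4 4 C].

(* The first component is the matrix B e_i (e_j h), one for each orbit of     *)
(* impure matrices under the affine group of Z/5 on rows and on columns; then *)
(* a word w in the powers of y (letters below 5) and of y^h, an exponent n    *)
(* and a word c such that (w^n)^c is the 3-cycle K3.                          *)
Definition certs : seq (seq nat * seq nat * nat * seq nat) := [::
([:: 1; 0; 0; 0], [:: 3; 7], 7, [:: 4; 6; 1; 6; 3; 6; 1; 6]);
([:: 7; 0; 0; 0], [:: 1; 8; 4; 7], 2, [:: 2; 8; 1; 6; 1; 6; 1; 8]);
([:: 2; 1; 0; 0], [:: 3; 9], 8, [:: 7; 3; 6; 3; 6]);
([:: 3; 1; 0; 0], [:: 3; 9; 1; 6], 4, [:: 4; 9; 3]);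
([:: 6; 1; 0; 0], [:: 1; 7], 7, [:: 2; 6; 1; 8; 1; 6]);
([:: 7; 1; 0; 0], [:: 3; 9], 14, [:: 1; 6; 2; 6; 2; 6]);
([:: 10; 1; 0; 0], [:: 4; 8; 1; 7], 2, [:: 2; 8; 3; 7]);
([:: 11; 1; 0; 0], [:: 4; 7; 1; 8], 2, [:: 2; 7; 3; 8]);
([:: 14; 1; 0; 0], [:: 4; 8; 3; 9], 8, [:: 2; 6; 1; 6; 3]);
([:: 8; 7; 0; 0], [:: 4; 6], 16, [:: 8; 2; 6]);
([:: 1; 1; 1; 0], [:: 4; 7; 1; 7], 2, [:: 1; 7; 3; 6; 1; 6; 1; 7; 2]);
([:: 2; 1; 1; 0], [:: 2; 6], 14, [:: 4; 6; 1]);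
([:: 3; 1; 1; 0], [:: 4; 8], 7, [:: 2; 6; 1; 7; 1; 6; 2; 8]);
([:: 6; 1; 1; 0], [:: 1; 6; 2; 8], 8, [:: 4; 7; 1; 9]);
([:: 7; 1; 1; 0], [:: 3; 6], 14, [:: 6; 1; 7; 4]);
([:: 10; 1; 1; 0], [:: 4; 6; 1; 7], 2, [:: 6; 1; 6; 1; 6; 1; 6; 1; 6]);
([:: 11; 1; 1; 0], [:: 1; 8], 14, [:: 6; 3; 6; 3]);
([:: 14; 1; 1; 0], [:: 1; 9; 3; 7], 4, [:: 1; 6; 3; 7]);
([:: 2; 2; 1; 0], [:: 4; 9; 4; 6], 4, [:: 6; 1; 8; 2; 7; 2; 6]);
([:: 4; 2; 1; 0], [:: 2; 7], 4, [:: 7; 2; 6; 1; 7; 1; 6; 2]);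
([:: 5; 2; 1; 0], [:: 1; 6], 7, [:: 6; 1; 6; 1; 6; 3; 6]);
([:: 6; 2; 1; 0], [:: 3; 9], 14, [:: 1; 6; 1; 6; 1; 6; 3; 7]);
([:: 7; 2; 1; 0], [:: 2; 7; 1; 7], 4, [:: 6; 1; 7; 3; 9]);
([:: 8; 2; 1; 0], [:: 1; 9; 4; 8], 4, [:: 8; 1; 6; 3; 7]);
([:: 9; 2; 1; 0], [:: 3; 6], 14, [:: 6; 2; 6; 2; 7; 3]);
([:: 10; 2; 1; 0], [:: 3; 9; 3; 7], 5, [:: 4; 6; 1; 6; 1; 7; 2]);
([:: 12; 2; 1; 0], [:: 2; 9; 3; 6], 4, [:: 3; 6; 2; 6; 1]);
([:: 13; 2; 1; 0], [:: 1; 6], 7, [:: 6; 4; 9; 1; 6]);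
([:: 14; 2; 1; 0], [:: 3; 6], 14, [:: 8; 2; 6; 1; 6]);
([:: 15; 2; 1; 0], [:: 2; 9; 1; 9], 4, [:: 6; 1; 8]);
([:: 3; 3; 1; 0], [:: 1; 6; 4; 9], 2, [:: 2; 6; 2; 9]);
([:: 9; 3; 1; 0], [:: 3; 7; 2; 6], 8, [:: 6; 1; 7; 1; 8; 1; 6]);
([:: 10; 3; 1; 0], [:: 1; 6; 4; 6], 5, [:: 6; 2; 6; 1; 7]);
([:: 11; 3; 1; 0], [:: 3; 8], 4, [:: 6; 1; 7; 1; 8; 1; 6; 1; 6; 1]);
([:: 12; 3; 1; 0], [:: 2; 8], 16, [:: 1; 7; 1; 8; 1]);
([:: 13; 3; 1; 0], [:: 2; 7], 7, [:: 6; 2; 6; 2; 6]);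
([:: 14; 3; 1; 0], [:: 2; 6], 20, [:: 6; 4; 6; 3]);
([:: 15; 3; 1; 0], [:: 3; 6], 14, [:: 1; 6; 4; 7]);
([:: 2; 4; 1; 0], [:: 4; 6], 4, [:: 6; 1; 6; 2; 6; 1; 6; 2; 7]);
([:: 9; 4; 1; 0], [:: 4; 7; 2; 7], 14, [:: 8; 2]);
([:: 10; 4; 1; 0], [:: 1; 6; 1; 9], 4, [:: 6; 2; 6; 1; 6; 2; 9]);
([:: 11; 4; 1; 0], [:: 4; 8], 7, [:: 6; 3; 7; 1]);
([:: 14; 4; 1; 0], [:: 3; 9], 14, [:: 7; 2; 7; 1; 6; 3; 6]);
([:: 15; 4; 1; 0], [:: 3; 6], 8, [:: 6; 2; 6; 2; 6; 1; 7]);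
([:: 6; 6; 1; 0], [:: 3; 7; 1; 8], 4, [:: 7; 1; 8; 1; 7]);
([:: 10; 6; 1; 0], [:: 2; 9; 1; 7], 20, [:: 2; 6; 1; 8; 1; 6; 1; 6]);
([:: 12; 6; 1; 0], [:: 1; 7; 2; 7], 4, [:: 2; 8; 3]);
([:: 14; 6; 1; 0], [:: 2; 6; 4; 7], 8, [:: 1; 6; 1; 6; 1; 7; 2; 6]);
([:: 7; 7; 1; 0], [:: 2; 9], 14, [:: 6; 1; 9; 1; 7; 4]);
([:: 11; 7; 1; 0], [:: 4; 8], 8, [:: 1; 6; 1; 8; 1; 7; 1; 6]);
([:: 13; 7; 1; 0], [:: 3; 6], 8, [:: 1; 6; 1; 8; 1; 6; 2; 8]);
([:: 14; 7; 1; 0], [:: 3; 8], 7, [:: 6; 4; 6; 1; 6; 2; 6]);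
([:: 15; 7; 1; 0], [:: 2; 8], 14, [:: 1; 8; 2; 7; 1; 6; 1]);
([:: 7; 11; 1; 0], [:: 3; 6], 4, [:: 1; 6; 2; 7; 1; 7; 2; 6]);
([:: 7; 14; 1; 0], [:: 4; 9], 7, [:: 1; 6; 3; 9; 2; 6]);
([:: 11; 14; 1; 0], [:: 1; 9; 3; 9], 8, [:: 1; 8; 1; 8]);
([:: 14; 14; 1; 0], [:: 2; 6; 1; 9], 2, [:: 4; 6; 2; 8]);
([:: 7; 7; 7; 0], [:: 1; 9; 4; 6], 2, [:: 2; 9; 2]);
([:: 11; 7; 7; 0], [:: 1; 6], 14, [:: 6; 1; 7; 2; 7; 2]);
([:: 11; 11; 7; 0], [:: 2; 6], 14, [:: 8; 1; 7; 1; 6; 1]);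
([:: 2; 1; 1; 1], [:: 4; 7; 4; 6], 5, [:: 2; 9; 1; 7]);
([:: 4; 1; 1; 1], [:: 2; 7], 20, [:: 3; 8]);
([:: 6; 1; 1; 1], [:: 2; 7; 2; 6], 10, [:: 1; 7; 2; 6; 1; 8]);
([:: 10; 1; 1; 1], [:: 1; 9; 4; 8], 2, [:: 6; 2; 6; 1; 6; 2; 8]);
([:: 14; 1; 1; 1], [:: 2; 6], 20, [:: 3; 9]);
([:: 4; 2; 1; 1], [:: 3; 9; 2; 7], 4, [:: 2; 8; 1; 6; 1; 6; 2; 6]);
([:: 5; 2; 1; 1], [:: 4; 9], 14, [:: 3; 7; 1; 7; 1]);
([:: 6; 2; 1; 1], [:: 3; 7], 8, [:: 6; 1; 6; 1; 6; 3]);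
([:: 7; 2; 1; 1], [:: 1; 9], 14, [:: 1; 6; 1; 6; 1; 7; 1; 6]);
([:: 8; 2; 1; 1], [:: 2; 8; 2; 6], 4, [:: 4; 6; 4; 6; 1]);
([:: 9; 2; 1; 1], [:: 4; 8; 1; 9], 8, [:: 7; 1; 6; 3; 6; 1]);
([:: 10; 2; 1; 1], [:: 2; 7; 1; 8], 8, [:: 1; 7; 2; 6; 3; 6; 1]);
([:: 11; 2; 1; 1], [:: 1; 9], 7, [:: 4; 6; 2; 6; 2; 7]);
([:: 12; 2; 1; 1], [:: 2; 7; 4; 9], 10, [:: 1; 7; 1; 7; 3; 7]);
([:: 13; 2; 1; 1], [:: 1; 9], 16, [:: 4; 7; 1; 6; 1; 6]);
([:: 14; 2; 1; 1], [:: 3; 7; 3; 8], 4, [:: 2; 7; 2; 8]);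
([:: 15; 2; 1; 1], [:: 4; 7; 3; 6], 4, [:: 8; 1; 7; 1; 6; 1]);
([:: 4; 3; 1; 1], [:: 4; 7], 7, [:: 1; 6; 1; 6; 3; 7; 1; 6; 1]);
([:: 5; 3; 1; 1], [:: 1; 7; 2; 8], 4, [:: 6; 2; 6; 3; 6; 3]);
([:: 6; 3; 1; 1], [:: 4; 8], 10, [:: 6; 1; 6; 1; 6; 4]);
([:: 7; 3; 1; 1], [:: 4; 7], 7, [:: 6; 4; 6; 1; 6; 3]);
([:: 8; 3; 1; 1], [:: 4; 7], 14, [:: 1; 6; 1; 8; 2; 8]);
([:: 9; 3; 1; 1], [:: 1; 8; 1; 6], 4, [:: 1; 7; 4; 6]);
([:: 11; 3; 1; 1], [:: 2; 7], 7, [:: 6; 1; 6; 3]);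
([:: 12; 3; 1; 1], [:: 2; 8; 2; 9], 5, [:: 2; 7; 1; 6; 1; 7]);
([:: 13; 3; 1; 1], [:: 2; 9; 2; 8], 10, [:: 9; 1; 6]);
([:: 14; 3; 1; 1], [:: 3; 7], 16, [:: 1; 6; 4; 6; 1; 6; 1]);
([:: 15; 3; 1; 1], [:: 3; 6; 3; 9], 4, [:: 7; 4; 6; 1]);
([:: 2; 4; 1; 1], [:: 4; 8; 3; 9], 5, [:: 9; 1]);
([:: 3; 4; 1; 1], [:: 4; 7], 14, [:: 1; 6; 3; 8; 3]);
([:: 8; 4; 1; 1], [:: 2; 7], 8, [:: 3; 8; 4]);
([:: 9; 4; 1; 1], [:: 4; 7], 14, [:: 3; 7; 3; 6]);
([:: 10; 4; 1; 1], [:: 2; 6; 1; 7], 10, [:: 1; 6; 2; 7; 3; 7]);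
([:: 11; 4; 1; 1], [:: 1; 7], 20, [:: 2; 7; 1; 6; 1; 8; 1]);
([:: 14; 4; 1; 1], [:: 1; 6; 3; 8], 10, [:: 4; 6; 1; 6; 1; 7; 1]);
([:: 15; 4; 1; 1], [:: 3; 8], 16, [:: 1; 8; 4]);
([:: 8; 6; 1; 1], [:: 3; 8; 4; 6], 5, [:: 4; 6; 2; 6]);
([:: 9; 6; 1; 1], [:: 3; 6; 1; 6], 10, [:: 6; 4; 6; 1]);
([:: 10; 6; 1; 1], [:: 4; 8], 4, [:: 6; 2; 6]);
([:: 11; 6; 1; 1], [:: 4; 7], 8, [:: 1; 7; 2; 6; 1]);
([:: 12; 6; 1; 1], [:: 3; 8], 8, [:: 6; 3; 6; 1]);
([:: 13; 6; 1; 1], [:: 2; 8; 2; 9], 10, [:: 3; 7; 1; 7; 1]);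
([:: 8; 7; 1; 1], [:: 4; 8], 8, [:: 2; 7; 1; 6; 1; 6; 1]);
([:: 9; 7; 1; 1], [:: 4; 9], 20, [:: 1; 6; 1; 6; 1; 7; 3; 8]);
([:: 10; 7; 1; 1], [:: 1; 7], 16, [:: 6; 3; 6; 1; 6; 1; 6]);
([:: 12; 7; 1; 1], [:: 1; 8], 10, [:: 2; 6; 4; 6; 1]);
([:: 13; 7; 1; 1], [:: 1; 9], 10, [:: 1; 6; 1; 6; 3; 6; 3]);
([:: 4; 10; 1; 1], [:: 4; 9; 4; 8], 8, [:: 2; 6; 1; 6; 1; 6; 2; 6]);
([:: 4; 11; 1; 1], [:: 1; 7], 8, [:: 6; 1; 6; 2; 6; 2; 6]);
([:: 7; 3; 2; 1], [:: 3; 9], 4, [:: 6; 1; 7; 1; 6]);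
([:: 13; 3; 2; 1], [:: 2; 9], 8, [:: 7; 2; 6]);
([:: 14; 3; 2; 1], [:: 2; 6], 16, [:: 1; 6; 3; 7]);
([:: 8; 4; 2; 1], [:: 3; 8], 4, [:: 2; 7; 1; 7; 1; 6]);
([:: 9; 4; 2; 1], [:: 4; 8; 3; 9], 20, [:: 2; 6; 4]);
([:: 10; 4; 2; 1], [:: 2; 9], 16, [:: 1; 8; 3; 7; 1; 7]);
([:: 11; 4; 2; 1], [:: 1; 7; 2; 9], 4, [:: 4; 7; 1; 8; 1]);
([:: 12; 4; 2; 1], [:: 2; 6], 16, [:: 1; 9; 1; 6; 1; 7]);
([:: 13; 4; 2; 1], [:: 2; 9], 8, [:: 1; 7; 4; 7; 1]);
([:: 14; 4; 2; 1], [:: 2; 6], 8, [:: 7; 1; 7; 2; 7]);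
([:: 15; 4; 2; 1], [:: 4; 8; 2; 6], 8, [:: 9; 2; 6; 1]);
([:: 9; 5; 2; 1], [:: 2; 7; 2; 6], 8, [:: 1; 6; 2; 7; 4]);
([:: 10; 5; 2; 1], [:: 3; 9; 1; 9], 4, [:: 8; 1; 8; 1; 6; 2; 6]);
([:: 11; 5; 2; 1], [:: 2; 8], 7, [:: 1; 7; 1; 8]);
([:: 12; 5; 2; 1], [:: 3; 8; 4; 8], 5, [:: 2; 7; 3; 6]);
([:: 13; 5; 2; 1], [:: 2; 9], 7, [:: 6; 1; 7; 2; 7; 1; 7]);
([:: 14; 5; 2; 1], [:: 1; 9; 3; 6], 8, [:: 6; 3; 6; 1; 7; 1]);
([:: 15; 5; 2; 1], [:: 3; 7; 4; 9], 4, [:: 4; 6]);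
([:: 10; 6; 2; 1], [:: 3; 9], 16, [:: 7; 4; 7; 1]);
([:: 11; 6; 2; 1], [:: 4; 7; 3; 6], 14, [:: 6; 1; 6; 1; 6; 1]);
([:: 12; 6; 2; 1], [:: 1; 7; 2; 7], 4, [:: 1; 8; 1; 6; 2; 6; 2; 6]);
([:: 13; 6; 2; 1], [:: 1; 9; 1; 6], 20, [:: 8; 2; 6; 2; 6]);
([:: 14; 6; 2; 1], [:: 2; 8], 7, [:: 6; 1; 6; 3; 6; 1; 7]);
([:: 3; 7; 2; 1], [:: 3; 8], 4, [:: 1; 6; 2; 9]);
([:: 7; 7; 2; 1], [:: 1; 7], 8, [:: 3; 8; 1; 9; 2]);
([:: 9; 7; 2; 1], [:: 4; 8; 1; 8], 7, [:: 8; 2; 6; 1; 6]);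
([:: 10; 7; 2; 1], [:: 3; 9], 14, [:: 1; 6; 1; 7; 2; 6; 1; 6]);
([:: 11; 7; 2; 1], [:: 1; 9; 2; 8], 8, [:: 6; 1; 7; 1; 6; 1; 8; 2]);
([:: 12; 7; 2; 1], [:: 3; 7], 10, [:: 2; 8; 1; 8; 2; 6]);
([:: 13; 7; 2; 1], [:: 2; 9], 14, [:: 1; 6; 1; 9; 2]);
([:: 14; 7; 2; 1], [:: 3; 9], 14, [:: 1; 6; 1; 6; 2; 6; 2; 6; 1; 6]);
([:: 15; 7; 2; 1], [:: 2; 9], 8, [:: 6; 1; 7; 2; 6; 3; 6]);
([:: 5; 8; 2; 1], [:: 2; 6], 8, [:: 7; 1; 6; 1; 9; 1; 6]);
([:: 7; 8; 2; 1], [:: 4; 7; 2; 7], 4, [:: 1; 9; 4; 6]);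
([:: 12; 8; 2; 1], [:: 2; 8], 10, [:: 2; 7; 2; 7; 1; 7]);
([:: 13; 8; 2; 1], [:: 1; 6], 8, [:: 2; 9; 1; 6; 2]);
([:: 12; 9; 2; 1], [:: 2; 8; 4; 9], 10, [:: 8; 1]);
([:: 13; 9; 2; 1], [:: 2; 6], 7, [:: 1; 6; 3; 6; 2; 6; 1; 6]);
([:: 4; 10; 2; 1], [:: 3; 9], 16, [:: 1; 8; 2; 9]);
([:: 7; 10; 2; 1], [:: 1; 8], 14, [:: 3; 8; 2; 6]);
([:: 14; 10; 2; 1], [:: 3; 9], 7, [:: 2; 6; 1; 9]);
([:: 4; 11; 2; 1], [:: 4; 6; 2; 8], 2, [:: 2; 9; 1; 6; 1; 6; 1]);
([:: 5; 11; 2; 1], [:: 3; 7], 7, [:: 1; 6; 3; 9; 2]);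
([:: 7; 11; 2; 1], [:: 1; 6; 2; 6], 8, [:: 6; 1; 6; 3; 6; 1; 7]);
([:: 14; 11; 2; 1], [:: 3; 7], 7, [:: 1; 6; 1; 6]);
([:: 15; 11; 2; 1], [:: 3; 9], 8, [:: 1; 9; 1; 6; 3]);
([:: 3; 13; 2; 1], [:: 2; 8; 3; 9], 4, [:: 9; 3; 7]);
([:: 13; 13; 2; 1], [:: 4; 9], 20, [:: 2; 6; 2; 7; 2; 6]);
([:: 3; 14; 2; 1], [:: 1; 9], 10, [:: 2; 6; 3; 6; 2; 6]);
([:: 7; 14; 2; 1], [:: 1; 9], 14, [:: 1; 6; 3; 6; 4; 6; 1; 6]);
([:: 10; 14; 2; 1], [:: 2; 6], 7, [:: 6; 2; 7; 2; 6]);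
([:: 7; 15; 2; 1], [:: 4; 9], 8, [:: 1; 8; 3; 7]);
([:: 11; 15; 2; 1], [:: 4; 8; 3; 6], 8, [:: 1; 6; 1; 6; 1; 7; 2; 6]);
([:: 8; 6; 3; 1], [:: 4; 8; 2; 6], 10, [:: 3; 8; 2; 7]);
([:: 11; 6; 3; 1], [:: 2; 6], 7, [:: 3; 8; 1; 6; 1]);
([:: 15; 6; 3; 1], [:: 2; 7], 7, [:: 1; 6; 1; 7; 1; 6; 1; 6; 1]);
([:: 8; 7; 3; 1], [:: 3; 6], 14, [:: 2; 6; 1; 7; 3]);
([:: 11; 7; 3; 1], [:: 4; 7], 8, [:: 1; 6; 2; 9; 1; 6]);
([:: 14; 7; 3; 1], [:: 1; 7], 4, [:: 2; 8; 1; 7; 3; 7]);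
([:: 13; 8; 3; 1], [:: 2; 8], 7, [:: 6; 3; 7; 2]);
([:: 7; 11; 3; 1], [:: 1; 8], 8, [:: 1; 6; 3; 6; 1; 6; 4]);
([:: 14; 11; 3; 1], [:: 3; 8], 4, [:: 6; 2; 7; 1; 6; 2]);
([:: 7; 7; 6; 1], [:: 1; 6], 7, [:: 2; 7; 2; 6; 1; 7; 2]);
([:: 11; 7; 6; 1], [:: 1; 6], 7, [:: 3; 6; 3; 6]);
([:: 13; 7; 6; 1], [:: 3; 6], 7, [:: 6; 1; 6; 2; 6; 2; 8]);
([:: 14; 7; 6; 1], [:: 1; 8], 7, [:: 4; 7; 1; 7]);
([:: 15; 7; 6; 1], [:: 4; 7], 14, [:: 6; 3; 6; 2; 6; 1; 7]);
([:: 7; 11; 6; 1], [:: 3; 8], 14, [:: 8; 3; 8]);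
([:: 7; 13; 6; 1], [:: 2; 7], 7, [:: 3; 8; 4; 6; 1]);
([:: 10; 7; 7; 1], [:: 2; 9], 7, [:: 8; 3; 8; 1; 6; 1]);
([:: 11; 7; 7; 1], [:: 3; 6], 14, [:: 1; 6; 1; 8; 1; 8; 1]);
([:: 14; 7; 7; 1], [:: 1; 9], 8, [:: 1; 6; 1; 7; 2; 8; 1; 6]);
([:: 15; 7; 7; 1], [:: 1; 6], 8, [:: 3; 8; 4; 6; 1]);
([:: 11; 10; 7; 1], [:: 1; 6], 7, [:: 2; 6; 1; 6; 1; 7; 1; 6; 2]);
([:: 15; 14; 7; 1], [:: 1; 8; 4; 9], 4, [:: 6; 2; 7; 1; 6]);
([:: 11; 11; 10; 1], [:: 4; 7], 7, [:: 6; 2; 6; 1; 6; 2]);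
([:: 14; 11; 11; 1], [:: 2; 6; 3; 9], 4, [:: 6; 1; 7; 1; 7; 1; 6; 1]);
([:: 15; 14; 11; 1], [:: 3; 7], 4, [:: 1; 6; 1; 6; 1; 6; 4; 6]);
([:: 14; 14; 14; 1], [:: 2; 7], 8, [:: 6; 3; 6; 4]);
([:: 15; 13; 11; 7], [:: 3; 8], 4, [:: 2; 6; 2; 6; 1; 6; 1])]%N.

Definition rep_code (c : seq nat * seq nat * nat * seq nat) : code :=
  full (map (bl 4) c.1.1.1).
Definition mk_trie cs :=
  foldl (fun t c => foldl (fun t C => tins (flatten C) t) t (imgs (rep_code c))) Lf cs.

Lemma certs_ok : lall (fun c => cert_ok (rep_code c) (c.1.1.2, c.1.2, c.2)) certs.
Proof. vm_cast_no_check (erefl true). Qed.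

Definition cov t l : bool :=
  let C := full (rows4 l) in
  if pureb false C then true else if pureb true C then true else tmem (flatten C) t.

Lemma covered : lall (cov (mk_trie certs)) (allv [:: false; true] 16).
Proof. vm_cast_no_check (erefl true). Qed.

Lemma trie_foldl (s : seq code) t k : all (fun C => size (flatten C) == size k) s ->
  tmem k (foldl (fun t C => tins (flatten C) t) t s) ->
  tmem k t \/ exists2 C, C \in s & k = flatten C.
Proof.
elim: s t => [|C s IHs] t /=; first by left.
case/andP=> /eqP sC /IHs{}IHs /IHs[|[D sD ->]]; last by right; exists D; rewrite // inE sD orbT.
by case/tmem_ins=> // [->|]; [right; exists C; rewrite // mem_head | left].
Qed.

Lemma trie_foldl2 (A : eqType) (f : A -> seq code) cs t k :
  all (fun c => all (fun C => size (flatten C) == size k) (f c)) cs ->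
  tmem k (foldl (fun t c => foldl (fun t C => tins (flatten C) t) t (f c)) t cs) ->
  tmem k t \/ exists2 c, c \in cs & exists2 C, C \in f c & k = flatten C.
Proof.
elim: cs t => [|c cs IHcs] t; first by left.
case/andP=> szc /IHcs{}IHcs /IHcs[|[d dc dE]]; last by right; exists d; rewrite // inE dc orbT.
case/(trie_foldl szc) => [|[C iC kC]]; first by left.
by right; exists c; rewrite ?mem_head //; exists C.
Qed.

Lemma mk_trieP cs k : size k = 25%N ->
  all (fun c => all (fun C => size (flatten C) == 25%N) (imgs (rep_code c))) cs ->
  tmem k (mk_trie cs) ->
  exists2 c, c \in cs & exists2 C, C \in imgs (rep_code c) & k = flatten C.
Proof.
move=> sk; rewrite -{1}sk => sz tk.
case: (trie_foldl2 sz tk) => [|h]; last exact: h.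
by clear; case: k.
Qed.

Definition ok5 (C : code) := okc 5 C.

Lemma perm2_4 T (x : T) r : size r = 5 -> iter 4 (perm2 x) r = r.
Proof. by case: r => [|a [|b [|c [|d [|e [|f r]]]]]]. Qed.

Lemma rot1_5 T (r : seq T) : size r = 5 -> iter 5 (seq.rot 1%N) r = r.
Proof. by case: r => [|a [|b [|c [|d [|e [|f r]]]]]]. Qed.

Lemma iter_map T (f : T -> T) n s : iter n (map f) s = map (iter n f) s.
Proof.
elim: n => [|n IHn] /=; first by rewrite map_id.
by rewrite IHn -map_comp.
Qed.

Lemma T1_5 C : ok5 C -> iter 5 T1 C = C.
Proof.
case/andP=> _ /allP rC; rewrite (iter_map (seq.rot 1%N) 5 C) -[RHS]map_id.
by apply/eq_in_map => r /rC/eqP sr; apply: rot1_5.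
Qed.
Lemma T2_5 C : ok5 C -> iter 5 T2 C = C.
Proof. by case/andP=> /eqP sC _; apply: rot1_5. Qed.
Lemma T3_4 C : ok5 C -> iter 4 T3 C = C.
Proof.
case/andP=> _ /allP rC; rewrite (iter_map (perm2 false) 4 C) -[RHS]map_id.
by apply/eq_in_map => r /rC/eqP sr; apply: perm2_4.
Qed.
Lemma T4_4 C : ok5 C -> iter 4 T4 C = C.
Proof. by case/andP=> /eqP sC _; apply: perm2_4. Qed.

Lemma ok5_T1 C : ok5 C -> ok5 (T1 C).
Proof.
case/andP=> sC /allP rC; rewrite /ok5 /okc size_map sC all_map.
by apply/allP=> r /rC/eqP sr; rewrite /= size_rot sr.
Qed.
Lemma ok5_T2 C : ok5 C -> ok5 (T2 C).
Proof.
case/andP=> sC rC; rewrite /ok5 /okc size_rot sC.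
by rewrite (eq_all_r (mem_rot 1%N C)) rC.
Qed.
Lemma ok5_T3 C : ok5 C -> ok5 (T3 C).
Proof.
by case/andP=> sC /allP rC; rewrite /ok5 /okc size_map sC all_map; apply/allP.
Qed.
Lemma ok5_T4 C : ok5 C -> ok5 (T4 C).
Proof.
case/andP=> /eqP sC /allP rC; apply/andP; split=> //.
by apply/allP=> _ /mapP[i i5 ->]; apply/rC/mem_nth; rewrite sC; move: i5; rewrite !inE; lia.
Qed.

Section Closure.

Variable P : code -> Prop.
Hypotheses (P1 : forall C, P (T1 C) -> P C) (P2 : forall C, P (T2 C) -> P C).
Hypotheses (P3 : forall C, P (T3 C) -> P C) (P4 : forall C, P (T4 C) -> P C).

(** As [T] has finite order on 5 x 5 codes, a property that passes from [T C] to [C] also passes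
    from [C] to [T C]. *)
Lemma orb_closed (T : code -> code) n k C : (forall C, ok5 C -> ok5 (T C)) ->
  (forall C, P (T C) -> P C) -> (forall C, ok5 C -> iter n.+1 T C = C) ->
  ok5 C -> P C -> forall D, D \in orb T k C -> ok5 D /\ P D.
Proof.
move=> okT PT Tn; have step C0 : ok5 C0 -> P C0 -> P (T C0).
  move=> okC PC; have iterP j : P (iter j.+1 T C0) -> P (T C0).
    by elim: j => // j IHj /PT/IHj.
  by apply: (iterP n); rewrite Tn.
elim: k C => // k IHk C okC PC D; rewrite inE => /predU1P[-> //|].
by apply: IHk; [apply: okT | apply: step].
Qed.

Lemma imgs_closed C : ok5 C -> P C -> forall D, D \in imgs C -> ok5 D /\ P D.
Proof.
move=> okC PC D /flatten_mapP[C0 + /flatten_mapP[C1 + /flatten_mapP[C2 + ]]].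
move=> /(orb_closed ok5_T4 P4 T4_4 okC PC)[okC0 PC0].
move=> /(orb_closed ok5_T3 P3 T3_4 okC0 PC0)[okC1 PC1].
move=> /(orb_closed ok5_T2 P2 T2_5 okC1 PC1)[okC2 PC2].
exact: (orb_closed ok5_T1 P1 T1_5 okC2 PC2).
Qed.

Lemma all_closed : (forall c, c \in certs -> P (rep_code c)) ->
  forall l, size l = 16%N ->
  pureb false (full (rows4 l)) \/ pureb true (full (rows4 l)) \/ P (full (rows4 l)).
Proof.
move=> Pcert l sl; have cv := covered; rewrite lallE in cv.
have {cv} := allP cv l (mem_allvb sl); rewrite /cov.
case: ifP => [|_]; first by left.
case: ifP => [|_ tf]; first by right; left.
have okrep : all (fun c => ok5 (rep_code c)) certs by vm_compute.
have okfull : ok5 (full (rows4 l)).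
  by clear -sl; do 16 (case: l sl => [//|? l] sl); case: l sl.
have sz25 C : ok5 C -> shape C = nseq 5 5 /\ size (flatten C) = 25%N.
  case/andP=> /eqP sC /allP rC; suff sh : shape C = nseq 5 5.
    by rewrite size_flatten sh.
  apply: (@eq_from_nth _ 0%N) => [|i]; rewrite size_map sC // => lt_i.
  by rewrite (nth_map [::]) ?sC // nth_nseq lt_i; apply/eqP/rC/mem_nth; rewrite sC.
have [shf sf] := sz25 _ okfull.
have szc : all (fun c => all (fun C => size (flatten C) == 25%N) (imgs (rep_code c))) certs.
  apply/allP=> c cc; apply/allP=> D iD.
  have [okD _] := imgs_closed (allP okrep _ cc) (Pcert _ cc) iD.
  by apply/eqP; case: (sz25 _ okD).
have [c cc [D iD fE]] := mk_trieP sf szc tf; have [okD PD] := imgs_closed (allP okrep _ cc) (Pcert _ cc) iD.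
right; right; have [shD _] := sz25 _ okD.
by rewrite -[full _]flattenK shf fE -shD flattenK.
Qed.

End Closure.

End PurityCertificates.

(** * From coefficient matrices back to isometries: words in y and y^g *)

Module Derivations.

Import QuadraticForms WittFrames Codings IsometryGroups ModelElements PurityCertificates.

Definition E4l : code := take 4 El.
Definition JEr : code := [seq [seq bT addb (qp 6) u e | e <- E4l] | u <- idl 12].
(** These explicit matrices are locked to keep unification from computing with them. *)
HB.lock Definition E4 : 'M['F_2]_(4, 12) := matr 4 12 E4l.
HB.lock Definition JE : 'M['F_2]_(12, 4) := matr 12 4 JEr.
HB.lock Definition eps : 'M['F_2]_12 := mat 12 epsr.
HB.lock Definition tht : 'M['F_2]_12 := mat 12 thr.
HB.lock Definition ev (i : nat) : 'rV['F_2]_12 := vcb 12 (nth [::] El (i %% 5)).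
Lemma evE i : ev i = vcb 12 (nth [::] El (i %% 5)). Proof. by rewrite ev.unlock. Qed.

Local Notation Q := Q12.
Local Notation B := (polar Q12).

Lemma polar12C u v : B u v = B v u. Proof. exact: polarC. Qed.
Lemma polar12Dl u v w : B (u + v) w = B u w + B v w. Proof. exact: polarDl q12 u v w. Qed.
Lemma polar12Dr u v w : B w (u + v) = B w u + B w v. Proof. exact: polarDr q12 u v w. Qed.
Lemma addV (v : 'rV['F_2]_12) : v + v = 0. Proof. exact: addc2v char2_F2 v. Qed.
Lemma addM n p (A : 'M['F_2]_(n, p)) : A + A = 0.
Proof. by apply/matrixP=> i j; rewrite !mxE addF2. Qed.

Definition cmx := (E4.unlock, JE.unlock, eps.unlock, tht.unlock).

Lemma row_mul_JE v : v *m JE = \row_(i < 4) B v (ev i).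
Proof.
move: v; apply: (vcb_all (p := fun l => veq 4 (lmul l JEr) [seq bT addb (qp 6) l e | e <- E4l]));
  last by vm_compute.
move=> l sl lE; rewrite cmx vcb_mat // (veqP lE); apply/rowP=> i; rewrite !mxE.
rewrite evE polar12E (nth_map [::]) ?nth_take //.
by rewrite (modn_small (ltn_trans (ltn_ord i) _)).
Qed.

Lemma E4_row i : row i E4 = ev i.
Proof. by rewrite cmx row_mat nth_take ?ltn_ord // evE modn_small // (ltn_trans (ltn_ord i)). Qed.

Lemma E4JE : E4 *m JE = mat 4 J4.
Proof. by rewrite !cmx mat_mul //; apply: ceqP; vm_compute. Qed.

(** The formula for an orthogonal projection: products with e_0, ..., e_3, the inverse Gram matrix,
    then the vectors. The Gram matrix [J4] is its own inverse. *)
Lemma epsE : eps = JE *m mat 4 J4 *m E4.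
Proof. by rewrite !cmx !mat_mul //; apply: ceqP; vm_compute. Qed.

Lemma eps_tht : eps *m tht = tht. Proof. by rewrite !cmx mat_mul //; apply: ceqP; vm_compute. Qed.
Lemma tht_eps : tht *m eps = tht. Proof. by rewrite !cmx mat_mul //; apply: ceqP; vm_compute. Qed.
Lemma eps_eps : eps *m eps = eps. Proof. by rewrite !cmx mat_mul //; apply: ceqP; vm_compute. Qed.

Lemma ev_modn i : ev (i %% 5) = ev i. Proof. by rewrite !evE modn_mod. Qed.

Lemma ev_S i : ev i.+1 = ev (i %% 5).+1.
Proof.
by rewrite !evE; congr (vcb 12 (nth [::] El _)); rewrite -addn1 -[in RHS]addn1 modnDml.
Qed.
Lemma ev_add i k : ev (i + k) = ev (i %% 5 + k)%N.
Proof. by rewrite -ev_modn -[RHS]ev_modn modnDml. Qed.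

Lemma ev_tht i : ev i *m tht = ev i.+1 + ev (i + 4).
Proof.
rewrite -ev_modn ev_S ev_add.
have: (i %% 5 < 5)%N by rewrite ltn_mod.
case: (i %% 5)%N => [|[|[|[|[|//]]]]] _; rewrite cmx !evE vcb_mat // -vcbD; apply: veqP; by vm_compute.
Qed.

Lemma ev_eps i : ev i *m eps = ev i.
Proof.
rewrite -ev_modn; have: (i %% 5 < 5)%N by rewrite ltn_mod.
case: (i %% 5)%N => [|[|[|[|[|//]]]]] _; rewrite cmx !evE vcb_mat //; apply: veqP; by vm_compute.
Qed.

Lemma size_gramc C : size C = 5%N -> size (gramc C) = 8%N.
Proof.
move=> sC; have s4 : size (take 4 C) = 4%N by rewrite size_takel ?sC.
rewrite /gramc /blockc size_cat !(size_map (fun p : seq bool * seq bool => p.1 ++ p.2)).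
by rewrite !size_zip !size_map size_iota s4.
Qed.

Definition mk5 (b : nat -> nat -> bool) : code := mkseq (fun i => mkseq (b i) 5) 5.

Lemma T1_mk b b' : (forall i j, b' i j = b i (j.+1 %% 5)%N) -> mk5 b' = T1 (mk5 b).
Proof. by move=> E; rewrite /mk5 /T1 /mkseq /= !E. Qed.
Lemma T2_mk b b' : (forall i j, b' i j = b (i.+1 %% 5)%N j) -> mk5 b' = T2 (mk5 b).
Proof. by move=> E; rewrite /mk5 /T2 /mkseq /= !E. Qed.
Lemma T3_mk b b' : (forall i j, b' i j = b i (2 * j %% 5)%N) -> mk5 b' = T3 (mk5 b).
Proof. by move=> E; rewrite /mk5 /T3 /perm2 /mkseq /= !E. Qed.
Lemma T4_mk b b' : (forall i j, b' i j = b (2 * i %% 5)%N j) -> mk5 b' = T4 (mk5 b).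
Proof. by move=> E; rewrite /mk5 /T4 /perm2 /mkseq /= !E. Qed.

Lemma full_mk b :
  (forall i, b i 4 = xors [:: b i 0; b i 1; b i 2; b i 3]%N) ->
  (forall j, b 4 j = xors [:: b 0 j; b 1 j; b 2 j; b 3 j]%N) ->
  exists2 l, size l = 16%N & mk5 b = full (rows4 l).
Proof.
move=> b4 b4'; exists (flatten (mkseq (fun i => mkseq (b i) 4) 4)); first by [].
by rewrite /mk5 /mkseq /= !b4 !b4'.
Qed.

Section PartI.

Variable L : GLmodel 'F_2 11.
Local Notation G := (G12 L).
Local Notation gmx := (gmx L).

Definition gx : L := mkGL L (mat 12 Xr).
Definition gy : L := mkGL L (mat 12 Yr).
Definition gf : L := mkGL L (mat 12 Fr).

Lemma gx_ok : isom_ok Xr Xi. Proof. by vm_compute. Qed.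
Lemma gy_ok : isom_ok Yr Yi. Proof. by vm_compute. Qed.
Lemma gf_ok : isom_ok Fr Fi. Proof. by vm_compute. Qed.
Lemma gxE : gmx gx = mat 12 Xr. Proof. by case: (isom_okP L gx_ok). Qed.
Lemma gyE : gmx gy = mat 12 Yr. Proof. by case: (isom_okP L gy_ok). Qed.
Lemma gfE : gmx gf = mat 12 Fr. Proof. by case: (isom_okP L gf_ok). Qed.
Lemma gxG : gx \in G. Proof. by case: (isom_okP L gx_ok). Qed.
Lemma gyG : gy \in G. Proof. by case: (isom_okP L gy_ok). Qed.
Lemma gfG : gf \in G. Proof. by case: (isom_okP L gf_ok). Qed.

Lemma y5 : (gy ^+ 5)%g = 1%g.
Proof.
apply: (@gmx_inj _ _ L); rewrite !expgS expg0 mulg1 !gmxM gyE gmx1 -mat_id !mat_mul //.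
Qed.

Lemma tht_y : tht = gmx gy + gmx (gy ^+ 4)%g.
Proof.
rewrite cmx !expgS expg0 mulg1 !gmxM gyE !mat_mul // mat_add.
by apply: ceqP; vm_compute.
Qed.

Lemma tht_adj v w : B (v *m tht) w = B v (w *m tht).
Proof.
have adj g h u u' : g \in G -> (h * g = 1)%g -> B (app u h) u' = B u (app u' g).
  by move=> Gg hg; rewrite -(GO_polar (app u h) u' Gg) -appM hg app1.
rewrite tht_y !mulmxDr -!appE polar12Dl polar12Dr addrC; congr (_ + _); apply: adj.
- exact: gyG.
- by rewrite -expgSr y5.
- exact/groupX/gyG.
- by rewrite -expgS y5.
Qed.

Lemma ev_y i : app (ev i) gy = ev i.+1.
Proof.
rewrite -ev_modn ev_S appE gyE.
have: (i %% 5 < 5)%N by rewrite ltn_mod.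
case: (i %% 5)%N => [|[|[|[|[|//]]]]] _; rewrite !evE vcb_mat //; apply: veqP; by vm_compute.
Qed.

Lemma ev_f i : app (ev i) gf = ev (2 * i).
Proof.
rewrite -ev_modn (_ : ev (2 * i) = ev (2 * (i %% 5))%N) ?appE ?gfE; last first.
  by rewrite -ev_modn -[RHS]ev_modn modnMmr.
have: (i %% 5 < 5)%N by rewrite ltn_mod.
case: (i %% 5)%N => [|[|[|[|[|//]]]]] _; rewrite !evE vcb_mat //; apply: veqP; by vm_compute.
Qed.

Lemma y_f : (gy ^ gf)%g = (gy ^+ 2)%g.
Proof.
have : (gy * gf)%g = (gf * gy ^+ 2)%g.
  apply: (@gmx_inj _ _ L); rewrite expgS expg1 !gmxM gyE gfE !mat_mul //.
by move=> e; rewrite conjgE e mulKg.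
Qed.

Lemma f_eps : gmx gf *m eps = eps *m gmx gf.
Proof. by rewrite !cmx gfE !mat_mul //; apply: ceqP; vm_compute. Qed.

Definition cmat (g : L) : code := mk5 (fun i j => B (ev i) (app (ev j) g) != 0).

(** As [B v (e_i g)] is the product of [v g^-1] with e_i, placing K between [JF g] and [FF g] gives
    the map sending v to the sum of the B v f_i K_ij f_j over the frame e_i, e_i g. *)
Definition JF g : 'M['F_2]_(12, 4 + 4) := row_mx JE (gmx g^-1%g *m JE).
Definition FF g : 'M['F_2]_(4 + 4, 12) := col_mx E4 (E4 *m gmx g).

Lemma b2F_neq0 (x : 'F_2) : b2F (x != 0) = x.
Proof. by case: (F2_cases x) => ->. Qed.

Lemma cmat_nth g i j : (i < 5)%N -> (j < 5)%N ->
  nth false (nth [::] (cmat g) i) j = (B (ev i) (app (ev j) g) != 0).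
Proof. by move=> li lj; rewrite !nth_mkseq. Qed.

(** The Gram matrix of the frame is what the composition of two such maps inserts between their
    coefficient matrices; this makes [compK] correct. *)
Lemma FJ g : g \in G -> FF g *m JF g = mat 8 (gramc (cmat g)).
Proof.
move=> Gg; rewrite /FF /JF mul_col_row -!mulmxA (mulmxA (gmx g) (gmx g^-1%g) JE) gmxKV mul1mx E4JE.
rewrite (mat_block (m := 4)) //; congr (block_mx _ _ _ _); apply/row_matrixP=> i.
  rewrite row_mul E4_row mulmxA -appE row_mul_JE row_mat.
  apply/rowP=> j; rewrite !mxE (nth_map [::]) ?size_takel ?size_mkseq ?ltn_ord //.
  rewrite nth_take ?ltn_ord // nth_take ?ltn_ord //.
  rewrite cmat_nth ?(ltn_trans (ltn_ord _)) // b2F_neq0.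
  by rewrite -[in LHS](appK g (ev j)) (GO_polar _ _ (groupVr Gg)).
rewrite mulmxA row_mul row_mul E4_row -appE row_mul_JE row_mat.
apply/rowP=> j; rewrite !mxE (nth_map 0%N) ?size_iota // nth_iota // add0n.
rewrite (nth_map [::]) ?size_map ?size_takel ?size_mkseq ?ltn_ord //.
rewrite (nth_map [::]) ?size_takel ?size_mkseq ?ltn_ord // !nth_take ?ltn_ord //.
by rewrite cmat_nth ?(ltn_trans (ltn_ord _)) // b2F_neq0 polar12C.
Qed.

Definition rep g h (K : code) := size K = 8%N /\ gmx h = 1%:M + JF g *m mat 8 K *m FF g.

Lemma size_madd A C : size (madd A C) = maxn (size A) (size C).
Proof. by elim: A C => [|x A IHA] [|y C] //=; rewrite ?max0n ?maxn0 // IHA maxnSS. Qed.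

Lemma mat_compK n G0 K K' : size G0 = n -> size K' = n ->
  mat n (compK G0 K K') = mat n K + mat n K' + mat n K *m mat n G0 *m mat n K'.
Proof. by move=> sG sK; rewrite /compK -!mat_add !mat_mul. Qed.

Lemma mat_Z4 : mat 4 Z4 = 0.
Proof.
apply/row_matrixP=> i; rewrite row_mat row0 nth_nseq ltn_ord.
exact: (vec_nseq codingF2 4 4).
Qed.

Lemma size_gram g : size (gramc (cmat g)) = 8%N.
Proof. by apply: size_gramc; rewrite size_mkseq. Qed.

Lemma JF_ul g K : okc 4 K ->
  JF g *m mat 8 (blockc K Z4 Z4 Z4) *m FF g = JE *m mat 4 K *m E4.
Proof.
move=> oK; transitivity (row_mx JE (gmx g^-1%g *m JE) *m block_mx (mat 4 K) 0 0 0
    *m col_mx E4 (E4 *m gmx g)).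
  by congr (_ *m _ *m _); rewrite -mat_Z4; apply: (mat_block (m := 4)).
by rewrite mul_row_block mul_row_col !mulmx0 !addr0 mul0mx addr0.
Qed.

Lemma JF_dr g K : okc 4 K ->
  JF g *m mat 8 (blockc Z4 Z4 Z4 K) *m FF g = gmx g^-1%g *m (JE *m mat 4 K *m E4) *m gmx g.
Proof.
move=> oK; transitivity (row_mx JE (gmx g^-1%g *m JE) *m block_mx 0 0 0 (mat 4 K)
    *m col_mx E4 (E4 *m gmx g)).
  by congr (_ *m _ *m _); rewrite -mat_Z4; apply: (mat_block (m := 4)).
by rewrite mul_row_block mul_row_col !mulmx0 !add0r mul0mx add0r !mulmxA.
Qed.

Lemma rep_comp g h h' K K' : g \in G -> rep g h K -> rep g h' K' ->
  rep g (h * h')%g (compK (gramc (cmat g)) K K').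
Proof.
move=> Gg [sK hE] [sK' hE']; split.
  by rewrite /compK !size_madd !size_map sK sK'.
rewrite gmxM hE hE' (mat_compK _ (size_gram g) sK') -(FJ Gg).
rewrite mulmxDl mul1mx mulmxDr mulmx1 -!addrA; congr (_ + _).
by rewrite !mulmxDr !mulmxDl addrCA -!mulmxA.
Qed.

Lemma rep_1 g : rep g 1%g Kid.
Proof.
split=> //; rewrite gmx1; suff -> : mat 8 Kid = 0 by rewrite mulmx0 mul0mx addr0.
apply/row_matrixP=> i; rewrite row_mat row0 nth_nseq ltn_ord.
exact: (vec_nseq codingF2 8 8).
Qed.

Lemma gy_KU : gmx gy = 1%:M + JE *m mat 4 KU *m E4.
Proof. by rewrite !cmx gyE -mat_id !mat_mul // mat_add; apply: ceqP; vm_compute. Qed.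

Lemma rep_y g : rep g gy Ky.
Proof.
split=> //; rewrite gy_KU; congr (_ + _).
by rewrite (JF_ul _ (K := KU)).
Qed.

Lemma rep_yg g : rep g (gy ^ g)%g Kz.
Proof.
split=> //; rewrite conjgE !gmxM gy_KU mulmxDl mulmxDr mul1mx gmxVK; congr (_ + _).
by rewrite (JF_dr _ (K := KU)) // !mulmxA.
Qed.

(** A word in y and y^g is evaluated on coefficient matrices, in step with an element of [H]. *)
Lemma rep_in_H (H : {group L}) g (w : seq nat) (P := fun k => nth Kid (letters (gramc (cmat g))) k) :
  g \in G -> gy \in H -> (gy ^ g)%g \in H ->
  exists2 h, h \in H & rep g h (evalK (gramc (cmat g)) P w).
Proof.
move=> Gg Hy Hyg; have repP k : exists2 h, h \in H & rep g h (P k).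
  have pw h K n : rep g h K -> rep g (h ^+ n)%g (powK (gramc (cmat g)) K n).
    move=> hK; elim: n => [|n IHn]; first exact: rep_1.
    by rewrite expgS /powK iterS; apply: rep_comp.
  have [lt5|ge5] := ltnP k 5.
    exists (gy ^+ k)%g; first exact: groupX.
    rewrite /P /letters nth_cat size_map size_iota lt5 (nth_map 0%N) ?size_iota //.
    by rewrite nth_iota //; apply/pw/rep_y.
  have [lt10|ge10] := ltnP k 10.
    exists ((gy ^ g) ^+ (k - 5))%g; first exact: groupX.
    have ltk : (k - 5 < 5)%N by rewrite ltn_subLR.
    rewrite /P /letters nth_cat size_map size_iota ifN -?leqNgt // (nth_map 0%N) ?size_iota //.
    by rewrite nth_iota //; apply/pw/rep_yg.
  exists 1%g; first exact: group1.
  by rewrite /P nth_default ?size_cat ?size_map ?size_iota //; apply: rep_1.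
rewrite /evalK; elim/last_ind: w => [|w k [h Hh IHw]] /=.
  by exists 1%g; [apply: group1 | apply: rep_1].
have [h' Hh' repk] := repP k; exists (h * h')%g; first exact: groupM.
by rewrite foldl_rcons; apply: rep_comp.
Qed.

Definition a01 := ev 0 + ev 1.
Definition a12 := ev 1 + ev 2.

Lemma ev_Q i : Q (ev i) = 0.
Proof.
rewrite -ev_modn; have: (i %% 5 < 5)%N by rewrite ltn_mod.
by case: (i %% 5)%N => [|[|[|[|[|//]]]]] _; rewrite evE Q12E.
Qed.

Lemma refl_K a K : Q (vcb 12 a) = 1 ->
  lall (fun l => veq 12 (if bT addb (qp 6) l a then addb_l l a else l)
     (lmul l (madd (idl 12) (mmul (mmul JEr K) E4l)))) (allv [:: false; true] 12) ->
  size K = 4%N ->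
  gmx (refl Q L (vcb 12 a)) = 1%:M + JE *m mat 4 K *m E4.
Proof.
move=> Qa ok sK; rewrite !cmx -mat_id !mat_mul // mat_add; apply: gmx_eqP => v.
rewrite -appE; move: v; apply: vcb_all ok => l sl lE.
rewrite vcb_mat ?size_madd ?size_map // -(veqP lE) (app_refl char2_F2 q12) ?Qa ?oner_neq0 //.
by rewrite divr1 polar12E; case: (bT _ _ _ _); rewrite ?scale1r ?vcbD // scale0r addr0.
Qed.

Definition l01 := addb_l (nth [::] El 0) (nth [::] El 1).
Definition l12 := addb_l (nth [::] El 1) (nth [::] El 2).
Lemma refl_K01 : gmx (refl Q L a01) = 1%:M + JE *m mat 4 K01 *m E4.
Proof.
have Ql : Q (vcb 12 l01) = 1 by rewrite Q12E.
rewrite (_ : a01 = vcb 12 l01); last by rewrite /l01 /a01 !evE vcbD.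
apply: (refl_K (a := l01) Ql); by vm_compute.
Qed.
Lemma refl_K12 : gmx (refl Q L a12) = 1%:M + JE *m mat 4 K12 *m E4.
Proof.
have Ql : Q (vcb 12 l12) = 1 by rewrite Q12E.
rewrite (_ : a12 = vcb 12 l12); last by rewrite /l12 /a12 !evE vcbD.
apply: (refl_K (a := l12) Ql); by vm_compute.
Qed.

Lemma refl_K3 : gmx (refl Q L a01 * refl Q L a12)%g = 1%:M + JE *m mat 4 K3 *m E4.
Proof.
have K3E : K3 = compK J4 K01 K12 := erefl _.
have sJ : size J4 = 4%N := erefl _; have sK : size K12 = 4%N := erefl _.
rewrite gmxM.
rewrite refl_K01.
rewrite refl_K12.
rewrite K3E.
rewrite (mat_compK _ sJ sK).
rewrite -E4JE.
rewrite mulmxDl mul1mx mulmxDr mulmx1 -!addrA; congr (_ + _).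
by rewrite !mulmxDr !mulmxDl addrCA -!mulmxA.
Qed.

(** The certified word has the coefficient matrix of the 3-cycle, and a coefficient matrix
    determines the isometry. *)
Lemma cert_in_H (H : {group L}) g c : g \in G -> gy \in H -> (gy ^ g)%g \in H ->
  cert_ok (cmat g) c -> (refl Q L a01 * refl Q L a12)%g \in H.
Proof.
case: c => [[w n] cj] Gg Hy Hyg; rewrite /cert_ok => /eqP KE.
have [h1 Hh1 r1] := rep_in_H (rev (map invl cj)) Gg Hy Hyg.
have [h2 Hh2 r2] := rep_in_H w Gg Hy Hyg.
have [h3 Hh3 r3] := rep_in_H cj Gg Hy Hyg.
have r2n : rep g (h2 ^+ n)%g (powK (gramc (cmat g)) (evalK (gramc (cmat g))
    (fun k => nth Kid (letters (gramc (cmat g))) k) w) n).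
  elim: n {KE} => [|n IHn]; first exact: rep_1.
  by rewrite expgS /powK iterS; apply: rep_comp.
have := rep_comp Gg (rep_comp Gg r1 r2n) r3; rewrite KE => -[_ hE].
suff -> : (refl Q L a01 * refl Q L a12)%g = (h1 * h2 ^+ n * h3)%g.
  by rewrite !groupM ?groupX.
apply: (@gmx_inj _ _ L); rewrite hE refl_K3; congr (_ + _).
by rewrite (JF_ul _ (K := K3)).
Qed.

End PartI.

End Derivations.

(** * Either the block of g respects theta, or H contains the even isometries of U *)

Module Purity.

Import QuadraticForms WittFrames Codings IsometryGroups ModelElements PurityCertificates Derivations.

Local Notation Q := Q12.
Local Notation B := (polar Q12).

Section PartIb.

Variable L : GLmodel 'F_2 11.
Local Notation G := (G12 L).
Local Notation gmx := (gmx L).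
Local Notation gx := (gx L).
Local Notation gy := (gy L).
Local Notation gf := (gf L).
Local Notation gyG := (gyG L).
Local Notation gfG := (gfG L).
Local Notation ev_y := (ev_y L).
Local Notation ev_f := (ev_f L).
Local Notation tht_adj := (tht_adj L).
Local Notation f_eps := (f_eps L).
Local Notation y_f := (y_f L).

(** The ten nonsingular vectors of U are the sums of two of the five singular ones. They are called
    edges below: their transvections are the transpositions of S_5. *)
Definition nU (a : 'rV['F_2]_12) := a *m eps = a /\ Q a = 1.
Definition N10 (H : {group L}) := forall a b, nU a -> nU b -> (refl Q L a * refl Q L b)%g \in H.
(** Transvections over F_2 are involutions, so this says that t_a and t_b lie in the same coset of
    [H]. It is an equivalence relation preserved by the elements of [H]. *)
Definition eqv (H : {group L}) a b := (refl Q L a * refl Q L b)%g \in H.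

Lemma Q1_neq0 a : Q a = 1 -> Q a != 0. Proof. by move->; rewrite oner_neq0. Qed.

Lemma app_refl1 v a : Q a = 1 -> app v (refl Q L a) = v + B v a *: a.
Proof. by move=> Qa; rewrite (app_refl char2_F2 q12) ?Qa ?oner_neq0 // divr1. Qed.

Lemma refl_sqr a : Q a = 1 -> (refl Q L a * refl Q L a)%g = 1%g.
Proof. by move=> Qa; rewrite (reflK char2_F2 q12) ?Q1_neq0. Qed.

Lemma refl_inv a : Q a = 1 -> (refl Q L a)^-1%g = refl Q L a.
Proof. by move=> Qa; rewrite (reflV char2_F2 q12) ?Q1_neq0. Qed.

Lemma reflJ a g : g \in G -> Q a = 1 -> (refl Q L a ^ g)%g = refl Q L (app a g).
Proof. by move=> Gg Qa; apply: (refl_conj char2_F2 q12); rewrite ?Q1_neq0. Qed.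

Lemma refl_in_G a : Q a = 1 -> refl Q L a \in G.
Proof. by move=> Qa; apply: (refl_GO char2_F2 q12); rewrite Q1_neq0. Qed.

Lemma eqv_refl (H : {group L}) a : Q a = 1 -> eqv H a a.
Proof. by move=> Qa; rewrite /eqv refl_sqr. Qed.

Lemma eqv_sym (H : {group L}) a b : Q a = 1 -> Q b = 1 -> eqv H a b -> eqv H b a.
Proof. by move=> Qa Qb; rewrite /eqv -groupV invMg !refl_inv. Qed.

Lemma eqv_trans (H : {group L}) a b c : Q b = 1 -> eqv H a b -> eqv H b c -> eqv H a c.
Proof.
move=> Qb ab bc; have := groupM ab bc.
by rewrite mulgA -(mulgA (refl Q L a)) refl_sqr // mulg1.
Qed.

Lemma eqvJ (H : {group L}) a b h : Q a = 1 -> Q b = 1 -> h \in G -> h \in H ->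
  eqv H a b -> eqv H (app a h) (app b h).
Proof. by move=> Qa Qb Gh Hh ab; rewrite /eqv -!reflJ // -conjMg groupJ. Qed.

Lemma QD a b : Q (a + b) = Q a + Q b + B a b. Proof. exact: quadD. Qed.

(** The transvection in [a + b] is t_a conjugated by t_b, and its product with t_a is the square of
    t_a t_b. *)
Lemma eqv_add (H : {group L}) a b : Q a = 1 -> Q b = 1 -> B a b = 1 ->
  eqv H a b -> eqv H a (a + b).
Proof.
move=> Qa Qb Bab ab; have -> : a + b = app a (refl Q L b) by rewrite app_refl1 // Bab scale1r.
rewrite /eqv -(reflJ (refl_in_G Qb) Qa) conjgE refl_inv // !mulgA -(mulgA _ _ (refl Q L b)).
exact: groupM.
Qed.

Definition aij i j := ev i + ev j.
Definition n10l : seq (seq bool) :=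
  [seq addb_l (nth [::] El p.1) (nth [::] El p.2) |
    p <- [:: (0, 1); (1, 2); (2, 3); (3, 4); (4, 0); (0, 2); (1, 3); (2, 4); (3, 0); (4, 1)]]%N.

Lemma nU_cases a : nU a -> exists i, a = aij i i.+1 \/ a = aij i i.+2.
Proof.
case; move: a; apply: (vcb_all (p := fun l => if veq 12 (lmul l epsr) l then
  if qp 6 l then l \in n10l else true else true)); last by vm_compute.
move=> l sl; case: ifP => [_|neq _ leps]; last first.
  case/negP: neq; rewrite /veq lallE; apply/allP=> j; rewrite mem_iota add0n => /andP[_ ltj].
  move: leps; rewrite cmx vcb_mat // => /rowP/(_ (Ordinal ltj)); rewrite !mxE => /b2F_inj->.
  exact: eqxx.
rewrite Q12E; case: ifP => [_ ln _ _ | _ _ _ /eqP]; last by rewrite eq_sym oner_eq0.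
move: ln; rewrite !inE.
have ew i j : ev i + ev j = vcb 12 (addb_l (nth [::] El (i %% 5)) (nth [::] El (j %% 5))).
  by rewrite !evE vcbD.
do ?[case/orP]=> /eqP->;
  by [exists 0%N; left; rewrite /aij ew | exists 1%N; left; rewrite /aij ew
     |exists 2%N; left; rewrite /aij ew | exists 3%N; left; rewrite /aij ew
     |exists 4%N; left; rewrite /aij ew
     |exists 0%N; right; rewrite /aij ew | exists 1%N; right; rewrite /aij ew
     |exists 2%N; right; rewrite /aij ew | exists 3%N; right; rewrite /aij ew
     |exists 4%N; right; rewrite /aij ew].
Qed.

Lemma ev_B i j : B (ev i) (ev j) = b2F (i %% 5 != j %% 5)%N.
Proof.
rewrite -[in LHS]ev_modn -[ev j]ev_modn.
have: (i %% 5 < 5)%N by rewrite ltn_mod.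
have: (j %% 5 < 5)%N by rewrite ltn_mod.
case: (i %% 5)%N => [|[|[|[|[|//]]]]]; case: (j %% 5)%N => [|[|[|[|[|//]]]]] _ _;
  by rewrite !evE polar12E.
Qed.

Lemma aij_Q i j : (i %% 5 != j %% 5)%N -> Q (aij i j) = 1.
Proof. by move=> ij; rewrite QD !ev_Q !add0r ev_B ij. Qed.

(** Powers of y carry the 3-cycle to all pairs of consecutive edges e_i + e_(i+1), which are
    therefore equivalent; the other five edges are sums of two consecutive ones, and [eqv_add]
    applies. *)
Lemma N10_gen (H : {group L}) : gy \in H -> (refl Q L a01 * refl Q L a12)%g \in H -> N10 H.
Proof.
move=> Hy H012.
have QS i : Q (aij i i.+1) = 1.
  by apply: aij_Q; lia.
have QSS i : Q (aij i i.+2) = 1.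
  by apply: aij_Q; lia.
have step i : eqv H (aij i i.+1) (aij i.+1 i.+2).
  elim: i => [|i IHi]; first exact: H012.
  by have := eqvJ (QS _) (QS _) gyG Hy IHi; rewrite /aij !appD !ev_y.
have all1 i : eqv H (aij 0 1) (aij i i.+1).
  elim: i => [|i IHi]; first exact: eqv_refl.
  exact: eqv_trans (QS _) IHi (step i).
have all2 i : eqv H (aij 0 1) (aij i i.+2).
  apply: eqv_trans (QS _) (all1 i) _.
  have -> : aij i i.+2 = aij i i.+1 + aij i.+1 i.+2.
    by rewrite /aij addrA -(addrA (ev i)) addV addr0.
  apply: eqv_add => //; rewrite /aij !polar12Dl !polar12Dr !ev_B.
  have [-> -> -> ->] : [/\ (i %% 5 != i.+1 %% 5)%N, (i %% 5 != i.+2 %% 5)%N,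
    (i.+1 %% 5 != i.+1 %% 5)%N = false & (i.+1 %% 5 != i.+2 %% 5)%N] by split; lia.
  by rewrite -!b2FD.
have all3 a : nU a -> eqv H (aij 0 1) a by case/nU_cases=> i [] ->.
move=> a b na nb; apply: eqv_trans (QS 0%N) _ (all3 _ nb).
by apply: eqv_sym (QS _) _ (all3 _ na); case: na.
Qed.

(** The property that [all_closed] carries from the certified matrices to their whole orbits. *)
Definition Good C := forall (H : {group L}) g, g \in G -> gy \in H -> (gy ^ g)%g \in H ->
  cmat g = C -> N10 H.

Lemma cert_Good C c : cert_ok C c -> Good C.
Proof. by move=> ok H g Gg Hy Hyg gC; apply: N10_gen (cert_in_H Gg Hy Hyg _) => //; rewrite gC; exact: ok. Qed.

(** Replacing g by y g shifts the columns of its matrix. The next lemmas use g y^-1, f g and g f^-1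
    in the same way, where f normalises the group generated by y and doubles indices; in the last
    case [H] is conjugated as well. *)
Lemma Good1 C : Good (T1 C) -> Good C.
Proof.
move=> gC H g Gg Hy Hyg gE; apply: (gC H (gy * g)%g) => //.
- by rewrite groupM ?gyG.
- by rewrite conjgM (_ : gy ^ gy = gy)%g // conjgE mulKg.
rewrite -gE; have yE j : app (ev j) (gy * g)%g = app (ev j.+1) g by rewrite appM ev_y.
by apply: T1_mk => i j; rewrite yE ev_modn.
Qed.

Lemma Good2 C : Good (T2 C) -> Good C.
Proof.
move=> gC H g Gg Hy Hyg gE; apply: (gC H (g * gy^-1)%g) => //.
- by rewrite groupM ?groupV ?gyG.
- by rewrite conjgM groupJ ?groupV.
rewrite -gE; have yE i j : B (ev i) (app (ev j) (g * gy^-1)%g) = B (ev i.+1) (app (ev j) g).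
  by rewrite appM -ev_y -(GO_polar (ev i) _ gyG) appKV.
by apply: T2_mk => i j; rewrite yE ev_modn.
Qed.

Lemma Good3 C : Good (T3 C) -> Good C.
Proof.
move=> gC H g Gg Hy Hyg gE; apply: (gC H (gf * g)%g) => //.
- by rewrite groupM ?gfG.
- by rewrite conjgM y_f conjXg groupX.
rewrite -gE; have yE j : app (ev j) (gf * g)%g = app (ev (2 * j)) g by rewrite appM ev_f.
by apply: T3_mk => i j; rewrite yE ev_modn.
Qed.

Lemma nU_f a : nU a -> nU (app a gf^-1%g).
Proof.
have GV := groupVr gfG.
case=> ea Qa; split; last by rewrite (GO_P _ _ GV).
have e1 : gmx gf^-1%g *m eps = eps *m gmx gf^-1%g.
  rewrite -[LHS]mulmx1 -(gmxKV gf) mulmxA -(mulmxA _ eps) -f_eps mulmxA.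
  by rewrite gmxVK mul1mx.
by rewrite !appE -mulmxA e1 mulmxA ea.
Qed.

Lemma Good4 C : Good (T4 C) -> Good C.
Proof.
move=> gC H g Gg Hy Hyg gE; have GV := groupVr gfG.
have N' : N10 (H :^ gf^-1)%G.
  apply: (gC _ (g * gf^-1)%g) => //.
  - by rewrite groupM.
  - by rewrite mem_conjgV y_f groupX.
  - by rewrite conjgM memJ_conjg.
  rewrite -gE; have yE i j : B (ev i) (app (ev j) (g * gf^-1)%g) = B (ev (2 * i)) (app (ev j) g).
    by rewrite appM -ev_f -(GO_polar (ev i) _ gfG) appKV.
  by apply: T4_mk => i j; rewrite yE ev_modn.
move=> a b na nb; have := N' _ _ (nU_f na) (nU_f nb).
rewrite mem_conjgV conjMg !reflJ ?gfG ?appKV //.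
- by case: (nU_f nb).
- by case: (nU_f na).
Qed.

Definition Pc (k : 'M['F_2]_12) := eps *m k *m eps.

Lemma cmat_full (g : L) : exists2 l, size l = 16%N & cmat g = full (rows4 l).
Proof.
pose b i j := B (ev i) (app (ev j) g) != 0.
have e4 : ev 4 = ev 0 + (ev 1 + (ev 2 + ev 3)).
  by rewrite !evE -!vcbD; apply: veqP.
have nD (x y : 'F_2) : (x + y != 0) = addb (x != 0) (y != 0).
  by case: (F2_cases x) => ->; case: (F2_cases y) => ->.
have b4 i : b i 4 = xors [:: b i 0; b i 1; b i 2; b i 3]%N.
  by rewrite /b e4 !appD !polar12Dr !nD /= addbF.
have b4' j : b 4 j = xors [:: b 0 j; b 1 j; b 2 j; b 3 j]%N.
  by rewrite /b e4 !polar12Dl !nD /= addbF.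
by have [l sl lE] := full_mk b4 b4'; exists l.
Qed.

Lemma e5E (g : L) i j : b2F (e5 (cmat g) i j) = B (ev i) (app (ev j) g).
Proof. by rewrite /e5 cmat_nth ?ltn_mod // b2F_neq0 !ev_modn. Qed.

(** The vectors e_0, ..., e_3 span U, and [eps] is computed from products with them. *)
Lemma eps_eq0 (Z : 'M['F_2]_12) :
  (forall i j, (i < 4)%N -> (j < 4)%N -> B (ev i) (ev j *m Z) = 0) -> eps *m Z *m eps = 0.
Proof.
move=> z0; have Z0 : E4 *m (Z *m eps) = 0.
  apply/row_matrixP=> j; rewrite row_mul row0 E4_row epsE !mulmxA.
  suff -> : ev j *m Z *m JE = 0 by rewrite !mul0mx.
  by rewrite row_mul_JE; apply/rowP=> i; rewrite !mxE polar12C z0.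
by rewrite {1}epsE -!mulmxA Z0 !mulmx0.
Qed.

Lemma pure_brk c g : pureb c (cmat g) ->
  tht *m Pc (gmx g) + Pc (gmx g) *m tht = b2F c *: Pc (gmx g).
Proof.
rewrite /pureb lallE => /allP pc; set k := gmx g.
(* The defect of the commutation relation. As theta is self-adjoint, the products of e_i with
   [e_j Z] are what [pureb] tests. *)
pose Z := k *m tht + tht *m k + b2F c *: k.
have : eps *m Z *m eps = 0.
  apply: eps_eq0 => i j.
  move=> li lj; have := pc i; rewrite mem_iota (leq_trans li) // => /(_ isT).
  rewrite lallE => /allP/(_ j); rewrite mem_iota (leq_trans lj) // => /(_ isT)/eqP/(congr1 b2F).
  rewrite !b2FD !e5E => eqc.
  have -> : ev j *m Z = ev j *m k *m tht + ev j *m tht *m k + b2F c *: (ev j *m k).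
    by rewrite /Z !mulmxDr !mulmxA -scalemxAr.
  rewrite !polar12Dr -(tht_adj (ev i)) !ev_tht polar12Dl mulmxDl polar12Dr (polarZr q12).
  rewrite /k -!appE eqc; case: (c); first by rewrite e5E mul1r addF2.
  by rewrite mul0r addr0.
rewrite /Z !mulmxDr !mulmxDl -scalemxAr -scalemxAl -/(Pc k).
have -> : eps *m (k *m tht) *m eps = Pc k *m tht.
  by rewrite /Pc -!mulmxA tht_eps eps_tht.
have -> : eps *m (tht *m k) *m eps = tht *m Pc k.
  by rewrite /Pc !mulmxA tht_eps eps_tht.
by move/(canRL (addrK _)); rewrite add0r addrC => ->; apply/matrixP=> i j; rewrite !mxE (oppc2 char2_F2).
Qed.

Theorem partI (H : {group L}) g : g \in G -> gy \in H -> (gy ^ g)%g \in H ->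
  N10 H \/ exists c, tht *m Pc (gmx g) + Pc (gmx g) *m tht = c *: Pc (gmx g).
Proof.
move=> Gg Hy Hyg; have [l sl gE] := cmat_full g.
have rg : forall c, c \in certs -> Good (rep_code c).
  move=> c cc; have := certs_ok; rewrite lallE => /allP/(_ c cc); exact: cert_Good.
have [p0|[p1|gd]] := all_closed Good1 Good2 Good3 Good4 rg sl.
- by right; exists (b2F false); apply: pure_brk; rewrite gE.
- by right; exists (b2F true); apply: pure_brk; rewrite gE.
- by left; apply: (gd H g).
Qed.

End PartIb.

End Purity.

(** * The splitting V = U + W; irreducibility of U under y and of W under x *)

Module Decomposition.

Import QuadraticForms WittFrames Codings IsometryGroups ModelElements PurityCertificates Derivations Purity.

Local Notation Q := Q12.
Local Notation B := (polar Q12).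

Definition inW (w : 'rV['F_2]_12) := w *m eps = 0.

Lemma inWD u v : inW u -> inW v -> inW (u + v).
Proof. by rewrite /inW mulmxDl => -> ->; rewrite addr0. Qed.

Lemma lin_comb n (T : 'rV['F_2]_n -> Prop) c A : T 0 -> (forall u v, T u -> T v -> T (u + v)) ->
  (forall r, r \in A -> T (vcb n r)) -> T (vcb n (lmul c A)).
Proof.
move=> T0 TD; elim: A c => [|r A IHA] [|b c] TA /=; rewrite ?vcb0 //.
have{IHA} IH : T (vcb n (lmul c A)) by apply: IHA => s sA; apply: TA; rewrite inE sA orbT.
by case: b => //; rewrite vcbD; apply: TD => //; apply: TA; rewrite mem_head.
Qed.

Lemma F2_neq1 (x : 'F_2) : (x != 1) = (x == 0).
Proof. by case: (F2_cases x) => ->. Qed.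

Lemma polar12cat u v w t : B (u + w) (v + t) = B u v + B u t + B w v + B w t.
Proof. by rewrite polar12Dl !polar12Dr !addrA. Qed.

Lemma nUP a : nU a <-> exists2 l, l \in n10l & a = vcb 12 l.
Proof.
split=> [[] |[l ln ->]].
  move: a; apply: (vcb_all (p := fun l => if veq 12 (lmul l epsr) l then
    if qp 6 l then l \in n10l else true else true)); last by vm_compute.
  move=> l sl; case: ifP => [_|neq _ leps]; last first.
    case/negP: neq; rewrite /veq lallE; apply/allP=> j; rewrite mem_iota add0n => /andP[_ ltj].
    move: leps; rewrite cmx vcb_mat // => /rowP/(_ (Ordinal ltj)); rewrite !mxE => /b2F_inj->.
    exact: eqxx.
  rewrite Q12E; case: ifP => [_ ln _ _ | _ _ _ /eqP]; last by rewrite eq_sym oner_eq0.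
  by exists l.
have ok : lall (fun l => if veq 12 (lmul l epsr) l then qp 6 l else false) n10l by vm_compute.
move: ok; rewrite lallE => /allP/(_ l ln); case: ifP => // le ql; split.
  by rewrite cmx vcb_mat //; apply: veqP.
by rewrite Q12E ql.
Qed.

Lemma ev_code i : exists2 l, l \in El & ev i = vcb 12 l.
Proof. by rewrite evE; exists (nth [::] El (i %% 5)) => //; apply: mem_nth; rewrite ltn_mod. Qed.

Lemma code_ev l : l \in El -> exists i, ev i = vcb 12 l.
Proof.
move=> lE; exists (index l El); rewrite evE modn_small ?nth_index //.
by rewrite -index_mem in lE.
Qed.

Lemma sum2 l l1 l2 b : (if veq 12 (addb_l l1 l2) l then bT addb (qp 6) l1 l2 == b else false) ->
  vcb 12 l = vcb 12 l1 + vcb 12 l2 /\ B (vcb 12 l1) (vcb 12 l2) = b2F b.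
Proof. by case: ifP => // /veqP<- /eqP<-; rewrite vcbD polar12E. Qed.

(** Tables inside U: each vector of one kind is a sum of two vectors of prescribed kinds with
    prescribed product. Four such tables serve the four cases of [Ew_add]. *)
Definition sum2_ok (A A1 A2 : seq (seq bool)) b : bool :=
  lall (fun l => lhas (fun l1 => lhas (fun l2 =>
    if veq 12 (addb_l l1 l2) l then bT addb (qp 6) l1 l2 == b else false) A2) A1) A.

Lemma sum2P A A1 A2 b l : sum2_ok A A1 A2 b -> l \in A ->
  exists l1 l2, [/\ l1 \in A1, l2 \in A2, vcb 12 l = vcb 12 l1 + vcb 12 l2
    & B (vcb 12 l1) (vcb 12 l2) = b2F b].
Proof.
rewrite /sum2_ok lallE => /allP ok /ok; rewrite lhasE => /hasP[l1 i1].
by rewrite lhasE => /hasP[l2 i2] /sum2[e1 e2]; exists l1, l2.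
Qed.

Lemma nU_sum n : nU n -> exists n1 n2, [/\ nU n1, nU n2, n = n1 + n2 & B n1 n2 = 1].
Proof.
case/nUP=> l ln ->; have ok : sum2_ok n10l n10l n10l true by vm_compute.
have [l1 [l2 [i1 i2 e eB]]] := sum2P ok ln; exists (vcb 12 l1), (vcb 12 l2).
by split; [apply/nUP; exists l1 | apply/nUP; exists l2 | exact: e | exact: eB].
Qed.

Lemma ev_sum i : exists n1 n2, [/\ nU n1, nU n2, ev i = n1 + n2 & B n1 n2 = 0].
Proof.
have [l lE ->] := ev_code i; have ok : sum2_ok El n10l n10l false by vm_compute.
have [l1 [l2 [i1 i2 e eB]]] := sum2P ok lE; exists (vcb 12 l1), (vcb 12 l2).
by split; [apply/nUP; exists l1 | apply/nUP; exists l2 | exact: e | exact: eB].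
Qed.

Lemma ev_sum1 i : exists n1 j, [/\ nU n1, ev i = n1 + ev j & B n1 (ev j) = 1].
Proof.
have [l lE ->] := ev_code i; have ok : sum2_ok El n10l El true by vm_compute.
have [l1 [l2 [i1 /code_ev[j jE] e eB]]] := sum2P ok lE; exists (vcb 12 l1), j.
by rewrite jE; split; [apply/nUP; exists l1 | exact: e | exact: eB].
Qed.

Lemma nU_sum1 n : nU n -> exists n1 j, [/\ nU n1, n = n1 + ev j & B n1 (ev j) = 0].
Proof.
case/nUP=> l lE ->; have ok : sum2_ok n10l n10l El false by vm_compute.
have [l1 [l2 [i1 /code_ev[j jE] e eB]]] := sum2P ok lE; exists (vcb 12 l1), j.
by rewrite jE; split; [apply/nUP; exists l1 | exact: e | exact: eB].
Qed.

Lemma nU_link n n' : nU n -> nU n' -> [\/ n' = n, B n n' = 1 |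
  exists m, [/\ nU m, B n m = 1 & B m n' = 1]].
Proof.
case/nUP=> l ln -> /nUP[l' ln' ->].
pose b := bT addb (qp 6).
have : lall (fun l => lall (fun l' => if l' == l then true else if b l l' then true else
   lhas (fun m => if b l m then b m l' else false) n10l) n10l) n10l by vm_compute.
rewrite lallE => /allP/(_ l ln); rewrite lallE => /allP/(_ l' ln').
case: eqP => [-> _|_]; first exact: Or31.
case: ifP => [bll _|_]; first by apply: Or32; rewrite polar12E -/(b l l') bll.
rewrite lhasE => /hasP[m im]; case: ifP => // b1 b2; apply: Or33; exists (vcb 12 m).
by split; rewrite ?polar12E -?/(b _ _) ?b1 ?b2 //; apply/nUP; exists m.
Qed.

Lemma inU_cases u : u *m eps = u -> Q u = 0 -> u = 0 \/ exists i, u = ev i.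
Proof.
move: u; apply: (vcb_all (p := fun l => if veq 12 (lmul l epsr) l then
    if qp 6 l then true else if veq 12 l [::] then true else l \in El else true)); last by vm_compute.
move=> l sl; case: ifP => [_|neq _ leps]; last first.
  case/negP: neq; rewrite /veq lallE; apply/allP=> j; rewrite mem_iota add0n => /andP[_ ltj].
  move: leps; rewrite cmx vcb_mat // => /rowP/(_ (Ordinal ltj)); rewrite !mxE => /b2F_inj->.
  exact: eqxx.
rewrite Q12E; case: ifP => [_ _ _ /eqP | _]; first by rewrite oner_eq0.
case: ifP => [/veqP-> _ _ _|_]; first by left; rewrite vcb0.
by case/code_ev=> i <-; right; exists i.
Qed.

Lemma eps_adj v w : B (v *m eps) w = B v (w *m eps).
Proof.
have key l : bT addb (qp 6) l = bT addb (qp 6) l by [].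
have rowB u : forall i : 'I_12, B (vcb 12 (nth [::] epsr i)) u = B (delta_mx 0 i) (u *m eps).
  move: u; apply: (vcb_all (p := fun l => lall (fun i =>
    bT addb (qp 6) (nth [::] epsr i) l == bT addb (qp 6) (nth [::] (idl 12) i) (lmul l epsr)) (iota 0 12))); last by vm_compute.
  move=> l sl; rewrite lallE => /allP ok i.
  rewrite -row1 -mat_id row_mat cmx vcb_mat // !polar12E.
  by rewrite (eqP (ok i _)) // mem_iota add0n ltn_ord.
rewrite [v]row_sum_delta mulmx_suml !(polar_sum q12); apply: eq_bigr => i _.
by rewrite -scalemxAl !(polarZl q12) -rowB -rowE cmx row_mat.
Qed.

Lemma UWperp u w : u *m eps = u -> inW w -> B u w = 0.
Proof. by move=> <- Ww; rewrite eps_adj Ww (polar0r q12). Qed.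

Lemma splitUW (v : 'rV['F_2]_12) : v = v *m eps + (v + v *m eps).
Proof. by rewrite addrCA addV addr0. Qed.
Lemma inU_eps (v : 'rV['F_2]_12) : v *m eps *m eps = v *m eps.
Proof. by rewrite -mulmxA eps_eps. Qed.
Lemma inW_del v : inW (v + v *m eps).
Proof. by rewrite /inW mulmxDl inU_eps addV. Qed.

Lemma Q_UW u w : u *m eps = u -> inW w -> Q (u + w) = Q u + Q w.
Proof. by move=> Uu Ww; rewrite QD UWperp // addr0. Qed.

Lemma nU_W n w : nU n -> inW w -> B n w = 0.
Proof. by case=> Un _; apply: UWperp. Qed.
Lemma ev_W i w : inW w -> B (ev i) w = 0.
Proof. by apply: UWperp; rewrite ev_eps. Qed.

Section Xaction.

Variable L : GLmodel 'F_2 11.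
Local Notation G := (G12 L).
Local Notation gmx := (gmx L).
Local Notation gx := (gx L).
Local Notation gy := (gy L).

Lemma x_eps : gmx gx *m eps = eps.
Proof. by rewrite ?cmx gxE !mat_mul //; apply: ceqP; vm_compute. Qed.
Lemma eps_x : eps *m gmx gx = eps.
Proof. by rewrite ?cmx gxE !mat_mul //; apply: ceqP; vm_compute. Qed.
Lemma y_eps : gmx gy *m eps = eps *m gmx gy.
Proof. by rewrite ?cmx gyE !mat_mul //; apply: ceqP; vm_compute. Qed.
Lemma y_del : gmx gy + eps *m gmx gy = 1%:M + eps.
Proof. by rewrite ?cmx gyE -mat_id !mat_mul // !mat_add; apply: ceqP; vm_compute. Qed.

Lemma x_code n l : app (vcb 12 l) (gx ^+ n)%g = vcb 12 (iter n (lmul^~ Xr) l).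
Proof.
elim: n => [|n IHn]; first by rewrite expg0 app1.
by rewrite expgSr appM IHn appE gxE vcb_mat.
Qed.
Lemma y_code n l : app (vcb 12 l) (gy ^+ n)%g = vcb 12 (iter n (lmul^~ Yr) l).
Proof.
elim: n => [|n IHn]; first by rewrite expg0 app1.
by rewrite expgSr appM IHn appE gyE vcb_mat.
Qed.

Lemma x_inW w i : inW w -> inW (app w (gx ^+ i)%g).
Proof.
rewrite /inW => Ww; elim: i => [|i IHi]; first by rewrite expg0 app1.
by rewrite expgSr appM appE -mulmxA x_eps.
Qed.

Definition xgens l := traject (lmul^~ Xr) l 8.

Lemma xgensP l r : r \in xgens l -> exists2 i, (i < 8)%N & vcb 12 r = app (vcb 12 l) (gx ^+ i)%g.
Proof. by case/trajectP=> i lt_i ->; exists i; rewrite ?x_code. Qed.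

(** A nonsingular vector of W whose first eight translates under x form a basis of W; [delc] holds,
    in this basis, the coordinates of the projections of the unit vectors to W. *)
Definition w0l : seq bool := bl 12 260.
Definition delc : code := map (bl 8) [:: 0; 1; 2; 5; 10; 20; 0; 1; 3; 37; 79; 158].

Lemma W_codes l : size l = 12 -> inW (vcb 12 l) -> veq 12 (lmul l epsr) [::].
Proof.
move=> sl; rewrite /inW cmx vcb_mat // -(vcb0 12) => le; rewrite /veq lallE.
apply/allP=> j; rewrite mem_iota add0n => /andP[_ ltj].
by move/rowP/(_ (Ordinal ltj)): le; rewrite !mxE => /b2F_inj->.
Qed.

Lemma W_to_w0 w : inW w -> w != 0 ->
  exists c l, w = vcb 12 l /\ vcb 12 w0l = vcb 12 (lmul c (xgens l)).
Proof.
move: w; apply: (vcb_all (p := fun l => if veq 12 (lmul l epsr) [::] then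
  if veq 12 l [::] then true else
  lhas (fun c => veq 12 w0l (lmul c (xgens l))) (allv [:: false; true] 8) else true)); last by vm_compute.
move=> l sl; case: ifP => [_|nW _ /W_codes]; last by move=> /(_ sl); rewrite nW.
case: ifP => [/veqP-> _ _|_]; first by rewrite vcb0 eqxx.
by rewrite lhasE => /hasP[c _ /veqP->] _ _; exists c, l.
Qed.

Lemma del_w0 : 1%:M + eps = matr 12 8 delc *m matr 8 12 (xgens w0l).
Proof. by rewrite ?cmx -mat_id mat_add mat_mul //; apply: ceqP; vm_compute. Qed.

(** The irreducibility of W under x in a form suited to induction: the translates of any nonzero [w]
    combine to the fixed vector [w0l] ([W_to_w0]), whose own translates span W ([del_w0]). *)
Theorem spanW (P : 'rV['F_2]_12 -> Prop) w : inW w -> w != 0 -> P 0 ->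
    (forall i v, inW v -> P v -> P (app w (gx ^+ i)%g + v)) ->
  forall w', inW w' -> P w'.
Proof.
move=> Ww nzw P0 Pw; pose T g := inW g /\ forall v, inW v -> P v -> P (g + v).
have T0 : T 0 by split=> [|v _]; rewrite ?add0r // /inW mul0mx.
have TD u v : T u -> T v -> T (u + v).
  case=> Wu Pu [Wv Pv]; split=> [|x Wx Px]; first exact: inWD.
  by rewrite -addrA; apply: (Pu); [apply: inWD | apply: Pv].
have Tw i : T (app w (gx ^+ i)%g) by split=> [|v]; [apply: x_inW | apply: Pw].
have Tw0 i : T (app (vcb 12 w0l) (gx ^+ i)%g).
  have [c [l [wE ->]]] := W_to_w0 Ww nzw.
  apply: (@lin_comb 12 (fun v => T (app v (gx ^+ i)%g))) => [|u v Tu Tv|r].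
  - by rewrite app0.
  - by rewrite appD; apply: TD.
  by case/xgensP=> j _ ->; rewrite -appM -expgD -wE.
move=> w' Ww'; suff [_] : T w' by move/(_ 0); rewrite addr0; apply; rewrite // /inW mul0mx.
have -> : w' = w' *m (1%:M + eps) by rewrite mulmxDr Ww' mulmx1 addr0.
rewrite del_w0 mulmxA; have [c sc <-] := vcb_surj (w' *m matr 12 8 delc).
by rewrite vcb_mat //; apply: lin_comb => // r /xgensP[j _ ->].
Qed.

Lemma spanU_code v : v *m eps = v -> v != 0 -> forall i, exists c l, v = vcb 12 l /\
  ev i = vcb 12 (lmul c [seq addb_l l (iter j (lmul^~ Yr) l) | j <- [:: 1; 2; 3; 4]%N]).
Proof.
move: v; apply: (vcb_all (p := fun l => if veq 12 (lmul l epsr) l then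
  if veq 12 l [::] then true else
  lall (fun e => lhas (fun c => veq 12 e (lmul c [seq addb_l l (iter j (lmul^~ Yr) l) | j <- [:: 1; 2; 3; 4]%N])) (allv [:: false; true] 4)) El else true)); last by vm_compute.
move=> l sl; case: ifP => [_|neq _ leps]; last first.
  case/negP: neq; rewrite /veq lallE; apply/allP=> j; rewrite mem_iota add0n => /andP[_ ltj].
  move: leps; rewrite cmx vcb_mat // => /rowP/(_ (Ordinal ltj)); rewrite !mxE => /b2F_inj->.
  exact: eqxx.
case: ifP => [/veqP-> _ _|_]; first by rewrite vcb0 eqxx.
rewrite lallE => /allP ok _ _ i; have [e eE ->] := ev_code i.
have := ok _ eE; rewrite lhasE => /hasP[c _ /veqP->].
by exists c, l.
Qed.

(* If every [v (1 + y^j)] is killed by [A] then so is all of [U]. *)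
Theorem spanU (A : 'M['F_2]_12) v : v *m eps = v -> v != 0 ->
  (forall j, (v + app v (gy ^+ j)%g) *m A = 0) -> eps *m A = 0.
Proof.
move=> Uv nzv vA; have eA i : ev i *m A = 0.
  have [c [l [vE ->]]] := spanU_code Uv nzv i.
  apply: (@lin_comb 12 (fun v => v *m A = 0)) => [|u u'|r]; first by rewrite mul0mx.
    by rewrite mulmxDl => -> ->; rewrite addr0.
  by case/mapP=> j _ ->; rewrite vcbD -y_code -vE.
rewrite epsE -mulmxA; have -> : E4 *m A = 0 by apply/row_matrixP=> i; rewrite row_mul row0 E4_row.
by rewrite mulmx0.
Qed.

Lemma W_perpx w : inW w -> Q w = 1 -> exists i, B w (app w (gx ^+ i)%g) = 0 /\ w + app w (gx ^+ i)%g != 0.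
Proof.
move: w; apply: (vcb_all (p := fun l => if veq 12 (lmul l epsr) [::] then
  if qp 6 l then
  lhas (fun i => if bT addb (qp 6) l (iter i (lmul^~ Xr) l) then false else
     ~~ veq 12 (addb_l l (iter i (lmul^~ Xr) l)) [::]) (iota 1 8) else true else true)); last by vm_compute.
move=> l sl; case: ifP => [_|nW _ /W_codes]; last by move=> /(_ sl); rewrite nW.
rewrite Q12E; case: ifP => [_|_ _ _ /eqP]; last by rewrite eq_sym oner_eq0.
rewrite lhasE => /hasP[i _]; case: ifP => // bi nz _ _; exists i.
rewrite x_code polar12E bi; split=> //; apply: contra nz; rewrite -vcbD => /eqP le.
rewrite /veq lallE; apply/allP=> j; rewrite mem_iota add0n => /andP[_ ltj].
by move: le; rewrite -(vcb0 12) => /rowP/(_ (Ordinal ltj)); rewrite !mxE => /b2F_inj->.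
Qed.

Definition wSl : seq bool := bl 12 8.

Lemma wS_W : inW (vcb 12 wSl).
Proof. by rewrite /inW cmx vcb_mat // -(vcb0 12); apply: veqP; vm_compute. Qed.

Lemma wS_sing i : (i < 8)%N -> Q (app (vcb 12 wSl) (gx ^+ i)%g) = 0.
Proof.
have : lall (fun i => ~~ qp 6 (iter i (lmul^~ Xr) wSl)) (iota 0 8) by vm_compute.
rewrite lallE x_code Q12E => /allP ok lt_i.
by rewrite (negPf (ok i _)) // mem_iota.
Qed.

Lemma W_split w : inW w -> Q w = 1 -> exists w1, [/\ inW w1, Q w1 = 0 & B w1 w = 1].
Proof.
move: w; apply: (vcb_all (p := fun l => if veq 12 (lmul l epsr) [::] then
  if qp 6 l then
  lhas (fun i => bT addb (qp 6) (iter i (lmul^~ Xr) wSl) l) (iota 0 8) else true else true)); last by vm_compute.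
move=> l sl; case: ifP => [_|nW _ /W_codes]; last by move=> /(_ sl); rewrite nW.
rewrite Q12E; case: ifP => [_|_ _ _ /eqP]; last by rewrite eq_sym oner_eq0.
rewrite lhasE => /hasP[i]; rewrite mem_iota => i8 bi _ _; exists (app (vcb 12 wSl) (gx ^+ i)%g).
split; [exact/x_inW/wS_W | exact: wS_sing |].
by rewrite x_code polar12E bi.
Qed.

End Xaction.

End Decomposition.

(** * A 3-cycle spreads to all of Omega *)

Module ThreeCycles.

Import QuadraticForms WittFrames Codings IsometryGroups ModelElements PurityCertificates Derivations Purity Decomposition.

Local Notation Q := Q12.
Local Notation B := (polar Q12).

(* Two edges [a], [b] of the pentad and two adjacent edges [n'], [m'] of its   *)
(* image such that only [b] and [m'] are not orthogonal.                       *)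
Definition edges := [:: (0, 1); (0, 2); (0, 3); (0, 4); (1, 2); (1, 3); (1, 4); (2, 3); (2, 4); (3, 4)]%N.
Definition ce (C : code) (p q : nat * nat) : bool :=
  addb (addb (e5 C p.1 q.1) (e5 C p.1 q.2)) (addb (e5 C p.2 q.1) (e5 C p.2 q.2)).
Definition adj_ok (C : code) : bool :=
  lhas (fun n => lhas (fun a => if ce C a n then false else
    lhas (fun b => if ce C b n then false else
      lhas (fun m => if (n.1 == m.1) (+) (n.2 == m.2) then
         if ce C a m then false else ce C b m else false) edges) edges) edges) edges.

(** The zero block is the only one without such a configuration of edges. *)
Lemma adj_all : lall (fun l => if adj_ok (full (rows4 l)) then true else
  l == nseq 16 false) (allv [:: false; true] 16).
Proof. by vm_compute. Qed.

Section PartII.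

Variable L : GLmodel 'F_2 11.
Local Notation G := (G12 L).
Local Notation gmx := (gmx L).
Local Notation gx := (gx L).
Local Notation gy := (gy L).
Local Notation refl := (refl Q L).

Lemma Pc_neq0 (g : L) : Pc (gmx g) != 0 -> adj_ok (cmat g).
Proof.
have [l sl gE] := cmat_full g; have := adj_all; rewrite lallE => /allP/(_ l (mem_allvb sl)).
rewrite -gE; case: ifP => // _ /eqP l0; case/eqP; apply: eps_eq0 => i j _ _.
rewrite -appE -e5E gE l0 /e5 -[full _]/(nseq 5 (nseq 5 false)) nth_nseq ltn_mod /=.
by rewrite (nth_nseq false 5 false) if_same.
Qed.

Lemma ceE (g : L) p q : b2F (ce (cmat g) p q) = B (aij p.1 p.2) (app (aij q.1 q.2) g).
Proof. by rewrite /ce !b2FD !e5E /aij appD polar12cat !addrA -addrA [X in _ + X]addrC -!addrA; do !congr (_ + _); ring. Qed.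

Lemma edges_nU p : p \in edges -> nU (aij p.1 p.2).
Proof.
move=> ep; split; first by rewrite /aij mulmxDl !ev_eps.
by apply: aij_Q; move: p ep; apply/allP.
Qed.

Variable H : {group L}.
Hypotheses (sHG : H \subset G) (Hx : gx \in H) (N : N10 H).

(** Let m and m' be the images under [k] of the two adjacent edges. The product t_a t_b in [H] fixes
    m and moves m' to m' + b. As m and m' are equivalent, so are m' and m' + b, and then also their
    sum b, which is an edge of U. *)
Lemma adj_rel k : k \in H -> Pc (gmx k) != 0 ->
  forall n n', nU n -> nU n' -> eqv H n (app n' k).
Proof.
move=> Hk /Pc_neq0; have Gk := subsetP sHG _ Hk.
rewrite /adj_ok lhasE => /hasP[q eq]; rewrite lhasE => /hasP[a ea].
case: ifP => // aq; rewrite lhasE => /hasP[b eb]; case: ifP => // bq; rewrite lhasE => /hasP[r er].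
case: ifP => // qr; case: ifP => // ar br.
have [na [nb [nq nr]]] := (edges_nU ea, (edges_nU eb, (edges_nU eq, edges_nU er))).
have := (ceE k a q, (ceE k b q, (ceE k a r, ceE k b r))); rewrite aq bq ar br.
move: (aij a.1 a.2) (aij b.1 b.2) na nb => va vb na nb; have [[_ Qa] [_ Qb]] := (na, nb).
move: (nq) (nr); set nq' := aij _ _; set nr' := aij _ _ => nq2 nr2.
have [[_ Qq] [_ Qr]] := (nq2, nr2).
set m := app _ k; set m' := app _ k => -[aq0 [bq0 [ar0 br1]]].
have [Qm Qm'] : Q m = 1 /\ Q m' = 1 by rewrite !(GO_P _ _ Gk).
have h : (refl va * refl vb)%g \in H by apply: N.
have Gab : (refl va * refl vb)%g \in G by apply: subsetP h.
have mm' : eqv H m m' by apply: eqvJ => //; apply: N.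
have mb : eqv H m (m' + vb).
  have -> : m = app m (refl va * refl vb)%g.
    by rewrite appM !app_refl1 // polar12C -aq0 scale0r addr0 polar12C -bq0 scale0r addr0.
  have -> : m' + vb = app m' (refl va * refl vb)%g.
    by rewrite appM !app_refl1 // polar12C -ar0 scale0r addr0 polar12C -br1 scale1r.
  exact: eqvJ.
have Bmb : B m' vb = 1 by rewrite polar12C -br1.
have Qmb : Q (m' + vb) = 1 by rewrite QD Qm' Qb Bmb addF2 add0r.
have m'b : eqv H m' (m' + vb) by apply: (eqv_trans Qm _ mb); apply: (eqv_sym Qm Qm' mm').
have m'b2 : eqv H m' vb.
  have -> : vb = m' + (m' + vb) by rewrite addrA addV add0r.
  by apply: eqv_add => //; rewrite polar12Dr (polarvv char2_F2 q12) add0r.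
move=> n n' nn nn'; have [[_ Qn] [_ Qn']] := (nn, nn').
apply: (@eqv_trans _ H n vb) => //; first exact: N.
apply: (@eqv_trans _ H vb m') => //; first exact: eqv_sym.
by apply: eqvJ => //; apply: N.
Qed.

(** The class of the ten edges under [eqv]; the aim is that it contains every nonsingular vector. *)
Definition Dn v := Q v = 1 /\ forall n, nU n -> eqv H n v.

Lemma Dn_nU n : nU n -> Dn n.
Proof. by move=> nn; split=> [|m nm]; [case: nn | apply: N]. Qed.

Lemma Dn_add a b : Dn a -> Dn b -> B a b = 1 -> Dn (a + b).
Proof.
move=> [Qa Da] [Qb Db] Bab; split; first by rewrite QD Qa Qb Bab addF2 add0r.
move=> n nn; have Qn : Q n = 1 by case: nn.
apply: eqv_trans (Da n nn) _ => //; apply: eqv_add => //.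
by apply: (eqv_trans Qn _ (Db n nn)); apply: (eqv_sym Qn Qa (Da n nn)).
Qed.

Lemma Dn_x i v : Dn v -> Dn (app v (gx ^+ i)%g).
Proof.
move=> [Qv Dv]; have Hxi := groupX i Hx; have Gxi := subsetP sHG _ Hxi.
split=> [|n nn]; first by rewrite (GO_P _ _ Gxi).
have <- : app n (gx ^+ i)%g = n.
  elim: i {Hxi Gxi} => [|i IHi]; first by rewrite expg0 app1.
  by rewrite expgSr appM IHi appE -{1}(proj1 nn) -mulmxA eps_x (proj1 nn).
by apply: eqvJ => //; [case: nn | apply: Dv].
Qed.

(** Adding the edge m + m' to m + w replaces m by m' and is allowed when m and m' have product 1;
    orthogonal edges are joined through a third one. *)
Lemma Dn_U0 n n' w : nU n -> inW w -> Dn (n + w) -> nU n' -> Dn (n' + w).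
Proof.
move=> nn Ww Dnw nn'.
have step m m' : nU m -> nU m' -> B m m' = 1 -> Dn (m + w) -> Dn (m' + w).
  move=> nm nm' Bm Dmw; have nmm : nU (m + m').
    split; first by rewrite mulmxDl (proj1 nm) (proj1 nm').
    by rewrite QD (proj2 nm) (proj2 nm') Bm addF2 add0r.
  have -> : m' + w = (m + w) + (m + m') by rewrite addrACA addV add0r addrC.
  apply: Dn_add => //; first exact: Dn_nU.
  by rewrite polar12Dl polar12Dr (polarvv char2_F2 q12) add0r Bm polar12C nU_W ?addr0.
have [-> // | Bn | [m [nm B1 B2]]] := nU_link nn nn'; first exact: step Dnw.
exact: step B2 (step _ _ nn nm B1 Dnw).
Qed.

Lemma ev_aij i j : ev i = ev j \/ nU (aij i j) /\ B (ev i) (ev j) = 1.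
Proof.
case: (eqVneq (i %% 5)%N (j %% 5)%N) => ij.
  by left; rewrite -ev_modn ij ev_modn.
right; split; last by rewrite ev_B ij.
by split; [rewrite /aij mulmxDl !ev_eps | apply: aij_Q].
Qed.

Lemma Dn_U1 i j w : inW w -> Dn (ev i + w) -> Dn (ev j + w).
Proof.
move=> Ww Di; have [<- // | [nij Bij]] := ev_aij i j.
have -> : ev j + w = (ev i + w) + aij i j by rewrite /aij addrACA addV add0r addrC.
apply: Dn_add => //; first exact: Dn_nU.
by rewrite /aij polar12cat (polarvv char2_F2 q12) add0r Bij !(polar12C w) !ev_W ?addr0.
Qed.

Definition A0 w := forall n, nU n -> Dn (n + w).
Definition A1 w := forall i, Dn (ev i + w).
(** All nonsingular vectors with W-component [w] and nonzero U-component lie in the class. The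
    U-component is an edge if [w] is singular, and one of the five singular vectors of U
    otherwise. *)
Definition Ew w := (Q w = 0 -> A0 w) /\ (Q w = 1 -> A1 w).

Lemma Ew0 w : Q w = 0 -> A0 w -> Ew w.
Proof. by move=> Qw ?; split=> // Qw1; have := oner_neq0 'F_2; rewrite -Qw1 Qw eqxx. Qed.
Lemma Ew1 w : Q w = 1 -> A1 w -> Ew w.
Proof. by move=> Qw ?; split=> // Qw1; have := oner_neq0 'F_2; rewrite -Qw Qw1 eqxx. Qed.

(** A vector u + w1 + w2 is written as (u1 + w1) + (u2 + w2) with both parts in the class and with
    product 1. The tables of sums in U supply u = u1 + u2 with [B u1 u2 = 1 + B w1 w2]. *)
Lemma Ew_add w1 w2 : inW w1 -> inW w2 -> Q w1 = 0 -> A0 w1 -> Ew w2 -> Ew (w1 + w2).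
Proof.
move=> W1 W2 Q1 D1 [D20 D21]; have QE : Q (w1 + w2) = Q w2 + B w1 w2 by rewrite QD Q1 add0r.
have add u1 u2 : u1 *m eps = u1 -> u2 *m eps = u2 -> Dn (u1 + w1) -> Dn (u2 + w2) ->
    B u1 u2 + B w1 w2 = 1 -> Dn (u1 + u2 + (w1 + w2)).
  move=> U1 U2 Du1 Du2 Bu; rewrite addrACA; apply: Dn_add => //.
  by rewrite polar12cat (UWperp U1 W2) (polar12C w1 u2) (UWperp U2 W1) !addr0.
case: (F2_cases (Q w2)) => Q2; case: (F2_cases (B w1 w2)) => B12.
- apply: Ew0 => [|n nn]; first by rewrite QE Q2 B12 addr0.
  have [n1 [n2 [h1 h2 -> Bn]]] := nU_sum nn.
  by apply: add; rewrite ?Bn ?B12 ?addr0 ?(proj1 h1) ?(proj1 h2) //; [apply: D1 | apply: D20].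
- apply: Ew1 => [|i]; first by rewrite QE Q2 B12 add0r.
  have [n1 [n2 [h1 h2 -> Bn]]] := ev_sum i.
  by apply: add; rewrite ?Bn ?B12 ?add0r ?(proj1 h1) ?(proj1 h2) //; [apply: D1 | apply: D20].
- apply: Ew1 => [|i]; first by rewrite QE Q2 B12 addr0.
  have [n1 [j [h1 -> Bn]]] := ev_sum1 i.
  by apply: add; rewrite ?Bn ?B12 ?addr0 ?(proj1 h1) ?ev_eps //; [apply: D1 | apply: D21].
- apply: Ew0 => [|n nn]; first by rewrite QE Q2 B12 addF2.
  have [n1 [j [h1 -> Bn]]] := nU_sum1 nn.
  by apply: add; rewrite ?Bn ?B12 ?add0r ?(proj1 h1) ?ev_eps //; [apply: D1 | apply: D21].
Qed.

(* If two equivalence relations cover all pairs, one of them is total.        *)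
Lemma nU_two (P R : 'M['F_2]_12) : eps *m P != 0 -> eps *m R != 0 ->
  exists n, [/\ nU n, n *m P != 0 & n *m R != 0].
Proof.
have five (A : 'M['F_2]_12) a : (forall c, (ev c + ev a) *m A = 0) -> eps *m A = 0.
  move=> eA; have eAa c : ev c *m A = ev a *m A.
    by have /eqP := eA c; rewrite mulmxDl addr_eq0 (oppc2v char2_F2) => /eqP.
  have s5 : ev 4 = ev 0 + (ev 1 + (ev 2 + ev 3)) by rewrite !evE -!vcbD; apply: veqP.
  have a0 : ev a *m A = 0.
    rewrite -(eAa 4) s5 !mulmxDl !eAa addV addr0 addV; done.
  rewrite epsE -mulmxA; have -> : E4 *m A = 0.
    by apply/row_matrixP=> i; rewrite row_mul row0 E4_row eAa.
  by rewrite mulmx0.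
have [a0 [b0]] : exists a b, eps *m P != 0 -> (ev b + ev a) *m P != 0.
  case: (boolP [forall c : 'I_5, (ev c + ev 0) *m P == 0]) => [/forallP c0 | ].
    exists 0%N, 0%N; rewrite (five P 0%N) ?eqxx // => c; rewrite -(ev_modn c).
    by have := c0 (inord (c %% 5)); rewrite inordK ?ltn_mod // => /eqP.
  by rewrite negb_forall => /existsP[c c0]; exists 0%N, (c : nat).
move=> abP nzP nzR; have{abP nzP} abP := abP nzP.
have key c d : (ev c + ev d) *m P != 0 -> (ev c + ev d) *m R != 0 ->
    exists n, [/\ nU n, n *m P != 0 & n *m R != 0].
  move=> cP cR; exists (aij c d); split=> //.
  by case: (ev_aij c d) cP => [-> | [] //]; rewrite addV mul0mx eqxx.
have [abR | ] := eqVneq ((ev b0 + ev a0) *m R) 0; last by move=> cR; apply: (key b0 a0 abP cR).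
case: (boolP [forall c : 'I_5, (ev c + ev a0) *m R == 0]) => [/forallP c0 | ].
  case/eqP: nzR; apply: (five R a0) => c; rewrite -(ev_modn c).
  by have := c0 (inord (c %% 5)); rewrite inordK ?ltn_mod // => /eqP.
rewrite negb_forall => /existsP[c cR].
have [caP | ] := eqVneq ((ev c + ev a0) *m P) 0; last by move=> cP; apply: (key _ _ cP cR).
have E : ev c + ev b0 = (ev c + ev a0) + (ev b0 + ev a0) by rewrite addrACA addV addr0.
by apply: (key c b0); rewrite E mulmxDl ?caP ?add0r // abR addr0.
Qed.

(** By [nU_two] some edge moved by [k] has nonzero components in U and in W. It lies in the class by
    [adj_rel], and the irreducibility of W under x spreads this to all W-components. *)
Theorem allD k : k \in H -> Pc (gmx k) != 0 -> eps *m gmx k *m (1%:M + eps) != 0 ->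
  forall v, Q v = 1 -> Dn v.
Proof.
move=> Hk nzP nzR; have Gk := subsetP sHG _ Hk.
have nzP' : eps *m (gmx k *m eps) != 0 by rewrite mulmxA.
have nzR' : eps *m (gmx k *m (1%:M + eps)) != 0 by rewrite mulmxA.
have [n [nn nP nR]] := nU_two nzP' nzR'.
pose v := app n k; pose u := v *m eps; pose w := v + v *m eps.
have Dv : Dn v.
  by split=> [|m nm]; [rewrite (GO_P _ _ Gk); case: nn | apply: adj_rel].
have uE : u != 0 by rewrite /u /v appE -mulmxA; exact: nP.
have wE : w != 0.
  by apply: contra nR; rewrite mulmxA -appE mulmxDr mulmx1.
have Ww : inW w by apply: inW_del.
have Uu : u *m eps = u by apply: inU_eps.
have vE : v = u + w by apply: splitUW.
have Qv : Q u + Q w = 1 by rewrite -Q_UW // -vE; case: Dv.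
(* The induction needs a nonzero singular starting vector in W. If [w] is nonsingular, then [u] is
   one of the e_i; with an orthogonal translate w' of [w], the sum of e_0 + w and e_1 + w' has the
   singular W-component w + w'. *)
have [w0 [W0 nz0 Q0 D0]] : exists w0, [/\ inW w0, w0 != 0, Q w0 = 0 & A0 w0].
  case: (F2_cases (Q w)) => Qw.
    exists w; split=> // m nm; apply: (Dn_U0 (n := u)) => //; last by rewrite -vE.
    by split=> //; rewrite -Qv Qw addr0.
  have Qu : Q u = 0 by apply: (addIr (Q w)); rewrite Qv Qw add0r.
  have [u0|[i uEi]] := inU_cases Uu Qu; first by rewrite u0 eqxx in uE.
  have Di j : Dn (ev j + w) by apply: (@Dn_U1 i) => //; rewrite -uEi -vE.
  have [j [Bj nzj]] := W_perpx L Ww Qw.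
  set w' := app w _ in Bj nzj; have Ww' : inW w' by apply: x_inW.
  have Hxj := groupX j Hx; have Gxj := subsetP sHG _ Hxj.
  exists (w + w'); split=> //; first exact: inWD.
    by rewrite QD Bj (GO_P _ _ Gxj) Qw addr0 addF2.
  have Dj l : Dn (ev l + w').
    have <- : app (ev l) (gx ^+ j)%g = ev l.
      elim: (j) => [|m IHm]; first by rewrite expg0 app1.
      by rewrite expgSr appM IHm appE -{1}(ev_eps l) -mulmxA eps_x ev_eps.
    by rewrite -appD; apply: Dn_x; apply: Di.
  move=> m nm; apply: (@Dn_U0 (aij 0 1)) => //; first by apply: (edges_nU (p := (0, 1)%N)).
    exact: inWD.
  rewrite /aij addrACA; apply: Dn_add => //.
  by rewrite polar12cat (ev_W 0 Ww') (polar12C w) (ev_W 1 Ww) Bj !addr0 ev_B.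
(* [spanW] adds the singular translates of [w0] one at a time, each time by [Ew_add]. *)
have EW : forall w', inW w' -> Ew w'.
  apply: (@spanW L _ w0 W0 nz0) => [|i t Wt Et].
    by apply: Ew0 => [|m nm]; rewrite ?(quad0 q12) // addr0; apply: Dn_nU.
  have Hxi := groupX i Hx; have Gxi := subsetP sHG _ Hxi.
  apply: Ew_add => //; first exact: x_inW.
    by rewrite (GO_P _ _ Gxi).
  move=> m nm; have -> : m = app m (gx ^+ i)%g.
    elim: (i) => [|l IHl]; first by rewrite expg0 app1.
    by rewrite expgSr appM -IHl appE -{2}(proj1 nm) -mulmxA eps_x (proj1 nm).
  by rewrite -appD; apply: Dn_x; apply: D0.
move=> t Qt; rewrite (splitUW t); set tu := t *m eps; set tw := t + _.
have [Utu Wtw] : tu *m eps = tu /\ inW tw by split; [apply: inU_eps | apply: inW_del].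
have QtE : Q tu + Q tw = 1 by rewrite -Q_UW // -splitUW.
have [E0 E1] := EW _ Wtw; case: (F2_cases (Q tw)) => Qtw.
  by apply: E0 => //; split=> //; rewrite -QtE Qtw addr0.
have Qtu : Q tu = 0 by apply: (addIr (Q tw)); rewrite QtE Qtw add0r.
have [-> | [i ->]] := inU_cases Utu Qtu; last exact: E1.
(* The vector lies in W, where [Ew] says nothing. It is a sum of two class members with a common
   edge as U-component and with singular W-components [w1] and [w1 + tw]. *)
rewrite add0r; have [w1 [W1 Q1 B1]] := W_split L Wtw Qtw.
have W2 : inW (w1 + tw) by apply: inWD.
have Q2 : Q (w1 + tw) = 0 by rewrite QD Q1 Qtw B1 add0r addF2.
have [[D1 _] [D2 _]] := (EW _ W1, EW _ W2).
have -> : tw = (aij 0 1 + w1) + (aij 0 1 + (w1 + tw)) by rewrite addrACA addV add0r addrA addV add0r.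
have n01 := edges_nU (p := (0, 1)%N) isT.
apply: Dn_add; [exact: D1 | exact: D2 |].
rewrite polar12cat (polarvv char2_F2 q12) (nU_W n01 W2) polar12C (nU_W n01 W1) !add0r.
by rewrite polar12Dr (polarvv char2_F2 q12) add0r.
Qed.

(** The products of two transvections generate a normal subgroup [K], over which G is generated by a
    single transvection. So G / K is cyclic, and K contains the derived group. *)
Theorem Omega_sub : (forall v, Q v = 1 -> Dn v) -> (G^`(1))%g \subset H.
Proof.
move=> allDv; have rr a b : Q a = 1 -> Q b = 1 -> (refl a * refl b)%g \in H.
  move=> Qa Qb; have n01 := edges_nU (p := (0, 1)%N) isT; have Q01 : Q (aij 0 1) = 1 by case: n01.
  have [_ Da] := allDv _ Qa; have [_ Db] := allDv _ Qb.
  by apply: (eqv_trans Q01 _ (Db _ n01)); apply: (eqv_sym Q01 Qa (Da _ n01)).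
pose X := [set (refl p.1 * refl p.2)%g | p : 'rV['F_2]_12 * 'rV['F_2]_12 & (Q p.1 == 1) && (Q p.2 == 1)].
pose K := <<X>>%G.
have sKH : K \subset H.
  rewrite gen_subG; apply/subsetP=> g /imsetP[[a b]]; rewrite inE /= => /andP[/eqP Qa /eqP Qb] ->.
  exact: rr.
apply: subset_trans sKH; have n01 := edges_nU (p := (0, 1)%N) isT.
set a0 := aij _ _ in n01; have Q0 : Q a0 = 1 by case: n01.
have Kin a b : Q a = 1 -> Q b = 1 -> (refl a * refl b)%g \in K.
  by move=> Qa Qb; apply/mem_gen/imsetP; exists (a, b); rewrite ?inE /= ?Qa ?Qb ?eqxx.
have nK : G \subset 'N(K)%g.
  apply/subsetP=> g Gg; rewrite inE -genJ gen_subG; apply/subsetP=> h /imsetP[h' /imsetP[[a b]] + -> ->].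
  rewrite inE /= => /andP[/eqP Qa /eqP Qb]; rewrite conjMg !reflJ //.
  by apply: Kin; rewrite (GO_P _ _ Gg).
have sGK : G \subset (K <*> <[refl a0]>)%g.
  apply: subset_trans (G12_gen L) _; rewrite gen_subG; apply/subsetP=> g /imsetP[a + ->].
  rewrite inE F2_neq0 => /eqP Qa.
  have -> : refl a = (refl a * refl a0 * refl a0)%g by rewrite -mulgA refl_sqr // mulg1.
  apply: groupM; apply: mem_gen; rewrite inE; first by rewrite Kin.
  by rewrite cycle_id orbT.
apply: der1_min => //; apply: abelianS (quotientS K sGK) _.
have nr : (<[refl a0]> \subset 'N(K))%g.
  by rewrite cycle_subG (subsetP nK) // refl_in_G.
by rewrite quotientYidl // quotient_abelian // cycle_abelian.
Qed.

End PartII.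

End ThreeCycles.

(** * The field-structure case and the trichotomy for overgroups of x and y *)

Module Overgroups.

Import QuadraticForms WittFrames Codings IsometryGroups ModelElements PurityCertificates Derivations Purity Decomposition ThreeCycles.

Local Notation Q := Q12.
Local Notation B := (polar Q12).

Section Twist.

Variables (F : fieldType) (n : nat).
Implicit Types (t A C M : 'M[F]_n) (c d : F).

(** If t1 and t2 are generators of F_4, that is roots of X^2 + X + 1, then [A] is linear for [c = 0]
    and semilinear for [c = 1], because t + 1 is the conjugate of t. *)
Definition tw t1 t2 c A := t1 *m A = A *m t2 + c *: A.

Lemma tw_mul t1 t2 t3 c d A C : tw t1 t2 c A -> tw t2 t3 d C -> tw t1 t3 (c + d) (A *m C).
Proof.
rewrite /tw => tA tC; rewrite mulmxA tA mulmxDl -!mulmxA tC mulmxDr mulmxA -scalemxAl -scalemxAr.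
by rewrite scalerDl -addrA; congr (_ + _); rewrite addrC.
Qed.

Lemma tw_add t1 t2 c A C : tw t1 t2 c A -> tw t1 t2 c C -> tw t1 t2 c (A + C).
Proof. by rewrite /tw mulmxDr => -> ->; rewrite mulmxDl scalerDr addrACA. Qed.

Lemma tw_sub t1 t2 c A C : tw t1 t2 c (A + C) -> tw t1 t2 c A -> tw t1 t2 c C.
Proof.
rewrite /tw mulmxDr => tAC tA; apply: (addrI (t1 *m A)); rewrite tAC tA mulmxDl scalerDr.
by rewrite addrACA.
Qed.

Lemma tw_comm t A : t *m A = A *m t -> tw t t 0 A.
Proof. by rewrite /tw scale0r addr0. Qed.

(** When the types of the product [A *m M *m C] and of its right factor are known, the failure of
    [A] to have the remaining type is a matrix that kills [M *m C]. The next lemma is the mirror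
    image. *)
Lemma tw_cancel_r t1 t2 t3 c d A M C : tw t1 t3 (c + d) (A *m M *m C) -> tw t2 t3 d C ->
  t2 *m M = M *m t2 -> (t1 *m A - A *m t2 - c *: A) *m M *m C = 0.
Proof.
rewrite /tw => tAC tC tM; rewrite -mulmxA !mulmxBl -!mulmxA (mulmxA t2) tM -(mulmxA M) tC.
rewrite !mulmxA in tAC *; rewrite tAC !mulmxDr !mulmxA -!scalemxAr -!scalemxAl scalerDl.
by rewrite opprD addrACA subrr add0r -addrA -opprD addrC [d *: _ + _]addrC addNr.
Qed.

Lemma tw_cancel_l t1 t2 t3 c d A M C : tw t1 t3 (d + c) (A *m M *m C) -> tw t1 t2 d A ->
  t2 *m M = M *m t2 -> A *m M *m (t2 *m C - C *m t3 - c *: C) = 0.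
Proof.
rewrite /tw => tAC tA tM; rewrite !mulmxBr !mulmxA -(mulmxA A) -tM mulmxA -!scalemxAr.
rewrite !mulmxA tA in tAC; rewrite !mulmxDl -!scalemxAl scalerDl in tAC.
have -> : A *m t2 *m M *m C = A *m M *m C *m t3 + c *: (A *m M *m C).
  by apply: (addIr (d *: (A *m M *m C))); rewrite tAC [d *: _ + _]addrC addrA.
by rewrite addrAC addrK subrr.
Qed.

Lemma tw_of_zero t2 t3 c C (d : 'M[F]_n) : d *m (t2 *m C - C *m t3 - c *: C) = 0 -> d *m t2 = t2 -> d *m C = C ->
  tw t2 t3 c C.
Proof.
rewrite !mulmxBr !mulmxA -scalemxAr => E dt dC; move: E; rewrite dt dC => /eqP.
by rewrite -addrA -opprD subr_eq0 => /eqP.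
Qed.

Lemma tw_of_zero0 t2 t3 c C : t2 *m C - C *m t3 - c *: C = 0 -> tw t2 t3 c C.
Proof. by move/eqP; rewrite -addrA -opprD subr_eq0 => /eqP. Qed.

Lemma mx_neq0 p (A : 'M[F]_(p, n)) : A != 0 -> exists v : 'rV[F]_p, v *m A != 0.
Proof.
move=> nzA; have [/forallP A0 | ] := boolP [forall i, row i A == 0].
  by case/eqP: nzA; apply/row_matrixP=> i; rewrite row0; apply/eqP.
by rewrite negb_forall => /existsP[i]; rewrite rowE; exists (delta_mx 0 i).
Qed.

End Twist.

Section Blocks.

Variables (F : fieldType) (n : nat) (e d : 'M[F]_n).
Hypotheses (ee : e *m e = e) (dd : d *m d = d) (ed : e + d = 1%:M).
Implicit Types (A C K M : 'M[F]_n).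

Lemma block_sum K : K = (e *m K *m e + e *m K *m d) + (d *m K *m e + d *m K *m d).
Proof. by rewrite -!mulmxDr ed !mulmx1 -mulmxDl ed mul1mx. Qed.

Lemma block_mul A C K1 K2 M : e *m M = M *m e -> d *m M = M *m d ->
  A *m (K1 *m M *m K2) *m C =
  (A *m K1 *m e) *m M *m (e *m K2 *m C) + (A *m K1 *m d) *m M *m (d *m K2 *m C).
Proof.
have s f : f *m f = f -> f *m M = M *m f ->
   A *m K1 *m f *m M *m (f *m K2 *m C) = A *m K1 *m (M *m f) *m (K2 *m C).
  by move=> ff fM; rewrite -fM !mulmxA -(mulmxA _ M f) -fM -!mulmxA (mulmxA f f) ff.
move=> eM dM; rewrite (s _ ee eM) (s _ dd dM).
by rewrite -mulmxDl -mulmxDr -mulmxDr ed mulmx1 !mulmxA.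
Qed.

Lemma comm_mul M N K : K *m M = M *m K -> K *m N = N *m K -> K *m (M *m N) = (M *m N) *m K.
Proof. by move=> eg eh; rewrite mulmxA eg -mulmxA eh mulmxA. Qed.

End Blocks.

HB.lock Definition del : 'M['F_2]_12 := 1%:M + eps.
Lemma delE : del = 1%:M + eps. Proof. by rewrite del.unlock. Qed.
HB.lock Definition eta : 'M['F_2]_12 := mat 12 etar.
(** On U this is theta; on W it is [eta] or its conjugate [eta + del]. The two values of [e] are the
    two ways of matching the F_4-structures of U and W. *)
Definition om (e : 'F_2) := tht + eta + e *: del.

Lemma eps_del : eps *m del = 0. Proof. by rewrite delE mulmxDr mulmx1 eps_eps addM. Qed.
Lemma del_eps : del *m eps = 0. Proof. by rewrite delE mulmxDl mul1mx eps_eps addM. Qed.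
Lemma del_del : del *m del = del. Proof. by rewrite {2}delE mulmxDr mulmx1 del_eps addr0. Qed.
Lemma epsDdel : eps + del = 1%:M. Proof. by rewrite delE addrC -addrA addM addr0. Qed.
Lemma eta_del : eta *m del = eta.
Proof. by rewrite delE eta.unlock ?cmx -mat_id mat_add mat_mul //; apply: ceqP; vm_compute. Qed.
Lemma del_eta : del *m eta = eta.
Proof. by rewrite delE eta.unlock ?cmx -mat_id mat_add mat_mul //; apply: ceqP; vm_compute. Qed.
Lemma eta_sqr : eta *m eta = eta + del.
Proof. by rewrite delE eta.unlock ?cmx -mat_id !mat_mul // !mat_add; apply: ceqP; vm_compute. Qed.
Lemma tht_sqr : tht *m tht = tht + eps.
Proof. by rewrite !cmx !mat_mul // !mat_add; apply: ceqP; vm_compute. Qed.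
Lemma tht_del : tht *m del = 0. Proof. by rewrite -tht_eps -mulmxA eps_del mulmx0. Qed.
Lemma del_tht : del *m tht = 0. Proof. by rewrite -eps_tht mulmxA del_eps mul0mx. Qed.

Lemma inW_mdel v : inW (v *m del). Proof. by rewrite /inW -mulmxA del_eps mulmx0. Qed.
Lemma inWE v : inW v -> v *m del = v.
Proof. by rewrite /inW delE mulmxDr mulmx1 => ->; rewrite addr0. Qed.

(** The four blocks of g along V = U + W: [Pk] from U to U, [Rk] from U to W, [Lk] from W to U and
    [Sk] from W to W. *)
HB.lock Definition Pk (L : GLmodel 'F_2 11) (g : L) : 'M['F_2]_12 := eps *m gmx L g *m eps.
Arguments Pk {L} g.
Lemma PkE (L : GLmodel 'F_2 11) (g : L) : Pk g = eps *m gmx L g *m eps.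
Proof. by rewrite Pk.unlock. Qed.
HB.lock Definition Rk (L : GLmodel 'F_2 11) (g : L) : 'M['F_2]_12 := eps *m gmx L g *m del.
Arguments Rk {L} g.
Lemma RkE (L : GLmodel 'F_2 11) (g : L) : Rk g = eps *m gmx L g *m del.
Proof. by rewrite Rk.unlock. Qed.
HB.lock Definition Lk (L : GLmodel 'F_2 11) (g : L) : 'M['F_2]_12 := del *m gmx L g *m eps.
Arguments Lk {L} g.
Lemma LkE (L : GLmodel 'F_2 11) (g : L) : Lk g = del *m gmx L g *m eps.
Proof. by rewrite Lk.unlock. Qed.
HB.lock Definition Sk (L : GLmodel 'F_2 11) (g : L) : 'M['F_2]_12 := del *m gmx L g *m del.
Arguments Sk {L} g.
Lemma SkE (L : GLmodel 'F_2 11) (g : L) : Sk g = del *m gmx L g *m del.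
Proof. by rewrite Sk.unlock. Qed.

Lemma addM_eq n p (A C : 'M['F_2]_(n, p)) : A + C = 0 -> A = C.
Proof. by move=> h; rewrite -[A]addr0 -(addM C) addrA h add0r. Qed.

Local Opaque mulmx.

Section PartIII.

Variable L : GLmodel 'F_2 11.
Local Notation G := (G12 L).
Local Notation gmx := (gmx L).
Local Notation gx := (gx L).
Local Notation gy := (gy L).

Definition mm j i : L := (gy ^+ j * gx ^+ i)%g.

Lemma xy_comm : commute gx gy.
Proof.
by apply: (@gmx_inj _ _ L); rewrite !gmxM gxE gyE !mat_mul //; apply: ceqP; vm_compute.
Qed.

Lemma mmD j i k : mm (j + k) i = (mm j i * gy ^+ k)%g.
Proof.
by rewrite /mm expgD -!mulgA; congr (_ * _)%g; apply/commuteX/commute_sym/commuteX/xy_comm.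
Qed.

Lemma eps_mm j i : eps *m gmx (mm j i) = gmx (mm j i) *m eps.
Proof.
have cX g k : eps *m gmx g = gmx g *m eps -> eps *m gmx (g ^+ k)%g = gmx (g ^+ k)%g *m eps.
  move=> eg; elim: k => [|k IHk]; first by rewrite gmx1 mulmx1 mul1mx.
  by rewrite expgS gmxM; apply: comm_mul.
by rewrite gmxM; apply: comm_mul; apply: cX; rewrite ?y_eps // eps_x x_eps.
Qed.

Lemma del_mm j i : del *m gmx (mm j i) = gmx (mm j i) *m del.
Proof. by rewrite delE mulmxDl mulmxDr mul1mx mulmx1 eps_mm. Qed.

Lemma eps_xi i : eps *m gmx (gx ^+ i)%g = eps.
Proof. by elim: i => [|i IHi]; rewrite ?gmx1 ?mulmx1 // expgSr gmxM mulmxA IHi eps_x. Qed.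

Lemma del_yj j : del *m gmx (gy ^+ j)%g = del.
Proof.
elim: j => [|j IHj]; first by rewrite gmx1 mulmx1.
by rewrite expgSr gmxM mulmxA IHj delE mulmxDl mul1mx y_del.
Qed.

Lemma del_mmx j i : del *m gmx (mm j i) = del *m gmx (gx ^+ i)%g.
Proof. by rewrite gmxM mulmxA del_yj. Qed.

Lemma tht_mm j i : tht *m gmx (mm j i) = gmx (mm j i) *m tht.
Proof.
rewrite (tht_y L) mulmxDl mulmxDr -!gmxM.
have c1 : commute gy (mm j i).
  by apply: commuteM; [apply/commuteX | apply/commuteX/commute_sym/xy_comm].
by rewrite c1 -(commuteX2 4 1 c1) ?expg1.
Qed.

Lemma eta_x : eta *m gmx gx = gmx gx *m eta.
Proof. by rewrite gxE eta.unlock !mat_mul //; apply: ceqP; vm_compute. Qed.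

Lemma eta_mm j i : eta *m gmx (mm j i) = gmx (mm j i) *m eta.
Proof.
have ex : eta *m gmx (gx ^+ i)%g = gmx (gx ^+ i)%g *m eta.
  elim: (i) => [|k IHk]; first by rewrite gmx1 mulmx1 mul1mx.
  by rewrite expgS gmxM; apply: comm_mul; rewrite ?eta_x.
rewrite -[in LHS]eta_del -mulmxA del_mmx mulmxA eta_del ex.
rewrite -[in RHS]del_eta mulmxA -del_mm del_mmx -mulmxA -ex mulmxA del_eta.
by [].
Qed.

(* [xpoly A]: the matrix [A] is a polynomial in [x].                          *)
Definition xpoly (A : 'M['F_2]_12) := exists s : seq nat, A = \sum_(i <- s) gmx (gx ^+ i)%g.

Lemma xpoly_x A i : xpoly A -> A *m gmx (gx ^+ i)%g = gmx (gx ^+ i)%g *m A.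
Proof.
case=> s ->; rewrite mulmx_suml mulmx_sumr; apply: eq_bigr => j _.
by rewrite -!gmxM -!expgD addnC.
Qed.

Lemma xpoly_eps A : xpoly A -> A *m eps = eps *m A.
Proof.
case=> s ->; rewrite mulmx_suml mulmx_sumr; apply: eq_bigr => j _.
by have := eps_mm 0 j; rewrite /mm expg0 mul1g.
Qed.

Lemma spanW_poly w w' : inW w -> w != 0 -> inW w' -> exists2 A, xpoly A & w' = w *m A.
Proof.
move=> Ww nzw; move: w'; apply: (@spanW L _ w) => //.
  by exists 0; rewrite ?mulmx0 //; exists [::]; rewrite big_nil.
move=> i v Wv [A [s ->] ->]; exists (\sum_(j <- i :: s) gmx (gx ^+ j)%g); first by exists (i :: s).
by rewrite big_cons mulmxDr appE.
Qed.

Lemma spanW_mx (A : 'M['F_2]_12) w : inW w -> w != 0 ->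
  (forall i, w *m gmx (gx ^+ i)%g *m A = 0) -> del *m A = 0.
Proof.
move=> Ww nzw wA; have AW : forall w', inW w' -> w' *m A = 0.
  apply: (@spanW L _ w) => //; first by rewrite mul0mx.
  by move=> i v _ vA; rewrite mulmxDl appE wA vA addr0.
by apply/row_matrixP=> i; rewrite row0 rowE mulmxA; apply: AW; apply: inW_mdel.
Qed.

(** The row space of [T] contains a nonzero vector of W, and the translates of this vector under x
    span W. *)
Lemma spanW_mx2 (T A : 'M['F_2]_12) : T *m del = T -> T != 0 ->
  (forall i, T *m gmx (gx ^+ i)%g *m A = 0) -> del *m A = 0.
Proof.
move=> Td /mx_neq0[v nzv] TA; apply: (@spanW_mx A (v *m T)) => //.
  by rewrite -Td mulmxA; apply: inW_mdel.
by move=> i; rewrite -!mulmxA (mulmxA T) TA mulmx0.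
Qed.

Lemma Pk_eps (g : L) : Pk g *m eps = Pk g. Proof. by rewrite PkE -mulmxA eps_eps. Qed.
Lemma eps_Pk (g : L) : eps *m Pk g = Pk g. Proof. by rewrite PkE !mulmxA eps_eps. Qed.
Lemma Rk_del (g : L) : Rk g *m del = Rk g. Proof. by rewrite RkE -mulmxA del_del. Qed.
Lemma eps_Rk (g : L) : eps *m Rk g = Rk g. Proof. by rewrite RkE !mulmxA eps_eps. Qed.
Lemma del_Lk (g : L) : del *m Lk g = Lk g. Proof. by rewrite LkE !mulmxA del_del. Qed.
Lemma Lk_eps (g : L) : Lk g *m eps = Lk g. Proof. by rewrite LkE -mulmxA eps_eps. Qed.
Lemma Sk_del (g : L) : Sk g *m del = Sk g. Proof. by rewrite SkE -mulmxA del_del. Qed.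
Lemma del_Sk (g : L) : del *m Sk g = Sk g. Proof. by rewrite SkE !mulmxA del_del. Qed.

Lemma gmx_split g : gmx g = (Pk g + Rk g) + (Lk g + Sk g).
Proof. by rewrite PkE RkE LkE SkE; apply: block_sum epsDdel _. Qed.

Lemma PkM (k1 k2 : L) j i : Pk (k1 * mm j i * k2)%g =
  Pk k1 *m gmx (mm j i) *m Pk k2 + Rk k1 *m gmx (mm j i) *m Lk k2.
Proof.
rewrite !PkE RkE LkE !gmxM -gmxM.
exact: (block_mul eps_eps del_del epsDdel eps eps (gmx k1) (gmx k2) (eps_mm j i) (del_mm j i)).
Qed.

Lemma RkM (k1 k2 : L) j i : Rk (k1 * mm j i * k2)%g =
  Pk k1 *m gmx (mm j i) *m Rk k2 + Rk k1 *m gmx (mm j i) *m Sk k2.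
Proof.
rewrite PkE !RkE SkE !gmxM -gmxM.
exact: (block_mul eps_eps del_del epsDdel eps del (gmx k1) (gmx k2) (eps_mm j i) (del_mm j i)).
Qed.

Lemma Rk_mm (g : L) j i : Rk g *m gmx (mm j i) = Rk g *m gmx (gx ^+ i)%g.
Proof. by rewrite -(Rk_del g) -!mulmxA del_mmx. Qed.

Lemma mm0 i : mm 0 i = (gx ^+ i)%g. Proof. by rewrite /mm mul1g. Qed.

Lemma del_adj v w : B (v *m del) w = B v (w *m del).
Proof. by rewrite delE !mulmxDr !mulmx1 polar12Dl polar12Dr eps_adj. Qed.

(** The two block products are adjoint to each other, because the inverse of an isometry is its
    adjoint. *)
Lemma block_eq0 (a b : 'M['F_2]_12) (g : L) : (forall v w, B (v *m a) w = B v (w *m a)) ->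
    (forall v w, B (v *m b) w = B v (w *m b)) -> g \in G ->
  b *m gmx g^-1%g *m a = 0 -> a *m gmx g *m b = 0.
Proof.
move=> adja adjb Gg ba0; apply/row_matrixP=> i; rewrite row0 rowE.
apply: (polar_nd q12) => w; rewrite !mulmxA adjb -appE.
rewrite -[w *m b](appKV g) (GO_polar _ _ Gg) adja appE -!mulmxA (mulmxA b) ba0.
by rewrite mulmx0 (polar0r q12).
Qed.

Lemma Pk_inv g : g \in G -> Pk g != 0 -> Pk g^-1%g != 0.
Proof.
move=> Gg; apply: contraNneq; rewrite !PkE => h.
by apply/eqP; apply: block_eq0 h => //; apply: eps_adj.
Qed.

Lemma Lk_inv g : g \in G -> Rk g != 0 -> Lk g^-1%g != 0.
Proof.
move=> Gg; apply: contraNneq; rewrite LkE RkE => h.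
by apply/eqP; apply: block_eq0 h => //; [apply: eps_adj | apply: del_adj].
Qed.

Lemma Rk_inv g : g \in G -> Lk g != 0 -> Rk g^-1%g != 0.
Proof.
move=> Gg; apply: contraNneq; rewrite LkE RkE => h.
by apply/eqP; apply: block_eq0 h => //; [apply: del_adj | apply: eps_adj].
Qed.

Section Pure.

Variable H : {group L}.
Hypotheses (sHG : H \subset G) (Hx : gx \in H) (Hy : gy \in H).
Hypothesis pure : forall k, k \in H -> exists c, tw tht tht c (Pk k).

Lemma mm_in j i : mm j i \in H. Proof. by rewrite groupM ?groupX. Qed.

(** The differences of a nonzero vector of U and its translates under y span U, so [Pk k2] cannot
    kill them all. *)
Lemma P_diff (k1 k2 : L) j0 i0 : Pk k1 != 0 -> Pk k2 != 0 ->
  exists j, Pk k1 *m (gmx (mm j0 i0) + gmx (mm (j0 + j) i0)) *m Pk k2 != 0.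
Proof.
move=> /mx_neq0[v nzv] nz2.
pose u := v *m Pk k1 *m gmx (mm j0 i0).
have Uu : u *m eps = u by rewrite /u -mulmxA -eps_mm !mulmxA -(mulmxA v) Pk_eps.
have nzu : u != 0.
  apply: contra nzv => /eqP u0; rewrite -[v *m _]mulmx1 -(gmxKV (mm j0 i0)) mulmxA.
  by rewrite -/u u0 mul0mx.
have [/forallP all0 | ] := boolP [forall j : 'I_5,
  Pk k1 *m (gmx (mm j0 i0) + gmx (mm (j0 + j) i0)) *m Pk k2 == 0]; last first.
  by rewrite negb_forall => /existsP[j]; exists (j : nat).
case/eqP: nz2; rewrite -eps_Pk; apply: (spanU (L := L) Uu nzu) => j.
have -> : (gy ^+ j)%g = (gy ^+ (j %% 5))%g by rewrite expg_mod ?(y5 L).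
have := all0 (inord (j %% 5)); rewrite inordK ?ltn_mod // => /eqP e.
rewrite appE /u -[X in _ + X]mulmxA -gmxM -mmD -mulmxDr -(mulmxA v) -(mulmxA v).
by rewrite e mulmx0.
Qed.

(** As y is trivial on W, only the path through U depends on the exponent of y. *)
Lemma PkM_diff (k1 k2 : L) j i l : Pk (k1 * mm (j + l) i * k2)%g =
  Pk (k1 * mm j i * k2)%g + Pk k1 *m (gmx (mm j i) + gmx (mm (j + l) i)) *m Pk k2.
Proof.
rewrite !PkM !Rk_mm mulmxDr mulmxDl [RHS]addrC -!addrA [RHS]addrCA.
by rewrite (addrA (Pk k1 *m gmx (mm j i) *m Pk k2)) addM add0r.
Qed.

Lemma F2_tri (a b c : 'F_2) : a != b -> c = a \/ c = b.
Proof.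
by case: (F2_cases a) => ->; case: (F2_cases b) => ->; case: (F2_cases c) => ->; rewrite ?eqxx; auto.
Qed.

(** Changing the exponent of y alters the block by a nonzero matrix E of type [c1 + c2]. Suppose
    that the block has the other type. If the altered block has it too, then E has both types and
    vanishes; otherwise the block, as a difference of two matrices of type [c1 + c2], has that type
    after all. *)
Lemma sg_mul k1 k2 c1 c2 j i : k1 \in H -> k2 \in H -> Pk k1 != 0 -> Pk k2 != 0 ->
  tw tht tht c1 (Pk k1) -> tw tht tht c2 (Pk k2) ->
  tw tht tht (c1 + c2) (Pk (k1 * mm j i * k2)%g).
Proof.
move=> H1 H2 nz1 nz2 t1 t2.
have [c0 t0] := pure (groupM (groupM H1 (mm_in j i)) H2).
have [<- // | nc] := eqVneq c0 (c1 + c2).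
have [l nzl] := P_diff j i nz1 nz2.
have [c tc] := pure (groupM (groupM H1 (mm_in (j + l) i)) H2).
set Z := Pk (k1 * _ * _)%g in t0 *; set Zl := Pk (k1 * _ * _)%g in tc.
set E := (X in X != 0) in nzl.
have ZlE : Zl = Z + E := PkM_diff _ _ _ _ _.
have tE : tw tht tht (c1 + c2) E.
  by rewrite /E mulmxDr mulmxDl; apply: tw_add; apply: tw_mul t2;
    rewrite -[c1]addr0; apply: tw_mul t1 _; apply/tw_comm/tht_mm.
have tsc a b A : tw tht tht a A -> tw tht tht b A -> a != b -> A = 0.
  rewrite /tw => -> /addrI/eqP; rewrite -subr_eq0 -scalerBl scaler_eq0 subr_eq0.
  by case/orP=> [/eqP-> | /eqP //]; rewrite eqxx.
have [cE|cE] := F2_tri c nc.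
  have tZE : tw tht tht c0 (Z + E) by rewrite -ZlE -cE; exact: tc.
  have tE0 := tw_sub tZE t0.
  by case/eqP: nzl; apply: tsc tE0 tE nc.
have tEZ : tw tht tht (c1 + c2) (E + Z) by rewrite [E + Z]addrC -ZlE -cE; exact: tc.
exact: tw_sub tEZ tE.
Qed.

Lemma sg_RL k1 k2 c1 c2 i : k1 \in H -> k2 \in H -> Pk k1 != 0 -> Pk k2 != 0 ->
  tw tht tht c1 (Pk k1) -> tw tht tht c2 (Pk k2) ->
  tw tht tht (c1 + c2) (Rk k1 *m gmx (gx ^+ i)%g *m Lk k2).
Proof.
move=> H1 H2 nz1 nz2 t1 t2; have := sg_mul 0 i H1 H2 nz1 nz2 t1 t2.
rewrite PkM mm0 => /tw_sub; apply; apply: tw_mul t2.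
by rewrite -[c1]addr0; apply: tw_mul t1 _; apply/tw_comm; rewrite -mm0 tht_mm.
Qed.

Section Base.

Variable k1 : L.
Hypotheses (H1 : k1 \in H) (nzP1 : Pk k1 != 0) (nzR1 : Rk k1 != 0).
Variable c1 : 'F_2.
Hypothesis t1 : tw tht tht c1 (Pk k1).
Let G1 : k1 \in G. Proof. exact: subsetP H1. Qed.
Let P1' : Pk k1^-1%g != 0. Proof. exact: Pk_inv. Qed.
Let L1 := Lk k1^-1%g.
Let nzL1 : L1 != 0. Proof. exact: Lk_inv. Qed.

Lemma t1' : tw tht tht c1 (Pk k1^-1%g).
Proof.
have [c tc] := pure (groupVr H1).
have := sg_mul 0 0 H1 (groupVr H1) nzP1 P1' t1 tc; rewrite mm0 expg0 mulg1 mulgV.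
rewrite /tw PkE gmx1 mulmx1 eps_eps tht_eps eps_tht => /esym/eqP.
rewrite -[X in _ == X]addr0 (inj_eq (addrI _)) scaler_eq0.
have [e0|_] := eqVneq eps 0; last by rewrite orbF addr_eq0 (oppc2 char2_F2) => /eqP->.
by case/eqP: nzP1; rewrite PkE e0 mulmx0.
Qed.

(** The products [Rk k1], power of x, [L1] commute with theta. Irreducibility of W under x
    transports theta through them to a root of X^2 + X + 1 on W, which must be [eta] or
    [eta + del]. *)
Lemma tw_base : exists2 e : 'F_2, tw tht (eta + e *: del) c1 (Rk k1) & tw (eta + e *: del) tht c1 L1.
Proof.
have [v nzv] := mx_neq0 nzR1; set w := v *m _ in nzv.
have Ww : inW w by rewrite /w -Rk_del mulmxA; apply: inW_mdel.
have Ww' : inW (v *m tht *m Rk k1) by rewrite -Rk_del mulmxA; apply: inW_mdel.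
(* For the single vector [w], theta becomes a polynomial [a] in x. Comparison with the products
   [Rk k1], power of x, [L1] extends this to all of W. *)
have [a pa aE] := spanW_poly Ww nzv Ww'.
have tRL i : tht *m (Rk k1 *m gmx (gx ^+ i)%g *m L1) = Rk k1 *m gmx (gx ^+ i)%g *m L1 *m tht.
  have := sg_RL i H1 (groupVr H1) nzP1 P1' t1 t1'.
  by rewrite /tw addF2 scale0r addr0.
have dLt : del *m (L1 *m tht - a *m L1) = 0.
  apply: (@spanW_mx _ w) => // i; rewrite mulmxBr !mulmxA.
  rewrite -(mulmxA w _ a) -(xpoly_x i pa) mulmxA -aE.
  apply/eqP; rewrite subr_eq0 /w -!mulmxA.
  by have := tRL i; rewrite -!mulmxA => <-.
have Lt : a *m L1 = L1 *m tht.
  move/eqP: dLt; rewrite mulmxBr subr_eq0 !mulmxA del_Lk => /eqP->.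
  have -> : del *m a = a *m del.
    by rewrite delE mulmxDl mulmxDr mul1mx mulmx1 xpoly_eps.
  by rewrite -mulmxA del_Lk.
have tR : tht *m Rk k1 = Rk k1 *m a.
  apply/eqP; rewrite -subr_eq0; apply/negPn/negP=> nzT.
  set T := _ - _ in nzT.
  have Td : T *m del = T.
    have ad : a *m del = del *m a by rewrite delE mulmxDl mulmxDr mul1mx mulmx1 xpoly_eps.
    by rewrite mulmxBl -!mulmxA ad Rk_del (mulmxA (Rk k1) del) Rk_del.
  case/eqP: nzL1; rewrite /L1 -del_Lk; apply: (spanW_mx2 Td nzT) => i; rewrite -/L1.
  rewrite !mulmxBl -!mulmxA (mulmxA (Rk k1)) tRL -!mulmxA (mulmxA a) (xpoly_x i pa).
  by rewrite -(mulmxA _ a) Lt subrr.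
have ad : a *m del = del *m a by rewrite delE mulmxDl mulmxDr mul1mx mulmx1 xpoly_eps.
have ax i : a *m gmx (gx ^+ i)%g = gmx (gx ^+ i)%g *m a by apply: xpoly_x.
have R2 : Rk k1 *m (a *m a + a + 1%:M) = 0.
  rewrite !mulmxDr mulmx1 mulmxA -tR -mulmxA -tR mulmxA tht_sqr mulmxDl eps_Rk.
  by rewrite -addrA addM.
have da : del *m (a *m a + a + 1%:M) = 0.
  apply: (spanW_mx2 (Rk_del k1) nzR1) => i; rewrite -mulmxA.
  have -> : gmx (gx ^+ i)%g *m (a *m a + a + 1%:M) = (a *m a + a + 1%:M) *m gmx (gx ^+ i)%g.
    by rewrite !mulmxDl !mulmxDr mul1mx mulmx1 mulmxA -ax -!mulmxA -ax.
  by rewrite mulmxA R2 mul0mx.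
have ea : a *m eta = eta *m a.
  case: pa => s ->; rewrite mulmx_suml mulmx_sumr; apply: eq_bigr => i _.
  by rewrite -mm0 eta_mm.
(* On W both [a] and [eta] are roots of X^2 + X + 1, and they commute, so [b] is idempotent; it
   commutes with x, and irreducibility leaves only [b = 0] and [b = del]. *)
pose b := del *m a + eta.
have bx i : b *m gmx (gx ^+ i)%g = gmx (gx ^+ i)%g *m b.
  by rewrite /b mulmxDl mulmxDr -mulmxA ax mulmxA -mm0 del_mm eta_mm mulmxA.
have bd : b *m del = b by rewrite /b mulmxDl -mulmxA ad mulmxA del_del eta_del.
have db : del *m b = b by rewrite /b mulmxDr mulmxA del_del del_eta.
have bb : b *m b = b.
  have daa : del *m a *m (del *m a) = del *m a + del.
    rewrite -mulmxA (mulmxA a) ad !mulmxA del_del; apply: addM_eq.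
    by move: da; rewrite !mulmxDr mulmx1 mulmxA -addrA.
  rewrite {1}/b mulmxDl {1}/b mulmxDr daa {1}/b mulmxDr eta_sqr.
  have -> : eta *m (del *m a) = del *m a *m eta.
    by rewrite mulmxA eta_del -mulmxA ea mulmxA del_eta.
  rewrite addrACA addrA -(addrA (del *m a + del)) addM addr0 -addrA addrCA [del + _]addrC.
  by rewrite -addrA -(addrA eta) addM addr0.
have [e be] : exists e : 'F_2, b = e *: del.
  have [b0 | nzb] := eqVneq b 0; first by exists 0; rewrite scale0r.
  exists 1; rewrite scale1r; have := spanW_mx2 bd nzb (A := b + del).
  move=> /(_ _)/eqP; rewrite mulmxDr db del_del addr_eq0.
  have -> : - del = del by apply/matrixP=> i j; rewrite mxE (oppc2 char2_F2).
  move=> h; apply/eqP/h => i; by rewrite bx -mulmxA mulmxDr bb bd addM mulmx0.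
have dae : del *m a = eta + e *: del by rewrite -be /b addrCA addM addr0.
(* [Rk k1] intertwines theta with [eta + e *: del] exactly; in terms of the twist [c1] this shifts
   [e] by [c1]. *)
exists (e + c1); rewrite /tw scalerDl.
  rewrite tR -{1}(Rk_del k1) -mulmxA dae !mulmxDr -!scalemxAr Rk_del -!addrA.
  by rewrite addM addr0.
have aL : a *m L1 = (eta + e *: del) *m L1 by rewrite -dae -ad -mulmxA /L1 del_Lk.
rewrite -Lt aL addrA [in LHS]mulmxDl; congr (_ + _).
by rewrite -scalemxAl /L1 del_Lk.
Qed.

Section Fix.

Variable e : 'F_2.
Let h := eta + e *: del.
Hypotheses (hR1 : tw tht h c1 (Rk k1)) (hL1 : tw h tht c1 L1).

Lemma del_h : del *m h = h.
Proof. by rewrite mulmxDr del_eta -scalemxAr del_del. Qed.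
Lemma h_del : h *m del = h.
Proof. by rewrite mulmxDl eta_del -scalemxAl del_del. Qed.
Lemma h_mm j i : h *m gmx (mm j i) = gmx (mm j i) *m h.
Proof. by rewrite mulmxDl mulmxDr eta_mm -scalemxAl -scalemxAr del_mm. Qed.
Lemma h_x i : h *m gmx (gx ^+ i)%g = gmx (gx ^+ i)%g *m h.
Proof. by rewrite -mm0 h_mm. Qed.
Lemma h_eps : h *m eps = 0. Proof. by rewrite -h_del -mulmxA del_eps mulmx0. Qed.
Lemma eps_h : eps *m h = 0. Proof. by rewrite -del_h mulmxA eps_del mul0mx. Qed.

(** The type of [Rk k], power of x, [L1] is known from [sg_RL] and that of [L1] from the base
    element. After cancellation the defect of [Rk k] kills all translates of [L1], which is
    nonzero. *)
Lemma twR k c : k \in H -> Pk k != 0 -> tw tht tht c (Pk k) -> tw tht h c (Rk k).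
Proof.
move=> Hk nzk tk; apply: tw_of_zero0; apply/eqP/negPn/negP=> nzT.
have Td : (tht *m Rk k - Rk k *m h - c *: Rk k) *m del = tht *m Rk k - Rk k *m h - c *: Rk k.
  by rewrite !mulmxBl -scalemxAl -!mulmxA Rk_del h_del.
case/eqP: nzL1; rewrite /L1 -del_Lk; apply: (spanW_mx2 Td nzT) => i; rewrite -/L1.
by apply: tw_cancel_r hL1 (h_x i); apply: sg_RL t1'; rewrite ?groupV.
Qed.

Lemma twL k c : k \in H -> Pk k != 0 -> tw tht tht c (Pk k) -> tw h tht c (Lk k).
Proof.
move=> Hk nzk tk; apply: (@tw_of_zero _ _ _ _ _ _ del) del_h (del_Lk k).
apply: (spanW_mx2 (Rk_del k1) nzR1) => i.
by apply: tw_cancel_l hR1 (h_x i); apply: sg_RL.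
Qed.

Lemma twS k c : k \in H -> Pk k != 0 -> tw tht tht c (Pk k) -> tw h h c (Sk k).
Proof.
move=> Hk nzk tk; apply: (@tw_of_zero _ _ _ _ _ _ del) del_h (del_Sk k).
apply: (spanW_mx2 (Rk_del k1) nzR1) => i.
(* The exponent of y is chosen so that the product has a nonzero U-block and [twR] applies to it.
   Removing the path through U leaves [Rk k1], the inserted power, [Sk k], from which [Rk k1] is
   cancelled. *)
have [j nzj] : exists j, Pk (k1 * mm j i * k)%g != 0.
  have [l nzl] := P_diff 0 i nzP1 nzk.
  have [P0 | ] := eqVneq (Pk (k1 * mm 0 i * k)%g) 0; last by exists 0%N.
  by exists (0 + l)%N; rewrite PkM_diff P0 add0r.
have Hg : (k1 * mm j i * k)%g \in H by apply: groupM Hk; apply: groupM H1 (mm_in j i).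
have := twR Hg nzj (sg_mul j i H1 Hk nzP1 nzk t1 tk).
rewrite RkM => /tw_sub tRS; rewrite -(Rk_mm k1 j i).
apply: tw_cancel_l hR1 (h_mm j i); apply: tRS.
apply: tw_mul (twR Hk nzk tk); rewrite -[c1]addr0; apply: tw_mul t1 _.
exact/tw_comm/tht_mm.
Qed.

Lemma tw_ext (t t' s s' : 'M['F_2]_12) c A : t' *m A = t *m A -> A *m s' = A *m s ->
  tw t s c A -> tw t' s' c A.
Proof. by rewrite /tw => -> ->. Qed.

Lemma tw_all k c : k \in H -> Pk k != 0 -> tw tht tht c (Pk k) ->
  tw (tht + h) (tht + h) c (gmx k).
Proof.
move=> Hk nzk tk; rewrite gmx_split.
have hl (A : 'M['F_2]_12) : eps *m A = A -> (tht + h) *m A = tht *m A.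
  by move=> eA; rewrite mulmxDl -{2}eA (mulmxA h) h_eps mul0mx addr0.
have hr (A : 'M['F_2]_12) : A *m eps = A -> A *m (tht + h) = A *m tht.
  by move=> eA; rewrite mulmxDr -{2}eA -(mulmxA _ eps) eps_h mulmx0 addr0.
have dl (A : 'M['F_2]_12) : del *m A = A -> (tht + h) *m A = h *m A.
  by move=> eA; rewrite mulmxDl -{1}eA (mulmxA tht) tht_del mul0mx add0r.
have dr (A : 'M['F_2]_12) : A *m del = A -> A *m (tht + h) = A *m h.
  by move=> eA; rewrite mulmxDr -{1}eA -(mulmxA _ del) del_tht mulmx0 add0r.
apply: tw_add; apply: tw_add.
- exact: (tw_ext (hl _ (eps_Pk k)) (hr _ (Pk_eps k)) tk).
- exact: (tw_ext (hl _ (eps_Rk k)) (dr _ (Rk_del k)) (twR Hk nzk tk)).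
- exact: (tw_ext (dl _ (del_Lk k)) (hr _ (Lk_eps k)) (twL Hk nzk tk)).
- exact: (tw_ext (dl _ (del_Sk k)) (dr _ (Sk_del k)) (twS Hk nzk tk)).
Qed.

Lemma tw_inv t c (g : L) : tw t t c (gmx g) -> tw t t c (gmx g^-1%g).
Proof.
rewrite /tw => tg; have : gmx g^-1%g *m (t *m gmx g) *m gmx g^-1%g = gmx g^-1%g *m t.
  by rewrite -!mulmxA gmxKV mulmx1.
rewrite tg mulmxDr mulmxDl -scalemxAr -scalemxAl !mulmxA gmxVK !mul1mx => <-.
by rewrite -addrA addM addr0.
Qed.

Lemma tw_gmxM t c d (g g' : L) : tw t t c (gmx g) -> tw t t d (gmx g') -> tw t t (c + d) (gmx (g * g')%g).
Proof. by rewrite gmxM; apply: tw_mul. Qed.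

(** If the U-block of [k] vanishes, [k] is still the quotient of k x^i k1^-1 by x^i k1^-1, and for a
    suitable i both have a nonzero U-block. *)
Lemma tw_H k : k \in H -> exists c, tw (tht + h) (tht + h) c (gmx k).
Proof.
move=> Hk; have [c tc] := pure Hk.
have [Pk0 | nzk] := eqVneq (Pk k) 0; last by exists c; apply: tw_all.
have nzR : Rk k != 0.
  apply: contraNneq nzP1 => Rk0; rewrite PkE.
  have : eps *m gmx k = 0.
    by rewrite -[gmx k]mulmx1 -epsDdel !mulmxDr !mulmxA -PkE -RkE Pk0 Rk0 addr0.
  move=> ek; have -> : eps = 0 by rewrite -[LHS]mulmx1 -(gmxKV k) mulmxA ek mul0mx.
  by rewrite !mul0mx.
have [i nzi] : exists i, Rk k *m gmx (gx ^+ i)%g *m L1 != 0.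
  have [/forallP all0 | ] := boolP [forall i : 'I_(#[gx]%g), Rk k *m gmx (gx ^+ i)%g *m L1 == 0]; last first.
    by rewrite negb_forall => /existsP[i]; exists (i : nat).
  case/eqP: nzL1; rewrite /L1 -del_Lk; apply: (spanW_mx2 (Rk_del k) nzR) => i; rewrite -/L1.
  by rewrite -expg_mod_order; apply/eqP; apply: (all0 (Ordinal (ltn_pmod i (order_gt0 gx)))).
have Hm : mm 0 i \in H by apply: mm_in.
have Hh : (mm 0 i * k1^-1)%g \in H by apply: groupM Hm (groupVr H1).
have Hg : (k * mm 0 i * k1^-1)%g \in H by rewrite -mulgA; apply: groupM Hk Hh.
have nzg : Pk (k * mm 0 i * k1^-1)%g != 0.
  by rewrite PkM Pk0 !mul0mx add0r mm0.
have nzh : Pk (mm 0 i * k1^-1)%g != 0.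
  by rewrite PkE gmxM mulmxA mm0 eps_xi -PkE.
have [a ta] := pure Hg; have [b tb] := pure Hh.
have := tw_gmxM (tw_all Hg nzg ta) (tw_inv (tw_all Hh nzh tb)).
by rewrite -(mulgA k) mulgK; exists (a + b).
Qed.

End Fix.

Lemma pure_om : exists e, forall k, k \in H -> exists c, tw (om e) (om e) c (gmx k).
Proof.
have [e hR1 hL1] := tw_base; exists e => k Hk.
by have [c] := tw_H hR1 hL1 Hk; rewrite /om -addrA; exists c.
Qed.

End Base.

End Pure.

Lemma x17 : (gx ^+ 17)%g = 1%g.
Proof.
apply: (@gmx_inj _ _ L); rewrite gmx1; apply: gmx_eqP => v; rewrite -appE mulmx1.
have [l sl <-] := vcb_surj v; rewrite x_code; apply: veqP; move: l sl.
suff: lall (fun l => veq 12 (iter 17 (lmul^~ Xr) l) l) (allv [:: false; true] 12).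
  by rewrite lallE => /allP ok l sl; apply: ok; apply: mem_allvb.
by vm_compute.
Qed.

Lemma x_fix w : inW w -> w *m gmx gx = w -> w = 0.
Proof.
rewrite -appE; move: w; apply: (vcb_all (p := fun l => if veq 12 (lmul l epsr) [::] then
  if veq 12 (lmul l Xr) l then veq 12 l [::] else true else true)); last by vm_compute.
move=> l sl; case: ifP => [_|nW _ /W_codes]; last by move=> /(_ sl); rewrite nW.
case: ifP => [_ /veqP-> _ _|nx _ _]; first by rewrite vcb0.
rewrite appE gxE vcb_mat // => /rowP xl; case/negP: nx; rewrite /veq lallE; apply/allP=> j.
by rewrite mem_iota add0n => /andP[_ ltj]; have := xl (Ordinal ltj); rewrite !mxE => /b2F_inj->.
Qed.

(** The sum is fixed by x, and x has no nonzero fixed vector in W. *)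
Lemma sum_x : del *m (\sum_(i < 17) gmx (gx ^+ i)%g) = 0.
Proof.
set S := \sum_(_ < _) _; have Sx : S *m gmx gx = S.
  rewrite /S mulmx_suml [RHS]big_ord_recl big_ord_recr /= -gmxM -expgSr x17 addrC.
  by congr (_ + _); apply: eq_bigr => i _; rewrite -gmxM -expgSr.
have Sd : del *m S = S *m del.
  by rewrite mulmx_suml mulmx_sumr; apply: eq_bigr => i _; rewrite -mm0 del_mm.
apply/row_matrixP=> i; rewrite row0 rowE; apply: x_fix.
  by rewrite Sd mulmxA; apply: inW_mdel.
by rewrite -!mulmxA Sx.
Qed.

Lemma rank_eps : (\rank eps <= 4)%N.
Proof. by rewrite epsE; apply: leq_trans (mxrankM_maxl _ _) (mulmx_max_rank _ _). Qed.

Lemma rank_del : (8 <= \rank del)%N.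
Proof.
have : (12 <= \rank eps + \rank del)%N.
  rewrite -{1}(mxrank1 'F_2 12) -epsDdel; apply: leq_trans (mxrank_add _ _) _; exact: leqnn.
by have := rank_eps; lia.
Qed.

(** If [Pk h = 0], the U-blocks of the conjugates h x^i h^-1 add up to 0 by [sum_x], while the one
    for i = 0 is [eps]; so some other i gives a nonzero block. If that conjugate had no block from U
    to W, the row space of [Rk h] would be invariant under x, hence all of W, although its dimension
    is at most 4. *)
Lemma base_ex (H : {group L}) h : H \subset G -> gx \in H -> h \in H -> Rk h != 0 ->
  exists k, [/\ k \in H, Pk k != 0 & Rk k != 0].
Proof.
move=> sHG Hx Hh nzR; have Gh := subsetP sHG _ Hh.
have [P0 | nzP] := eqVneq (Pk h) 0; last by exists h.
pose k i := (h * mm 0 i * h^-1)%g.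
have Hk i : k i \in H by rewrite /k mm0 groupM ?groupV // groupM // groupX.
have kE i : Pk (k i) = Rk h *m gmx (gx ^+ i)%g *m Lk h^-1%g.
  by rewrite PkM P0 !mul0mx add0r mm0.
have nze : eps != 0.
  by apply: contraNneq nzR => e0; rewrite RkE e0 !mul0mx.
have [i i0 nzi] : exists2 i : 'I_17, i != 0 :> nat & Pk (k i) != 0.
  have sumP : \sum_(i < 17) Pk (k i) = 0.
    under eq_bigr => i _ do rewrite kE; rewrite -mulmx_suml -mulmx_sumr.
    by rewrite -(Rk_del h) -(mulmxA _ del) sum_x mulmx0 mul0mx.
  have [/forallP all0 | ] := boolP [forall i : 'I_17, (i != 0 :> nat) ==> (Pk (k i) == 0)]; last first.
    by rewrite negb_forall => /existsP[i]; rewrite negb_imply => /andP[i0 nzi]; exists i.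
  case/eqP: nze; rewrite -sumP big_ord_recl big1 => [|i _].
    by rewrite addr0 /k mm0 expg0 mulg1 mulgV PkE gmx1 mulmx1 eps_eps.
  exact/eqP/(implyP (all0 (lift ord0 i))).
exists (k i); split=> //; apply/negP=> /eqP R0.
have epsR : eps *m gmx h = Rk h.
  by rewrite -[gmx h]mulmx1 -epsDdel !mulmxDr !mulmxA -PkE -RkE P0 add0r.
have Ri : Rk h *m gmx (gx ^+ i)%g = Pk (k i) *m Rk h.
  rewrite -epsR mulmxA Pk_eps -[Pk _]addr0 -R0 PkE RkE -mulmxDr epsDdel mulmx1.
  by rewrite -!mulmxA -!gmxM /k mm0 mulgKV.
(* The exponent i is prime to 17, so x is a power of x^i. *)
have [m im] : exists m, (i * m %% 17 = 1)%N.
  have : all (fun i => has (fun m => i * m %% 17 == 1)%N (iota 1 16)) (iota 1 16) by [].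
  move/allP/(_ (i : nat)); rewrite mem_iota lt0n i0 ltn_ord => /(_ isT).
  by case/hasP=> m _ /eqP im; exists m.
have Rim j : exists C, Rk h *m gmx (gx ^+ (i * j))%g = C *m Rk h.
  elim: j => [|j [C IHj]]; first by exists 1%:M; rewrite muln0 gmx1 mulmx1 mul1mx.
  exists (C *m Pk (k i)); rewrite mulnS addnC expgD gmxM mulmxA IHj -mulmxA Ri mulmxA.
  by [].
have Rx j : exists C, Rk h *m gmx (gx ^+ j)%g = C *m Rk h.
  have [C CE] := Rim (m * j)%N; exists C; rewrite -CE; congr (_ *m gmx _).
  by rewrite -[LHS](expg_mod _ x17) -[RHS](expg_mod _ x17) mulnA -modnMml im mul1n.
have [v nzv] := mx_neq0 nzR.
have sW : forall w', inW w' -> (w' <= Rk h)%MS.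
  apply: (@spanW L _ (v *m Rk h)) => //.
  - by rewrite -Rk_del mulmxA; apply: inW_mdel.
  - exact: sub0mx.
  move=> j w Ww sw; rewrite addmx_sub // appE -mulmxA; have [C ->] := Rx j.
  by rewrite mulmxA submxMl.
have : (del <= Rk h)%MS.
  by apply/row_subP=> j; apply: sW; rewrite rowE; apply: inW_mdel.
move/mxrankS => le1; have := leq_trans rank_del le1.
have : (\rank (Rk h) <= 4)%N.
  by rewrite RkE -mulmxA; apply: leq_trans (mxrankM_maxl _ _) rank_eps.
by move=> r4 r8; have := leq_trans r8 r4.
Qed.

(** If all blocks from U to W vanish, U is stable. Otherwise there is a base element. If every
    U-block in [H] is linear or semilinear over theta, [pure_om] gives a field structure; if some
    U-block is not, [partI] gives the 3-cycle, which spreads to Omega. *)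
Theorem core (H : {group L}) : H \subset G -> gx \in H -> gy \in H ->
  [\/ forall k, k \in H -> eps *m gmx k = gmx k *m eps,
      exists e, forall k, k \in H -> exists c, tw (om e) (om e) c (gmx k)
    | (G^`(1))%g \subset H].
Proof.
move=> sHG Hx Hy.
have [/forall_inP allR | ] := boolP [forall h in H, Rk h == 0].
  apply: Or31 => k Hk; have Gk := subsetP sHG _ Hk.
  have Rk0 := eqP (allR _ Hk).
  have Lk0 : Lk k = 0.
    apply/eqP/negPn/negP=> nzL; have := Rk_inv Gk nzL.
    by rewrite (eqP (allR _ (groupVr Hk))) eqxx.
  have [e1 e2] : eps *m gmx k = Pk k + Rk k /\ gmx k *m eps = Pk k + Lk k.
    split; first by rewrite PkE RkE -mulmxDr epsDdel mulmx1.
    by rewrite PkE LkE -!mulmxA -mulmxDl epsDdel mul1mx.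
  by rewrite e1 e2 Rk0 Lk0.
rewrite negb_forall => /existsP[h]; rewrite negb_imply => /andP[Hh nzR].
have [k [Hk nzP nzRk]] := base_ex sHG Hx Hh nzR.
have [/forall_inP pu | ] := boolP [forall k in H, [exists c : 'F_2,
    tht *m Pk k == Pk k *m tht + c *: Pk k]].
  have pure k' : k' \in H -> exists c, tw tht tht c (Pk k').
    by move/pu/existsP=> [c /eqP]; exists c.
  have [c tc] := pure _ Hk.
  by apply: Or32; apply: (pure_om sHG Hx Hy pure Hk nzP nzRk tc).
rewrite negb_forall => /existsP[g]; rewrite negb_imply => /andP[Hg npu].
apply: Or33; have Gg := subsetP sHG _ Hg.
have [N | [c ce]] := partI Gg Hy (groupJ Hy Hg).
  have nzP' : Pc (gmx k) != 0 by rewrite /Pc -PkE.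
  have nzR' : eps *m gmx k *m (1%:M + eps) != 0 by rewrite -delE -RkE.
  exact: (Omega_sub (allD sHG Hx N Hk nzP' nzR')).
case/negP: npu; apply/existsP; exists c; apply/eqP.
move: ce; rewrite /Pc -PkE => ce; apply: addM_eq.
by rewrite addrA ce addM.
Qed.

End PartIII.

End Overgroups.

(** * Every element of the given type is conjugate to the model, up to a power of its part of order
    17 *)

Module Reduction.

Import QuadraticForms WittFrames Codings IsometryGroups ModelElements PurityCertificates Derivations Purity Decomposition ThreeCycles Overgroups.

Local Notation Q := Q12.
Local Notation B := (polar Q12).
Local Opaque mulmx.

Lemma sum_parity (V : zmodType) (f : nat -> V) l N : (forall v : V, v + v = 0) ->
    all (fun n => n < N)%N l ->
  \sum_(n <- l) f n = \sum_(n < N | odd (count_mem (n : nat) l)) f n.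
Proof.
move=> VV; elim: l => [|a l IHl] /=; first by rewrite big_nil big_pred0.
case/andP=> ltaN /IHl{}IHl; rewrite big_cons IHl.
have [ol | el] := boolP (odd (count_mem a l)).
  rewrite (bigD1 (Ordinal ltaN)) //= addrA VV add0r; apply: eq_bigl => i /=.
  rewrite -(inj_eq val_inj) /= eq_sym; case: eqP => [<- | _] /=; last by rewrite andbT.
  by rewrite andbF ol.
rewrite [RHS](bigD1 (Ordinal ltaN)) /= ?eqxx ?el //; congr (_ + _); apply: eq_bigl => i /=.
rewrite -(inj_eq val_inj) /= eq_sym; case: eqP => [-> | _] /=; last by rewrite andbT.
by rewrite andbF (negPf el).
Qed.

Lemma gram_quad n (r r' : 'M['F_2]_(n, 12)) :
    (forall i, Q (row i r) = Q (row i r')) ->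
    (forall i j, B (row i r) (row j r) = B (row i r') (row j r')) ->
  forall c : 'rV_n, Q (c *m r) = Q (c *m r').
Proof.
move=> Qr Br c; rewrite !mulmx_sum_row.
suff: Q (\sum_i c 0 i *: row i r) = Q (\sum_i c 0 i *: row i r') /\
   forall j, B (\sum_i c 0 i *: row i r) (row j r) = B (\sum_i c 0 i *: row i r') (row j r').
  by case.
elim/big_rec2: _ => [|i u u' _ [Qu Bu]].
  by split=> [|j]; rewrite ?(quad0 q12) // !(polar0l q12).
split=> [|j]; last by rewrite !polar12Dl !(polarZl q12) Bu Br.
by rewrite !QD Qu !(quadZ q12) Qr !(polarZl q12) !(polar12C (row i _)) Bu.
Qed.

(** The list holds the products of w and w x^n for n at most 8; the others follow from the period 17
    and the symmetry between n and 17 - n. The next definitions evaluate the forms on sums of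
    translates of w, with 16 i in place of - i. *)
Definition beta (bl : seq bool) (n : nat) : bool :=
  let m := (n %% 17)%N in nth false bl (if (m <= 8)%N then m else 17 - m)%N.
Definition brow (b : nat -> bool) i d := foldr (fun j a => addb (b (j + 16 * i)%N) a) false d.
Definition bcode (b : nat -> bool) c d := foldr (fun i a => addb (brow b i d) a) false c.
Fixpoint qcode (b : nat -> bool) q (c : seq nat) : bool :=
  if c is i :: c' then addb (addb q (qcode b q c')) (brow b i c') else false.
Definition prof := [:: false; true; false; true; false; false; false; false].
(** The exponents of 1 + X^3 + X^4 + X^5 + X^8, one of the two factors of degree 8 of 1 + X + ... +
    X^16 over F_2; [p2l] below is the other one. *)
Definition p1l := [:: 0; 3; 4; 5; 8]%N.
(** For a list of products and a value [q] of Q w: either the data are contradictory (w not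
    orthogonal to itself, the relation of [p1l] violated, all products zero), or some sum of the
    first eight translates has value 1 and the products [prof] of the model vector. *)
Definition prof_ok (bl : seq bool) (q : bool) : bool :=
  let b := beta bl in
  if nth false bl 0 then true else
  if lall (fun i => ~~ bcode b [:: i] p1l) (iota 0 17) then
    if qcode b q p1l then true else
    if bl == nseq 9 false then true else
    lhas (fun m => let c := mask m (iota 0 8) in
      if qcode b q c then lall (fun k => bcode b c [seq (j + k)%N | j <- c] == nth false prof k) (iota 0 8)
      else false) (allv [:: false; true] 8)
  else true.

Lemma prof_all : lall (fun bl => if prof_ok bl true then prof_ok bl false else false) (allv [:: false; true] 9).
Proof. by vm_compute. Qed.

Definition MBl := E4l ++ xgens w0l.
Definition MBi := map (bl 12) [:: 1; 23; 44; 80; 160; 320; 2; 27; 60; 592; 1264; 2528]%N.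
Lemma MB_inv : mat 12 MBl *m mat 12 MBi = 1%:M.
Proof. by rewrite -mat_id mat_mul //; apply: ceqP; vm_compute. Qed.
Lemma MBi_inv : mat 12 MBi *m mat 12 MBl = 1%:M.
Proof. exact: mulmx1C MB_inv. Qed.

Lemma w0_prof : [/\ Q (vcb 12 w0l) = 1 & forall L i, (i < 8)%N ->
  B (vcb 12 w0l) (app (vcb 12 w0l) (gx L ^+ i)%g) = b2F (nth false prof i)].
Proof.
split=> [|L i lti]; first by rewrite Q12E.
have : all (fun i => bT addb (qp 6) w0l (iter i (lmul^~ Xr) w0l) == nth false prof i) (iota 0 8) by vm_compute.
by rewrite x_code polar12E => /allP/(_ i); rewrite mem_iota => /(_ lti)/eqP->.
Qed.

Lemma w0_profE (L : GLmodel 'F_2 11) v : inW v -> Q v = 1 ->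
    (forall i, (i < 8)%N -> B v (app v (gx L ^+ i)%g) = b2F (nth false prof i)) ->
  exists2 j, (j < 17)%N & v = app (vcb 12 w0l) (gx L ^+ j)%g.
Proof.
move: v; apply: (vcb_all (p := fun l => if veq 12 (lmul l epsr) [::] then if qp 6 l then
  if lall (fun i => bT addb (qp 6) l (iter i (lmul^~ Xr) l) == nth false prof i) (iota 0 8)
  then lhas (fun j => veq 12 l (iter j (lmul^~ Xr) w0l)) (iota 0 17) else true else true else true)); last by vm_compute.
move=> l sl; case: ifP => [_|nW _ /W_codes]; last by move=> /(_ sl); rewrite nW.
rewrite Q12E; case: ifP => [_|_ _ _ /eqP]; last by rewrite eq_sym oner_eq0.
case: ifP => [_ + _ _ _ | + _ _ _ prl].
  by rewrite lhasE => /hasP[j j17 /veqP lE]; exists j; [rewrite mem_iota in j17 | rewrite x_code].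
move/negP; case; rewrite lallE; apply/allP=> i; rewrite mem_iota => /andP[_ lti].
by have := prl i lti; rewrite x_code polar12E => /b2F_inj->.
Qed.

Section Reduction.

Variable L : GLmodel 'F_2 11.
Local Notation G := (G12 L).
Local Notation gmx := (gmx L).
Variables (s : L) (U W : 'M['F_2]_12).
Hypotheses (Gs : s \in G) (s85 : #[s]%g = 85%N).
Hypotheses (rU : \rank U = 4%N) (rW : \rank W = 8%N).
Hypotheses (sU : (U *m gmx s <= U)%MS) (sW : (W *m gmx s <= W)%MS).
Hypothesis irrU : forall X : 'M_12, (X *m gmx s <= X)%MS -> (X <= U)%MS -> X != 0 -> (U <= X)%MS.
Hypothesis irrW : forall X : 'M_12, (X *m gmx s <= X)%MS -> (X <= W)%MS -> X != 0 -> (W <= X)%MS.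
Hypothesis perpUW : forall u w : 'rV_12, (u <= U)%MS -> (w <= W)%MS -> B u w = 0.
Hypothesis UW1 : (1%:M <= U + W)%MS.

Lemma stab_pow (X : 'M['F_2]_12) (u : 'rV_12) n :
  (X *m gmx s <= X)%MS -> (u <= X)%MS -> (app u (s ^+ n)%g <= X)%MS.
Proof.
move=> sX uX; elim: n => [|n IHn]; first by rewrite app1.
by rewrite expgSr appM appE; apply: submx_trans sX; apply: submxMr.
Qed.

(** The kernel of [A] on the irreducible module [X] is a nonzero submodule. *)
Lemma kill (X A : 'M['F_2]_12) (u : 'rV_12) :
    (forall Y : 'M_12, (Y *m gmx s <= Y)%MS -> (Y <= X)%MS -> Y != 0 -> (X <= Y)%MS) ->
    (X *m gmx s <= X)%MS -> gmx s *m A = A *m gmx s ->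
  (u <= X)%MS -> u != 0 -> u *m A = 0 -> X *m A = 0.
Proof.
move=> irrX sX cA uX nzu uA; apply/sub_kermxP.
have uK : (u <= X :&: kermx A)%MS by rewrite sub_capmx uX; apply/sub_kermxP.
apply: submx_trans (capmxSr X (kermx A)); apply: irrX; last 1 first.
- by apply: contraNneq nzu => K0; move: uK; rewrite K0 submx0.
- rewrite sub_capmx (submx_trans (submxMr _ (capmxSl _ _)) sX).
  apply/sub_kermxP; rewrite -mulmxA cA mulmxA.
  by have /sub_kermxP-> : (X :&: kermx A <= kermx A)%MS := capmxSr _ _; rewrite mul0mx.
exact: capmxSl.
Qed.

(** 35 is 1 modulo 17 and 0 modulo 5, and 51 is 1 modulo 5 and 0 modulo 17: these are the parts of
    [s] of order 17 and 5. *)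
Let x0 := (s ^+ 35)%g.
Let y0 := (s ^+ 51)%g.

Lemma s_ord n : (85 %| n)%N -> (s ^+ n)%g = 1%g.
Proof. by rewrite -s85 order_dvdn => /eqP. Qed.
Lemma x0_17 : (x0 ^+ 17)%g = 1%g. Proof. by rewrite -expgM s_ord. Qed.
Lemma y0_5 : (y0 ^+ 5)%g = 1%g. Proof. by rewrite -expgM s_ord. Qed.
Lemma s_xy : s = (x0 * y0)%g.
Proof. by rewrite /x0 /y0 -expgD (_ : (35 + 51 = 85 + 1)%N) // expgD s_ord // mul1g expg1. Qed.

Lemma s_comm n : gmx s *m gmx (s ^+ n)%g = gmx (s ^+ n)%g *m gmx s.
Proof. by rewrite -!gmxM -expgS -expgSr. Qed.

Lemma pcard n : prime n -> forall (g : L), (g ^+ n)%g = 1%g -> forall X : 'M['F_2]_12,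
    (forall u : 'rV_12, (u <= X)%MS -> (app u g <= X)%MS) ->
  (2 ^ \rank X = #|[set u : 'rV_12 | (u <= X)%MS & app u g == u]| %[mod n])%N.
Proof.
move=> pn g gn X sX; have pg : (n.-group <[g]>)%g.
  by rewrite /pgroup -orderE; apply: pnat_dvd (_ : n.-nat n)%N; rewrite ?order_dvdn ?gn // pnat_id.
have act : [acts <[g]>%g, on rowg X | app_action L].
  apply/subsetP=> h /cycleP[i ->]; rewrite inE; apply/andP; split; first by rewrite inE.
  rewrite inE; apply/subsetP=> u; rewrite !inE => uX.
  elim: i => [|i IHi]; first by rewrite /= app1.
  by rewrite /= expgSr appM sX.
have := pgroup_fix_mod pg act; rewrite card_rowg card_Fp // => ->.
congr (_ %% _)%N; apply: eq_card => u; rewrite inE [RHS]inE andbC.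
rewrite [LHS]andbC; congr (_ && _); first by rewrite inE.
apply/afixP/eqP => [fu | gu h /cycleP[i ->]].
  by apply: (fu g); rewrite cycle_id.
elim: i => [|i IHi]; first by rewrite /= app1.
by rewrite /= expgSr appM IHi gu.
Qed.

Lemma fix_all (X : 'M['F_2]_12) (g : L) (u : 'rV_12) :
  X *m (gmx g - 1%:M) = 0 -> (u <= X)%MS -> app u g = u.
Proof.
move=> Xg /submxP[D ->]; apply/eqP; rewrite -subr_eq0 -app_rk1 -mulmxA Xg.
by rewrite mulmx0.
Qed.

(** The number of fixed vectors in U is congruent to 16 modulo 17, so all 16 vectors are fixed. *)
Lemma x0_U (u : 'rV_12) : (u <= U)%MS -> app u x0 = u.
Proof.
have sx v : (v <= U)%MS -> (app v x0 <= U)%MS by apply: stab_pow.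
have := pcard (isT : prime 17) x0_17 sx; rewrite rU => cE uU.
have: (#|rowg U| <= #|[set u : 'rV_12 | (u <= U)%MS & app u x0 == u]|)%N.
  rewrite card_rowg card_Fp // rU; move: cE; rewrite modn_small //.
  by move->; apply: leq_mod.
have sF : [set u : 'rV_12 | (u <= U)%MS & app u x0 == u] \subset rowg U.
  by apply/subsetP=> v; rewrite !inE => /andP[].
move=> le; have /eqP/setP/(_ u) : [set u : 'rV_12 | (u <= U)%MS & app u x0 == u] == rowg U.
  by rewrite eqEcard sF.
by rewrite !inE uU => /eqP.
Qed.

Lemma all_UW (g : L) : (forall u : 'rV_12, (u <= U)%MS -> app u g = u) ->
  (forall u : 'rV_12, (u <= W)%MS -> app u g = u) -> g = 1%g.
Proof.
move=> gU gW; apply: app_eqP => v; rewrite app1.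
have /sub_addsmxP[[a b] /= ->] : (v <= U + W)%MS by apply: submx_trans UW1; apply: submx1.
by rewrite appD gU ?submxMl // gW ?submxMl.
Qed.

Lemma pow_neq1 n : ~~ (85 %| n)%N -> (s ^+ n)%g <> 1%g.
Proof. by move=> nd /eqP; rewrite -order_dvdn s85 (negPf nd). Qed.

Lemma x0_W (w : 'rV_12) : (w <= W)%MS -> app w x0 = w -> w = 0.
Proof.
move=> wW wx; apply/eqP/negPn/negP=> nzw; apply: (@pow_neq1 35) => //.
apply: all_UW => [u | u uW]; first exact: x0_U.
apply: (fix_all (X := W)) => //; apply: (kill irrW sW _ wW nzw).
  by rewrite mulmxBr mulmxBl s_comm mulmx1 mul1mx.
by rewrite app_rk1 wx subrr.
Qed.

(** As [x0] is trivial on U, a nonzero vector fixed by [y0] would span an [s]-invariant line in the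
    irreducible 4-space. *)
Lemma y0_U (u : 'rV_12) : (u <= U)%MS -> app u y0 = u -> u = 0.
Proof.
move=> uU uy; apply/eqP/negPn/negP=> nzu.
have: (\rank U <= \rank u)%N; last by rewrite rU leqNgt ltnS (leq_trans (rank_leq_row _)).
rewrite -(mxrank_gen u); apply: mxrankS; apply: irrU; rewrite ?genmxE //; last first.
  by rewrite -mxrank_eq0 mxrank_gen mxrank_eq0.
rewrite (eqmxMr _ (genmxE u)) -appE s_xy appM x0_U // uy.
exact: submx_refl.
Qed.

Lemma s_U (u : 'rV_12) : (u <= U)%MS -> app u s = app u y0.
Proof. by move=> uU; rewrite {1}s_xy appM x0_U. Qed.

Lemma nd_U (u : 'rV_12) : (u <= U)%MS -> (forall v : 'rV_12, (v <= U)%MS -> B u v = 0) -> u = 0.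
Proof.
move=> uU uperp; apply: (polar_nd q12) => v.
have /sub_addsmxP[[a b] /= ->] : (v <= U + W)%MS by apply: submx_trans UW1; apply: submx1.
by rewrite polar12Dr uperp ?submxMl // perpUW ?submxMl // addr0.
Qed.

Lemma nd_W (u : 'rV_12) : (u <= W)%MS -> (forall v : 'rV_12, (v <= W)%MS -> B u v = 0) -> u = 0.
Proof.
move=> uU uperp; apply: (polar_nd q12) => v.
have /sub_addsmxP[[a b] /= ->] : (v <= U + W)%MS by apply: submx_trans UW1; apply: submx1.
by rewrite polar12Dr polar12C perpUW ?submxMl // uperp ?submxMl // addr0.
Qed.

Lemma y0_sum (u : 'rV_12) : (u <= U)%MS -> \sum_(i < 5) app u (y0 ^+ i)%g = 0.
Proof.
have sy v n : (v <= U)%MS -> (app v (y0 ^+ n)%g <= U)%MS by rewrite -expgM; apply: stab_pow.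
move=> uU; apply: y0_U; first by apply: summx_sub => i _; apply: sy.
rewrite appE mulmx_suml [RHS]big_ord_recl big_ord_recr /= -appE -appM -expgSr y0_5 addrC.
by congr (_ + _); apply: eq_bigr => i _; rewrite -appE -appM -expgSr.
Qed.

Lemma s_GO n : (s ^+ n)%g \in G. Proof. exact: groupX. Qed.

Lemma cyc_B (g : L) N u i j : g \in G -> (g ^+ N.+1)%g = 1%g ->
  B (app u (g ^+ i)%g) (app u (g ^+ j)%g) = B u (app u (g ^+ (j + N * i))%g).
Proof.
move=> Gg gN; have Gn : (g ^+ (N * i))%g \in G by apply: groupX.
rewrite -(GO_polar (app u (g ^+ i)%g) _ Gn) -!appM -!expgD.
have -> : (g ^+ (i + N * i))%g = 1%g by rewrite -mulSn expgM gN expg1n.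
by rewrite app1.
Qed.

(** The counterpart, for the given [s], of the five singular vectors [ev i] of the model. *)
Definition pent (e : nat -> 'rV['F_2]_12) :=
  [/\ forall i, (e i <= U)%MS, forall i, Q (e i) = 0, forall i, e i.+1 = app (e i) y0,
      forall i j, (i < 5)%N -> (j < 5)%N -> B (e i) (e j) = b2F (i != j) &
      e 4%N = e 0%N + e 1%N + e 2%N + e 3%N].

Lemma y0_G : y0 \in G. Proof. exact: s_GO. Qed.
Lemma x0_G : x0 \in G. Proof. exact: s_GO. Qed.

Lemma y0_mod n : (y0 ^+ n)%g = (y0 ^+ (n %% 5))%g.
Proof. by rewrite expg_mod ?y0_5. Qed.

(** Let b_i be the product of u and u y^i. The five translates sum to 0, whence Q u = b_1 + b_2. If
    b_1 = b_2 = 0, then u is orthogonal to the span of its translates, which is U. If both are 1, u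
    is singular and its orbit is the pentad. In the mixed cases u + u y or u + u y^2 serves
    instead. *)
Lemma pent_ex : exists e, pent e.
Proof.
have [u0 u0U nzu0] : exists2 u : 'rV_12, (u <= U)%MS & u != 0.
  have : U != 0 by rewrite -mxrank_eq0 rU.
  by case/mx_neq0=> v nzv; exists (v *m U); rewrite ?submxMl.
pose E u i := app u (y0 ^+ i)%g.
have EU u i : (u <= U)%MS -> (E u i <= U)%MS by rewrite /E -expgM; apply: stab_pow.
have E0 u : E u 0%N = u by rewrite /E expg0 app1.
have EB u i j : B (E u i) (E u j) = B u (E u ((j + 4 * i) %% 5)%N).
  by rewrite /E -y0_mod; apply: cyc_B; rewrite ?y0_5 ?y0_G.
have B3 u : B u (E u 3) = B u (E u 2) by rewrite -{1}[u]E0 polar12C EB.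
have B4 u : B u (E u 4) = B u (E u 1) by rewrite -{1}[u]E0 polar12C EB.
have QE u i : Q (E u i) = Q u by rewrite (GO_P _ _ (groupX i y0_G)).
have E4 u : (u <= U)%MS -> E u 4%N = E u 0%N + E u 1%N + E u 2%N + E u 3%N.
  move=> uU; have := y0_sum uU; rewrite !big_ord_recr big_ord0 /= add0r => /eqP.
  by rewrite addr_eq0 (oppc2v char2_F2) => /eqP e; rewrite /E -e.
have good u : (u <= U)%MS -> B u (E u 1) = 1 -> B u (E u 2) = 1 -> Q u = 0 -> exists e, pent e.
  move=> uU b1 b2 q; exists (E u); split.
  - by move=> i; apply: EU.
  - by move=> i; rewrite QE.
  - by move=> i; rewrite /E expgSr appM.
  - move=> i j lti ltj; rewrite EB.
    case: i lti => [|[|[|[|[|//]]]]] _; case: j ltj => [|[|[|[|[|//]]]]] _ /=;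
      rewrite ?B3 ?B4 ?b1 ?b2 // E0 (polarvv char2_F2 q12) //.
  - exact: E4.
have q u : (u <= U)%MS -> Q u = B u (E u 1) + B u (E u 2).
  move=> uU; rewrite -[LHS](QE _ 4) E4 // !QD !polar12Dl !QE !EB.
  rewrite -[((1 + 4 * 0) %% 5)%N]/1%N -[((2 + 4 * 0) %% 5)%N]/2%N -[((3 + 4 * 0) %% 5)%N]/3%N.
  rewrite -[((2 + 4 * 1) %% 5)%N]/1%N -[((3 + 4 * 1) %% 5)%N]/2%N -[((3 + 4 * 2) %% 5)%N]/1%N B3.
  move: (Q u) (B u (E u 1)) (B u (E u 2)) => a b c.
  by case: (F2_cases a) => ->; case: (F2_cases b) => ->; case: (F2_cases c) => ->; apply: val_inj.
case: (F2_cases (B u0 (E u0 1))) (F2_cases (B u0 (E u0 2))) => b1 [] b2.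
- case/negP: (nzu0); apply/eqP; apply: nd_U => // v vU.
  pose X := <<\matrix_(i < 5) E u0 i>>%MS.
  have sX : (U <= X)%MS.
    apply: irrU.
    - rewrite (eqmxMr _ (genmxE _)) genmxE; apply/row_subP=> i; rewrite row_mul rowK -appE.
      have -> : app (E u0 i) s = row (ordS i) (\matrix_(i < 5) E u0 i).
        by rewrite rowK s_U ?EU // /E -appM -expgSr [in LHS]y0_mod.
      exact: row_sub.
    - by rewrite genmxE; apply/row_subP=> i; rewrite rowK EU.
    rewrite -mxrank_eq0 mxrank_gen mxrank_eq0; apply: contra nzu0 => /eqP/row_matrixP/(_ ord0).
    by rewrite rowK row0 E0 => ->.
  have vX : (v <= X)%MS := submx_trans vU sX.
  rewrite genmxE in vX; case/submxP: vX => D ->.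
  rewrite mulmx_sum_row polar12C (polar_sum q12) big1 // => i _.
  rewrite (polarZl q12) rowK polar12C.
  case: i => [[|[|[|[|[|//]]]]]] lti /=; rewrite ?B3 ?B4 ?b1 ?b2 ?mulr0 //.
  by rewrite E0 (polarvv char2_F2 q12) mulr0.
- apply: (good (u0 + E u0 1)).
  - by rewrite addmx_sub ?EU.
  - rewrite /E appD -!appM -!expgD -!/(E _ _) -{1}[u0]E0 polar12cat !EB /= b1 b2 !E0.
    by rewrite (polarvv char2_F2 q12) !addr0 add0r.
  - rewrite /E appD -!appM -!expgD -!/(E _ _) -{1}[u0]E0 polar12cat !EB /= B3 b1 b2.
    by rewrite !addr0 addF2 ?add0r.
  - by rewrite QD QE b1 addr0 addF2.
- apply: (good (u0 + E u0 2)).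
  - by rewrite addmx_sub ?EU.
  - rewrite /E appD -!appM -!expgD -!/(E _ _) -{1}[u0]E0 polar12cat !EB /= B3 ?B4 b1 b2.
    by rewrite !addr0 ?add0r; apply/eqP.
  - rewrite /E appD -!appM -!expgD -!/(E _ _) -{1}[u0]E0 polar12cat !EB /= ?B3 B4 b1 b2 E0.
    by rewrite (polarvv char2_F2 q12) !addr0 ?add0r.
  - by rewrite QD QE b2 addr0 addF2.
by apply: (good u0) => //; rewrite q // b1 b2 addF2.
Qed.

Definition pev (l : seq nat) (g : L) : 'M['F_2]_12 := \sum_(n <- l) gmx (g ^+ n)%g.

Lemma pev_mul l l' g : pev l g *m pev l' g = pev [seq (i + j)%N | i <- l, j <- l'] g.
Proof.
rewrite /pev big_flatten big_map mulmx_suml; apply: eq_bigr => i _.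
by rewrite big_map mulmx_sumr; apply: eq_bigr => j _; rewrite -gmxM -expgD.
Qed.

Definition par_eq (l l' : seq nat) := all (fun n => n < 17)%N l && all (fun n => n < 17)%N l' &&
  all (fun n => odd (count_mem n l) == odd (count_mem n l')) (iota 0 17).

Lemma pev_mod l g : (g ^+ 17)%g = 1%g -> pev l g = pev [seq (n %% 17)%N | n <- l] g.
Proof. by move=> g17; rewrite /pev big_map; apply: eq_bigr => n _; rewrite expg_mod. Qed.

Lemma pev_par l l' g : par_eq l l' -> pev l g = pev l' g.
Proof.
case/andP=> /andP[l17 l17'] /allP par; rewrite /pev (sum_parity _ (@addM 12 12) l17).
rewrite (sum_parity _ (@addM 12 12) l17'); apply: eq_bigl => i.
by apply/eqP/par; rewrite mem_iota add0n ltn_ord.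
Qed.

Definition p2l := [:: 0; 1; 2; 4; 6; 7; 8]%N.
Definition p3l := [:: 0; 1; 3; 6; 7]%N.

Lemma pev_s l n : gmx s *m pev l (s ^+ n)%g = pev l (s ^+ n)%g *m gmx s.
Proof.
by rewrite /pev mulmx_suml mulmx_sumr; apply: eq_bigr => i _; rewrite -expgM s_comm.
Qed.

Lemma x0_all : W *m pev (iota 0 17) x0 = 0.
Proof.
apply/row_matrixP=> i; rewrite row0 row_mul; set w := row i W.
have wW : (w <= W)%MS by apply: row_sub.
have -> : pev (iota 0 17) x0 = \sum_(i < 17) gmx (x0 ^+ i)%g.
  by rewrite /pev -(big_mkord xpredT (fun i => gmx (x0 ^+ i)%g)).
apply: x0_W.
  rewrite mulmx_sumr; apply: summx_sub => j _; rewrite -appE -expgM.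
  exact: stab_pow.
rewrite appE -mulmxA; congr (_ *m _).
rewrite mulmx_suml [RHS]big_ord_recl big_ord_recr /= -gmxM -expgSr x0_17 addrC.
by congr (_ + _); apply: eq_bigr => j _; rewrite -gmxM -expgSr.
Qed.

(** By irreducibility one of the two factors of degree 8 of 1 + X + ... + X^16 kills W. If it is the
    wrong one, the cube of [x0] is used, as the substitution of X^3 exchanges the factors; 3 times 6
    is 1 modulo 17 and recovers [x0]. *)
Lemma x1_ex : exists m n, [/\ x0 = ((x0 ^+ m) ^+ n)%g, (0 < m < 17)%N & W *m pev p1l (x0 ^+ m)%g = 0].
Proof.
have [W0 | nz1] := eqVneq (W *m pev p1l x0) 0; first by exists 1%N, 1%N; rewrite !expg1.
have W2 : W *m pev p2l x0 = 0.
  apply/eqP/negPn/negP=> /mx_neq0[v nzv]; case/eqP: nz1.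
  apply: (kill irrW sW (pev_s _ _) _ nzv).
    rewrite mulmxA; move: (v *m W) (submxMl v W) => w wW.
    rewrite /pev mulmx_sumr; apply: summx_sub => j _; rewrite -appE -expgM.
    exact: stab_pow.
  rewrite -!mulmxA pev_mul (pev_par (l' := iota 0 17)) ?mulmxA -?(mulmxA v) ?x0_all ?mulmx0 //.
exists 3, 6; split=> //; first by rewrite -expgM (_ : 3 * 6 = 17 + 1)%N // expgD x0_17 mul1g expg1.
have -> : pev p1l (x0 ^+ 3)%g = pev [seq (3 * n)%N | n <- p1l] x0.
  by rewrite /pev big_map; apply: eq_bigr => i _; rewrite expgM.
rewrite (pev_mod _ x0_17) (pev_par (l' := [seq (n %% 17)%N | n <- [seq (i + j)%N | i <- p2l, j <- p3l]])) //.
by rewrite -(pev_mod _ x0_17) -pev_mul mulmxA W2 mul0mx.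
Qed.

Section Xpart.

Variables (m n : nat).
Let x := (x0 ^+ m)%g.
Hypotheses (xn : x0 = (x ^+ n)%g) (Wp1 : W *m pev p1l x = 0).

Lemma x_s : x = (s ^+ (35 * m))%g. Proof. by rewrite expgM. Qed.
Lemma xx17 : (x ^+ 17)%g = 1%g. Proof. by rewrite /x expgAC x0_17 expg1n. Qed.
Lemma xG : x \in G. Proof. by rewrite groupX ?x0_G. Qed.
Lemma xW (w : 'rV_12) i : (w <= W)%MS -> (app w (x ^+ i)%g <= W)%MS.
Proof. by rewrite x_s -expgM; apply: stab_pow. Qed.
Lemma xU (u : 'rV_12) : (u <= U)%MS -> app u x = u.
Proof.
move=> uU; rewrite /x; elim: (m) => [|k IHk]; first by rewrite app1.
by rewrite expgSr appM IHk x0_U.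
Qed.
Lemma xfix (w : 'rV_12) : (w <= W)%MS -> app w x = w -> w = 0.
Proof.
move=> wW wx; apply: x0_W => //; rewrite xn; elim: (n) => [|k IHk]; first by rewrite app1.
by rewrite expgSr appM IHk.
Qed.
Lemma xy0 i : (x * y0 ^+ i = y0 ^+ i * x)%g.
Proof. by rewrite x_s -expgM -!expgD addnC. Qed.

Lemma p1rel (w : 'rV_12) : (w <= W)%MS ->
  app w (x ^+ 8)%g = w + app w (x ^+ 3)%g + app w (x ^+ 4)%g + app w (x ^+ 5)%g.
Proof.
case/submxP=> D wE; have : w *m pev p1l x = 0 by rewrite wE -mulmxA Wp1 mulmx0.
rewrite /pev !big_cons big_nil addr0 !mulmxDr -!appE app1 !addrA => /eqP.
by rewrite addr_eq0 (oppc2v char2_F2) => /eqP->.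
Qed.

(** By [p1rel] the span of eight translates is invariant. Only 0 is fixed in it, so 2 to its
    dimension is 1 modulo 17, and the dimension is 8. *)
Lemma spanX (w : 'rV_12) : (w <= W)%MS -> w != 0 -> (W <= \matrix_(i < 8) app w (x ^+ i)%g)%MS.
Proof.
move=> wW nzw; set X := \matrix_i _.
have rX (i : 'I_8) : (app w (x ^+ i)%g <= X)%MS by have := row_sub i X; rewrite rowK.
have wX : (w <= X)%MS by have := rX ord0; rewrite expg0 app1.
have sX : (X <= W)%MS by apply/row_subP=> i; rewrite rowK; apply: xW.
have stX (u : 'rV_12) : (u <= <<X>>)%MS -> (app u x <= <<X>>)%MS.
  rewrite !genmxE appE => /submxP[D ->]; rewrite -mulmxA; apply: submx_trans (submxMl _ _) _.
  apply/row_subP=> i; rewrite row_mul rowK -appE -appM -expgSr.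
  have [lt7 | ge7] := ltnP i 7.
    by have := rX (Ordinal (lt7 : (i.+1 < 8)%N)).
  have -> : i = 7 :> nat by apply/eqP; rewrite eqn_leq ge7 -ltnS ltn_ord.
  rewrite p1rel // !addmx_sub //.
  - exact: (rX (@Ordinal 8 3 isT)).
  - exact: (rX (@Ordinal 8 4 isT)).
  - exact: (rX (@Ordinal 8 5 isT)).
have := pcard (isT : prime 17) xx17 stX.
have -> : [set u : 'rV_12 | (u <= <<X>>)%MS & app u x == u] = [set 0].
  apply/setP=> u; rewrite !inE genmxE; apply/andP/eqP => [[uX /eqP ux] | ->].
    by apply: xfix => //; apply: submx_trans sX.
  by rewrite sub0mx app0 eqxx.
rewrite cards1 mxrank_gen => r17.
have r8 : \rank X = 8%N.
  have r0 : (0 < \rank X)%N.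
    rewrite lt0n mxrank_eq0; apply: contra nzw => /eqP X0.
    by case/submxP: wX => D ->; rewrite X0 mulmx0.
  have := rank_leq_row X; move: (\rank X) r0 r17 => [|[|[|[|[|[|[|[|[|k]]]]]]]]] //.
by rewrite -(geq_leqif (mxrank_leqif_sup sX)) rW r8.
Qed.

Section Profile.

Variable w : 'rV['F_2]_12.
Hypotheses (wW : (w <= W)%MS) (nzw : w != 0).
Let bt k := B w (app w (x ^+ k)%g).
Let bl := mkseq (fun k => bt k != 0) 9.

Lemma btE k : bt k = b2F (beta bl k).
Proof.
have b17 : bt k = bt (k %% 17)%N by rewrite /bt expg_mod ?xx17.
rewrite b17 /beta; have: (k %% 17 < 17)%N by rewrite ltn_mod.
move: (k %% 17)%N => j lt17; case: ifP => [le8 | /negbT].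
  by rewrite nth_mkseq // b2F_neq0.
rewrite -ltnNge => gt8; rewrite nth_mkseq ?b2F_neq0 //; last by rewrite ltnS leq_subLR; lia.
rewrite /bt -(GO_polar w _ (groupX (17 - j) xG)) -appM -expgD subnKC ?(ltnW lt17) //.
by rewrite xx17 app1 polar12C.
Qed.

Definition cw (c : seq nat) : 'rV['F_2]_12 := \sum_(i <- c) app w (x ^+ i)%g.

Lemma cwW c : (cw c <= W)%MS.
Proof. by apply: summx_sub => i _; apply: xW. Qed.

Lemma B_brow i d : B (app w (x ^+ i)%g) (cw d) = b2F (brow (beta bl) i d).
Proof.
rewrite /cw; elim: d => [|j d IHd] /=; first by rewrite big_nil (polar0r q12).
by rewrite big_cons polar12Dr IHd b2FD -btE (cyc_B _ _ _ xG xx17).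
Qed.

Lemma B_code c d : B (cw c) (cw d) = b2F (bcode (beta bl) c d).
Proof.
rewrite {1}/cw; elim: c => [|i c IHc] /=; first by rewrite big_nil (polar0l q12).
by rewrite big_cons polar12Dl IHc b2FD B_brow.
Qed.

Lemma Q_code c : Q (cw c) = b2F (qcode (beta bl) (Q w != 0) c).
Proof.
rewrite /cw; elim: c => [|i c IHc] /=; first by rewrite big_nil (quad0 q12).
rewrite big_cons QD IHc !b2FD -[X in B _ X]/(cw c) B_brow (GO_P _ _ (groupX i xG)).
by rewrite b2F_neq0.
Qed.

Lemma cw_x c k : app (cw c) (x ^+ k)%g = cw [seq (j + k)%N | j <- c].
Proof.
rewrite /cw big_map appE mulmx_suml; apply: eq_bigr => i _.
by rewrite -appE -appM -expgD.
Qed.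

(** By the enumeration [prof_all] some sum of translates of [w] looks like the model vector; the
    exceptional cases of [prof_ok] are excluded by [p1rel] and, when all products vanish, by
    nondegeneracy. *)
Lemma norm_ex : exists w', [/\ (w' <= W)%MS, Q w' = 1 &
  forall i, (i < 8)%N -> B w' (app w' (x ^+ i)%g) = b2F (nth false prof i)].
Proof.
have p10 : cw p1l = 0.
  have := p1rel wW; rewrite /cw !big_cons big_nil addr0 expg0 app1 => ->.
  by rewrite 3!addrA addV.
have := prof_all; rewrite lallE => /allP/(_ bl).
rewrite mem_allvb ?size_mkseq // => /(_ isT) ok.
have {ok} : prof_ok bl (Q w != 0).
  by move: ok; case: ifP => // o1 o2; case: (Q w != 0).
rewrite /prof_ok; case: ifP => [|_].
  by rewrite nth_mkseq // /bt expg0 app1 (polarvv char2_F2 q12) eqxx.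
case: ifP => [_|]; last first.
  rewrite lallE => /negP; case; apply/allP=> i _.
  have := B_code [:: i] p1l; rewrite p10 (polar0r q12).
  by case: (bcode _ _ _) => // /eqP; rewrite eq_sym oner_eq0.
case: ifP => [|_]; first by move=> qc; have := Q_code p1l; rewrite p10 qc (quad0 q12) => /eqP; rewrite eq_sym oner_eq0.
case: eqP => [bl0 _ | _].
  case/eqP: nzw; apply: nd_W => // v vW.
  have /submxP[D ->] : (v <= \matrix_(i < 8) app w (x ^+ i)%g)%MS by apply: submx_trans (spanX wW nzw).
  rewrite mulmx_sum_row polar12C (polar_sum q12) big1 // => i _.
  rewrite (polarZl q12) rowK polar12C -/(bt i) btE bl0 /beta nth_nseq if_same.
  by rewrite mulr0.
rewrite lhasE => /hasP[k _]; case: ifP => // qc; rewrite lallE => /allP bc.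
exists (cw (mask k (iota 0 8))); split; first exact: cwW.
  by rewrite Q_code qc.
by move=> i lti; rewrite cw_x B_code (eqP (bc i _)) // mem_iota.
Qed.

End Profile.

Section Frame.

Variables (e : nat -> 'rV['F_2]_12) (w : 'rV['F_2]_12).
Hypotheses (pe : pent e) (wW : (w <= W)%MS) (Qw : Q w = 1).
Hypothesis wprof : forall i, (i < 8)%N -> B w (app w (x ^+ i)%g) = b2F (nth false prof i).

(** [f1] is the frame adapted to [s], [f0] that of the model. Since their Gram data agree
    ([frameE]), the linear map [A] taking [f0] to [f1] is an isometry. *)
Let f1 (i : nat) : 'rV['F_2]_12 := if (i < 4)%N then e i else app w (x ^+ (i - 4))%g.
Let f0 (i : nat) : 'rV['F_2]_12 := if (i < 4)%N then ev i else app (vcb 12 w0l) (gx L ^+ (i - 4))%g.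
Let r1 : 'M['F_2]_12 := \matrix_(i < 12) f1 i.
Let r0 : 'M['F_2]_12 := \matrix_(i < 12) f0 i.

Lemma r0E : r0 = mat 12 MBl.
Proof.
apply/row_matrixP=> i; rewrite rowK row_mat /f0 /MBl nth_cat.
case: ltnP => [lt4 | ge4]; first by rewrite evE modn_small ?nth_take // (ltn_trans lt4).
have l8 : (i - 4 < 8)%N by rewrite ltn_subLR.
rewrite (set_nth_default w0l) ?size_traject //.
by rewrite nth_traject // x_code.
Qed.

Lemma w0W : inW (vcb 12 w0l).
Proof. by rewrite /inW cmx vcb_mat // -(vcb0 12); apply: veqP; vm_compute. Qed.

Lemma B_shift (g : L) v i j : g \in G -> (i <= j)%N ->
  B (app v (g ^+ i)%g) (app v (g ^+ j)%g) = B v (app v (g ^+ (j - i))%g).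
Proof. by move=> Gg ij; rewrite -{1}(subnK ij) expgD appM (GO_polar _ _ (groupX i Gg)). Qed.

Lemma frameE i j : (i < 12)%N -> (j < 12)%N -> Q (f0 i) = Q (f1 i) /\ B (f0 i) (f0 j) = B (f1 i) (f1 j).
Proof.
case: pe => eU eQ _ eB _; have [Qw0 prof0] := w0_prof; move=> lti ltj; have W0 k : inW (app (vcb 12 w0l) (gx L ^+ k)%g) by apply/x_inW/w0W.
split.
  rewrite /f0 /f1; case: ifP => _; first by rewrite ev_Q eQ.
  by rewrite !(GO_P _ _ (groupX _ _)) ?xG ?gxG // Qw Qw0.
rewrite /f0 /f1; case: (ltnP i 4) => i4; case: (ltnP j 4) => j4.
- by rewrite ev_B eB ?(leq_trans i4) ?(leq_trans j4) // !modn_small ?(leq_trans i4) ?(leq_trans j4).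
- by rewrite (ev_W _ (W0 _)) perpUW ?xW.
- by rewrite (polar12C _ (ev j)) (polar12C _ (e j)) (ev_W _ (W0 _)) perpUW ?xW.
have [ij | /ltnW ij] := leqP i j.
  have le := leq_sub2r 4 ij; rewrite !(B_shift _ _ le) ?xG ?gxG //.
  have l8 : (j - 4 - (i - 4) < 8)%N by lia.
  by rewrite prof0 // wprof.
have le := leq_sub2r 4 ij; rewrite polar12C [RHS]polar12C !(B_shift _ _ le) ?xG ?gxG //.
have l8 : (i - 4 - (j - 4) < 8)%N by lia.
by rewrite prof0 // wprof.
Qed.

Let A := mat 12 MBi *m r1.

Lemma r0A : r0 *m A = r1.
Proof. by rewrite /A r0E mulmxA MB_inv mul1mx. Qed.

Lemma A_quad (v : 'rV_12) : Q (v *m A) = Q v.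
Proof.
rewrite /A mulmxA -[in RHS](mulmx1 v) -MBi_inv -r0E mulmxA.
by apply/esym; apply: gram_quad => [i | i j]; rewrite !rowK; have [] := frameE (ltn_ord i) (ltn_ord i) => //; have [] := frameE (ltn_ord i) (ltn_ord j).
Qed.

Lemma A_unit : A \in unitmx.
Proof.
rewrite -row_free_unit -kermx_eq0; apply/eqP/row_matrixP=> i; rewrite row0.
have vA : row i (kermx A) *m A = 0 by apply/sub_kermxP/row_sub.
apply: (polar_nd q12) => u; rewrite /polar -[Q (_ + u)]A_quad -[Q (row _ _)]A_quad -(A_quad u).
by rewrite mulmxDl vA add0r (quad0 q12) subr0 subrr.
Qed.

Let gA : L := mkGL L A.
Lemma gAE v : app v gA = v *m A. Proof. by rewrite appE mkGLE ?A_unit. Qed.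
Lemma gA_G : gA \in G. Proof. by apply/GO_P=> v; rewrite gAE A_quad. Qed.
Lemma gA_f i : (i < 12)%N -> app (f0 i) gA = f1 i.
Proof.
move=> lti; have := congr1 (row (Ordinal lti)) r0A; rewrite row_mul !rowK => <-.
exact: gAE.
Qed.

Lemma f0_all (g h : L) : (forall i, (i < 12)%N -> app (f0 i) g = app (f0 i) h) -> g = h.
Proof.
move=> gh; apply/(@gmx_inj _ _ L).
have : r0 *m gmx g = r0 *m gmx h.
  by apply/row_matrixP=> i; rewrite !row_mul !rowK -!appE gh.
by move/(congr1 (mulmx (mat 12 MBi))); rewrite r0E !mulmxA MBi_inv !mul1mx.
Qed.

Lemma ev4_sum : ev 4 = ev 0 + ev 1 + ev 2 + ev 3.
Proof. by rewrite !evE -!vcbD; apply: veqP. Qed.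

Lemma gA_e i : (i < 5)%N -> app (ev i) gA = e i.
Proof.
rewrite ltnS leq_eqVlt => /predU1P[-> | lt4].
  case: pe => _ _ _ _ ->; rewrite ev4_sum !appD.
  by rewrite (gA_f (i := 0)) // (gA_f (i := 1)) // (gA_f (i := 2)) // (gA_f (i := 3)).
by have := @gA_f i; rewrite /f0 /f1 lt4 => -> //; apply: leq_trans lt4 _.
Qed.

Lemma gA_w i : (i < 8)%N -> app (app (vcb 12 w0l) (gx L ^+ i)%g) gA = app w (x ^+ i)%g.
Proof. move=> lti; have lt12 : (i + 4 < 12)%N by rewrite addnC (ltn_add2l 4 i 8).
by have := gA_f lt12; rewrite /f0 /f1 ltnNge leq_addl addnK. Qed.

Lemma ev_gx i : app (ev i) (gx L) = ev i.
Proof. by rewrite appE -{1}(ev_eps i) -mulmxA eps_x ev_eps. Qed.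

Lemma w0_x8 : app (vcb 12 w0l) (gx L ^+ 8)%g = vcb 12 w0l + app (vcb 12 w0l) (gx L ^+ 3)%g +
  app (vcb 12 w0l) (gx L ^+ 4)%g + app (vcb 12 w0l) (gx L ^+ 5)%g.
Proof. by rewrite !x_code -!vcbD; apply: veqP; vm_compute. Qed.

Lemma gA_x : (gA * x = gx L * gA)%g.
Proof.
case: pe => eU _ _ _ _.
apply: f0_all => i lti; rewrite !appM /f0; case: ltnP => i4.
  by rewrite ev_gx gA_e ?xU // ltnW.
rewrite gA_w; last by lia.
rewrite -appM -expgSr -(appM _ (gx L ^+ _)%g) -expgSr.
have [lt11 | ge11] := ltnP i 11; first by rewrite gA_w //; lia.
have -> : (i - 4).+1 = 8 by lia.
rewrite w0_x8 !appD !gA_w // p1rel //; congr (_ + _ + _ + _).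
by have := @gA_w 0; rewrite !app1 => ->.
Qed.

(** The pull-back [y1] of [y0] commutes with [gx], so it sends the model vector to one with the same
    products, which is a translate by some power x^j ([w0_profE]). As [y1] has exponent 5, j must be
    0; thus [y1] is trivial on W and agrees with [gy] on U. *)
Lemma gA_y : (gA * y0 = gy L * gA)%g.
Proof.
case: (pe) => eU _ eS _ e4; have Ge := gA_G.
pose y1 := (gA * y0 * gA^-1)%g.
have y1E : (y1 * gA = gA * y0)%g by rewrite mulgKV.
have y1G : y1 \in G by rewrite !groupM ?groupV ?y0_G.
have xy1 : commute (gx L) y1.
  have gxc : gx L = (x ^ gA^-1)%g by rewrite conjgE invgK mulgA gA_x mulgK.
  have y1c : y1 = (y0 ^ gA^-1)%g by rewrite conjgE invgK mulgA.
  by rewrite /commute gxc y1c -!conjMg; have := xy0 1; rewrite expg1 => ->.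
have Wv : inW (app (vcb 12 w0l) y1).
  have E : app (app (vcb 12 w0l) y1) gA = app w y0.
    by rewrite -appM y1E appM; have := @gA_w 0; rewrite !app1 => ->.
  have : (app w y0 <= \matrix_(i < 8) app w (x ^+ i)%g)%MS.
    apply: submx_trans (spanX wW _); first by have := stab_pow 51 sW wW.
    by apply: contraTneq isT => w0; have := oner_neq0 'F_2; rewrite -Qw w0 (quad0 q12) eqxx.
  case/submxP=> D DE; suff -> : app (vcb 12 w0l) y1 = D *m \matrix_(i < 8) app (vcb 12 w0l) (gx L ^+ i)%g.
    rewrite mulmx_sum_row /inW mulmx_suml big1 // => i _; rewrite -scalemxAl rowK.
    by have := x_inW L i w0W; rewrite /inW => ->; rewrite scaler0.
  apply: (@app_inj _ _ _ gA); rewrite E DE !mulmx_sum_row appE mulmx_suml.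
  apply: eq_bigr => i _; rewrite -scalemxAl !rowK -appE gA_w //.
have [Qw0 prof0] := w0_prof.
have cx i : app (app (vcb 12 w0l) (gx L ^+ i)%g) y1 = app (app (vcb 12 w0l) y1) (gx L ^+ i)%g.
  by rewrite -!appM; congr app; apply/esym/commuteX/commute_sym.
have Qv : Q (app (vcb 12 w0l) y1) = 1 by rewrite (GO_P _ _ y1G).
have [i lti | j j17 jE] := w0_profE (L := L) Wv Qv.
  by rewrite -cx (GO_polar _ _ y1G) prof0.
have y1k k : app (vcb 12 w0l) (y1 ^+ k)%g = app (vcb 12 w0l) (gx L ^+ (j * k))%g.
  elim: k => [|k IHk]; first by rewrite muln0 !app1.
  by rewrite expgSr appM IHk cx jE -appM -expgD mulnS.
have y15 : (y1 ^+ 5)%g = 1%g.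
  have -> : y1 = (y0 ^ gA^-1)%g by rewrite conjgE invgK mulgA.
  by rewrite -conjXg y0_5 conj1g.
have j0 : j = 0%N.
  have := y1k 5; rewrite y15 app1 => fix5; apply/eqP/negPn/negP=> nzj.
  have [k kj] : exists k, (j * 5 * k %% 17 = 1)%N.
    have : all (fun i => has (fun k => i * 5 * k %% 17 == 1)%N (iota 0 17)) (iota 1 16) by vm_compute.
    move/allP/(_ j); rewrite mem_iota lt0n nzj j17 => /(_ isT)/hasP[k _ /eqP kj].
    by exists k.
  have fixk n' : app (vcb 12 w0l) (gx L ^+ (j * 5 * n'))%g = vcb 12 w0l.
    elim: n' => [|n' IHn]; first by rewrite muln0 app1.
    by rewrite mulnS expgD appM -fix5 IHn.
  have := fixk k; rewrite -(expg_mod _ (x17 L)) kj expg1 appE => /(x_fix w0W) w00.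
  by have := oner_neq0 'F_2; rewrite -Qw0 w00 (quad0 q12) eqxx.
have y1w : app (vcb 12 w0l) y1 = vcb 12 w0l by rewrite jE j0 app1.
suff <- : y1 = gy L by rewrite y1E.
apply: f0_all => i lti; rewrite /f0; case: ltnP => i4.
  have lt5 : (i < 5)%N by exact: ltnW.
  apply: (@app_inj _ _ _ gA); rewrite -[LHS]appM y1E [LHS]appM (gA_e lt5) ev_y.
  rewrite gA_e ?ltn_pmod //; exact: eS.
rewrite cx y1w; have := inWE (x_inW L (i - 4) w0W).
move: (app _ _) => v vd; rewrite -[in RHS]vd appE -mulmxA.
by have := del_yj L 1; rewrite expg1 => ->; rewrite vd.
Qed.

End Frame.

End Xpart.

(** The part of order 17 is matched with [gx] only after passing to a power that generates the same
    group, so the conclusion is about membership in subgroups. *)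
Theorem reduction : exists2 A : L, A \in G &
  forall M : {group L}, ((s ^ A)%g \in M) = (gx L \in M) && (gy L \in M).
Proof.
have [m [n [xn _ Wp1]]] := x1_ex; have [e pe] := pent_ex.
have [w0 w0W' nzw0] : exists2 u : 'rV_12, (u <= W)%MS & u != 0.
  have : W != 0 by rewrite -mxrank_eq0 rW.
  by case/mx_neq0=> v nzv; exists (v *m W); rewrite ?submxMl.
have [w [wW Qw wprof]] := norm_ex xn Wp1 w0W' nzw0.
have Ex := gA_x Wp1 pe wW Qw wprof; have Ey := gA_y xn Wp1 pe wW Qw wprof.
have GA := gA_G pe wW Qw wprof.
set gA := mkGL L _ in Ex Ey GA.
exists gA^-1%g; first by rewrite groupV.
have cx : ((x0 ^+ m) ^ gA^-1)%g = gx L by rewrite conjgE invgK mulgA Ex mulgK.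
have cy : (y0 ^ gA^-1)%g = gy L by rewrite conjgE invgK mulgA Ey mulgK.
move=> M; apply/idP/andP => [sM | [xM yM]].
  split; first by rewrite -cx -expgM conjXg groupX.
  by rewrite -cy conjXg groupX.
by rewrite s_xy conjMg cy xn conjXg cx groupM ?groupX.
Qed.

End Reduction.

End Reduction.

(** * The stabiliser of U and its structure (Omega^-(4,2) x Omega^-(8,2)).2 *)

Module PlaneStabilizer.

Import QuadraticForms WittFrames Codings IsometryGroups ModelElements PurityCertificates Derivations Purity Decomposition ThreeCycles Overgroups.

Local Notation Q := Q12.
Local Notation B := (polar Q12).

Lemma mxrank_conj (F : fieldType) n (A C M : 'M[F]_n) : C *m A = 1%:M ->
  \rank (A *m M *m C) = \rank M.
Proof.
move=> CA; have [uC uA] := mulmx1_unit CA.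
by rewrite mxrankMfree ?row_free_unit // (eqmxMfull _ (_ : row_full A)) ?row_full_unit.
Qed.

Lemma two_cosets (gT : finGroupType) (N M : {group gT}) r : N \subset M -> r \in M -> r \notin N ->
    (forall g, g \in M -> g \notin N -> g * r^-1 \in N)%g ->
  (N <| M)%g /\ #|M / N|%g = 2%N.
Proof.
move=> sNM Mr nNr cos; have i2 : #|M : N|%g = 2%N.
  have -> : #|M : N|%g = #|[set (N : {set gT}); (N :* r)%g]|.
    congr #|pred_of_set _|; apply/setP=> X; rewrite !inE; apply/rcosetsP/orP => [[g Mg ->] | ].
      have [Ng | nNg] := boolP (g \in N); first by left; rewrite rcoset_id.
      by right; apply/eqP/rcoset_eqP; rewrite mem_rcoset cos.
    by case=> /eqP->; [exists 1%g; rewrite ?mulg1 | exists r].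
  rewrite cards2; case: eqP => // Nr; case/negP: nNr; rewrite Nr; exact: rcoset_refl.
have nNM := index2_normal sNM i2; split=> //.
by rewrite card_quotient ?normal_norm.
Qed.

(** In this basis [eps] is diagonal ([eps_BM]) and Q is the sum of the two standard minus forms
    ([Q_BM]). *)
Definition BM : 'M['F_2]_12 := mat 12 BMr.
Definition BMV : 'M['F_2]_12 := mat 12 BMi.

Lemma BMK : BMV *m BM = 1%:M.
Proof. by rewrite /BMV /BM mat_mul // -mat_id; apply: ceqP; vm_compute. Qed.

Lemma BMVK : BM *m BMV = 1%:M.
Proof. exact: mulmx1C BMK. Qed.

Definition diag48 (A : 'M['F_2]_4) (C : 'M['F_2]_8) : 'M['F_2]_12 := block_mx A 0 0 C.
Definition cat48 (u : 'rV['F_2]_4) (w : 'rV['F_2]_8) : 'rV['F_2]_12 := row_mx u w.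

Lemma diag48M A C A' C' : diag48 A C *m diag48 A' C' = diag48 (A *m A') (C *m C').
Proof.
apply: etrans (@mulmx_block _ 4 8 4 8 4 8 A 0 0 C A' 0 0 C') _.
by rewrite !mul0mx !mulmx0 !addr0 !add0r.
Qed.

Lemma diag48_1 : diag48 1%:M 1%:M = 1%:M.
Proof. by rewrite /diag48 -scalar_mx_block. Qed.

Lemma diag48_inj A C A' C' : diag48 A C = diag48 A' C' -> A = A' /\ C = C'.
Proof. by move/(@eq_block_mx _ 4 8 4 8) => [-> _ _ ->]. Qed.

Lemma diag48_rank A C : \rank (diag48 A C - 1%:M) = (\rank (A - 1%:M)%R + \rank (C - 1%:M)%R)%N.
Proof.
rewrite -[in LHS]diag48_1 /diag48 (opp_block_mx (1%:M : 'M_4)) (add_block_mx A) !oppr0 !addr0.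
exact: (@rank_diag_block_mx _ 4 4 8 8).
Qed.

Lemma diag48_unit A C : (diag48 A C \in unitmx) = (A \in unitmx) && (C \in unitmx).
Proof. by rewrite !unitmxE (det_ublock A) unitrM. Qed.

Lemma diag48_comm (X : 'M_12) : X *m diag48 1%:M 0 = diag48 1%:M 0 *m X ->
  exists A C, X = diag48 A C.
Proof.
move=> cX; pose Y : 'M_(4 + 8) := X; exists (ulsubmx Y), (drsubmx Y).
have := etrans (esym (@mulmx_block _ 4 8 4 8 4 8 (ulsubmx Y) (ursubmx Y) (dlsubmx Y) (drsubmx Y) 1%:M 0 0 0))
  (etrans (congr1 (fun Z : 'M_12 => Z *m diag48 1%:M 0) (submxK Y)) (etrans cX
  (etrans (congr1 (fun Z : 'M_12 => diag48 1%:M 0 *m Z) (esym (submxK Y)))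
  (@mulmx_block _ 4 8 4 8 4 8 1%:M 0 0 0 (ulsubmx Y) (ursubmx Y) (dlsubmx Y) (drsubmx Y))))).
rewrite !mulmx0 !mul0mx !mulmx1 !mul1mx !addr0 => /(@eq_block_mx _ 4 8 4 8)[_ ur0 dl0 _].
by rewrite /diag48 {1}ur0 -dl0 submxK.
Qed.

Lemma cat48_diag u w A C : cat48 u w *m diag48 A C = cat48 (u *m A) (w *m C).
Proof.
by apply: etrans (@mul_row_block _ 1 4 8 4 8 u w A 0 0 C) _; rewrite !mulmx0 addr0 add0r.
Qed.

Lemma BM_conjM (X Y : 'M_12) : (BMV *m X *m BM) *m (BMV *m Y *m BM) = BMV *m (X *m Y) *m BM.
Proof. by rewrite !mulmxA -(mulmxA _ BM BMV) BMVK mulmx1. Qed.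

Lemma eps_BM : BM *m eps *m BMV = diag48 1%:M 0.
Proof.
rewrite /BM /BMV !cmx !mat_mul //.
transitivity (mat 12 (map (bl 12) [:: 1; 2; 4; 8])); first by apply: ceqP; vm_compute.
apply/matrixP=> i j; rewrite !mxE /=; case: splitP => i' ->; rewrite !mxE; case: splitP => j' ->; rewrite !mxE.
- by case: i' => [[|[|[|[|//]]]] ?]; case: j' => [[|[|[|[|//]]]] ?].
- by case: i' => [[|[|[|[|//]]]] ?]; case: j' => [[|[|[|[|[|[|[|[|//]]]]]]]] ?].
- by rewrite (@nth_default _ _ _ (4 + i')%N) ?nth_nil //= leq_addr.
- by rewrite (@nth_default _ _ _ (4 + i')%N) ?nth_nil //= leq_addr.
Qed.

Lemma vcb_cat m n l l' : size l = m -> row_mx (vcb m l) (vcb n l') = vcb (m + n) (l ++ l').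
Proof.
move=> sl; apply/rowP=> i; rewrite !mxE; case: splitP => j ->; rewrite !mxE nth_cat sl.
  by rewrite ltn_ord.
by rewrite ltnNge leq_addr addKn.
Qed.

Lemma Q_BM u w : Q (cat48 u w *m BM) = Q4 u + Q8 w.
Proof.
have [l sl <-] := vcb_surj u; have [l' sl' <-] := vcb_surj w.
rewrite /cat48 vcb_cat // /BM vcb_mat // Q12E Q4E Q8E -b2FD; congr b2F; apply/eqP.
have : lall (fun c => qp 6 (lmul c BMr) == addb (qm 2 (take 4 c)) (qm 4 (drop 4 c))) (allv [:: false; true] 12).
  by vm_compute.
rewrite lallE => /allP/(_ (l ++ l')); rewrite take_size_cat // drop_size_cat //; apply.
by apply: mem_allvb; rewrite size_cat sl sl'.
Qed.

Local Opaque mulmx.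

Section Reducible.

Variables (L : GLmodel 'F_2 11) (L4 : GLmodel 'F_2 3) (L8 : GLmodel 'F_2 7).
Local Notation G := (G12 L).

Definition centE_set : {set L} := [set g in G | eps *m gmx L g == gmx L g *m eps].

Lemma centE_group_set : group_set centE_set.
Proof.
apply/group_setP; split=> [|g h]; first by rewrite inE group1 gmx1 mulmx1 mul1mx eqxx.
rewrite !inE => /andP[Gg /eqP eg] /andP[Gh /eqP eh]; rewrite groupM //= gmxM.
by rewrite mulmxA eg -!mulmxA eh.
Qed.

Definition centE : {group L} := locked (Group centE_group_set).

Lemma centEP g : reflect (g \in G /\ eps *m gmx L g = gmx L g *m eps) (g \in centE).
Proof.
rewrite /centE -lock inE; apply: (iffP andP) => -[Gg /eqP eg]; split=> //; exact/eqP.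
Qed.

Definition M1 : {group L} := (centE :&: G^`(1))%G.

Definition dsum_mx (p : L4 * L8) : 'M['F_2]_12 :=
  BMV *m diag48 (gmx L4 p.1) (gmx L8 p.2) *m BM.

Lemma dsum_mxM p q : dsum_mx (p * q)%g = dsum_mx p *m dsum_mx q.
Proof.
by rewrite /dsum_mx BM_conjM diag48M !gmxM.
Qed.

Lemma dsum_mx1 : dsum_mx 1%g = 1%:M.
Proof. by rewrite /dsum_mx !gmx1 diag48_1 mulmx1 BMK. Qed.

Definition dsum p : L := mkGL L (dsum_mx p).

Lemma gmx_dsum p : gmx L (dsum p) = dsum_mx p.
Proof.
apply: mkGLE; apply: (mulmx1_unit (_ : _ *m dsum_mx p^-1%g = 1%:M)).1.
by rewrite -dsum_mxM mulgV dsum_mx1.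
Qed.

Lemma dsumM : {in [set: L4 * L8]%g &, {morph dsum : p q / (p * q)%g}}.
Proof.
by move=> p q _ _; apply: (@gmx_inj _ _ L); rewrite gmxM !gmx_dsum dsum_mxM.
Qed.
Canonical dsum_morphism := Morphism dsumM.

Lemma BM_dsum p : BM *m gmx L (dsum p) *m BMV = diag48 (gmx L4 p.1) (gmx L8 p.2).
Proof.
by rewrite gmx_dsum /dsum_mx !mulmxA BMVK mul1mx -mulmxA BMVK mulmx1.
Qed.

Lemma dsum_inj : injective dsum.
Proof.
move=> [a b] [c d] eq_ab.
have := BM_dsum (a, b); rewrite eq_ab BM_dsum => /= /diag48_inj[ac bd].
by rewrite (gmx_inj ac) (gmx_inj bd).
Qed.

Lemma dsum_app (a : L4) (b : L8) u w :
  app (cat48 u w *m BM) (dsum (a, b)) = cat48 (app u a) (app w b) *m BM.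
Proof.
rewrite !appE gmx_dsum /dsum_mx !mulmxA -(mulmxA _ BM BMV) BMVK mulmx1.
by rewrite cat48_diag.
Qed.

Lemma BM_surj (v : 'rV_12) : exists u w, v = cat48 u w *m BM.
Proof.
exists (lsubmx (v *m BMV : 'rV_(4 + 8))), (rsubmx (v *m BMV : 'rV_(4 + 8))).
by rewrite /cat48 hsubmxK -mulmxA BMK mulmx1.
Qed.

Lemma dsum_G a b : (dsum (a, b) \in G) = (a \in G4 L4) && (b \in G8 L8).
Proof.
apply/idP/andP => [Gab | [/GO_P Qa /GO_P Qb]].
  have h u w : Q4 (app u a) + Q8 (app w b) = Q4 u + Q8 w.
    by rewrite -!Q_BM -dsum_app (GO_P _ _ Gab).
  split; apply/GO_P=> v.
    by have := h v 0; rewrite app0 => /addIr.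
  by have := h 0 v; rewrite app0 => /addrI.
by apply/GO_P=> v; have [u [w ->]] := BM_surj v; rewrite dsum_app !Q_BM Qa Qb.
Qed.

Lemma dsum_rk1 a b : rk1 (dsum (a, b)) = (rk1 a + rk1 b)%N.
Proof.
rewrite /rk1 gmx_dsum -[X in _ - X]BMK -[BMV in X in _ - X]mulmx1 /dsum_mx -mulmxBl -mulmxBr.
by rewrite mxrank_conj ?BMVK // diag48_rank.
Qed.

Lemma centE_dsum g : g \in centE -> exists2 p, p \in setX (G4 L4) (G8 L8) & g = dsum p.
Proof.
case/centEP=> Gg eg; pose X : 'M_12 := BM *m gmx L g *m BMV.
have [A [C XE]] : exists A C, X = diag48 A C.
  apply: diag48_comm; rewrite -eps_BM /X !mulmxA -(mulmxA _ BMV) BMK mulmx1 -(mulmxA BM _ eps) -eg.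
  by rewrite !mulmxA -(mulmxA _ BMV) BMK mulmx1.
have gX : gmx L g = BMV *m X *m BM by rewrite /X !mulmxA BMK mul1mx -mulmxA BMK mulmx1.
have : X \in unitmx by rewrite /X !unitmx_mul gmx_unit (mulmx1_unit BMK).1 (mulmx1_unit BMK).2.
rewrite XE diag48_unit => /andP[uA uC].
have gE : g = dsum (mkGL L4 A, mkGL L8 C).
  by apply: (@gmx_inj _ _ L); rewrite gmx_dsum /dsum_mx gX XE !mkGLE.
by exists (mkGL L4 A, mkGL L8 C); rewrite // inE /= -dsum_G -gE.
Qed.

Lemma dsum_centE p : p \in setX (G4 L4) (G8 L8) -> dsum p \in centE.
Proof.
case: p => a b; rewrite inE /= => Gab; apply/centEP; rewrite dsum_G; split=> //.
have epsE : eps = BMV *m diag48 1%:M 0 *m BM.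
  by rewrite -eps_BM !mulmxA BMK mul1mx -mulmxA BMK mulmx1.
by rewrite epsE gmx_dsum /dsum_mx !BM_conjM !diag48M !mul0mx !mulmx0 !mul1mx !mulmx1.
Qed.

(** A pair (a, b) acting on U + W is even exactly when a and b have the same parity ([dsum_rk1]).
    The pairs with both even form the normal subgroup, and two odd transvections [a0], [b0]
    represent the other coset. *)
Lemma M1_type : exists N : {group L},
  [/\ (N <| M1)%g, (N \isog setX (G4 L4)^`(1) (G8 L8)^`(1))%g & #|M1 / N|%g = 2%N].
Proof.
exists (dsum @* setX (G4 L4)^`(1) (G8 L8)^`(1))%G => /=.
pose a0 := refl Q4 L4 (vcb 4 (bl 4 1)); pose b0 := refl Q8 L8 (vcb 8 (bl 8 3)).
have Qa : Q4 (vcb 4 (bl 4 1)) != 0 by rewrite Q4E.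
have Qb : Q8 (vcb 8 (bl 8 3)) != 0 by rewrite Q8E.
have Ga : a0 \in G4 L4 by apply: refl_GO char2_F2 q4 _ _ _.
have Gb : b0 \in G8 L8 by apply: refl_GO char2_F2 q8 _ _ _.
have oa : odd (rk1 a0) by apply: rk1_refl1 char2_F2 q4 _ _ Qa.
have ob : odd (rk1 b0) by apply: rk1_refl1 char2_F2 q8 _ _ Qb.
have dG g : (g \in G^`(1))%g = (g \in G) && ~~ odd (rk1 g) by rewrite der12 inE.
have memM1 a b : (dsum (a, b) \in M1) = [&& a \in G4 L4, b \in G8 L8 & odd (rk1 a) == odd (rk1 b)].
  rewrite inE dG dsum_rk1 oddD negb_add; apply/andP/and3P => [[/centEP[]] | [Ga' Gb' pab]].
    by rewrite dsum_G => /andP[-> ->] _ /andP[_ ->].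
  by rewrite dsum_G Ga' Gb' pab; split=> //; apply: dsum_centE; rewrite inE /= Ga' Gb'.
have memN a b : (dsum (a, b) \in dsum @* setX (G4 L4)^`(1) (G8 L8)^`(1))%g =
    [&& a \in G4 L4, b \in G8 L8, ~~ odd (rk1 a) & ~~ odd (rk1 b)].
  rewrite morphimEsub ?subsetT // (mem_imset _ _ dsum_inj) inE /= der4 der8 !inE -!andbA; congr (_ && _); exact: andbCA.
have sNM : (dsum @* setX (G4 L4)^`(1) (G8 L8)^`(1) \subset M1)%g.
  apply/subsetP=> _ /morphimP[[a b] _ ab ->].
  have := memN a b; rewrite mem_morphim ?in_setT // memM1 => /esym/and4P[-> -> /negPf-> /negPf->].
  by [].
have rM : dsum (a0, b0) \in M1 by rewrite memM1 Ga Gb oa ob.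
have [] := two_cosets sNM rM.
- by rewrite /= memN oa /= !andbF.
- move=> g Mg; have [[a b] ab gE] : exists2 p, p \in setX (G4 L4) (G8 L8) & g = dsum p.
    by apply: centE_dsum; move: Mg; rewrite inE => /andP[].
  move: Mg; rewrite gE memM1 memN.
  have -> : (dsum (a, b) * (dsum (a0, b0))^-1)%g = dsum (a * a0^-1, b * b0^-1)%g.
    by rewrite -(morphV dsum_morphism) ?in_setT // -(morphM dsum_morphism) ?in_setT.
  rewrite memN => /and3P[Ga' Gb' pab].
  rewrite Ga' Gb' !groupM ?groupV //=.
  rewrite (rk1M char2_F2 q4 (G4_gen L4)) ?groupV // (rk1M char2_F2 q8 (G8_gen L8)) ?groupV //.
  rewrite (rk1_V char2_F2 q4 (G4_gen L4)) // (rk1_V char2_F2 q8 (G8_gen L8)) //.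
  by rewrite [odd (rk1 a0)]oa [odd (rk1 b0)]ob -(eqP pab) !addbT; case: (odd _).
move=> nNM i2; split=> //.
rewrite isog_sym; apply: sub_isog; first exact: subsetT.
by apply/injmP=> p q _ _; apply: dsum_inj.
Qed.

End Reducible.

End PlaneStabilizer.

(** * The normaliser of an F_4-structure and its structure Omega^+(6,4).2^2 *)

Module FieldStructures.

Import QuadraticForms WittFrames Codings IsometryGroups ModelElements PurityCertificates Derivations Purity Decomposition ThreeCycles Overgroups PlaneStabilizer.

Local Notation F4 := Defs.F4.
Local Notation Q := Q12.
Local Notation B := (polar Q12).

Section MatrixOfMap.

Variables (F : fieldType) (n p : nat) (f : 'rV[F]_n -> 'rV[F]_p).
Hypothesis f_lin : forall c u v, f (c *: u + v) = c *: f u + f v.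

Definition mxof : 'M[F]_(n, p) := \matrix_i f (delta_mx 0 i).

Lemma mul_mxof u : u *m mxof = f u.
Proof.
have f0 : f 0 = 0.
  have := f_lin 1 0 0; rewrite !scale1r addr0 => /(congr1 (fun x => x - f 0)).
  by rewrite subrr addrK => ->.
rewrite mulmx_sum_row [in RHS](row_sum_delta u).
elim: {1 2}(index_enum _) => [|i r IHr]; first by rewrite !big_nil f0.
by rewrite !big_cons f_lin IHr rowK.
Qed.

End MatrixOfMap.

Lemma F2_lin n p (f : 'rV['F_2]_n -> 'rV['F_2]_p) : {morph f : u v / u + v} ->
  forall c u v, f (c *: u + v) = c *: f u + f v.
Proof. by move=> fD c u v; case: (F2_cases c) => ->; rewrite ?scale0r ?scale1r ?add0r. Qed.

Definition c4 (x : F4) : bool * bool := odflt (false, false) [pick p | d4 p == x].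

Lemma c4K x : d4 (c4 x) = x.
Proof.
rewrite /c4; case: pickP => [p /eqP // | no].
have [_ _ _ _ _ sj _] := codingF4; have [p _ px] := sj x.
by have := no p; rewrite px eqxx.
Qed.

Lemma d4K p : c4 (d4 p) = p.
Proof. by apply: d4_inj; rewrite c4K. Qed.

Notation vc4 n := (vec (false, false) d4 n).

Lemma vc4_surj n (v : 'rV_n) : exists2 l, size l = n & vc4 n l = v.
Proof. by have [l] := vec_surj codingF4 v; rewrite mem_allv => /andP[/eqP sl _]; exists l. Qed.

Lemma vc4_all n (P : 'rV[F4]_n -> Prop) (p : seq (bool * bool) -> bool) :
  (forall l, size l = n -> p l -> P (vc4 n l)) -> lall p (allv elts4 n) -> forall v, P v.
Proof.
move=> pP; rewrite lallE => /allP allp v; have [l la <-] := vec_surj codingF4 v.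
by apply: pP; [move: la; rewrite mem_allv => /andP[/eqP] | apply: allp].
Qed.

Definition HM : 'M['F_2]_12 := mat 12 H12r.
Definition HV : 'M['F_2]_12 := mat 12 H12i.

Definition lphi (l : seq (bool * bool)) := lmul (map fst l ++ map snd l) H12r.

Definition crd (v : 'rV[F4]_6) : 'rV['F_2]_12 :=
  \row_(i < 12) b2F (nth false (map fst (map c4 (mkseq (fun j => v 0 (inord j)) 6)) ++
                         map snd (map c4 (mkseq (fun j => v 0 (inord j)) 6))) i).

HB.lock Definition phi (v : 'rV[F4]_6) : 'rV['F_2]_12 := crd v *m HM.
(** Restriction of scalars: F_4^6 is identified with F_2^12 in such a way that multiplication by
    [w4] becomes [om 0] ([phi_om]). *)
HB.lock Definition phiV (u : 'rV['F_2]_12) : 'rV[F4]_6 :=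
  \row_(j < 6) d4 ((u *m HV) 0 (lshift 6 j) != 0, (u *m HV) 0 (rshift 6 j) != 0).

Lemma phi_vc4 l : size l = 6 -> phi (vc4 6 l) = vcb 12 (lphi l).
Proof.
move=> sl; rewrite phi.unlock /lphi -(vcb_mat 12 _ (erefl : size H12r = 12%N)); congr (_ *m _); apply/rowP=> i; rewrite !mxE.
suff -> : map c4 (mkseq (fun j => vc4 6 l 0 (inord j)) 6) = l by [].
apply: (@eq_from_nth _ (false, false)); rewrite !size_map size_iota // => j ltj.
by rewrite (nth_map 0) ?size_map ?size_iota // nth_mkseq // mxE d4K inordK.
Qed.

Lemma phiV_vcb l :
  phiV (vcb 12 l) = vc4 6 (mkseq (fun j => (nth false (lmul l H12i) j, nth false (lmul l H12i) (6 + j))) 6).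
Proof.
rewrite phiV.unlock; apply/rowP=> j; rewrite mxE /HV vcb_mat // !mxE nth_mkseq //.
by do 2![case: (nth false _ _)].
Qed.

Local Opaque mulmx.

Lemma phiD : {morph phi : u v / u + v}.
Proof.
move=> u v; have [l sl <-] := vc4_surj u; have [k sk <-] := vc4_surj v.
have szl : size (mkseq (fun j => add4 (nth (false, false) l j) (nth (false, false) k j)) 6) = 6%N by rewrite size_mkseq.
have -> : vc4 6 l + vc4 6 k = vc4 6 (mkseq (fun j => add4 (nth (false, false) l j) (nth (false, false) k j)) 6).
  by apply/rowP=> j; rewrite !mxE nth_mkseq // d4D.
rewrite !phi_vc4 // /lphi -!(vcb_mat 12 _ (erefl : size H12r = 12%N)) -mulmxDl; congr (_ *m _); clear szl.
do 6![case: l sl => [//|? l] sl]; case: l sl => // _.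
do 6![case: k sk => [//|? k] sk]; case: k sk => // _.
apply/rowP=> i; rewrite !mxE /= -b2FD; congr b2F.
by case: i; do 12![case=> //].
Qed.

Lemma phiK : cancel phi phiV.
Proof.
pose p l := mkseq (fun j => (nth false (lmul (lphi l) H12i) j, nth false (lmul (lphi l) H12i) (6 + j))) 6 == l.
apply: (@vc4_all _ (fun v => phiV (phi v) = v) p); last by vm_compute.
move=> l sl; rewrite /p => /eqP pl; by rewrite phi_vc4 // phiV_vcb // pl.
Qed.

Lemma phiVK : cancel phiV phi.
Proof.
have bij : bijective phi.
  by apply: inj_card_bij (can_inj phiK) _; rewrite !card_mx card_F4 card_Fp.
by move=> u; have [g gK Kg] := bij; rewrite -[u]Kg phiK.
Qed.

Lemma phiVD : {morph phiV : u v / u + v}.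
Proof. by move=> u v; apply: (can_inj phiK); rewrite phiVK phiD !phiVK. Qed.

Lemma om0E : om 0 = mat 12 (madd thr etar).
Proof. by rewrite /om scale0r addr0 eta.unlock !cmx mat_add. Qed.

Lemma phi_om v : phi (w4 *: v) = phi v *m om 0.
Proof.
pose p l := veq 12 (lphi (scl mul4 (false, true) l)) (lmul (lphi l) (madd thr etar)).
apply: (@vc4_all _ (fun v => phi (w4 *: v) = phi v *m om 0) p); last by vm_compute.
move=> l sl /veqP; rewrite om0E phi_vc4 // vcb_mat // => <-.
have -> : w4 *: vc4 6 l = vc4 6 (scl mul4 (false, true) l).
  by rewrite (vecZ codingF4) /d4 /= add0r mul1r.
by rewrite phi_vc4 // size_map.
Qed.

(** The second coordinate of a code is the trace from F_4 to F_2, so Q is the trace of the form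
    [Q6]. *)
Lemma Q_phi v : Q (phi v) = b2F (c4 (Q6 v)).2.
Proof.
pose p l := qp 6 (lphi l) == (qp4 3 l).2.
apply: (@vc4_all _ (fun v => Q (phi v) = b2F (c4 (Q6 v)).2) p); last by vm_compute.
by move=> l sl /eqP pl; rewrite phi_vc4 // Q12E Q6E d4K pl.
Qed.

(** The trace form is nondegenerate, and 1 and w^2 form a basis of F_4 over F_2. *)
Lemma Q6_trace (x y : F4) : (c4 x).2 = (c4 y).2 -> (c4 (w4 ^+ 2 * x)).2 = (c4 (w4 ^+ 2 * y)).2 -> x = y.
Proof.
have w2 : w4 ^+ 2 = d4 (true, true) by rewrite w4_sqr /d4 /= mul1r addrC.
rewrite -(c4K x) -(c4K y) w2 -!d4M !d4K.
by move: (c4 x) (c4 y) => [[] []] [[] []].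
Qed.

Lemma F4_lin n p (f : 'rV[F4]_n -> 'rV[F4]_p) : {morph f : u v / u + v} ->
  (forall v, f (w4 *: v) = w4 *: f v) -> forall c u v, f (c *: u + v) = c *: f u + f v.
Proof.
move=> fD fw c u v; rewrite fD; congr (_ + _); rewrite -(c4K c).
have f0 : f 0 = 0 by apply: (addrI (f 0)); rewrite -fD !addr0.
case: (c4 c) => [[] []]; rewrite /d4 /= ?mul1r ?mul0r ?addr0 ?add0r ?scale1r ?scale0r ?f0 ?fw //.
by rewrite !scalerDl !scale1r fD fw.
Qed.

Section Extension.

Variables (L : GLmodel 'F_2 11) (L6 : GLmodel F4 5).
Local Notation G := (G12 L).

Definition ext_map (a : L6) u := phi (app (phiV u) a).
Definition ext (a : L6) : L := mkGL L (mxof (ext_map a)).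

Lemma mul_ext a u : u *m mxof (ext_map a) = ext_map a u.
Proof.
apply: mul_mxof; apply: F2_lin => v w.
by rewrite /ext_map phiVD appD phiD.
Qed.

Lemma app_ext a u : app u (ext a) = phi (app (phiV u) a).
Proof.
rewrite appE mkGLE ?mul_ext //.
apply: (@mulmx1_unit _ _ _ (mxof (ext_map a^-1%g)) _).1; apply: gmx_eqP => v.
by rewrite mulmxA mulmx1 !mul_ext /ext_map phiK appK phiVK.
Qed.

Lemma app_ext_phi a v : app (phi v) (ext a) = phi (app v a).
Proof. by rewrite app_ext phiK. Qed.

Lemma extM : {in [set: L6] &, {morph ext : a b / (a * b)%g}}.
Proof.
by move=> a b _ _; apply: app_eqP => u; rewrite appM !app_ext phiK appM.
Qed.
Canonical ext_morphism := Morphism extM.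

Lemma ext_inj : injective ext.
Proof.
move=> a b eq_ab; apply: app_eqP => v; apply: (can_inj phiK).
by rewrite -!app_ext_phi eq_ab.
Qed.

Definition centW : {set L} := [set g in G | om 0 *m gmx L g == gmx L g *m om 0].

(** An F_4-linear isometry of Q preserves the traces of [Q6 v] and of [Q6 (w4 *: v)], hence [Q6]
    itself. *)
Lemma centW_ext : centW = ext @: G6 L6.
Proof.
apply/setP=> g; apply/idP/imsetP => [|[a Ga ->]]; last first.
  rewrite inE; apply/andP; split.
    by apply/GO_P=> u; rewrite app_ext Q_phi (GO_P _ _ Ga) -Q_phi phiVK.
  apply/eqP/gmx_eqP => u; rewrite !mulmxA -!appE -(phiVK u) -phi_om !app_ext_phi appZ.
  by rewrite phi_om.
rewrite inE => /andP[Gg /eqP og].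
have step h : om 0 *m gmx L h = gmx L h *m om 0 ->
    forall v, v *m mxof (fun v => phiV (app (phi v) h)) = phiV (app (phi v) h).
  move=> oh; apply: mul_mxof; apply: F4_lin => [u v | v].
    by rewrite phiD appD phiVD.
  by apply: (can_inj phiK); rewrite phiVK [in RHS]phi_om phiVK phi_om !appE -!mulmxA oh.
have oV : om 0 *m gmx L g^-1%g = gmx L g^-1%g *m om 0.
  by rewrite -[om 0 in LHS]mul1mx -(gmxVK g) -!mulmxA (mulmxA (gmx L g)) -og -mulmxA gmxKV mulmx1.
pose A := mxof (fun v => phiV (app (phi v) g)); pose AV := mxof (fun v => phiV (app (phi v) g^-1%g)).
have uA : A \in unitmx.
  apply: (@mulmx1_unit _ _ A AV _).1; apply: gmx_eqP => v.
  by rewrite mulmxA mulmx1 step // step // phiVK appK phiK.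
have aA v : app v (mkGL L6 A) = phiV (app (phi v) g) by rewrite appE mkGLE // step.
exists (mkGL L6 A); last by apply: app_eqP => u; rewrite app_ext aA !phiVK.
have im v : (c4 (Q6 (app v (mkGL L6 A)))).2 = (c4 (Q6 v)).2.
  by apply: b2F_inj; rewrite -!Q_phi aA phiVK (GO_P _ _ Gg).
by apply/GO_P=> v; apply: Q6_trace; rewrite // -!(quadZ q6) -appZ.
Qed.

(** The same fixed vectors are counted over F_2 and over F_4. *)
Lemma ext_rk1 a : rk1 (ext a) = (2 * rk1 a)%N.
Proof.
have cE : #|[set u : 'rV_12 | app u (ext a) == u]| = #|[set v : 'rV_6 | app v a == v]|.
  rewrite -(card_imset _ (can_inj phiK)); apply: eq_card => u; apply/idP/imsetP => [|[v]].
    rewrite inE app_ext => /eqP uE; exists (phiV u); last by rewrite phiVK.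
    by rewrite inE -{2}uE phiK.
  by rewrite !inE => /eqP va ->; rewrite app_ext_phi va.
have fixE (F : finFieldType) m (L' : GLmodel F m) (g : L') :
    #|[set v | app v g == v]| = (#|F| ^ (m.+1 - rk1 g))%N.
  rewrite /rk1 -mxrank_ker -card_rowg; apply: eq_card => v; rewrite !inE.
  by rewrite -subr_eq0 -app_rk1; apply/eqP/sub_kermxP.
move: cE; rewrite !fixE card_F4 card_Fp // -[4%N]/(2 ^ 2)%N -expnM => /eqP.
rewrite eqn_exp2l // => /eqP e12.
have h1 : (rk1 a <= 6)%N by exact: rank_leq_row.
have h2 : (rk1 (ext a) <= 12)%N by exact: rank_leq_row.
have {}e12 : (12 - rk1 (ext a) = 2 * (6 - rk1 a))%N by exact: e12.
move: (rk1 a) (rk1 (ext a)) h1 h2 e12 => x y; lia.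
Qed.

End Extension.

Lemma sigma_ok : isom_ok Sr Sr. Proof. by vm_compute. Qed.

Lemma rank_Sr : \rank (mat 12 Sr - 1%:M) = 6.
Proof.
pose U := map (bl 6) [:: 0;0;0;0;0;0;10;1;56;21;12;4]; pose V := map (bl 12) [:: 1;2;4;8;16;32].
pose A := map (bl 12) [:: 128;3136;2048;3072;2688;1920].
pose C := map (bl 6) [:: 1;2;4;8;16;32;0;0;0;0;0;0].
have -> : mat 12 Sr - 1%:M = matr 12 6 U *m matr 6 12 V.
  by apply/eqP; rewrite subr_eq -mat_id mat_mul // mat_add; apply/eqP/ceqP; vm_compute.
apply/eqP; rewrite eqn_leq (leq_trans (mxrankM_maxl _ _) (rank_leq_col _)) /=.
have r1 : matr 6 12 A *m (matr 12 6 U *m matr 6 12 V) *m matr 12 6 C = 1%:M.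
  by rewrite -mat_id !mat_mul //; apply: ceqP; vm_compute.
rewrite -[X in (X <= _)%N](mxrank1 'F_2 6) -r1.
by apply: leq_trans (mxrankM_maxl _ _) (mxrankM_maxr _ _).
Qed.

Lemma om_Sr : tw (om 0) (om 0) 1 (mat 12 Sr).
Proof. by rewrite /tw scale1r om0E !mat_mul // mat_add; apply: ceqP; vm_compute. Qed.

Lemma Sr_sqr : mat 12 Sr *m mat 12 Sr = 1%:M.
Proof. by rewrite -mat_id mat_mul //; apply: ceqP; vm_compute. Qed.

Lemma index2_even (gT : finGroupType) (H K : {group gT}) : H \subset K -> #|K : H|%g = 2%N ->
  {in K &, forall a b, (a * b \in H)%g = ((a \in H) == (b \in H))}.
Proof.
move=> sHK i2 a b Ka Kb; have nHK := index2_normal sHK i2.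
have [Ha | nHa] := boolP (a \in H); first by rewrite groupMl //; case: (_ \in H).
have [Hb | nHb] := boolP (b \in H); first by rewrite groupMr // (negPf nHa).
have nH x : x \in K -> x \notin H -> (H :* x = K :\: H)%g.
  move=> Kx nHx; apply/eqP; rewrite eqEcard; apply/andP; split.
    apply/subsetP=> _ /rcosetP[h Hh ->]; rewrite inE groupMl // nHx groupM //; exact: (subsetP sHK).
  have := cardsID H K; rewrite (setIidPr sHK) -(Lagrange sHK) i2 muln2 -addnn => /addnI ->.
  by rewrite card_rcoset.
have : b^-1%g \in (H :* a)%g by rewrite nH // inE groupV nHb groupV.
by rewrite mem_rcoset -invMg groupV.
Qed.

Section TwistedNormaliser.

Variable (L : GLmodel 'F_2 11).
Local Notation G := (G12 L).

Definition twN_set (e : 'F_2) : {set L} :=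
  [set g in G | [exists c : 'F_2, om e *m gmx L g == gmx L g *m om e + c *: gmx L g]].

Lemma twN_setP e g : reflect (g \in G /\ exists c, tw (om e) (om e) c (gmx L g)) (g \in twN_set e).
Proof.
rewrite inE; apply: (iffP andP) => -[Gg].
  by move/existsP=> [c /eqP tg]; split=> //; exists c.
by case=> c tg; split=> //; apply/existsP; exists c; apply/eqP.
Qed.

Lemma twN_group_set e : group_set (twN_set e).
Proof.
apply/group_setP; split=> [|g h].
  apply/twN_setP; rewrite group1; split=> //; exists 0.
  by rewrite /tw gmx1 mulmx1 mul1mx scale0r addr0.
case/twN_setP=> Gg [c tg] /twN_setP[Gh [d th]]; apply/twN_setP; rewrite groupM //; split=> //.
by exists (c + d); rewrite gmxM; apply: tw_mul tg th.
Qed.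

Definition twN e : {group L} := locked (Group (twN_group_set e)).

Lemma twNP e g : reflect (g \in G /\ exists c, tw (om e) (om e) c (gmx L g)) (g \in twN e).
Proof. by rewrite /twN -lock; apply: twN_setP. Qed.

Definition sigma0 : L := mkGL L (mat 12 Sr).

Lemma gmx_sigma0 : gmx L sigma0 = mat 12 Sr.
Proof. by have [] := isom_okP L sigma_ok. Qed.

Lemma sigma0_G : sigma0 \in G.
Proof. by have [] := isom_okP L sigma_ok. Qed.

Lemma sigma0_twN : sigma0 \in twN 0.
Proof. by apply/twNP; rewrite sigma0_G; split=> //; exists 1; rewrite gmx_sigma0; apply: om_Sr. Qed.

Lemma sigma0_sqr : (sigma0 * sigma0 = 1)%g.
Proof. by apply: (@gmx_inj _ _ L); rewrite gmxM gmx1 gmx_sigma0 Sr_sqr. Qed.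

Variable (L6 : GLmodel F4 5).
Local Notation ext := (@ext L L6).

Lemma centW_even a : a \in G6 L6 -> ext a \in (G^`(1))%g.
Proof.
move=> Ga; rewrite der12 inE ext_rk1 oddM andbT.
suff : ext a \in centW L by rewrite inE => /andP[].
by rewrite (centW_ext L L6) imset_f.
Qed.

(** A semilinear element times the semilinear involution [sigma0] is linear. *)
Lemma twN_cent g : g \in twN 0 ->
  (exists2 a, a \in G6 L6 & g = ext a) \/ (exists2 a, a \in G6 L6 & g = (ext a * sigma0)%g).
Proof.
have cW h : h \in G -> tw (om 0) (om 0) 0 (gmx L h) -> exists2 a, a \in G6 L6 & h = ext a.
  move=> Gh th; apply/imsetP; rewrite -(centW_ext L L6) inE Gh /=; apply/eqP.
  by rewrite th scale0r addr0.
case/twNP=> Gg [c]; case: (F2_cases c) => -> tg; first by left; apply: cW.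
right; have [||a Ga gE] := cW (g * sigma0)%g; first by rewrite groupM ?sigma0_G.
  rewrite gmxM gmx_sigma0; have := tw_mul tg om_Sr.
  by rewrite (addc2 char2_F2).
by exists a; rewrite // -gE -mulgA sigma0_sqr mulg1.
Qed.

Lemma sigma0_even : sigma0 \in (G^`(1))%g.
Proof. by rewrite der12 inE sigma0_G /rk1 gmx_sigma0 rank_Sr. Qed.

Lemma twN_even : twN 0 \subset (G^`(1))%g.
Proof.
apply/subsetP=> g /twN_cent[] [a Ga ->]; first exact: centW_even.
by rewrite groupM ?centW_even // sigma0_even.
Qed.

Lemma ext_twN a : a \in G6 L6 -> ext a \in twN 0.
Proof.
move=> Ga; have : ext a \in centW L by rewrite (centW_ext L L6) imset_f.
rewrite inE => /andP[Gg /eqP og]; apply/twNP; split=> //; exists 0.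
by rewrite /tw og scale0r addr0.
Qed.

Lemma sigma0_notin a : a \in G6 L6 -> sigma0 != ext a.
Proof.
move=> Ga; apply/eqP=> sE; have : sigma0 \in centW L by rewrite sE (centW_ext L L6) imset_f.
rewrite inE => /andP[_ /eqP]; have := om_Sr; rewrite -gmx_sigma0 /tw scale1r => ->.
move/eqP; rewrite -subr_eq0 addrC addKr => /eqP s0.
have := gmxKV sigma0; rewrite s0 mul0mx => /eqP.
by rewrite eq_sym -mxrank_eq0 mxrank1.
Qed.

(** The image [N] of the derived group of [G6] has index 2 in the group [C] of linear elements,
    which has index 2 in [twN 0]. Squares lie in [N], so the quotient, of order 4, is elementary
    abelian. *)
Lemma twN_type : exists N : {group L},
  [/\ (N <| twN 0)%g, (N \isog (G6 L6)^`(1))%g & (twN 0 / N \isog [set: 'Z_2 * 'Z_2])%g].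
Proof.
pose N := (ext @* (G6 L6)^`(1))%G; pose C := (ext @* G6 L6)%G; exists N.
have injE : ('injm ext)%g by apply/injmP=> p q _ _; apply: ext_inj.
have memC a : (ext a \in C) = (a \in G6 L6).
  by rewrite /= morphimEsub ?subsetT // (mem_imset _ _ (@ext_inj L L6)).
have CP g : reflect (exists2 a, a \in G6 L6 & g = ext a) (g \in C).
  by rewrite /= morphimEsub ?subsetT //; apply: imsetP.
have sCM : C \subset twN 0 by apply/subsetP=> _ /CP[a Ga ->]; apply: ext_twN.
have sNC : N \subset C by apply: morphimS; apply: der_sub.
have sg_C : sigma0 \notin C by apply/CP=> -[a Ga]; apply/eqP/sigma0_notin.
have nCM : (C <| twN 0)%g /\ #|twN 0 / C|%g = 2%N.
  apply: two_cosets sCM sigma0_twN sg_C _ => g /twN_cent[] [a Ga ->]; first by rewrite memC Ga.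
  by rewrite mulgK memC.
have iNC : #|C : N|%g = 2%N.
  by rewrite /= index_injm ?subsetT //; apply: index6.
have NE : N :=: (C^`(1))%g by rewrite /= morphim_der ?subsetT.
have nNM : (N <| twN 0)%g by rewrite NE; apply: char_normal_trans (der_char 1 C) nCM.1.
have cN : #|twN 0 / N|%g = 4%N.
  rewrite card_quotient ?normal_norm // -(Lagrange_index sCM sNC) iNC.
  by rewrite -(card_quotient (normal_norm nCM.1)) nCM.2.
split=> //; first by rewrite isog_sym; apply: sub_isog; rewrite ?subsetT.
have sq g : g \in twN 0 -> (g * g)%g \in N.
  have evC := index2_even sNC iNC.
  have sqC h : h \in C -> (h * h)%g \in N by move=> Ch; rewrite evC // eqxx.
  case/twN_cent=> [] [a Ga ->]; first by apply: sqC; rewrite memC.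
  have Ca : ext a \in C by rewrite memC.
  have -> : (ext a * sigma0 * (ext a * sigma0) = ext a * (ext a ^ sigma0))%g.
    have sV : (sigma0^-1 = sigma0)%g by apply/eqP; rewrite eq_invg_mul sigma0_sqr.
    by rewrite conjgE sV !mulgA.
  have CJ : (ext a ^ sigma0)%g \in C by rewrite memJ_norm // (subsetP (normal_norm nCM.1)) ?sigma0_twN.
  by rewrite evC // memJ_norm ?eqxx // (subsetP (normal_norm nNM)) ?sigma0_twN.
have abN : (2.-abelem (twN 0 / N))%g.
  apply: exponent2_abelem; apply/exponentP=> x /morphimP[g Ng Mg ->].
  by rewrite -(morphX (coset_morphism N)) //; apply: coset_id; rewrite expgS expg1; apply: sq.
have abZ : (2.-abelem [set: 'Z_2 * 'Z_2])%g.
  by apply: exponent2_abelem; apply/exponentP=> -[a b] _; apply/eqP; case: a => [[|[|//]] ?]; case: b => [[|[|//]] ?].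
by rewrite (isog_abelem_card _ abN) abZ /= cN cardsT card_prod !card_ord.
Qed.

End TwistedNormaliser.

End FieldStructures.

(** * The exterior square: PSL(4,4) and Omega^+(6,4) *)

Module Wedge.

Import QuadraticForms WittFrames Codings IsometryGroups FieldStructures.

Local Notation F4 := Defs.F4.

Section Alternating.

Variable F : fieldType.
Implicit Types (X Y : 'M[F]_4) (v : 'rV[F]_6) (A C : 'M[F]_4).

Let o (n i : nat) : 'I_n.+1 := inord i.

(** Positions k and k + 3 hold complementary pairs, and (3, 1) is ordered so that the signs make
    [Qplus] the Pfaffian. *)
Definition pair_idx : seq (nat * nat) := [:: (0, 1); (0, 2); (0, 3); (2, 3); (3, 1); (1, 2)]%N.

Definition altc X : 'rV[F]_6 :=
  \row_k X (o 3 (nth (0, 0) pair_idx k).1) (o 3 (nth (0, 0) pair_idx k).2).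

Definition alt v : 'M[F]_4 :=
  \sum_(k < 6) v 0 k *: (delta_mx (o 3 (nth (0, 0) pair_idx k).1) (o 3 (nth (0, 0) pair_idx k).2) -
                         delta_mx (o 3 (nth (0, 0) pair_idx k).2) (o 3 (nth (0, 0) pair_idx k).1)).

(** In characteristic 2 the vanishing of the diagonal does not follow from antisymmetry. *)
Definition is_alt X := X^T = - X /\ forall i, X i i = 0.

Lemma ord4E (i : 'I_4) : [\/ i = o 3 0, i = o 3 1, i = o 3 2 | i = o 3 3].
Proof.
case: i => [[|[|[|[|//]]]] ?]; [apply: Or41 | apply: Or42 | apply: Or43 | apply: Or44];
  by apply: val_inj; rewrite /= inordK.
Qed.

Lemma o_eq i j : (i < 4)%N -> (j < 4)%N -> (o 3 i == o 3 j) = (i == j).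
Proof. by move=> li lj; rewrite -val_eqE /= !inordK. Qed.

Lemma sum4 (f : 'I_4 -> F) : \sum_i f i = f (o 3 0) + f (o 3 1) + f (o 3 2) + f (o 3 3).
Proof.
rewrite !big_ord_recr big_ord0 /= add0r; congr (f _ + f _ + f _ + f _);
  by apply: val_inj; rewrite /= inordK.
Qed.

Lemma sum6 (V : zmodType) (f : 'I_6 -> V) :
  \sum_i f i = f (o 5 0) + f (o 5 1) + f (o 5 2) + f (o 5 3) + f (o 5 4) + f (o 5 5).
Proof.
rewrite !big_ord_recr big_ord0 /= add0r; congr (f _ + f _ + f _ + f _ + f _ + f _);
  by apply: val_inj; rewrite /= inordK.
Qed.

Lemma altE v i j : alt v i j =
  v 0 (o 5 0) * ((i == o 3 0) && (j == o 3 1))%:R - v 0 (o 5 0) * ((i == o 3 1) && (j == o 3 0))%:R +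
  (v 0 (o 5 1) * ((i == o 3 0) && (j == o 3 2))%:R - v 0 (o 5 1) * ((i == o 3 2) && (j == o 3 0))%:R) +
  (v 0 (o 5 2) * ((i == o 3 0) && (j == o 3 3))%:R - v 0 (o 5 2) * ((i == o 3 3) && (j == o 3 0))%:R) +
  (v 0 (o 5 3) * ((i == o 3 2) && (j == o 3 3))%:R - v 0 (o 5 3) * ((i == o 3 3) && (j == o 3 2))%:R) +
  (v 0 (o 5 4) * ((i == o 3 3) && (j == o 3 1))%:R - v 0 (o 5 4) * ((i == o 3 1) && (j == o 3 3))%:R) +
  (v 0 (o 5 5) * ((i == o 3 1) && (j == o 3 2))%:R - v 0 (o 5 5) * ((i == o 3 2) && (j == o 3 1))%:R).
Proof. by rewrite /alt sum6 !mxE !mulrBr /o !inordK. Qed.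

Lemma alt_is_alt v : is_alt (alt v).
Proof.
split=> [|i]; last first.
  by rewrite altE; case: (ord4E i) => ->; rewrite !o_eq //= !mulr0 !subr0 !addr0.
apply/matrixP=> i j; rewrite !mxE !altE; do 12 rewrite andbC.
by case: (ord4E i) => ->; case: (ord4E j) => ->; rewrite !o_eq //=; ring.
Qed.

Lemma altcK X : is_alt X -> alt (altc X) = X.
Proof.
case=> tX dX; have aX i j : X j i = - X i j by have := congr1 (fun Y : 'M_4 => Y i j) tX; rewrite !mxE.
apply/matrixP=> i j; rewrite altE !mxE /o !inordK //= -/(o 3 _).
case: (ord4E i) => ->; case: (ord4E j) => ->; rewrite -?/(o 3 _) ?o_eq //= ?dX ?(aX (o 3 0)) ?(aX (o 3 1)) ?(aX (o 3 2)); ring.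
Qed.

Lemma conj_is_alt A X : is_alt X -> is_alt (A^T *m X *m A).
Proof.
case=> tX dX; split=> [|i].
  by rewrite !trmx_mul trmxK tX mulNmx mulmxN mulmxA.
have aX j k : X k j = - X j k by have := congr1 (fun Y : 'M_4 => Y j k) tX; rewrite !mxE.
rewrite !mxE sum4 !mxE !sum4 !mxE !dX (aX (o 3 0) (o 3 1)) (aX (o 3 0) (o 3 2)) (aX (o 3 0) (o 3 3)).
rewrite (aX (o 3 1) (o 3 2)) (aX (o 3 1) (o 3 3)) (aX (o 3 2) (o 3 3)); ring.
Qed.

Lemma altc_lin c X Y : altc (c *: X + Y) = c *: altc X + altc Y.
Proof. by apply/rowP=> k; rewrite !mxE. Qed.

Lemma alt_lin c u v : alt (c *: u + v) = c *: alt u + alt v.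
Proof.
rewrite /alt scaler_sumr -big_split; apply: eq_bigr => k _.
by rewrite !mxE scalerDl scalerA.
Qed.

(** The exterior square, realised as the action of [A] by congruence on alternating matrices. *)
Definition wedge A : 'M[F]_6 := mxof (fun v => altc (A^T *m alt v *m A)).

Lemma mul_wedge v A : v *m wedge A = altc (A^T *m alt v *m A).
Proof.
apply: (mul_mxof (f := fun v => altc (A^T *m alt v *m A))) => c u w.
by rewrite alt_lin mulmxDr mulmxDl -scalemxAr -scalemxAl altc_lin.
Qed.

Lemma wedgeM A C : wedge (A *m C) = wedge A *m wedge C.
Proof.
apply/row_matrixP=> i; rewrite !rowE mulmxA !mul_wedge.
rewrite altcK; last by apply: conj_is_alt; apply: alt_is_alt.
by rewrite trmx_mul !mulmxA.
Qed.

Lemma altK v : altc (alt v) = v.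
Proof.
apply/rowP=> k; rewrite !mxE altE.
have : [\/ k = o 5 0, k = o 5 1 | k = o 5 2] \/ [\/ k = o 5 3, k = o 5 4 | k = o 5 5].
  by case: k => [[|[|[|[|[|[|//]]]]]] ?]; [left; apply: Or31 | left; apply: Or32 | left; apply: Or33
    | right; apply: Or31 | right; apply: Or32 | right; apply: Or33]; apply: val_inj; rewrite /= inordK.
by case=> -[] ->; rewrite {1 2 3 4 5 6 7 8 9 10 11 12 13 14 15 16 17 18 19 20 21 22 23 24}/o !inordK //= !o_eq //=; ring.
Qed.

Lemma wedge1 : wedge 1%:M = 1%:M.
Proof. by apply/row_matrixP=> i; rewrite !rowE mul_wedge trmx1 mul1mx !mulmx1 altK. Qed.

Definition dnat n (f : nat -> nat -> F) := \det (\matrix_(i < n, j < n) f i j).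

Lemma dnatS n f :
  dnat n.+1 f = \sum_(j < n.+1) f 0%N j * ((-1) ^+ j * dnat n (fun i k => f i.+1 (bump j k))).
Proof.
rewrite /dnat (expand_det_row _ ord0); apply: eq_bigr => j _; rewrite mxE /cofactor add0n.
by congr (_ * (_ * \det _)); apply/matrixP=> i k; rewrite !mxE lift0.
Qed.

Lemma dnat1 f : dnat 1 f = f 0%N 0%N. Proof. by rewrite /dnat det_mx11 mxE. Qed.

Lemma dnat2 f : dnat 2 f = f 0%N 0%N * f 1%N 1%N - f 0%N 1%N * f 1%N 0%N.
Proof. by rewrite dnatS !big_ord_recl big_ord0 !dnat1 /=; ring. Qed.

Lemma dnat3 f : dnat 3 f = f 0%N 0%N * (f 1%N 1%N * f 2%N 2%N - f 1%N 2%N * f 2%N 1%N)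
  - f 0%N 1%N * (f 1%N 0%N * f 2%N 2%N - f 1%N 2%N * f 2%N 0%N)
  + f 0%N 2%N * (f 1%N 0%N * f 2%N 1%N - f 1%N 1%N * f 2%N 0%N).
Proof. by rewrite dnatS !big_ord_recl big_ord0 !dnat2 /= /bump /=; ring. Qed.

Lemma det4 A (a := fun i j => A (o 3 i) (o 3 j)) : \det A =
  a 0%N 0%N * (a 1%N 1%N * (a 2%N 2%N * a 3%N 3%N - a 2%N 3%N * a 3%N 2%N) - a 1%N 2%N * (a 2%N 1%N * a 3%N 3%N - a 2%N 3%N * a 3%N 1%N) + a 1%N 3%N * (a 2%N 1%N * a 3%N 2%N - a 2%N 2%N * a 3%N 1%N))
  - a 0%N 1%N * (a 1%N 0%N * (a 2%N 2%N * a 3%N 3%N - a 2%N 3%N * a 3%N 2%N) - a 1%N 2%N * (a 2%N 0%N * a 3%N 3%N - a 2%N 3%N * a 3%N 0%N) + a 1%N 3%N * (a 2%N 0%N * a 3%N 2%N - a 2%N 2%N * a 3%N 0%N))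
  + a 0%N 2%N * (a 1%N 0%N * (a 2%N 1%N * a 3%N 3%N - a 2%N 3%N * a 3%N 1%N) - a 1%N 1%N * (a 2%N 0%N * a 3%N 3%N - a 2%N 3%N * a 3%N 0%N) + a 1%N 3%N * (a 2%N 0%N * a 3%N 1%N - a 2%N 1%N * a 3%N 0%N))
  - a 0%N 3%N * (a 1%N 0%N * (a 2%N 1%N * a 3%N 2%N - a 2%N 2%N * a 3%N 1%N) - a 1%N 1%N * (a 2%N 0%N * a 3%N 2%N - a 2%N 2%N * a 3%N 0%N) + a 1%N 2%N * (a 2%N 0%N * a 3%N 1%N - a 2%N 1%N * a 3%N 0%N)).
Proof.
have -> : \det A = dnat 4 a by congr (\det _); apply/matrixP=> i j; rewrite mxE /a /o !inord_val.
by rewrite dnatS !big_ord_recl big_ord0 !dnat3 /= /bump /=; ring.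
Qed.

Lemma Qplus3 v : @Qplus F 3 v =
  v 0 (o 5 0) * v 0 (o 5 3) + v 0 (o 5 1) * v 0 (o 5 4) + v 0 (o 5 2) * v 0 (o 5 5).
Proof.
rewrite /Qplus !big_ord_recr big_ord0 /= add0r.
by congr (v _ _ * v _ _ + v _ _ * v _ _ + v _ _ * v _ _); apply: val_inj; rewrite /= inordK.
Qed.

Lemma conj_altE v A k l : (A^T *m alt v *m A) k l =
  v 0 (o 5 0) * (A (o 3 0) k * A (o 3 1) l - A (o 3 1) k * A (o 3 0) l) +
  v 0 (o 5 1) * (A (o 3 0) k * A (o 3 2) l - A (o 3 2) k * A (o 3 0) l) +
  v 0 (o 5 2) * (A (o 3 0) k * A (o 3 3) l - A (o 3 3) k * A (o 3 0) l) +
  v 0 (o 5 3) * (A (o 3 2) k * A (o 3 3) l - A (o 3 3) k * A (o 3 2) l) +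
  v 0 (o 5 4) * (A (o 3 3) k * A (o 3 1) l - A (o 3 1) k * A (o 3 3) l) +
  v 0 (o 5 5) * (A (o 3 1) k * A (o 3 2) l - A (o 3 2) k * A (o 3 1) l).
Proof. by rewrite mxE sum4 !mxE !sum4 !mxE !altE !o_eq //=; ring. Qed.

(* [Qplus] is the Pfaffian of [alt v]. *)
Lemma Q_wedge v A : @Qplus F 3 (v *m wedge A) = \det A * @Qplus F 3 v.
Proof.
have aE X p : (p < 6)%N -> altc X 0 (o 5 p) = X (o 3 (nth (0, 0) pair_idx p).1) (o 3 (nth (0, 0) pair_idx p).2).
  by move=> lp; rewrite mxE /o inordK.
by rewrite !Qplus3 mul_wedge !aE //= !conj_altE det4; ring.
Qed.

Lemma wedge_minors A : wedge A = 1%:M -> forall i j k l : 'I_4, i != j ->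
  A i k * A j l - A i l * A j k = ((k == i) && (l == j))%:R - ((k == j) && (l == i))%:R.
Proof.
move=> wA i j k l nij; pose D : 'M[F]_4 := delta_mx i j - delta_mx j i.
have aD : is_alt D.
  split=> [|x]; last by rewrite !mxE; case: (x =P i) => [->|]; rewrite ?(negPf nij) ?andbF ?subr0.
  by rewrite linearB /= !trmx_delta opprB.
have := mul_wedge (altc D) A; rewrite wA mulmx1 => /(congr1 alt).
rewrite !altcK //; last exact: conj_is_alt.
move/(congr1 (fun Y : 'M_4 => Y k l)); rewrite mulmxBr mulmxBl.
have dE x y : (A^T *m delta_mx x y *m A) k l = A x k * A y l.
  by rewrite -(mul_delta_mx (0 : 'I_1)) mulmxA -mulmxA -rowE -colE mxE big_ord1 !mxE.
have sE (X Y : 'M[F]_4) : (X - Y) k l = X k l - Y k l by rewrite !mxE.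
by rewrite /= /D !sE !dE ![in X in X -> _]mxE (mulrC (A i l)) => <-.
Qed.

(** The 2 x 2 minors of A are those of the identity ([wedge_minors]). This kills the off-diagonal
    entries and makes all products of two distinct diagonal entries 1, so each diagonal entry has
    square 1. *)
Lemma wedge_ker A : wedge A = 1%:M -> (forall c : F, c ^+ 2 = 1 -> c = 1) -> A = 1%:M.
Proof.
move=> wA sq1; have h := wedge_minors wA.
have off i k : k != i -> A i k = 0.
  move=> nki; have [j /andP[nji njk]] : exists j : 'I_4, (j != i) && (j != k).
    have /subsetPn[j _] : ~~ ([set: 'I_4] \subset [set i; k]).
      apply/negP=> /subset_leq_card; rewrite cardsT card_ord leqNgt cards2.
      by case: (i != k).
    by rewrite !inE negb_or => jik; exists j.
  have e1 := h i j i j; have e2 := h i j k j; have e3 := h i j k i.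
  rewrite eq_sym nji in e1 e2 e3; move: (e1 isT) (e2 isT) (e3 isT).
  rewrite !eqxx (negPf nki) (negPf nji) (eq_sym k) (negPf njk) /= => {}e1 {}e2 {}e3.
  (* A combination of the minors in [e1], [e2] and [e3], whose values are 1, 0 and 0. *)
  have -> : A i k = A i i * (A i k * A j j - A i j * A j k)
     - A i j * (A i k * A j i - A i i * A j k) + A i k * (1 - (A i i * A j j - A i j * A j i)) by ring.
  by rewrite e1 e2 e3; ring.
have diag i j : i != j -> A i i * A j j = 1.
  move=> nij; have := h i j i j nij; rewrite (off i j) 1?eq_sym // mul0r subr0 => ->.
  by rewrite !eqxx eq_sym (negPf nij) subr0.
have c1 i : A i i = 1.
  have [j [k [nij nik njk]]] : exists j k : 'I_4, [/\ i != j, i != k & j != k].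
    case: (ord4E i) => ->; [exists (o 3 1), (o 3 2) | exists (o 3 0), (o 3 2)
      | exists (o 3 0), (o 3 1) | exists (o 3 0), (o 3 1)]; by rewrite !o_eq.
  have dij := diag i j nij; have dik := diag i k nik; have djk := diag j k njk.
  apply: sq1; rewrite expr2.
  have -> : A i i * A i i = (A i i * A j j) * (A i i * A k k) + A i i * A i i * (1 - A j j * A k k) by ring.
  by rewrite dij dik djk; ring.
apply/matrixP=> i k; rewrite !mxE; case: (eqVneq i k) => [<- | nik]; first exact: c1.
by rewrite off // eq_sym.
Qed.

Lemma wedge_inj A C : A \in unitmx -> C \in unitmx -> (forall c : F, c ^+ 2 = 1 -> c = 1) ->
  wedge A = wedge C -> A = C.
Proof.
move=> uA uC sq1 eqAC; rewrite -[A]mulmx1 -(mulVmx uC) mulmxA.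
rewrite (wedge_ker (A := A *m invmx C)) ?mul1mx //.
by rewrite wedgeM eqAC -wedgeM mulmxV ?wedge1.
Qed.

End Alternating.

Section SpecialLinear.

Variables (L4 : GLmodel F4 3) (L6 : GLmodel F4 5).

Definition SLg_set : {set L4} := [set g | \det (gmx L4 g) == 1].

Lemma SLg_group_set : group_set SLg_set.
Proof.
apply/group_setP; split=> [|g h]; first by rewrite inE gmx1 det1.
by rewrite !inE gmxM det_mulmx => /eqP-> /eqP->; rewrite mulr1.
Qed.

Definition SLg : {group L4} := locked (Group SLg_group_set).

Lemma SLgP g : (g \in SLg) = (\det (gmx L4 g) == 1).
Proof. by rewrite /SLg -lock inE. Qed.

Lemma F4_cube (c : F4) : c != 0 -> c ^+ 3 = 1.
Proof.
move=> nzc; apply: (mulIf nzc); rewrite mul1r -exprSr.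
by have := expf_card c; rewrite card_F4.
Qed.

Lemma F4_sq1 (c : F4) : c ^+ 2 = 1 -> c = 1.
Proof.
move=> c2; have nzc : c != 0.
  by apply: contraTneq isT => c0; move/eqP: c2; rewrite c0 expr0n eq_sym oner_eq0.
by have := F4_cube nzc; rewrite exprS c2 mulr1.
Qed.

Definition wdg (g : L4) : L6 := mkGL L6 (wedge (gmx L4 g)).

Lemma gmx_wdg g : gmx L6 (wdg g) = wedge (gmx L4 g).
Proof.
apply: mkGLE; apply: (@mulmx1_unit _ _ _ (wedge (gmx L4 g^-1%g)) _).1.
by rewrite -wedgeM gmxKV wedge1.
Qed.

Lemma wdgM : {in [set: L4] &, {morph wdg : g h / (g * h)%g}}.
Proof. by move=> g h _ _; apply: (@gmx_inj _ _ L6); rewrite gmxM !gmx_wdg gmxM wedgeM. Qed.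
Canonical wdg_morphism := Morphism wdgM.

Lemma wdg_inj : injective wdg.
Proof.
move=> g h eq_gh; apply: (@gmx_inj _ _ L4); apply: wedge_inj (gmx_unit g) (gmx_unit h) F4_sq1 _.
by rewrite -!gmx_wdg eq_gh.
Qed.

Lemma wdg_G6 g : g \in SLg -> wdg g \in G6 L6.
Proof.
rewrite SLgP => /eqP dg; apply/GO_P=> v.
by rewrite appE gmx_wdg [Q6 _]Q_wedge dg mul1r.
Qed.

(** The determinant takes three nonzero values, each on one coset of [SLg]. *)
Lemma card_SLg : #|[set: L4]| = (3 * #|SLg|)%N.
Proof.
have dn0 (g : L4) : \det (gmx L4 g) != 0.
  by have := gmx_unit g; rewrite unitmxE unitfE.
rewrite -sum1_card (partition_big (fun g => \det (gmx L4 g)) (fun c => c != 0)) => [|g _]; last exact: dn0.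
transitivity (\sum_(c : F4 | c != 0%R) #|SLg|)%N; last first.
  rewrite sum_nat_const; congr (_ * _)%N; have c1 := cardC1 (0 : F4); rewrite card_F4 in c1.
  by apply: etrans c1; apply: eq_card.
apply: eq_bigr => c nzc; rewrite sum1_card.
pose d : 'rV[F4]_4 := \row_i (if i == 0 then c else 1); pose g0 := mkGL L4 (diag_mx d).
have dd : \det (diag_mx d) = c.
  rewrite det_diag (bigD1 0) //= mxE eqxx big1 ?mulr1 // => i ni0.
  by rewrite mxE (negPf ni0).
have dg0 : \det (gmx L4 g0) = c by rewrite mkGLE // unitmxE dd unitfE.
rewrite -(card_rcoset SLg g0); apply: eq_card => g.
rewrite mem_rcoset SLgP gmxM det_mulmx.
transitivity (\det (gmx L4 g) == c); first by rewrite unfold_in in_setT.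
have dV : \det (gmx L4 g0^-1%g) * c = 1 by rewrite -dg0 -det_mulmx gmxVK det1.
apply/idP/idP => [/eqP-> | /eqP dgV]; first by rewrite mulrC dV.
by rewrite -[X in X == _]mulr1 -dV mulrA dgV mul1r.
Qed.

Hypothesis cardL4 : #|[set: L4]| = #|'GL_4[F4]|%g.

Lemma card_SL_G6 : #|G6 L6| = (2 * #|SLg|)%N.
Proof.
have := card_SLg; rewrite cardL4 card_GL // card_F4 card_G6.
do 4 rewrite big_ltn //; rewrite big_geq //.
have -> : (4 ^ 'C(4, 2) = 64 * 64)%N by rewrite -[64%N]/(4 ^ 3)%N -expnD.
rewrite -[(4 ^ 1 - 1)%N]/3%N -[(4 ^ 2 - 1)%N]/15%N -[(4 ^ 3 - 1)%N]/63%N -[(4 ^ 4 - 1)%N]/255%N.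
rewrite /=; lia.
Qed.

(** By orders, the injective image of [SLg] has index 2 in [G6]. It therefore contains the derived
    group, which also has index 2. *)
Lemma SL_isog : (SLg \isog (G6 L6)^`(1))%g.
Proof.
pose K := (wdg @* SLg)%G.
have sKG : K \subset G6 L6 by apply/subsetP=> _ /morphimP[g _ Sg ->]; apply: wdg_G6.
have isoK : SLg \isog K.
  by apply: sub_isog; rewrite ?subsetT //; apply/injmP=> g h _ _; apply: wdg_inj.
have cK := card_isog isoK; have iK : #|G6 L6 : K|%g = 2%N.
  apply/eqP; rewrite -(eqn_pmul2l (cardG_gt0 K)) Lagrange // -cK card_SL_G6 mulnC.
  exact: eqxx.
have nK := index2_normal sKG iK.
have sdK : ((G6 L6)^`(1) \subset K)%g.
  apply: der1_min (normal_norm nK) _; apply: cyclic_abelian; apply: prime_cyclic.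
  by rewrite card_quotient ?normal_norm // iK.
suff KE : K :=: (G6 L6)^`(1)%g by rewrite -KE.
apply/eqP; rewrite eq_sym eqEcard sdK /= -(leq_pmul2r (m := 2)) //.
have i6 : #|G6 L6 : (G6 L6)^`(1)|%g = 2%N := index6 L6.
have l1 := Lagrange sKG; have l2 := Lagrange (der_sub 1 (G6 L6)).
by rewrite i6 in l2; rewrite iK in l1; rewrite [X in (X <= _)%N]l1 [X in (_ <= X)%N]l2.
Qed.

Lemma mul_delta_r (z : 'M[F4]_4) (i j k l : 'I_4) : (z *m delta_mx i j) k l = z k i * (l == j)%:R.
Proof. by rewrite -(mul_delta_mx (0 : 'I_1)) mulmxA -colE mxE big_ord1 !mxE. Qed.

Lemma mul_delta_l (z : 'M[F4]_4) (i j k l : 'I_4) : (delta_mx i j *m z) k l = (k == i)%:R * z j l.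
Proof. by rewrite -(mul_delta_mx (0 : 'I_1)) -mulmxA -rowE mxE big_ord1 !mxE andbT. Qed.

(** Commuting with the matrix units forces a scalar c, and c^4 = 1 gives c = 1 in F_4: the centre of
    SL(4,4) is trivial. *)
Lemma SL_comm_scalar (z : 'M[F4]_4) : \det z = 1 ->
  (forall i j : 'I_4, i != j -> z *m delta_mx i j = delta_mx i j *m z) -> z = 1%:M.
Proof.
move=> dz zE.
have zkl i j k l : i != j -> z k i * (l == j)%:R = (k == i)%:R * z j l.
  by move=> nij; rewrite -mul_delta_r zE // mul_delta_l.
have off k i : k != i -> z k i = 0.
  move=> nki; have := zkl i k k k; rewrite eq_sym nki => /(_ isT).
  by rewrite eqxx mulr1 (negPf nki) mul0r.
have z0 i : z i i = z 0 0.
  have [-> // | ni0] := eqVneq i 0.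
  by have := zkl i 0 i 0 ni0; rewrite !eqxx mulr1 mul1r.
have zc : z = (z 0 0)%:M.
  apply/matrixP=> i j; rewrite !mxE; case: (eqVneq i j) => [<- | nij]; first by rewrite z0.
  by rewrite off.
move: dz; rewrite zc det_scalar => z4; congr (_%:M).
by apply: F4_sq1; apply: F4_sq1; rewrite -exprM.
Qed.

Lemma SLg_center : ('Z(SLg) = 1)%g.
Proof.
apply/trivgP/subsetP=> z /centerP[]; rewrite SLgP => /eqP dz cz; rewrite inE.
apply/eqP/(@gmx_inj _ _ L4); rewrite gmx1; apply: SL_comm_scalar => // i j nij.
have uM : (1%:M + delta_mx i j : 'M[F4]_4) *m (1%:M - delta_mx i j) = 1%:M.
  rewrite mulmxDl mul1mx mulmxBr mulmx1 mul_delta_mx_cond eq_sym (negPf nij) mulr0n subr0.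
  by rewrite subrK.
have uE := (mulmx1_unit uM).1; pose t := mkGL L4 (1%:M + delta_mx i j).
have t2 : \det (gmx L4 t) ^+ 2 = 1.
  rewrite expr2 -det_mulmx mkGLE // -[in RHS](det1 _ 4) -[in RHS]uM.
  congr (\det (_ *m (_ + _))); apply/matrixP=> k l; rewrite !mxE.
  by rewrite (oppc2 char2_F4).
have St : t \in SLg by rewrite SLgP (F4_sq1 t2).
have := congr1 (gmx L4) (cz t St); rewrite !gmxM mkGLE // mulmxDr mulmxDl mulmx1 mul1mx.
exact: addrI.
Qed.

Lemma PSL_isog : (SLg / 'Z(SLg) \isog (G6 L6)^`(1))%g.
Proof.
apply: isog_trans SL_isog; rewrite isog_sym; apply: quotient_isog.
  by apply: normal_norm; apply: center_normal.
apply: etrans (congr1 (fun X : {set L4} => X :&: SLg) SLg_center) _.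
exact: setI1g.
Qed.

End SpecialLinear.

End Wedge.

(** * The maximal subgroups containing x and y *)

Module MaximalSubgroups.

Import QuadraticForms WittFrames Codings IsometryGroups ModelElements PurityCertificates Derivations Purity Decomposition ThreeCycles Overgroups PlaneStabilizer FieldStructures.

Local Notation Q := Q12.
Local Notation B := (polar Q12).

Lemma ceq_mat p n A C : matr p n A = matr p n C -> ceq p n A C.
Proof.
move=> eqAC; rewrite /ceq lallE; apply/allP=> i; rewrite mem_iota add0n => /= lti.
rewrite /veq lallE; apply/allP=> j; rewrite mem_iota add0n => /= ltj.
have := congr1 (fun X : 'M_(p, n) => X (Ordinal lti) (Ordinal ltj)) eqAC.
by rewrite !mxE => /b2F_inj/eqP.
Qed.

Lemma matP p n A C : reflect (matr p n A = matr p n C) (ceq p n A C).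
Proof. by apply: (iffP idP) => [|/ceq_mat //]; apply: ceqP. Qed.

Definition omr (e : bool) := if e then madd (madd thr etar) (madd (idl 12) epsr) else madd thr etar.

Lemma om_code e : om e = mat 12 (omr (e != 0)).
Proof.
have := om0E; rewrite /om scale0r addr0 => ->.
case: (F2_cases e) => ->; first by rewrite eqxx scale0r addr0.
by rewrite oner_eq0 scale1r delE -mat_id cmx !mat_add.
Qed.

Definition tw_code (e : bool) A := ceq 12 12 (mmul (omr e) A) (mmul A (omr e)) ||
  ceq 12 12 (mmul (omr e) A) (madd (mmul A (omr e)) A).

Lemma size_omr e : size (omr e) = 12%N. Proof. by case: e; vm_compute. Qed.

Section Maximality.

Variable L : GLmodel 'F_2 11.
Local Notation G := (G12 L).
Local Notation S := (G^`(1))%g.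
Local Notation gx := (gx L).
Local Notation gy := (gy L).
Local Notation gf := (gf L).
Local Notation gmx := (gmx L).
Local Notation centE := (centE L).
Local Notation twN := (twN L).
Local Notation M1 := (M1 L).

Lemma twN_code g A e : gmx g = mat 12 A -> size A = 12%N -> g \in G ->
  (g \in twN e) = tw_code (e != 0) A.
Proof.
move=> gA sA Gg; have sO := size_omr (e != 0); apply/twNP/idP => [[_ [c]] | /orP[] /matP tA].
- rewrite /tw gA om_code !mat_mul // /tw_code; case: (F2_cases c) => ->.
    by rewrite scale0r addr0 => /matP->.
  by rewrite scale1r mat_add => /matP->; rewrite orbT.
- by split=> //; exists 0; rewrite /tw scale0r addr0 gA om_code !mat_mul.
- by split=> //; exists 1; rewrite /tw scale1r gA om_code !mat_mul // mat_add.
Qed.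

Lemma centE_code g A : gmx g = mat 12 A -> size A = 12%N -> g \in G ->
  (g \in centE) = ceq 12 12 (mmul epsr A) (mmul A epsr).
Proof.
move=> gA sA Gg; apply/centEP/matP => [[_] | cA].
  by rewrite gA cmx !mat_mul.
by rewrite gA cmx !mat_mul.
Qed.

Lemma G_even (g h : L) : g \in G -> h \in G -> (g * h \in S)%g = ((g \in S) == (h \in S)).
Proof. by move=> Gg Gh; rewrite (index2_even (der_sub 1 G) (index12 L)). Qed.

(** An element of odd order is a square, and squares are even. *)
Lemma odd_even (g : L) n : g \in G -> (g ^+ n.*2.+1 = 1)%g -> g \in S.
Proof.
move=> Gg gn; have -> : g = (g ^+ n.+1 * g ^+ n.+1)%g.
  by rewrite -expgD addnn doubleS expgS gn mulg1.
by have Gn := groupX n.+1 Gg; rewrite (G_even Gn Gn) eqxx.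
Qed.

Lemma gxS : gx \in S. Proof. exact: (odd_even (n := 8)) (gxG L) (x17 L). Qed.
Lemma gyS : gy \in S. Proof. exact: (odd_even (n := 2)) (gyG L) (y5 L). Qed.

Lemma reflS (a b : 'rV_12) : Q a = 1 -> Q b = 1 -> (refl Q L a * refl Q L b)%g \in S.
Proof.
move=> Qa Qb; have [Ga Gb] := (refl_in_G L Qa, refl_in_G L Qb).
have od c : Q c = 1 -> (refl Q L c \in S) = false.
  move=> Qc; rewrite der12 inE refl_in_G //=.
  by apply/negbTE; rewrite negbK; apply: (rk1_refl1 char2_F2 q12); rewrite Qc oner_eq0.
by rewrite G_even // !od.
Qed.

(** Two test elements: [g3] lies in [M1] but in neither field-structure group, and [gw] lies in
    [twN 0] but neither in [twN 1] nor in [centE]. *)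
Definition g3 : L := locked (refl Q L a01 * refl Q L a12)%g.
Definition g3r := madd (idl 12) (mmul (mmul JEr K3) E4l).
Definition gw : L := mkGL L (mat 12 (map (bl 12) [:: 1; 7; 4; 8; 16; 37; 2271; 133; 2463; 517; 1029; 2048])).
Definition gwr := map (bl 12) [:: 1; 7; 4; 8; 16; 37; 2271; 133; 2463; 517; 1029; 2048].

Lemma gw_ok : isom_ok gwr gwr. Proof. by vm_compute. Qed.

Lemma Q_a01 : Q a01 = 1. Proof. exact: (aij_Q (i := 0) (j := 1)). Qed.
Lemma Q_a12 : Q a12 = 1. Proof. exact: (aij_Q (i := 1) (j := 2)). Qed.

Lemma g3S : g3 \in S. Proof. by rewrite /g3 -lock; apply: reflS Q_a01 Q_a12. Qed.
Lemma g3G : g3 \in G. Proof. exact: subsetP (der_sub 1 G) _ g3S. Qed.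

Lemma g3E : gmx g3 = mat 12 g3r.
Proof. rewrite /g3 -lock refl_K3 /g3r !cmx -mat_id mat_mul //. rewrite mat_mul //. by rewrite mat_add. Qed.

Lemma gwE : gmx gw = mat 12 gwr. Proof. by have [] := isom_okP L gw_ok. Qed.
Lemma gwG : gw \in G. Proof. by have [] := isom_okP L gw_ok. Qed.

Lemma g3_centE : g3 \in centE.
Proof. by rewrite (centE_code g3E) ?g3G //; vm_compute. Qed.

Lemma g3_M1 : g3 \in M1. Proof. by rewrite inE g3_centE g3S. Qed.

Lemma g3_twN e : g3 \notin twN e.
Proof. by rewrite (twN_code _ g3E) ?g3G //; case: (e != 0); vm_compute. Qed.

Lemma gw_centE : gw \notin centE.
Proof. by rewrite (centE_code gwE) ?gwG //; vm_compute. Qed.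

Lemma gw_twN e : (gw \in twN e) = (e == 0).
Proof. by rewrite (twN_code _ gwE) ?gwG //; case: (e == 0); vm_compute. Qed.

Lemma gwJ_twN : (gw ^ g3)%g \notin twN 0.
Proof.
have G3 := groupVr g3G; have Gc : (gw ^ g3)%g \in G by rewrite groupJ ?gwG ?g3G.
have gV : gmx g3^-1%g = mat 12 (mmul g3r g3r).
  have e : (g3 * g3 * g3 = 1)%g.
    by apply: (@gmx_inj _ _ L); rewrite !gmxM g3E gmx1 -mat_id !mat_mul //; apply: ceqP; vm_compute.
  have -> : (g3^-1 = g3 * g3)%g by apply/eqP; rewrite eq_invg_mul mulgA e.
  by rewrite gmxM g3E mat_mul.
have gJ : gmx (gw ^ g3)%g = mat 12 (mmul (mmul (mmul g3r g3r) gwr) g3r).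
  by rewrite conjgE !gmxM gV g3E gwE !mat_mul.
by rewrite (twN_code _ gJ) //; vm_compute.
Qed.

Lemma x_tw : {subset [:: gx; gy] <= centE}.
Proof.
move=> g; rewrite !inE => /orP[] /eqP->.
  by rewrite (centE_code (gxE L)) ?gxG //; vm_compute.
by rewrite (centE_code (gyE L)) ?gyG //; vm_compute.
Qed.

Lemma gx_twN e : gx \in twN e.
Proof. by rewrite (twN_code _ (gxE L)) ?gxG //; case: (e != 0); vm_compute. Qed.
Lemma gy_twN e : gy \in twN e.
Proof. by rewrite (twN_code _ (gyE L)) ?gyG //; case: (e != 0); vm_compute. Qed.

Lemma gf_odd : gf \notin S.
Proof.
rewrite der12 inE gfG /= /rk1 gfE.
pose U := map (bl 3) [:: 0;1;2;0;0;0;4;3;2;0;0;0]; pose V := map (bl 12) [:: 131;1;263].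
pose A := map (bl 12) [:: 4;6;66]; pose C := map (bl 3) [:: 1;2;4;0;0;0;0;0;0;0;0;0].
have -> : mat 12 Fr - 1%:M = matr 12 3 U *m matr 3 12 V.
  by apply/eqP; rewrite subr_eq -mat_id mat_mul // mat_add; apply/eqP/ceqP; vm_compute.
suff -> : \rank (matr 12 3 U *m matr 3 12 V) = 3%N by [].
apply/eqP; rewrite eqn_leq (leq_trans (mxrankM_maxl _ _) (rank_leq_col _)) /=.
have r1 : matr 3 12 A *m (matr 12 3 U *m matr 3 12 V) *m matr 12 3 C = 1%:M.
  by rewrite -mat_id !mat_mul //; apply: ceqP; vm_compute.
rewrite -[X in (X <= _)%N](mxrank1 'F_2 3) -r1.
by apply: leq_trans (mxrankM_maxl _ _) (mxrankM_maxr _ _).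
Qed.

(** Conjugation by [gf] squares y, so on U it replaces theta by theta + 1 and leaves the structure
    on W alone. Up to adding 1, which is the conjugation of F_4, this exchanges the two
    structures. *)
Lemma om_gf e : om e *m gmx gf = gmx gf *m (om (1 + e) + 1%:M).
Proof.
rewrite !om_code gfE -mat_id mat_add.
by case: (F2_cases e) => ->; rewrite !mat_mul //; apply: ceqP; vm_compute.
Qed.

Lemma twN_conj e : twN (1 + e) :=: (twN e :^ gf)%g.
Proof.
have h e' : (twN e' :^ gf \subset twN (1 + e'))%g.
  apply/subsetP=> _ /imsetP[k /twNP[Gk [c tk]] ->]; apply/twNP; rewrite groupJ ?gfG //.
  split=> //; exists c; set T := om (1 + e') + 1%:M.
  have tf : tw (om e') T 0 (gmx gf) by rewrite /tw om_gf scale0r addr0.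
  have tfV : tw T (om e') 0 (gmx gf^-1%g).
    have -> : T = gmx gf^-1%g *m (om e' *m gmx gf) by rewrite om_gf mulmxA gmxVK mul1mx.
    by rewrite /tw scale0r addr0 -!mulmxA gmxKV mulmx1.
  have := tw_mul (tw_mul tfV tk) tf; rewrite add0r addr0 -!gmxM -mulgA -conjgE.
  rewrite /tw /T mulmxDl mulmxDr mul1mx mulmx1 addrAC; exact: addIr.
have c2 : (1 + (1 + e) = e)%R by rewrite addrA (addc2 char2_F2) add0r.
apply/eqP; rewrite eq_sym eqEcard h /= cardJg.
by have := subset_leq_card (h (1 + e)); rewrite cardJg c2.
Qed.

Variable L6 : GLmodel Defs.F4 5.

Lemma twNS e : twN e \subset S.
Proof.
case: (F2_cases e) => ->; first exact: (twN_even L L6).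
rewrite -[1]addr0 twN_conj; apply/subsetP=> _ /imsetP[k Mk ->].
by rewrite memJ_norm ?(subsetP (twN_even L L6)) // (subsetP (der_norm 1 G)) ?gfG.
Qed.

Lemma coreP (H : {group L}) : H \subset G -> gx \in H -> gy \in H ->
  [\/ H \subset centE, exists e, H \subset twN e | S \subset H].
Proof.
move=> sHG Hx Hy; have [cE | [e tE] | sSH] := core sHG Hx Hy.
- by apply: Or31; apply/subsetP=> k Hk; apply/centEP; rewrite cE // (subsetP sHG).
- by apply: Or32; exists e; apply/subsetP=> k Hk; apply/twNP; rewrite (subsetP sHG) //; split=> //; apply: tE.
- exact: Or33.
Qed.

Lemma gx_M1 : gx \in M1. Proof. by rewrite inE gxS x_tw // inE eqxx. Qed.
Lemma gy_M1 : gy \in M1. Proof. by rewrite inE gyS x_tw // !inE eqxx orbT. Qed.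
Lemma M1S : M1 \subset S. Proof. exact: subsetIr. Qed.

(** A proper overgroup inside S falls under [coreP]: it stabilises U, hence equals [M1], or it would
    be a field-structure group containing [g3]. *)
Lemma M1_max : maximal M1 S.
Proof.
have sSG : S \subset G := der_sub 1 G.
apply/maxgroupP; split=> [|K /andP[sKS nSK] sMK].
  rewrite properE M1S; apply/negP=> /subsetP/(_ gw); rewrite (subsetP (twNS 0)) ?gw_twN // => /(_ isT).
  by rewrite inE (negPf gw_centE).
apply/eqP; rewrite eqEsubset sMK andbT.
have [cK | [e tK] | ] := coreP (subset_trans sKS sSG) (subsetP sMK _ gx_M1) (subsetP sMK _ gy_M1).
- by rewrite subsetI cK sKS.
- by have := g3_twN e; rewrite (subsetP tK) // (subsetP sMK) ?g3_M1.
- by rewrite (negPf nSK).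
Qed.

Lemma twN_sub e e' : twN e \subset twN e' -> e = e'.
Proof.
move=> sub; have [//|ne] := eqVneq e e'; have eE : e' = 1 + e.
  by move: ne; case: (F2_cases e) => ->; case: (F2_cases e') => ->; rewrite ?eqxx // => _; apply: val_inj.
have eq : twN e :=: twN e'.
  by apply/eqP; rewrite eqEcard sub /= eE twN_conj cardJg leqnn.
have := gw_twN e; rewrite eq gw_twN eE.
by case: (F2_cases e) => ->; rewrite ?addr0 ?(addc2 char2_F2) ?oner_eq0 eqxx.
Qed.

Lemma twN_centE e : ~~ (twN e \subset centE).
Proof.
case: (F2_cases e) => ->; first by apply/subsetPn; exists gw; rewrite ?gw_twN // gw_centE.
rewrite -[1]addr0 twN_conj; apply/subsetPn; exists (gw ^ gf)%g.
  by rewrite memJ_conjg gw_twN.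
by rewrite groupJr ?gw_centE //; apply/centEP; rewrite gfG f_eps.
Qed.

Lemma twN_max e : maximal (twN e) S.
Proof.
have sSG : S \subset G := der_sub 1 G.
apply/maxgroupP; split=> [|K /andP[sKS nSK] sMK].
  rewrite properE twNS; apply/negP=> sST; have := g3_twN e; by rewrite (subsetP sST) ?g3S.
apply/eqP; rewrite eqEsubset sMK andbT.
have [cK | [e' tK] | ] := coreP (subset_trans sKS sSG) (subsetP sMK _ (gx_twN e)) (subsetP sMK _ (gy_twN e)).
- by have := twN_centE e; rewrite (subset_trans sMK cK).
- by rewrite (twN_sub (subset_trans sMK tK)).
- by rewrite (negPf nSK).
Qed.

Lemma maxsubs_model : [set M : {group L} | maximal M S & (gx \in M) && (gy \in M)] =
  [set M1; twN 0; twN 1].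
Proof.
have sSG : S \subset G := der_sub 1 G.
apply/setP=> M; rewrite !inE -orbA; apply/andP/or3P => [[maxM /andP[Mx My]] | ].
  have [sMS nSM] := andP (maxgroupp maxM).
  have eqM (K : {group L}) : maximal K S -> M \subset K -> M = K.
    move=> maxK sMK; apply/val_inj/eqP; rewrite /= eqEsubset sMK /=.
    by have [_ ->] := maxgroupP maxM; rewrite ?(maxgroupp maxK).
  have [cM | [e tM] | ] := coreP (subset_trans sMS sSG) Mx My.
  - by apply: Or31; apply/eqP/eqM; [exact: M1_max | rewrite subsetI cM].
  - have := eqM _ (twN_max e) tM; case: (F2_cases e) => -> ->; [exact: Or32 | exact: Or33].
  - by rewrite (negPf nSM).
case=> /eqP->; rewrite ?M1_max ?twN_max ?gx_M1 ?gy_M1 ?gx_twN ?gy_twN //.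
Qed.

(** The normaliser falls under [coreP] as well. It cannot contain S, because [g3] moves [gw] out of
    [twN 0]. *)
Lemma twN_self : 'N_G(twN 0)%g \subset twN 0.
Proof.
pose H := ('N_G(twN 0))%G; have sMH : twN 0 \subset H.
  by rewrite subsetI normG (subset_trans (twNS 0)) ?der_sub.
have [cH | [e tH] | sSH] := coreP (subsetIl G 'N(twN 0)%g : H \subset G) (subsetP sMH _ (gx_twN 0)) (subsetP sMH _ (gy_twN 0)).
- by have := twN_centE 0; rewrite (subset_trans sMH cH).
- by rewrite {2}(twN_sub (subset_trans sMH tH)).
- have := subsetP sSH _ g3S; rewrite inE => /andP[_ n3].
  by have := gwJ_twN; rewrite memJ_norm // gw_twN eqxx.
Qed.

(** Otherwise [gf] times the inverse of [x] would normalise [twN 0], hence lie in it and in S,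
    although [gf] is odd. *)
Lemma twN_not_conj x : x \in S -> twN 1 :=: (twN 0 :^ x)%g -> False.
Proof.
move=> Sx; rewrite -[1]addr0 twN_conj => eqf.
have Gx : x \in G := subsetP (der_sub 1 G) _ Sx.
have N : (gf * x^-1)%g \in 'N_G(twN 0)%g.
  by rewrite inE groupM ?groupV ?gfG //=; apply/normP; rewrite conjsgM eqf conjsgK.
have := subsetP (twNS 0) _ (subsetP twN_self _ N).
by rewrite groupMr ?groupV // (negPf gf_odd).
Qed.

(** The field-structure groups are properly contained in S, so they are not maximal in G; a subgroup
    containing S and an odd element is all of G. *)
Lemma maxsubs'_model : [set M : {group L} | (maximal M G && ((gx \in M) && (gy \in M))) & M :!=: S] =
  [set centE].
Proof.
have cEG : centE \subset G by apply/subsetP=> k /centEP[].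
have cx : gx \in centE by rewrite x_tw // inE eqxx.
have cy : gy \in centE by rewrite x_tw // !inE eqxx orbT.
have SG : S \proper G by rewrite properE der_sub; apply/subsetPn; exists gf; rewrite ?gfG ?gf_odd.
have tG e : twN e \proper S := maxgroupp (twN_max e).
have a1G : refl Q L a01 \in G by rewrite refl_in_G ?Q_a01.
have gfc : gf \in centE by apply/centEP; rewrite gfG f_eps.
have maxc : maximal centE G.
  apply/maxgroupP; split=> [|K /andP[sKG nGK] scK].
    rewrite properE cEG; apply/subsetPn; exists gw; [exact: gwG | exact: gw_centE].
  apply/eqP; rewrite eqEsubset scK andbT.
  have [// | [e tK] | sSK] := coreP sKG (subsetP scK _ cx) (subsetP scK _ cy).
    by have := gf_odd; rewrite (subsetP (twNS e)) // (subsetP tK) // (subsetP scK).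
  case/negP: nGK; apply/subsetP=> g Gg; have Kf := subsetP scK _ gfc.
  have [Sg | nSg] := boolP (g \in S); first exact: (subsetP sSK).
  have Sgf : (g * gf)%g \in S by rewrite G_even ?gfG // (negPf nSg) (negPf gf_odd).
  by rewrite -(groupMr _ Kf) (subsetP sSK).
apply/setP=> M; rewrite !inE; apply/andP/eqP => [[/andP[maxM /andP[Mx My]] nMS] | ->]; last first.
  by rewrite maxc cx cy; split=> //; apply: contraNneq gf_odd => <-.
have [sMG nGM] := andP (maxgroupp maxM).
have [cM | [e tM] | sSM] := coreP sMG Mx My.
- apply/val_inj/eqP; rewrite /= eqEsubset cM /=.
  by have [_ ->] := maxgroupP maxM; rewrite ?(maxgroupp maxc).
- have [_ maxM'] := maxgroupP maxM; have := maxM' (G^`(1))%G SG (subset_trans tM (twNS e)).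
  by move=> eS; case/eqP: nMS; rewrite -eS.
- case/negP: nGM; have [sMS | /subsetPn[g Mg nSg]] := boolP (M \subset S).
    by case/eqP: nMS; apply/eqP; rewrite eqEsubset sMS.
  have Gg := subsetP sMG _ Mg.
  apply/subsetP=> h Gh; have [Sh | nSh] := boolP (h \in S); first exact: (subsetP sSM).
  have Shg : (h * g)%g \in S by rewrite G_even // (negPf nSg) (negPf nSh).
  by rewrite -(groupMr _ Mg) (subsetP sSM).
Qed.

End Maximality.

End MaximalSubgroups.

(** * Permutation characters as counts of conjugating elements *)

Module PermutationCharacters.

Import QuadraticForms WittFrames Codings IsometryGroups ModelElements PurityCertificates Derivations Purity Decomposition ThreeCycles Overgroups PlaneStabilizer FieldStructures MaximalSubgroups.

Local Notation Q := Q12.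
Local Notation B := (polar Q12).

Section PermutationCharacter.

Variable gT : finGroupType.
Implicit Types (H M : {group gT}) (g x : gT).

Definition conj_in H M g : {set gT} := [set x in H | (g ^ x^-1)%g \in M].

Lemma conj_inP M g x : ((g ^ x^-1)%g \in M) = ((M :* x) :* g == M :* x)%g.
Proof.
rewrite conjgE invgK -rcosetM; apply/idP/eqP => [Mg | e].
  by apply/rcoset_eqP; rewrite mem_rcoset -mulgA.
by rewrite mulgA -mem_rcoset -e rcoset_refl.
Qed.

(** An element x conjugates g into M in this sense exactly when g fixes the coset M x; such x fill
    whole cosets of [M]. *)
Lemma card_conj_in H M g : M \subset H -> g \in H ->
  (permchar H M g * #|M|)%N = #|conj_in H M g|.
Proof.
move=> sMH Hg; rewrite -[RHS]sum1_card.
rewrite (partition_big (fun x => (M :* x)%g) (mem 'Fix_(rcosets M H | 'Rs)[g]%g)) /=; last first.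
  move=> x; rewrite inE => /andP[Hx]; rewrite conj_inP => /eqP e.
  apply/setIP; split; first by apply/rcosetsP; exists x.
  by apply/afix1P; rewrite /= rcosetE.
rewrite -[LHS]sum_nat_const; apply: eq_bigr => C; rewrite inE => /andP[/rcosetsP[y Hy ->] /afix1P].
rewrite /= rcosetE => e; rewrite sum1_card -(card_rcoset M y); apply: eq_card => x.
rewrite [RHS]unfold_in inE conj_inP; apply/idP/andP => [My | [_ /eqP <-]]; last exact: rcoset_refl.
have xy := rcoset_eqP My; rewrite xy e !eqxx andbT; split=> //.
by move: My; rewrite mem_rcoset => /(subsetP sMH); rewrite groupMr ?groupV.
Qed.

Lemma permchar_ratio H M g : M \subset H -> g \in H ->
  (permchar H M g)%:R / (permchar H M 1%g)%:R = #|conj_in H M g|%:R / #|H|%:R :> rat.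
Proof.
move=> sMH Hg; have cM : #|M|%:R != 0 :> rat by rewrite pnatr_eq0 -lt0n cardG_gt0.
have -> : #|H| = #|conj_in H M 1%g|.
  by apply: eq_card => x; rewrite inE conj1g group1 andbT.
rewrite -!card_conj_in ?group1 // !natrM invfM mulrACA divff // mulr1 //.
Qed.

End PermutationCharacter.

Section Sigma.

Variable L : GLmodel 'F_2 11.
Variable L6 : GLmodel Defs.F4 5.
Local Notation G := (G12 L).
Local Notation S := (G^`(1))%g.
Local Notation gf := (gf L).
Local Notation centE := (centE L).
Local Notation twN := (twN L).
Local Notation M1 := (M1 L).

(** Conjugators are counted in the full isometry group, where Witt's theorem gives the orbits; the
    counts for S follow by [NE_half] and [NW_split]. *)
Definition NE g := #|conj_in G centE g|.
Definition NW g := #|conj_in G (twN 0) g|.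

Lemma card_GS : #|G| = (2 * #|S|)%N.
Proof.
by have i2 : #|G : S|%g = 2%N := index12 L; rewrite -(Lagrange (der_sub 1 G)) i2 mulnC.
Qed.

Lemma split_G (P : pred L) : #|[set x in G | P x]| =
  (#|[set x in S | P x]| + #|[set x in S | P (gf * x)%g]|)%N.
Proof.
have sSG : S \subset G := der_sub 1 G.
rewrite -(cardsID S [set x in G | P x]); congr (_ + _)%N.
  apply: eq_card => x; rewrite !inE; apply/idP/idP => [/andP[/andP[_ ->] ->] // | /andP[Sx ->]].
  by rewrite Sx (subsetP sSG).
rewrite -[RHS](card_imset _ (mulgI gf)); apply: eq_card => x; rewrite !inE.
apply/idP/imsetP => [/and3P[nSx Gx Px] | [y]].
  exists (gf^-1 * x)%g; last by rewrite mulKVg.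
  by rewrite inE mulKVg Px G_even ?groupV ?gfG // (negPf nSx) ?groupV (negPf (gf_odd L)).
rewrite inE => /andP[Sy Py] ->; have Gy := subsetP sSG _ Sy.
by rewrite Py G_even ?gfG // Sy (negPf (gf_odd L)) groupM ?gfG.
Qed.

(** The odd element [gf] commutes with [eps], so both cosets of S contribute equally. *)
Lemma NE_half g : g \in S -> (NE g = 2 * #|conj_in [group of S] M1 g|)%N.
Proof.
move=> Sg; rewrite /NE /conj_in split_G mul2n -addnn.
have h x : x \in S -> ((g ^ x^-1)%g \in centE) = ((g ^ x^-1)%g \in M1).
  by move=> Sx; rewrite [RHS]inE (_ : (g ^ x^-1)%g \in S) ?andbT // groupJ ?groupV.
congr (_ + _)%N; apply: eq_card => x; rewrite !inE /=; case Sx: (x \in S) => //=.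
  by rewrite [LHS]h // [LHS]inE.
rewrite invMg conjgM groupJr; first by rewrite [LHS]h // [LHS]inE.
rewrite groupV; by apply/centEP; rewrite gfG f_eps.
Qed.

(** On the odd coset, conjugation by [gf] turns [twN 0] into [twN 1]. *)
Lemma NW_split g : (NW g = #|conj_in [group of S] (twN 0%R) g| + #|conj_in [group of S] (twN 1%R) g|)%N.
Proof.
rewrite /NW /conj_in split_G; congr (_ + _)%N; apply: eq_card => x; rewrite !inE //=.
have e1 : twN 1 :=: (twN 0 :^ gf)%g by rewrite -(twN_conj L 0) addr0.
by rewrite e1 mem_conjg invMg conjgM.
Qed.

Lemma model_sigma g : g \in S ->
  \sum_(M in [set M1; twN 0; twN 1]) (permchar S M g)%:R / (permchar S M 1%g)%:R =
  (NE g + 2 * NW g)%:R / #|G|%:R :> rat.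
Proof.
move=> Sg.
have d12 e : M1 != twN e.
  by apply/eqP=> e1; have := g3_twN L e; rewrite -e1 g3_M1.
have d23 : twN 0 != twN 1.
  apply/eqP=> e1; have := gw_twN L 1; rewrite -e1 gw_twN eqxx.
  by move/esym; rewrite oner_eq0.
rewrite -setUA big_setU1 ?inE ?negb_or ?d12 //= big_setU1 ?inE //= big_set1.
rewrite !(@permchar_ratio _ [group of S]) ?M1S ?twNS //.
rewrite NE_half // NW_split -mulnDr card_GS !natrM invfM mulrACA divff ?mul1r ?pnatr_eq0 //.
by rewrite -!mulrDl !natrD addrA.
Qed.

Lemma model_sigma' g : g \in G ->
  \sum_(M in [set centE]) (permchar G M g)%:R / (permchar G M 1%g)%:R = (NE g)%:R / #|G|%:R :> rat.
Proof.
move=> Gg; rewrite big_set1 permchar_ratio //.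
by apply/subsetP=> x /centEP[].
Qed.

(** This and the next lemma reduce the upper bounds to elements of prime order. *)
Lemma NE_pow g n : (NE g <= NE (g ^+ n)%g)%N.
Proof.
apply: subset_leq_card; apply/subsetP=> x; rewrite !inE => /andP[-> h] /=.
by rewrite conjXg groupX.
Qed.

Lemma NW_pow g n : (NW g <= NW (g ^+ n)%g)%N.
Proof.
apply: subset_leq_card; apply/subsetP=> x; rewrite !inE => /andP[-> h] /=.
by rewrite conjXg groupX.
Qed.

End Sigma.

End PermutationCharacters.

(** * Bounding the conjugates that stabilise U, by images of its five singular vectors *)

Module Pentads.

Import QuadraticForms WittFrames Codings IsometryGroups ModelElements PurityCertificates Derivations Purity Decomposition ThreeCycles Overgroups PlaneStabilizer FieldStructures MaximalSubgroups PermutationCharacters.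

Local Notation Q := Q12.
Local Notation B := (polar Q12).

Lemma card_fib (I T : finType) (X : {set I}) (f : I -> T) (A : {set T}) k n :
  (forall x, x \in X -> f x \in A) -> (#|A| <= k)%N ->
  (forall p, #|[set x in X | f x == p]| <= n)%N -> (#|X| <= k * n)%N.
Proof.
move=> fA cA fib; apply: leq_trans (leq_mul cA (leqnn n)).
rewrite -[#|X|]sum1_card (partition_big f (mem A)) //= -sum_nat_const.
apply: leq_sum => p _; apply: leq_trans (fib p); rewrite sum1_card; apply: subset_leq_card.
by apply/subsetP=> x; rewrite unfold_in inE.
Qed.

Lemma card_cover (I : finType) (J : eqType) (X : {set I}) (F : J -> {set I}) (s : seq J) :
  (forall x, x \in X -> exists2 j, j \in s & x \in F j) -> (#|X| <= \sum_(j <- s) #|F j|)%N.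
Proof.
elim: s X => [|j s IHs] X cov.
  by rewrite big_nil leqn0 cards_eq0 -subset0; apply/subsetP=> x /cov[].
rewrite big_cons -(cardsID (F j) X) leq_add ?subset_leq_card ?subsetIr //.
apply: IHs => x; rewrite inE => /andP[nFx /cov[j']].
by rewrite inE => /orP[/eqP-> Fx | sj' Fx]; [rewrite Fx in nFx | exists j'].
Qed.

Lemma card_half (T : {set 'rV['F_2]_12}) w1 (phi : 'rV['F_2]_12 -> 'F_2) c :
  {in T, forall w, (w + w1 \in T) && (phi (w + w1) == phi w + 1)} ->
  (2 * #|[set w in T | phi w == c]|)%N = #|T|.
Proof.
move=> sh; rewrite -(cardsID [set w | phi w == c] T) mul2n -addnn.
have -> : T :&: [set w | phi w == c] = [set w in T | phi w == c] by apply/setP=> w; rewrite !inE.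
congr (_ + _)%N; have inj : injective (fun w : 'rV['F_2]_12 => w + w1) by apply: addIr.
rewrite -[LHS](card_imset _ inj); apply: eq_card => w; rewrite !inE; apply/imsetP/andP => [[v] | [nw Tw]].
  rewrite inE => /andP[Tv /eqP pv] ->; have /andP[-> /eqP->] := sh v Tv; split=> //.
  by rewrite pv -subr_eq0 addrC addKr oner_eq0.
exists (w + w1); last by rewrite -addrA addV addr0.
have /andP[Tw1 /eqP pw] := sh w Tw; rewrite inE Tw1 pw /=.
by move: nw; case: (F2_cases (phi w)) => ->; case: (F2_cases c) => ->; rewrite ?eqxx // => _; apply/eqP; apply: val_inj.
Qed.

Lemma card_codes (P : pred 'rV['F_2]_12) p : (forall l, size l = 12%N -> P (vcb 12 l) = p l) ->
  #|[set v | P v]| = count p (allv [:: false; true] 12).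
Proof.
move=> Pp; rewrite -size_filter.
have inj : {in allv [:: false; true] 12 &, injective (vcb 12)} := vec_inj codingF2 (n := 12).
have u : uniq [seq vcb 12 l | l <- allv [:: false; true] 12 & p l].
  rewrite map_inj_in_uniq ?filter_uniq ?(uniq_allv codingF2) // => a b.
  by rewrite !mem_filter => /andP[_ aa] /andP[_ bb]; apply: inj.
rewrite -(size_map (vcb 12)) -(card_uniqP u); apply: eq_card => v; rewrite inE.
apply/idP/mapP => [Pv | [l]]; last first.
  by rewrite mem_filter (mem_allvs codingF2) => /andP[pl /eqP sl] ->; rewrite Pp.
have [l sl lv] := vcb_surj v; exists l => //.
by rewrite mem_filter -Pp // lv Pv mem_allvb.
Qed.

Definition sing12 := [set v : 'rV['F_2]_12 | (v != 0) && (Q v == 0)].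

Lemma card_sing12 : #|sing12| = 2079%N.
Proof.
have z l : size l = 12%N -> (vcb 12 l != 0) = (l != nseq 12 false).
  move=> sl; congr (~~ _); apply/eqP/eqP => [e | ->]; last exact: (vec_nseq codingF2 12 12).
  by apply: (vcb_inj (n := 12)); rewrite // e (vec_nseq codingF2 12 12).
rewrite (card_codes (p := fun l => if qp 6 l then false else l != nseq 12 false)); first by apply/eqP; vm_compute.
by move=> l sl; rewrite z // Q12E; case: (qp 6 l); rewrite ?andbF ?andbT.
Qed.

Lemma polar12_nd p : p != 0 -> exists w, B w p = 1.
Proof.
move=> nzp; have /existsP[w /eqP Bw] : [exists w, B w p == 1].
  apply: contraNT nzp => /existsPn no; apply/eqP; apply: (polar_nd q12) => w.
  by have := no w; rewrite F2_neq1 polar12C => /eqP.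
by exists w.
Qed.

Lemma sing_partner p : p \in sing12 -> (#|[set w | (Q w == 0%R) && (B w p == 1%R)]| <= 1024)%N.
Proof.
rewrite inE => /andP[nzp /eqP Qp]; have [w1 Bw] := polar12_nd nzp.
have h1 := @card_half setT w1 (fun w => B w p) 1.
have h2 := @card_half [set w in setT | B w p == 1] p Q 0.
rewrite -(leq_pmul2l (m := 4)) //.
have -> : (4 * #|[set w | (Q w == 0%R) && (B w p == 1%R)]| = 2 * (2 * #|[set w in [set w in setT | B w p == 1%R] | Q w == 0%R]|))%N.
  rewrite mulnA; congr (_ * _)%N; apply: eq_card => w; rewrite !inE andbC //.
rewrite h2 ?h1.
- by rewrite cardsT card_mx card_Fp.
- by move=> w _; rewrite in_setT polar12Dl Bw eqxx.
move=> w; rewrite !inE /= => /eqP Bwp.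
by rewrite polar12Dl (polarvv char2_F2 q12) Bwp addr0 eqxx QD Qp Bwp addr0 eqxx.
Qed.

Section Pentads.

Variable L : GLmodel 'F_2 11.
Local Notation G := (G12 L).
Local Notation centE := (centE L).

Definition pent_fr := take 4 El.
Definition stabE : {set L} := @fixer _ _ Q12 L (map (vcb 12) (catrev pent_fr [::])).

Lemma pent_witt : witt_ok false [:: false; true] addb andb 11 (qp 6) [::] pent_fr.
Proof. vm_cast_no_check (erefl true). Qed.

Lemma pent_sizes :
  witt_sizes false [:: false; true] addb andb 11 (qp 6) [::] pent_fr = [:: 2079; 1024; 496; 240]%N.
Proof. apply/eqP; vm_cast_no_check (erefl true). Qed.

Lemma pent_all : all [in allv [:: false; true] 12] pent_fr.
Proof.
have sz : all (fun l => size l == 12) pent_fr by [].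
by apply/allP=> l lp; apply: mem_allvb; apply/eqP; move: l lp; apply/allP.
Qed.

Lemma card_stabE : #|G| = (2079 * (1024 * (496 * (240 * #|stabE|))))%N.
Proof.
have h := card_fixer codingF2 char2_F2 q12 Q12E L pent_witt pent_all.
by rewrite pent_sizes /= fixer_nil in h; rewrite h.
Qed.

Lemma sum_ev : ev 4 = ev 0 + ev 1 + ev 2 + ev 3.
Proof. by rewrite !evE -!vcbD; apply: veqP; vm_compute. Qed.

Lemma stabE_in h : h \in G -> (forall i, (i < 4)%N -> app (ev i) h = ev i) -> h \in stabE.
Proof.
move=> Gh fx; apply/fixerP; split=> // v /mapP[l]; rewrite catrevE cats0 mem_rev => lp ->.
have [i lti <-] : exists2 i, (i < 4)%N & nth [::] pent_fr i = l.
  by exists (index l pent_fr); rewrite ?nth_index // -[4%N]/(size pent_fr) index_mem.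
have := fx i lti; rewrite evE modn_small; last exact: leq_trans lti _.
by rewrite /pent_fr nth_take.
Qed.

Lemma four_fix (h : L) i0 : (forall i, (i < 5)%N -> i != i0 -> app (ev i) h = ev i) ->
  forall i, (i < 5)%N -> app (ev i) h = ev i.
Proof.
move=> fx i lti; have [-> | ] := eqVneq i i0; last exact: fx.
have s5 := sum_ev.
have [ge5 | lt5] := leqP 5 i0.
  have {}fx j : (j < 5)%N -> app (ev j) h = ev j.
    by move=> ltj; apply: fx => //; apply: contraTneq ltj => ->; rewrite -leqNgt.
  by rewrite -ev_modn fx // ltn_mod.
have e0 : ev 0 = ev 1 + ev 2 + ev 3 + ev 4 by rewrite !evE -!vcbD; apply: veqP; vm_compute.
have e1 : ev 1 = ev 0 + ev 2 + ev 3 + ev 4 by rewrite !evE -!vcbD; apply: veqP; vm_compute.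
have e2 : ev 2 = ev 0 + ev 1 + ev 3 + ev 4 by rewrite !evE -!vcbD; apply: veqP; vm_compute.
have e3 : ev 3 = ev 0 + ev 1 + ev 2 + ev 4 by rewrite !evE -!vcbD; apply: veqP; vm_compute.
move: fx; case: i0 lt5 => [|[|[|[|[|//]]]]] _ fx.
- by rewrite [ev 0]e0 !appD !fx.
- by rewrite [ev 1]e1 !appD !fx.
- by rewrite [ev 2]e2 !appD !fx.
- by rewrite [ev 3]e3 !appD !fx.
- by rewrite [ev 4]s5 !appD !fx.
Qed.

Lemma card_agree (X : {set L}) i0 : X \subset G ->
    (forall i, (i < 5)%N -> i != i0 -> {in X &, forall x y, app (ev i) x = app (ev i) y}) ->
  (#|X| <= #|stabE|)%N.
Proof.
move=> sXG ag; have [-> | [x Xx]] := set_0Vmem X; first by rewrite cards0.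
rewrite -(card_imset _ (mulIg x^-1%g)); apply: subset_leq_card; apply/subsetP=> _ /imsetP[y Xy ->].
have [Gx Gy] := (subsetP sXG _ Xx, subsetP sXG _ Xy).
apply: stabE_in => [|i lti]; first by rewrite groupM ?groupV.
apply: (@four_fix _ i0) => [j ltj nj|]; last exact: leq_trans lti _.
by rewrite appM (ag j ltj nj y x) // appK.
Qed.

Definition Xpi (g : L) (pi : seq nat) : {set L} :=
  [set x in G | all (fun i => app (app (ev i) x) g == app (ev (nth 0%N pi i)) x) (iota 0 5)].

Lemma XpiP g pi x i : x \in Xpi g pi -> (i < 5)%N ->
  app (app (ev i) x) g = app (ev (nth 0%N pi i)) x.
Proof. by rewrite inE => /andP[_ /allP h] lti; apply/eqP/h; rewrite mem_iota. Qed.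

Lemma XpiG g pi : Xpi g pi \subset G.
Proof. by apply/subsetP=> x; rewrite inE => /andP[]. Qed.

Lemma ev_inj i j : (i < 5)%N -> (j < 5)%N -> ev i = ev j -> i = j.
Proof.
move=> li lj eij; apply/eqP; have := ev_B i j; rewrite eij (polarvv char2_F2 q12) !modn_small //.
by case: (i == j) => //= /esym/eqP; rewrite oner_eq0.
Qed.

Lemma conj_in_Xpi g x : x \in conj_in G centE g ->
  exists2 pi, pi \in permutations (iota 0 5) & x \in Xpi g pi.
Proof.
rewrite inE => /andP[Gx /centEP[Gh eh]]; set h := (g ^ x^-1)%g in Gh eh.
have hE : (h * x = x * g)%g by rewrite /h conjgE invgK -!mulgA mulVg mulg1.
have step i : exists2 j, (j < 5)%N & app (ev i) h = ev j.
  have [|| i0 | [j jE]] := inU_cases (u := app (ev i) h).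
  - by rewrite appE -mulmxA -eh mulmxA ev_eps.
  - by rewrite (GO_P _ _ Gh) ev_Q.
  - have := ev_B i i.+1; rewrite -(GO_polar _ _ Gh) i0 (polar0l q12).
    have -> : (i %% 5 != i.+1 %% 5)%N by lia.
    by move/esym/eqP; rewrite oner_eq0.
  by exists (j %% 5)%N; rewrite ?ltn_mod // jE ev_modn.
pose jn i := ex_minn (let: ex_intro2 j lj e := step i in ex_intro (fun j => (j < 5)%N && (app (ev i) h == ev j)) j (introT andP (conj lj (introT eqP e)))).
have jP i : (jn i < 5)%N /\ app (ev i) h = ev (jn i).
  by rewrite /jn; case: ex_minnP => j /andP[lj /eqP e] _.
exists (map jn (iota 0 5)).
  rewrite mem_permutations; apply: uniq_perm; rewrite ?iota_uniq //.
    rewrite map_inj_in_uniq ?iota_uniq // => i j; rewrite !mem_iota !add0n => /= li lj eij.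
    by apply: ev_inj => //; apply: (@app_inj _ _ _ h); rewrite (jP i).2 (jP j).2 eij.
  have sub : {subset map jn (iota 0 5) <= iota 0 5}.
    by move=> _ /mapP[i _ ->]; rewrite mem_iota (jP i).1.
  apply: (uniq_min_size _ sub _).2; rewrite ?size_map //.
  rewrite map_inj_in_uniq ?iota_uniq // => i j; rewrite !mem_iota !add0n => /= li lj eij.
  by apply: ev_inj => //; apply: (@app_inj _ _ _ h); rewrite (jP i).2 (jP j).2 eij.
rewrite inE Gx; apply/allP=> i; rewrite mem_iota add0n => /= lti.
rewrite (_ : nth 0%N _ i = jn i); last by case: i lti => [|[|[|[|[|//]]]]].
by rewrite -(jP i).2 -!appM hE.
Qed.

Definition fixV (g : L) : {set 'rV['F_2]_12} := [set v | app v g == v].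

Lemma fixVD g u v : u \in fixV g -> v \in fixV g -> u + v \in fixV g.
Proof. by rewrite !inE appD => /eqP-> /eqP->. Qed.

Lemma card_fix1 g f (p : 'rV_12) q : (#|fixV g| <= 2 ^ f.+1)%N -> q \in fixV g -> B q p = 1 ->
  (#|[set w in fixV g | B w p == 1%R]| <= 2 ^ f)%N.
Proof.
move=> cF Fq Bq; rewrite -(leq_pmul2l (m := 2)) // -expnS; apply: leq_trans cF.
rewrite (@card_half _ q (fun w => B w p)) // => w Fw.
by rewrite fixVD // polar12Dl Bq eqxx.
Qed.

Lemma card_fix2 g f p1 p2 q : (#|[set w in fixV g | B w p1 == 1%R]| <= 2 ^ f.+1)%N ->
  q \in fixV g -> B q p1 = 0 -> B q p2 = 1 ->
  (#|[set w in [set w in fixV g | B w p1 == 1%R] | B w p2 == 1%R]| <= 2 ^ f)%N.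
Proof.
move=> cF Fq B1 B2; rewrite -(leq_pmul2l (m := 2)) // -expnS; apply: leq_trans cF.
rewrite (@card_half _ q (fun w => B w p2)) // => w; rewrite !inE => /andP[/eqP Fw /eqP Bw].
by rewrite appD Fw !polar12Dl Bw B1 B2 !addr0 !eqxx !andbT; move: Fq; rewrite inE => /eqP->.
Qed.

Lemma card_fix3 g f p1 p2 p3 q :
  (#|[set w in [set w in fixV g | B w p1 == 1%R] | B w p2 == 1%R]| <= 2 ^ f.+1)%N ->
  q \in fixV g -> B q p1 = 0 -> B q p2 = 0 -> B q p3 = 1 ->
  (#|[set w in [set w in [set w in fixV g | B w p1 == 1%R] | B w p2 == 1%R] | B w p3 == 1%R]| <= 2 ^ f)%N.
Proof.
move=> cF Fq B1 B2 B3; rewrite -(leq_pmul2l (m := 2)) // -expnS; apply: leq_trans cF.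
rewrite (@card_half _ q (fun w => B w p3)) // => w; rewrite !inE => /andP[/andP[/eqP Fw /eqP Bw1] /eqP Bw2].
by rewrite appD Fw !polar12Dl Bw1 Bw2 B1 B2 B3 !addr0 !eqxx !andbT; move: Fq; rewrite inE => /eqP->.
Qed.

Lemma evB x i j : x \in G -> (i < 5)%N -> (j < 5)%N -> B (app (ev i) x) (app (ev j) x) = b2F (i != j).
Proof. by move=> Gx li lj; rewrite (GO_polar _ _ Gx) ev_B !modn_small. Qed.

Lemma ev_sing x i : x \in G -> app (ev i) x \in sing12.
Proof.
move=> Gx; rewrite inE (GO_P _ _ Gx) ev_Q eqxx andbT; apply/eqP=> e0.
have := ev_B i i.+1; rewrite -(GO_polar _ _ Gx) e0 (polar0l q12).
have -> : (i %% 5 != i.+1 %% 5)%N by lia.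
by move/esym/eqP; rewrite oner_eq0.
Qed.

Definition idp := iota 0 5.

(** All five images are fixed by g. The first is any fixed vector, and each of the next three
    satisfies one more linear condition, which halves the choices; the last one is their sum. *)
Lemma card_Xid g f : (#|fixV g| <= 2 ^ f.+3)%N ->
  (#|Xpi g idp| <= 2 ^ f.+3 * (2 ^ f.+2 * (2 ^ f.+1 * (2 ^ f * #|stabE|))))%N.
Proof.
move=> cF; have XF x i : x \in Xpi g idp -> (i < 5)%N -> app (ev i) x \in fixV g.
  by move=> Xx lti; rewrite inE (XpiP Xx lti) nth_iota.
have XB x i j : x \in Xpi g idp -> (i < 5)%N -> (j < 5)%N -> B (app (ev i) x) (app (ev j) x) = b2F (i != j).
  by move=> Xx; apply: evB; apply: subsetP (XpiG g idp) _ Xx.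
apply: (card_fib (f := app (ev 0)) (A := fixV g)) => // [x Xx | p0]; first exact: XF.
set X0 := [set x in _ | _]; have [-> | [x0 /setIdP[Xx0 /eqP e00]]] := set_0Vmem X0; first by rewrite cards0.
have B0 x i : x \in X0 -> (0 < i < 5)%N -> app (ev i) x \in [set w in fixV g | B w p0 == 1%R].
  case/setIdP=> Xx /eqP <- /andP[i0 lti]; rewrite inE XF //= XB //.
  by case: i i0 {lti}.
have c1 : (#|[set w in fixV g | B w p0 == 1%R]| <= 2 ^ f.+2)%N.
  by apply: (card_fix1 (q := app (ev 1) x0)) => //; [exact: XF | rewrite -e00 XB].
apply: (card_fib (f := app (ev 1))) c1 _ => [x Xx | p1]; first exact: B0.
set X1 := [set x in _ | _]; have [-> | [x1 /setIdP[Xx1 /eqP e11]]] := set_0Vmem X1; first by rewrite cards0.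
have [Xx10 /eqP e10] := setIdP Xx1.
have c2 : (#|[set w in [set w in fixV g | B w p0 == 1%R] | B w p1 == 1%R]| <= 2 ^ f.+1)%N.
  apply: (card_fix2 (q := app (ev 0) x1)); first by
    apply: (card_fix1 (q := app (ev 1) x0)) => //; [exact: XF | rewrite -e00 XB].
  - exact: XF.
  - by rewrite -e10 XB.
  - by rewrite -e11 XB.
apply: (card_fib (f := app (ev 2))) c2 _ => [x /setIdP[Xx /eqP e1] | p2].
  by rewrite inE B0 //= -e1 XB //; case/setIdP: Xx.
set X2 := [set x in _ | _]; have [-> | [x2 /setIdP[Xx2 /eqP e22]]] := set_0Vmem X2; first by rewrite cards0.
have [Xx21 /eqP e21] := setIdP Xx2; have [Xx20 /eqP e20] := setIdP Xx21.
have c3 : (#|[set w in [set w in [set w in fixV g | B w p0 == 1%R] | B w p1 == 1%R] | B w p2 == 1%R]| <= 2 ^ f)%N.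
  (* This sum is orthogonal to the images of e_0 and e_1 but not to that of e_2, so the third
     condition is independent of the first two. *)
  apply: (card_fix3 (q := app (ev 0) x2 + app (ev 1) x2 + app (ev 3) x2)).
  - apply: (card_fix2 (q := app (ev 0) x1)); first by
      apply: (card_fix1 (q := app (ev 1) x0)) => //; [exact: XF | rewrite -e00 XB].
    + exact: XF.
    + by rewrite -e10 XB.
    + by rewrite -e11 XB.
  - by rewrite !fixVD // XF.
  - by rewrite -e20 !polar12Dl !XB //; apply: val_inj.
  - by rewrite -e21 !polar12Dl !XB //; apply: val_inj.
  - by rewrite -e22 !polar12Dl !XB //; apply: val_inj.
apply: (card_fib (f := app (ev 3))) c3 _ => [x /setIdP[Xx2' /eqP e2] | p3].
  have [Xx1' /eqP e1] := setIdP Xx2'; have [Xx' _] := setIdP Xx1'.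
  by rewrite inE inE B0 //= -e1 -e2 !XB.
apply: (@card_agree _ 4) => [|i lti ni4 x y].
  by apply/subsetP=> x /setIdP[/setIdP[/setIdP[/setIdP[/(subsetP (XpiG g idp))]]]].
case/setIdP=> /setIdP[/setIdP[/setIdP[_ /eqP a0] /eqP a1] /eqP a2] /eqP a3.
case/setIdP=> /setIdP[/setIdP[/setIdP[_ /eqP b0] /eqP b1] /eqP b2] /eqP b3.
case: i lti ni4 => [|[|[|[|[|//]]]]] //= _ _; by [rewrite a0 b0 | rewrite a1 b1 | rewrite a2 b2 | rewrite a3 b3].
Qed.

Definition is_transp (pi : seq nat) : bool :=
  has (fun i => has (fun j => (i < j)%N &&
    all (fun k => nth 0%N pi k == (if k == i then j else if k == j then i else k)) (iota 0 5)) (iota 0 5)) (iota 0 5).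

Lemma transpP pi : is_transp pi -> exists i j k l, [/\ [&& i < 5, j < 5, k < 5 & l < 5]%N,
  uniq [:: i; j; k; l], nth 0%N pi i = j, nth 0%N pi k = k & nth 0%N pi l = l].
Proof.
have tab : all (fun i => all (fun j => (i < j)%N ==> has (fun k => has (fun l => uniq [:: i; j; k; l])
  (iota 0 5)) (iota 0 5)) (iota 0 5)) (iota 0 5) by [].
case/hasP=> i ii /hasP[j ij /andP[ltij /allP h]]; have /allP/(_ i ii)/allP/(_ j ij) := tab.
rewrite ltij => /hasP[k kk /hasP[l ll u]]; exists i, j, k, l.
have := u; rewrite /= !inE !negb_or => /andP[/and3P[nij nik nil] /andP[/andP[njk njl] _]].
split=> //; first by move: ii ij kk ll; rewrite !mem_iota !add0n /= => -> -> -> ->.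
- by move: u; rewrite /= !inE !negb_or.
- by have /eqP := h i ii; rewrite eqxx.
- by have /eqP := h k kk; rewrite ![k == _]eq_sym (negPf nik) (negPf njk).
- by have /eqP := h l ll; rewrite ![l == _]eq_sym (negPf nil) (negPf njl).
Qed.

(** The image of one transposed vector is any of the 2079 singular vectors and determines its
    partner through g. Two of the others are chosen in the fixed space of g under one and two linear
    conditions, and the fifth is determined. *)
Lemma card_Xtransp g pi f : is_transp pi -> (#|fixV g| <= 2 ^ f.+2)%N ->
  (#|Xpi g pi| <= 2079 * (2 ^ f.+1 * (2 ^ f * #|stabE|)))%N.
Proof.
case/transpP=> i [j [k [l [/and4P[li lj lk ll] u pii pik pil]]]] cF.
have := u; rewrite /= !inE !negb_or => /andP[/and3P[nij nik nil] /andP[/andP[njk njl] /andP[nkl _]]].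
have [nki nli nlk] : [/\ k != i, l != i & l != k] by rewrite ![k == _]eq_sym ![l == _]eq_sym.
have XB x a b : x \in Xpi g pi -> (a < 5)%N -> (b < 5)%N -> B (app (ev a) x) (app (ev b) x) = b2F (a != b).
  by move=> Xx; apply: evB; apply: subsetP (XpiG g pi) _ Xx.
have Fk x : x \in Xpi g pi -> app (ev k) x \in fixV g by move=> Xx; rewrite inE (XpiP Xx lk) pik.
have Fl x : x \in Xpi g pi -> app (ev l) x \in fixV g by move=> Xx; rewrite inE (XpiP Xx ll) pil.
apply: (card_fib (f := app (ev i)) (A := sing12)) => [x Xx | | p0]; last first.
- set X0 := [set x in _ | _]; have [-> | [x0 /setIdP[Xx0 /eqP e00]]] := set_0Vmem X0; first by rewrite cards0.
  have c1 : (#|[set w in fixV g | B w p0 == 1%R]| <= 2 ^ f.+1)%N.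
    by apply: (card_fix1 (q := app (ev k) x0)) => //; [exact: Fk | rewrite -e00 XB // nki].
  apply: (card_fib (f := app (ev k))) c1 _ => [x /setIdP[Xx /eqP e] | p1].
    by rewrite inE Fk //= -e XB // nki.
  set X1 := [set x in _ | _]; have [-> | [x1 /setIdP[Xx1 /eqP e11]]] := set_0Vmem X1; first by rewrite cards0.
  have [Xx10 /eqP e10] := setIdP Xx1.
  have c2 : (#|[set w in [set w in fixV g | B w p0 == 1%R] | B w p1 == 1%R]| <= 2 ^ f)%N.
    apply: (card_fix2 (q := app (ev k) x1 + app (ev l) x1)); first by
      apply: (card_fix1 (q := app (ev k) x0)) => //; [exact: Fk | rewrite -e00 XB // nki].
    - by rewrite fixVD ?Fk ?Fl.
    - by rewrite -e10 polar12Dl !XB // nki nli; apply: val_inj.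
    - by rewrite -e11 polar12Dl !XB // eqxx nlk; apply: val_inj.
  apply: (card_fib (f := app (ev l))) c2 _ => [x /setIdP[/setIdP[Xx /eqP e0] /eqP e1] | p2].
    by rewrite inE inE Fl //= -e0 -e1 !XB // nli nlk.
  (* The fifth index, since 0 + 1 + 2 + 3 + 4 = 10. *)
  pose m := (10 - i - j - k - l)%N.
  apply: (@card_agree _ m) => [|n ltn nm x y].
    by apply/subsetP=> x /setIdP[/setIdP[/setIdP[/(subsetP (XpiG g pi))]]].
  case/setIdP=> /setIdP[/setIdP[Xx /eqP a0] /eqP a1] /eqP a2.
  case/setIdP=> /setIdP[/setIdP[Xy /eqP b0] /eqP b1] /eqP b2.
  have aj : app (ev j) x = app (ev j) y by rewrite -pii -(XpiP Xx li) -(XpiP Xy li) a0 b0.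
  have : n \in [:: i; j; k; l].
    have tab : all (fun n => all (fun i => all (fun j => all (fun k => all (fun l =>
      uniq [:: i; j; k; l] ==> (n != 10 - i - j - k - l)%N ==> (n \in [:: i; j; k; l]))
        (iota 0 5)) (iota 0 5)) (iota 0 5)) (iota 0 5)) (iota 0 5) by vm_compute.
    have io a : (a < 5)%N -> a \in iota 0 5 by rewrite mem_iota.
    have /allP/(_ n (io _ ltn))/allP/(_ i (io _ li))/allP/(_ j (io _ lj))/allP/(_ k (io _ lk))/allP/(_ l (io _ ll)) := tab.
    by rewrite u /= => /implyP; apply.
  by rewrite !inE => /or4P[] /eqP->; rewrite ?a0 ?b0 ?a1 ?b1 ?a2 ?b2.
- by rewrite card_sing12.
- by apply: ev_sing; apply: subsetP (XpiG g pi) _ Xx.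
Qed.

(** Iterating [pi] on [a] and [b] reaches at least four of the five indices, so the images of two
    singular vectors determine all five. *)
Definition gen_pair (pi : seq nat) a b :=
  let s := [:: a; nth 0%N pi a; nth 0%N pi (nth 0%N pi a); nth 0%N pi (nth 0%N pi (nth 0%N pi a)); b; nth 0%N pi b; nth 0%N pi (nth 0%N pi b)] in
  (a != b) && (4 <= count [in s] (iota 0 5))%N.

Definition two_gen (pi : seq nat) := has (fun a => has (gen_pair pi a) (iota 0 5)) (iota 0 5).

Lemma permsE : all (fun pi => [|| pi == idp, is_transp pi | two_gen pi] && all (fun n => (n < 5)%N) pi) (permutations (iota 0 5)).
Proof. vm_cast_no_check (erefl true). Qed.

Lemma card_Xtwo g pi : size pi = 5%N -> all (fun n => (n < 5)%N) pi -> two_gen pi ->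
  (#|Xpi g pi| <= 2079 * (1024 * #|stabE|))%N.
Proof.
move=> sp lp /hasP[a ia /hasP[b ib]]; rewrite /gen_pair; set s := [:: a, _ & _] => /andP[nab c4].
have io n : (n \in iota 0 5) = (n < 5)%N by rewrite mem_iota.
rewrite !io in ia ib.
have lpi n : (n < 5)%N -> (nth 0%N pi n < 5)%N by move=> ln; apply: (all_nthP 0%N lp); rewrite sp.
apply: (card_fib (f := app (ev a)) (A := sing12)) => [x Xx | | p0].
- by apply: ev_sing; apply: subsetP (XpiG g pi) _ Xx.
- by rewrite card_sing12.
set X0 := [set x in _ | _]; have [-> | [x0 /setIdP[Xx0 /eqP e00]]] := set_0Vmem X0; first by rewrite cards0.
have sp0 : p0 \in sing12 by rewrite -e00; apply: ev_sing; apply: subsetP (XpiG g pi) _ Xx0.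
apply: (card_fib (f := app (ev b))) (sing_partner sp0) _ => [x /setIdP[Xx /eqP e] | p1].
  have Gx := subsetP (XpiG g pi) _ Xx; rewrite inE (GO_P _ _ Gx) ev_Q eqxx /= -e evB //.
  by rewrite [b == a]eq_sym nab.
have [i0 i0P] : exists i0, forall n, (n < 5)%N -> n != i0 -> n \in s.
  have [/allP al | /allPn[i0 ii ni0]] := boolP (all [in s] (iota 0 5)).
    by exists 5%N => n ln _; apply: al; rewrite io.
  exists i0 => n ln nn; apply: contraLR c4 => nns; rewrite -ltnNge.
  have cp := count_predC [in s] (iota 0 5); rewrite size_iota in cp.
  have c2 : (2 <= count (predC [in s]) (iota 0 5))%N.
    have u2 : uniq [:: n; i0] by rewrite /= inE nn.
    rewrite -size_filter -[2%N]/(size [:: n; i0]); apply: uniq_leq_size u2 _ => m.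
    by rewrite !inE mem_filter => /orP[] /eqP->; rewrite inE ?nns ?ni0 ?ii ?io.
  by have := leq_add (leqnn (count [in s] (iota 0 5))) c2; rewrite cp; lia.
apply: (@card_agree _ i0) => [|n ltn nn x y].
  by apply/subsetP=> x /setIdP[/setIdP[/(subsetP (XpiG g pi))]].
case/setIdP=> /setIdP[Xx /eqP a0] /eqP a1; case/setIdP=> /setIdP[Xy /eqP b0] /eqP b1.
have st m : (m < 5)%N -> app (ev m) x = app (ev m) y -> app (ev (nth 0%N pi m)) x = app (ev (nth 0%N pi m)) y.
  by move=> lm e; rewrite -(XpiP Xx lm) -(XpiP Xy lm) e.
have ea : app (ev a) x = app (ev a) y by rewrite a0 b0.
have eb : app (ev b) x = app (ev b) y by rewrite a1 b1.
have l1 := lpi a ia; have e1 := st a ia ea; have e2 := st _ l1 e1; have e3 := st _ (lpi _ l1) e2.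
have f1 := st b ib eb; have f2 := st _ (lpi b ib) f1.
by have := i0P n ltn nn; rewrite /s !inE; do 6!(case/orP=> [/eqP-> // | ]); move/eqP->.
Qed.

(** The 120 permutations are the identity, ten transpositions and 109 others, for which two vectors
    determine the pentad. *)
Lemma NE_pent g f : (#|fixV g| <= 2 ^ f.+3)%N -> (NE g <=
  (2 ^ f.+3 * (2 ^ f.+2 * (2 ^ f.+1 * 2 ^ f)) + 10 * (2079 * (2 ^ f.+2 * 2 ^ f.+1)) + 109 * (2079 * 1024)) * #|stabE|)%N.
Proof.
move=> cF; pose bd (pi : seq nat) := ((if pi == idp then 2 ^ f.+3 * (2 ^ f.+2 * (2 ^ f.+1 * 2 ^ f))
  else if is_transp pi then 2079 * (2 ^ f.+2 * 2 ^ f.+1) else 2079 * 1024) * #|stabE|)%N.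
apply: leq_trans (card_cover (conj_in_Xpi (g := g))) _.
apply: (@leq_trans (\sum_(pi <- permutations (iota 0 5)) bd pi)%N).
  rewrite big_seq [X in (_ <= X)%N]big_seq; apply: leq_sum => pi ppi; rewrite /bd.
  have /allP/(_ pi ppi)/andP[t5 l5] := permsE.
  have sz : size pi = 5%N by move: ppi; rewrite mem_permutations => /perm_size ->.
  case: eqP t5 => [-> _ | _ /=]; first by have := card_Xid cF; rewrite !mulnA.
  case: ifP => [tp _ | _ /= tg]; last by have := card_Xtwo g sz l5 tg; rewrite !mulnA.
  by have := card_Xtransp tp cF; rewrite !mulnA.
rewrite /bd -big_distrl /=; apply: leq_mul => //.
have cnt (s : seq (seq nat)) A C D : (\sum_(pi <- s) (if pi == idp then A else if is_transp pi then C else D) =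
    count (pred1 idp) s * A + count (fun pi => (pi != idp) && is_transp pi) s * C + count (fun pi => (pi != idp) && ~~ is_transp pi) s * D)%N.
  elim: s => [|pi s IHs]; first by rewrite big_nil.
  rewrite big_cons IHs /=; case: (pi == idp) => /=; last case: (is_transp pi) => /=; lia.
rewrite cnt.
have -> : count (pred1 idp) (permutations (iota 0 5)) = 1%N by vm_compute.
have -> : count (fun pi => (pi != idp) && is_transp pi) (permutations (iota 0 5)) = 10%N by vm_compute.
have -> : count (fun pi => (pi != idp) && ~~ is_transp pi) (permutations (iota 0 5)) = 109%N by vm_compute.
by rewrite mul1n.
Qed.

End Pentads.

End Pentads.

(** * Counting F_4-structures that are compatible with an element *)

Module FieldStructureCounts.

Import QuadraticForms WittFrames Codings IsometryGroups ModelElements PurityCertificates Derivations Purity Decomposition ThreeCycles Overgroups PlaneStabilizer FieldStructures MaximalSubgroups PermutationCharacters Pentads.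

Local Notation Q := Q12.
Local Notation B := (polar Q12).
Local Notation M12 := 'M['F_2]_12.
Local Notation V := 'rV['F_2]_12.

Lemma card_agree_polar m (A : {set V}) (Z : 'M['F_2]_(m, 12)) :
  {in A &, forall w w', forall z : V, (z <= Z)%MS -> B w z = B w' z} ->
  (#|A| <= 2 ^ (12 - \rank Z))%N.
Proof.
move=> ag; have [-> | [w0 Aw0]] := set_0Vmem A; first by rewrite cards0.
have [J uJ JE] := polar_gram q12.
have rk : \rank (kermx (J *m Z^T)) = (12 - \rank Z)%N.
  by rewrite mxrank_ker (eqmxMfull _ (_ : row_full J)) ?row_full_unit // mxrank_tr.
have cr := card_rowg (kermx (J *m Z^T)); rewrite rk card_Fp // in cr.
rewrite -cr -(card_imset _ (addrI (- w0))).
apply: subset_leq_card; apply/subsetP=> _ /imsetP[w Aw ->]; rewrite inE; apply/sub_kermxP.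
apply/rowP=> i; rewrite mulmxA mxE [RHS]mxE.
have := ag _ _ Aw Aw0 (row i Z) (row_sub i Z); rewrite !JE => e.
have rE (u : V) : (u *m J *m (row i Z)^T) 0 0 = \sum_j (u *m J) 0 j * Z^T j i.
  by rewrite mxE; apply: eq_bigr => j _; rewrite !mxE.
rewrite mulmxDl mulNmx; transitivity (- (\sum_j (w0 *m J) 0 j * Z^T j i) + \sum_j (w *m J) 0 j * Z^T j i).
  by rewrite -sumrN -big_split; apply: eq_bigr => j _; rewrite /= !mxE mulrDl mulNr.
by rewrite -!rE e addNr.
Qed.

(** Properties shared by all conjugates of [om 0]: J is multiplication by a generator of F_4, and
    every vector is orthogonal to its image under J. *)
Definition isJ (J : M12) := [&& J *m J == J + 1%:M & [forall v : V, B (v *m J) v == 0]].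

Lemma isJ_sqr J : isJ J -> J *m J = J + 1%:M. Proof. by case/andP=> /eqP. Qed.
Lemma isJ_alt J v : isJ J -> B (v *m J) v = 0. Proof. by case/andP=> _ /forallP/(_ v)/eqP. Qed.

Lemma isJ_adj J u v : isJ J -> B (u *m J) v = B u (v *m J).
Proof.
move=> iJ; have := isJ_alt (u + v) iJ; rewrite mulmxDl polar12cat !(isJ_alt _ iJ) add0r addr0.
by move/eqP; rewrite addr_eq0 (oppc2 char2_F2) => /eqP->; rewrite polar12C.
Qed.

Lemma isJ_vJJ J (v : V) : isJ J -> v *m J *m J = v *m J + v.
Proof. by move=> iJ; rewrite -mulmxA isJ_sqr // mulmxDr mulmx1. Qed.

Lemma isJ_out J (Z : M12) (v : V) : isJ J -> (Z *m J <= Z)%MS -> ~~ (v <= Z)%MS ->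
  ~~ (v *m J <= Z + v)%MS.
Proof.
move=> iJ ZJ; apply: contra => /sub_addsmxP[[z c] /= e].
have stZ (u : V) : (u <= Z)%MS -> (u *m J <= Z)%MS.
  by move=> uZ; apply: submx_trans (submxMr J uZ) ZJ.
set z' := z *m Z in e; have Zz' : (z' <= Z)%MS by apply: submxMl.
have cv : c *m v = c 0 0 *: v by rewrite {1}[c]mx11_scalar mul_scalar_mx.
have vJJ := isJ_vJJ v iJ; move: e; rewrite cv; case: (F2_cases (c 0 0)) => -> e.
  rewrite scale0r addr0 in e; have -> : v = v *m J *m J + v *m J.
    by rewrite vJJ addrAC addV add0r.
  by rewrite e addmx_sub // stZ.
rewrite scale1r in e; have zE : z' = v *m J + v by rewrite e -addrA addV addr0.
suff -> : v = z' *m J by apply: stZ.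
by rewrite zE mulmxDl vJJ addrAC addV add0r.
Qed.

Lemma rank_addv (Z : M12) (v : V) : ~~ (v <= Z)%MS -> (\rank Z < \rank (Z + v)%MS)%N.
Proof.
move=> nvZ; rewrite ltnNge; apply: contra nvZ.
by rewrite (geq_leqif (mxrank_leqif_sup (addsmxSl Z v))) addsmx_sub => /andP[].
Qed.

Definition agree m (S : {set M12}) (Z : 'M['F_2]_(m, 12)) :=
  {in S &, forall J J', forall z : V, (z <= Z)%MS -> z *m J = z *m J'}.

Lemma agree_add m (S : {set M12}) (Z : 'M_(m, 12)) (v : V) : agree S Z ->
  {in S &, forall J J', v *m J = v *m J'} -> agree S (Z + v)%MS.
Proof.
move=> aZ av J J' SJ SJ' z /sub_addsmxP[[a c] /= ->].
rewrite !mulmxDl (aZ J J' SJ SJ') ?submxMl //; congr (_ + _).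
by rewrite -!mulmxA (av J J').
Qed.

Lemma agree1 (S : {set M12}) (Z : M12) : (1%:M <= Z)%MS -> agree S Z -> (#|S| <= 1)%N.
Proof.
move=> Z1 aZ; apply/card_le1_eqP => J J' SJ SJ'; apply/row_matrixP=> i.
by rewrite !rowE; apply: aZ => //; apply: submx_trans (submx1 _) Z1.
Qed.

Lemma lin_step (S : {set M12}) (Z : M12) (v : V) J0 : {in S, forall J, isJ J} -> J0 \in S ->
    (Z *m J0 <= Z)%MS -> agree S Z -> ~~ (v <= Z)%MS -> {in S &, forall J J', v *m J = v *m J'} ->
  [/\ (((Z + v)%MS + v *m J0)%MS *m J0 <= (Z + v) + v *m J0)%MS,
      agree S ((Z + v) + v *m J0)%MS & (\rank Z + 2 <= \rank ((Z + v)%MS + v *m J0)%MS)%N].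
Proof.
move=> SJ SJ0 ZJ aZ nvZ av; have iJ0 := SJ _ SJ0; split.
- rewrite addsmxMr addsmx_sub; apply/andP; split.
    rewrite addsmxMr addsmx_sub; apply/andP; split; last exact: addsmxSr.
    by apply: submx_trans ZJ _; apply: submx_trans (addsmxSl Z v) (addsmxSl _ _).
  rewrite isJ_vJJ // addmx_sub ?addsmxSr //.
  exact: submx_trans (addsmxSr Z v) (addsmxSl _ _).
- apply: agree_add; first exact: agree_add.
  move=> J J' SJ1 SJ2; have iJ := SJ _ SJ1; have iJ' := SJ _ SJ2.
  by rewrite {1}(av J0 J SJ0 SJ1) (av J0 J' SJ0 SJ2) !isJ_vJJ // (av J J' SJ1 SJ2).
- rewrite addn2; apply: leq_ltn_trans (rank_addv nvZ) _.
  by apply: rank_addv; apply: isJ_out.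
Qed.

Lemma full12 (Z : M12) : (12 <= \rank Z)%N -> (1%:M <= Z)%MS.
Proof. by move=> r12; rewrite sub1mx /row_full eqn_leq rank_leq_col. Qed.

Lemma notfull12 (Z : M12) : (\rank Z < 12)%N -> exists v : V, ~~ (v <= Z)%MS.
Proof.
move=> lt12; have /row_subPn[i ni] : ~~ (1%:M <= Z)%MS.
  by rewrite sub1mx /row_full neq_ltn lt12.
by exists (row i 1%:M).
Qed.

(** If 2k dimensions are missing, the image of a new vector v under J has known products with Z and
    with v, which leaves at most 2^(2k - 1) values; then J is known on two more dimensions. The
    exponents 1, 3, ..., 2k - 1 add up to k^2. *)
Lemma lin_bound k (S : {set M12}) (Z : M12) : {in S, forall J, isJ J} ->
    {in S, forall J, Z *m J <= Z}%MS -> agree S Z -> (12 <= \rank Z + 2 * k)%N ->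
  (#|S| <= 2 ^ (k * k))%N.
Proof.
elim: k S Z => [|k IHk] S Z SJ stZ aZ rZ.
  rewrite muln0 addn0 in rZ; rewrite expn0; apply: agree1 aZ.
  exact: full12.
have [le12 | lt12] := leqP 12 (\rank Z).
  apply: leq_trans (_ : (1 <= _)%N); last by rewrite expn_gt0.
  by apply: agree1 aZ; apply: full12.
have [v nvZ] := notfull12 lt12.
have -> : (2 ^ (k.+1 * k.+1) = 2 ^ (2 * k + 1) * 2 ^ (k * k))%N by rewrite -expnD; congr (2 ^ _)%N; lia.
apply: (card_fib (f := fun J : M12 => v *m J) (A := [set v *m J | J : M12 in S])) => [J SJ1 | | w].
- exact: imset_f.
- have bound : (#|[set v *m J | J : M12 in S]| <= 2 ^ (12 - \rank (Z + v)%MS))%N.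
    apply: card_agree_polar => _ _ /imsetP[J SJ1 ->] /imsetP[J' SJ2 ->] z /sub_addsmxP[[a c] /= ->].
    have iJ := SJ _ SJ1; have iJ' := SJ _ SJ2.
    have cv K : isJ K -> B (v *m K) (c *m v) = 0.
      by move=> iK; rewrite {1}[c]mx11_scalar mul_scalar_mx (polarZr q12) isJ_alt // mulr0.
    rewrite [LHS]polar12Dr [RHS]polar12Dr !cv // !addr0 [LHS]isJ_adj // [RHS]isJ_adj //.
    by rewrite (aZ J J') ?submxMl.
  apply: leq_trans bound _; rewrite leq_exp2l //.
  have := rank_addv nvZ; lia.
have [-> | [J0]] := set_0Vmem [set J in S | v *m J == w]; first by rewrite cards0.
set S' := [set J in S | _] => SJ0; have sS J : J \in S' -> J \in S by rewrite inE => /andP[].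
have av : {in S' &, forall J J', v *m J = v *m J'}.
  by move=> J J'; rewrite !inE => /andP[_ /eqP->] /andP[_ /eqP->].
have aZ' : agree S' Z by move=> J J' /sS SJ1 /sS SJ2; apply: aZ.
have sJ' : {in S', forall J, isJ J} by move=> J /sS; apply: SJ.
have h J (SJ1 : J \in S') := lin_step sJ' SJ1 (stZ _ (sS _ SJ1)) aZ' nvZ av.

have [_ agZ' rZ'] := h J0 SJ0.
have rk' : (12 <= \rank ((Z + v)%MS + v *m J0)%MS + 2 * k)%N.
  by rewrite mulnS addnA in rZ; exact: leq_trans rZ (leq_add rZ' (leqnn _)).
apply: (IHk S' ((Z + v)%MS + v *m J0)%MS) => // J SJ1.
by have [+ _ _] := h J SJ1; rewrite (av J J0).
Qed.

Lemma nonsing_moved (L : GLmodel 'F_2 11) (g : L) : g != 1%g -> exists2 v, Q v = 1 & app v g != v.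
Proof.
move=> ng; have /existsP[v /andP[/eqP Qv mv]] : [exists v, (Q v == 1) && (app v g != v)].
  apply: contraNT ng => /existsPn no.
  have fx v : Q v = 1 -> app v g = v.
    by move=> Qv; apply/eqP; have := no v; rewrite Qv eqxx /= negbK.
  apply/eqP; apply: (@gmx_inj _ _ L); rewrite gmx1; apply/row_matrixP=> i.
  rewrite !rowE mulmx1 -appE -[delta_mx 0 i]mulmx1 -rowE -mat_id row_mat.
  have : lall (fun l => lhas (fun a => if qp 6 a then qp 6 (addb_l l a) else false)
           [:: bl 12 65; bl 12 130]) (idl 12) by vm_compute.
  rewrite lallE => /allP/(_ (nth [::] (idl 12) i)); rewrite mem_nth ?size_map ?size_iota //.
  move=> /(_ isT); rewrite lhasE; move: (nth _ _ _) => l /hasP[a _]; case: ifP => // qa qla.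
  have e : vcb 12 l = vcb 12 (addb_l l a) + vcb 12 a by rewrite vcbD -addrA addV addr0.
  by rewrite [in LHS]e appD !fx ?Q12E ?qla ?qa // -e.
by exists v.
Qed.

Section Structures.

Variable L : GLmodel 'F_2 11.
Local Notation G := (G12 L).
Implicit Types (g h x : L).

Definition Jlin g : {set M12} := [set J | isJ J && (J *m gmx L g == gmx L g *m J)].
Definition Jsemi g : {set M12} := [set J | isJ J && (J *m gmx L g == gmx L g *m J + gmx L g)].

Lemma JlinP g J : reflect (isJ J /\ J *m gmx L g = gmx L g *m J) (J \in Jlin g).
Proof. by rewrite inE; apply: (iffP andP) => -[iJ /eqP]. Qed.

Lemma JsemiP g J : reflect (isJ J /\ J *m gmx L g = gmx L g *m J + gmx L g) (J \in Jsemi g).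
Proof. by rewrite inE; apply: (iffP andP) => -[iJ /eqP]. Qed.

(** Take a nonsingular [v] moved by [g]. Its image under J is orthogonal to [v], so there are at
    most 2^11 choices; this choice also determines J on [v g], hence on four dimensions, and
    [lin_bound] with k = 4 leaves 2^16. *)
Lemma card_Jlin g : g \in G -> g != 1%g -> (#|Jlin g| <= 2 ^ 27)%N.
Proof.
move=> Gg ng; have [v Qv mv] := nonsing_moved ng.
have nzv : v != 0 by apply: contraTneq isT => v0; have := oner_neq0 'F_2; rewrite -Qv v0 (quad0 q12) eqxx.
rewrite -[27%N]/(11 + 16)%N expnD.
apply: (card_fib (f := fun J : M12 => v *m J) (A := [set v *m J | J : M12 in Jlin g])) => [J SJ1 | | w].
- exact: imset_f.
- have rv : (12 - \rank v)%N = 11 by rewrite rank_rV nzv.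
  apply: leq_trans (card_agree_polar (Z := v) _) _; last by rewrite rv.
  move=> _ _ /imsetP[J /JlinP[iJ _] ->] /imsetP[J' /JlinP[iJ' _] ->] z /sub_rVP[c ->].
  by rewrite !(polarZr q12) !isJ_alt.
have [-> | [J0]] := set_0Vmem [set J in Jlin g | v *m J == w]; first by rewrite cards0.
set S' := [set J in Jlin g | _] => SJ0.
have sS J : J \in S' -> isJ J /\ J *m gmx L g = gmx L g *m J by case/setIdP=> /JlinP.
have sJ : {in S', forall J, isJ J} by move=> J /sS[].
have av : {in S' &, forall J J', v *m J = v *m J'}.
  by move=> J J'; rewrite !inE => /andP[_ /eqP->] /andP[_ /eqP->].
have a0 : agree S' (0 : M12).
  by move=> J J' _ _ z /submxP[D ->]; rewrite mulmx0 !mul0mx.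
have nv0 : ~~ (v <= (0 : M12))%MS.
  by apply: contra nzv => /submxP[D ->]; rewrite mulmx0.
have st0 (J : M12) : ((0 : M12) *m J <= (0 : M12))%MS by rewrite mul0mx sub0mx.
have h1 J (SJ1 : J \in S') := lin_step sJ SJ1 (st0 J) a0 nv0 av.
set Z1 := (((0 : M12) + v)%MS + v *m J0)%MS.
have [_ ag1 r1] := h1 J0 SJ0; rewrite -/Z1 in ag1 r1.
have st1 J : J \in S' -> (Z1 *m J <= Z1)%MS.
  by move=> SJ1; have [+ _ _] := h1 J SJ1; rewrite (av J J0).
(* [Z1] is the F_4-line of [v]. Exactly two of its three nonzero vectors are nonsingular, so an
   isometry commuting with J that maps the line to itself fixes [v]. *)
have nv1 : ~~ (app v g <= Z1)%MS.
  have [iJ cJ] := sS _ SJ0; apply/negP=> /sub_addsmxP[[a b] /= e].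
  have e' : app v g = (a *m ((0 : M12) + v)%MS) + b 0 0 *: (v *m J0).
    by rewrite e; congr (_ + _); rewrite {1}[b]mx11_scalar mul_scalar_mx.
  have [c cE] : exists c : 'F_2, a *m ((0 : M12) + v)%MS = c *: v.
    have : (a *m ((0 : M12) + v)%MS <= v)%MS.
      by apply: submx_trans (submxMl _ _) _; rewrite addsmx_sub sub0mx submx_refl.
    by case/sub_rVP=> c ->; exists c.
  rewrite cE in e'; set u := v *m J0 in e'.
  have Qg z : Q (app z g) = Q z := GO_P _ _ Gg z.
  have Buv : B u v = 0 := isJ_alt v iJ.
  have ug : app u g = app v g *m J0 by rewrite !appE -!mulmxA cJ.
  have uJ : u *m J0 = u + v := isJ_vJJ v iJ.
  case: (F2_cases c) (F2_cases (b 0 0)) e' => -> [] ->; rewrite ?scale0r ?scale1r ?add0r ?addr0 => e'.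
  - by have := Qg v; rewrite e' (quad0 q12) Qv => /esym/eqP; rewrite oner_eq0.
  - have Qu : Q u = 1 by rewrite -e' Qg.
    have := Qg u; rewrite ug e' uJ QD Qu Qv Buv addr0 (addc2 char2_F2) => /esym/eqP.
    by rewrite oner_eq0.
  - by rewrite e' eqxx in mv.
  - have Qu : Q u = 1.
      by rewrite -Qg ug e' mulmxDl uJ -/u addrCA addrA addV add0r.
    have := Qg v; rewrite e' QD Qu Qv polar12C Buv addr0 (addc2 char2_F2) => /esym/eqP.
    by rewrite oner_eq0.
have av1 : {in S' &, forall J J', app v g *m J = app v g *m J'}.
  move=> J J' SJ1 SJ2; have [_ cJ] := sS _ SJ1; have [_ cJ'] := sS _ SJ2.
  by rewrite appE -!mulmxA -cJ -cJ' !mulmxA (av J J').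
have h2 J (SJ1 : J \in S') := lin_step sJ SJ1 (st1 _ SJ1) ag1 nv1 av1.
have [_ ag2 r2] := h2 J0 SJ0.
apply: (@lin_bound 4 S' ((Z1 + app v g)%MS + app v g *m J0)%MS) => // [J SJ1 | ].
  by have [+ _ _] := h2 J SJ1; rewrite (av1 J J0).
rewrite mxrank0 add0n in r1; apply: leq_trans _ (leq_add r2 (leqnn (2 * 4))).
by rewrite -addnA; exact: (leq_add r1 (leqnn 10)).
Qed.

Lemma fix_im g (v : V) : (g * g = 1)%g -> (v <= gmx L g - 1%:M)%MS -> app v g = v.
Proof.
move=> gg /submxP[x ->]; rewrite app_rk1 appD -appM gg app1 (oppc2v char2_F2) appE.
exact: addrC.
Qed.

Lemma semi_fix g J (v : V) : J \in Jsemi g -> app v g = v -> v *m J *m (gmx L g - 1%:M) = v.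
Proof.
case/JsemiP=> _ cJ fv; rewrite mulmxBr mulmx1 -mulmxA cJ mulmxDr mulmxA -[v *m gmx L g]appE fv.
by rewrite addrAC subrr add0r.
Qed.

Lemma semi_polar g J (v u : V) : g \in G -> (g * g = 1)%g -> J \in Jsemi g -> app v g = v ->
  B (v *m J) (u *m (gmx L g - 1%:M)) = B v u.
Proof.
move=> Gg gg SJ fv; rewrite app_rk1 (oppc2v char2_F2) polar12Dr.
have -> : B (v *m J) (app u g) = B (app (v *m J) g) u by rewrite -(GO_polar _ _ Gg) -appM gg app1.
have -> : app (v *m J) g = v *m J + v.
  have := semi_fix SJ fv; rewrite app_rk1 => /(congr1 (fun z => v *m J + z)).
  by rewrite addrC subrK.
by rewrite polar12Dl addrAC (addc2 char2_F2) add0r.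
Qed.

Lemma isJ_unit J : isJ J -> J \in unitmx.
Proof.
move=> iJ; apply: (@mulmx1_unit _ _ _ (J + 1%:M) _).1.
by rewrite mulmxDr mulmx1 isJ_sqr // addrAC addM add0r.
Qed.

Lemma semi_rank g J (Y : M12) (K := gmx L g - 1%:M) : g \in G -> (g * g = 1)%g -> J \in Jsemi g ->
  (Y <= K)%MS -> \rank (K + Y *m J)%MS = (\rank K + \rank Y)%N.
Proof.
move=> Gg gg SJ YK; have [iJ _] := JsemiP _ _ SJ.
rewrite mxrank_disjoint_sum; first by rewrite mxrankMfree // row_free_unit isJ_unit.
apply/eqP; rewrite -submx0; apply/rV_subP=> z; rewrite sub_capmx => /andP[zK /submxP[d zE]].
have fy : app (d *m Y) g = d *m Y by apply: fix_im gg (submx_trans (submxMl _ _) YK).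
have y0 : d *m Y = 0.
  by rewrite -(semi_fix SJ fy) -(mulmxA d) -zE app_rk1 (fix_im gg zK) subrr.
by rewrite zE mulmxA y0 mul0mx sub0mx.
Qed.

(** J is chosen vector by vector on the image K of g - 1. By [semi_polar] the products of [v J] with
    K are known, and so are those with [Y J], which leaves 2^(6 - rank Y) values. Since K and K J
    span the space, J is then determined; the exponents add up to a binomial coefficient. *)
Lemma semi_bound g k (S : {set M12}) (Y : M12) (K := gmx L g - 1%:M) : g \in G -> (g * g = 1)%g ->
    \rank K = 6%N -> {subset S <= Jsemi g} -> (Y <= K)%MS -> agree S Y -> (6 <= \rank Y + k)%N ->
  (#|S| <= 2 ^ 'C(k.+1, 2))%N.
Proof.
move=> Gg gg rK; elim: k S Y => [|k IHk] S Y sS YK aY rY.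
  have [-> | [J0 SJ0]] := set_0Vmem S; first by rewrite cards0.
  rewrite addn0 in rY; have KY : (K <= Y)%MS by rewrite -(geq_leqif (mxrank_leqif_sup YK)) rK.
  have aK : agree S K by move=> J J' SJ SJ' z zK; apply: aY => //; apply: submx_trans KY.
  rewrite expn0; apply: (@agree1 S (K + K *m J0)%MS); first by apply: full12; rewrite (semi_rank Gg gg (sS _ SJ0) (submx_refl K)) rK.
  move=> J J' SJ SJ' z /sub_addsmxP[[a b] /= ->].
  have [[iJ _] [iJ' _]] := (JsemiP _ _ (sS _ SJ), JsemiP _ _ (sS _ SJ')).
  have bK : (b *m K <= K)%MS by apply: submxMl.
  have e J1 : J1 \in S -> b *m (K *m J0) *m J1 = b *m K *m J0 + b *m K.
    move=> SJ1; have [iJ1 _] := JsemiP _ _ (sS _ SJ1).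
    by rewrite mulmxA (aK J0 J1 SJ0 SJ1 _ bK) isJ_vJJ.
  by rewrite [LHS]mulmxDl [RHS]mulmxDl !e // (aK J J') ?submxMl.
have [-> | [J0 SJ0]] := set_0Vmem S; first by rewrite cards0.
have [KY | nKY] := boolP (K <= Y)%MS.
  apply: leq_trans (IHk S Y sS YK aY _) _; last by rewrite leq_exp2l // binS leq_addr.
  by have r6 := mxrankS KY; rewrite rK in r6; apply: leq_trans r6 (leq_addr _ _).
have [i nvY] := row_subPn nKY; set v := row i K in nvY.
have vK : (v <= K)%MS by apply: row_sub.
have fv : app v g = v := fix_im gg vK.
have -> : (2 ^ 'C(k.+2, 2) = 2 ^ k.+1 * 2 ^ 'C(k.+1, 2))%N by rewrite -expnD binS bin1 addnC.
apply: (card_fib (f := fun J : M12 => v *m J) (A := [set v *m J | J : M12 in S])) => [J SJ1 | | w].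
- exact: imset_f.
- apply: leq_trans (card_agree_polar (Z := (K + Y *m J0)%MS) _) _; last first.
    by rewrite (semi_rank Gg gg (sS _ SJ0) YK) rK leq_exp2l // subnDA leq_subLR.
  move=> _ _ /imsetP[J SJ1 ->] /imsetP[J' SJ2 ->] z /sub_addsmxP[[a b] /= ->].
  have [[iJ _] [iJ' _]] := (JsemiP _ _ (sS _ SJ1), JsemiP _ _ (sS _ SJ2)).
  rewrite [LHS]polar12Dr [RHS]polar12Dr !(semi_polar _ Gg gg _ fv) ?sS //; congr (_ + _).
  have bY : (b *m Y <= Y)%MS by apply: submxMl.
  rewrite mulmxA {1}(aY J0 J SJ0 SJ1 _ bY) (aY J0 J' SJ0 SJ2 _ bY).
  by rewrite [LHS]isJ_adj // [RHS]isJ_adj // !isJ_vJJ // (aY J J').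
set S' := [set J in S | _]; have sS' J : J \in S' -> J \in S by case/setIdP.
apply: (IHk S' (Y + v)%MS) => [J /sS'/sS // | | | ].
- by rewrite addsmx_sub YK.
- apply: agree_add => [J J' /sS' SJ1 /sS' SJ2 | J J']; first exact: aY.
  by rewrite !inE => /andP[_ /eqP->] /andP[_ /eqP->].
- by have := leq_add (rank_addv nvY) (leqnn k); rewrite addSn -addnS; apply: leq_trans.
Qed.

(** If J g = g J + g, then J g^n = g^n J + n g^n, so the prime order of g is 2. The image of g - 1
    is then equal to its kernel, of dimension 6, and the exponents 1, ..., 6 add up to 21. *)
Lemma card_Jsemi g : g \in G -> prime #[g]%g -> (#|Jsemi g| <= 2 ^ 21)%N.
Proof.
move=> Gg pg; have [-> | [J SJ]] := set_0Vmem (Jsemi g); first by rewrite cards0.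
have [iJ cJ] := JsemiP _ _ SJ.
have pw n : J *m gmx L (g ^+ n)%g = gmx L (g ^+ n)%g *m J + (n%:R : 'F_2) *: gmx L (g ^+ n)%g.
  elim: n => [|n IHn]; first by rewrite expg0 gmx1 mulmx1 mul1mx scale0r addr0.
  rewrite expgSr gmxM mulmxA IHn mulmxDl -(mulmxA _ J) cJ mulmxDr !mulmxA -scalemxAl -addrA.
  by rewrite -[n.+1]addn1 natrD scalerDl scale1r [_ *: _ + _]addrC.
have := pw #[g]%g; rewrite expg_order gmx1 mulmx1 mul1mx => /eqP.
rewrite -subr_eq0 opprD addrA subrr add0r oppr_eq0 scaler_eq0 => /orP[/eqP n0 | ]; last first.
  by rewrite -mxrank_eq0 mxrank1.
have gg : (g * g = 1)%g.
  have : (2 %| #[g]%g)%N by rewrite (dvdn_pcharf char2_F2) n0 eqxx.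
  by rewrite dvdn_prime2 // => /eqP o2; rewrite -(expg_order g) -o2 expgS expg1.
set K := gmx L g - 1%:M.
have rK : \rank K = 6%N.
  have sKf : (K <= kermx K)%MS.
    apply/sub_kermxP/row_matrixP=> i; rewrite row_mul row0 app_rk1 (fix_im gg (row_sub i K)) subrr //.
  have sfK : (kermx K <= K)%MS.
    apply/row_subP=> i; set v := row i _; have fv : app v g = v.
      have : v *m K = 0 by apply/sub_kermxP; apply: row_sub.
      by rewrite app_rk1 => /eqP; rewrite subr_eq0 => /eqP.
    by rewrite -(semi_fix SJ fv); apply: submxMl.
  have : \rank (kermx K) = \rank K by apply/eqP; rewrite eqn_leq !mxrankS.
  have := rank_leq_row K; rewrite mxrank_ker; move: (\rank K) => r; lia.
apply: (@semi_bound g 6 (Jsemi g) 0) => //.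
- by rewrite sub0mx.
- by move=> J1 J2 _ _ z /submxP[D ->]; rewrite mulmx0 !mul0mx.
- exact: leq_addl.
Qed.

Variable L6 : GLmodel Defs.F4 5.

Lemma isJ_om : isJ (om 0).
Proof.
apply/andP; split; first by rewrite om0E -mat_id mat_mul // mat_add; apply/eqP/ceqP; vm_compute.
apply/forallP; apply: (vcb_all (P := fun v => B (v *m om 0) v == 0)
  (p := fun l => ~~ bT addb (qp 6) (lmul l (madd thr etar)) l)); last by vm_compute.
by move=> l sl nb; rewrite om0E vcb_mat // polar12E (negbTE nb).
Qed.

Definition Jof x : M12 := gmx L x^-1%g *m om 0 *m gmx L x.

Lemma isJ_of x : x \in G -> isJ (Jof x).
Proof.
move=> Gx; have /andP[/eqP o2 /forallP oa] := isJ_om; apply/andP; split.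
  rewrite /Jof !mulmxA -(mulmxA _ (gmx L x) (gmx L x^-1)) gmxKV mulmx1 -(mulmxA _ (om 0) (om 0)) o2.
  by rewrite mulmxDr mulmx1 mulmxDl gmxVK.
apply/forallP=> v; rewrite /Jof !mulmxA -!appE.
by have := oa (app v x^-1%g); rewrite -(GO_polar _ _ Gx) -appM mulVg app1.
Qed.

Lemma tw_Jof c x g : tw (om 0) (om 0) c (gmx L (g ^ x^-1)%g) ->
  Jof x *m gmx L g = gmx L g *m Jof x + c *: gmx L g.
Proof.
rewrite /tw conjgE invgK !gmxM => e.
have := congr1 (fun X => gmx L x^-1%g *m X *m gmx L x) e.
rewrite /= mulmxDr mulmxDl -scalemxAr -scalemxAl !mulmxA !gmxVK !mul1mx.
rewrite -!(mulmxA _ (gmx L x^-1%g) (gmx L x)) !gmxVK !mulmx1 => h.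
by rewrite /Jof h -!mulmxA.
Qed.

(** Each x is sent to the structure [Jof x]; a fibre is contained in a coset of the centraliser of
    [om 0], which has the order of [G6]. *)
Lemma NW_le g : (NW g <= (#|Jlin g| + #|Jsemi g|) * #|G6 L6|)%N.
Proof.
rewrite /NW; apply: (card_fib (f := Jof) (A := Jlin g :|: Jsemi g)) => [x | | p].
- rewrite inE => /andP[Gx /twNP[_ [c]]]; case: (F2_cases c) => -> /tw_Jof e; rewrite inE.
    by apply/orP; left; apply/JlinP; split; [exact: isJ_of | rewrite e scale0r addr0].
  by apply/orP; right; apply/JsemiP; split; [exact: isJ_of | rewrite e scale1r].
- exact: leq_card_setU.
set X := [set x in _ | _]; have [-> | [y /setIdP[/setIdP[Gy _] /eqP yp]]] := set_0Vmem X; first by rewrite cards0.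
rewrite -(card_imset _ (@ext_inj L L6)) -centW_ext -(card_imset _ (mulIg y^-1%g)).
apply: subset_leq_card; apply/subsetP=> _ /imsetP[x /setIdP[/setIdP[Gx _] /eqP xp] ->].
rewrite inE groupM ?groupV //=; apply/eqP; rewrite gmxM.
have oE z : z \in G -> om 0 *m gmx L z = gmx L z *m Jof z.
  by move=> Gz; rewrite /Jof !mulmxA gmxKV mul1mx.
have oV z : z \in G -> gmx L z^-1%g *m om 0 = Jof z *m gmx L z^-1%g.
  by move=> Gz; rewrite /Jof -!mulmxA gmxKV mulmx1.
have -> : om 0 *m (gmx L x *m gmx L y^-1%g) = gmx L x *m (p *m gmx L y^-1%g).
  by rewrite mulmxA oE // xp mulmxA.
have -> : p *m gmx L y^-1%g = gmx L y^-1%g *m om 0 by rewrite oV // yp.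
exact: mulmxA.
Qed.

End Structures.

End FieldStructureCounts.

(** * Isometries g with small rank of g - 1 *)

Module SmallRank.

Import QuadraticForms WittFrames Codings IsometryGroups ModelElements PurityCertificates Derivations Purity Decomposition ThreeCycles Overgroups PlaneStabilizer FieldStructures MaximalSubgroups PermutationCharacters Pentads FieldStructureCounts.

Local Notation Q := Q12.
Local Notation B := (polar Q12).
Local Notation M12 := 'M['F_2]_12.
Local Notation V := 'rV['F_2]_12.

Lemma orbit_count (gT : finGroupType) (T : finType) (G H : {group gT}) (F : gT -> T) (D P : pred T) :
    H \subset G -> {in G &, forall x y, (F x == F y) = (x^-1 * y \in H)%g} ->
    (forall t, D t -> exists2 x, x \in G & F x = t) -> {in G, forall x, D (F x)} ->
  #|[set x in G | P (F x)]| = (#|[set t | D t && P t]| * #|H|)%N.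
Proof.
move=> sHG FE surj DF; rewrite -[LHS]sum1_card (partition_big F (mem [set t | D t && P t])) /=; last first.
  by move=> x; rewrite !inE => /andP[Gx ->]; rewrite DF.
rewrite -sum_nat_const; apply: eq_bigr => t; rewrite inE => /andP[/surj[x Gx <-] Px].
rewrite sum1_card -(card_lcoset H x); apply: eq_card => y; rewrite unfold_in inE mem_lcoset.
apply/andP/idP => [[/andP[Gy _]] | Hxy]; first by rewrite eq_sym FE.
have Gy : y \in G by rewrite -(mulKVg x y) groupM // (subsetP sHG).
by have := FE x y Gx Gy; rewrite Hxy => /eqP e; rewrite Gy -e Px eqxx.
Qed.

Section Elements.

Variable L : GLmodel 'F_2 11.
Variable L6 : GLmodel Defs.F4 5.
Local Notation G := (G12 L).
Local Notation gmx := (gmx L).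
Local Notation centE := (centE L).
Local Notation twN := (twN L).
Implicit Types (g h x : L) (u v w z a b : V).

Lemma conj_inJ (M : {group L}) g h : h \in G -> #|conj_in G M (g ^ h)%g| = #|conj_in G M g|.
Proof.
move=> Gh; rewrite -[LHS](card_imset _ (mulIg h^-1%g)); apply: eq_card => x; rewrite [RHS]inE.
apply/imsetP/andP => [[y /setIdP[Gy c] ->] | [Gx c]].
  by rewrite groupM ?groupV // invMg invgK conjgM.
exists (x * h)%g; last by rewrite mulgK.
by rewrite inE groupM //= invMg -conjgM mulKVg.
Qed.

(** Let b span the image. Comparing Q before and after shows that [Q b = B v b] whenever
    [v (h - 1) = b]; nondegeneracy excludes [Q b = 0], and h is the transvection in b. *)
Lemma rank_one h : h \in G -> rk1 h = 1%N -> exists2 a, Q a = 1 & h = refl Q L a.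
Proof.
move=> Gh r1; set N := gmx h - 1%:M in r1.
have [i nzi] : exists i, row i N != 0.
  have : N != 0 by rewrite -mxrank_eq0 [\rank N]r1.
  by case/matrix0Pn=> i [j Nij]; exists i; apply: contraNneq Nij => /rowP/(_ j); rewrite !mxE => ->.
set b := row i N in nzi.
have Nb v : exists c : 'F_2, v *m N = c *: b.
  have bN : (b <= N)%MS by apply: row_sub.
  have /sub_rVP[c ->] : (v *m N <= b)%MS.
    apply: submx_trans (submxMl _ _) _.
    by rewrite -(geq_leqif (mxrank_leqif_sup bN)) [\rank N]r1 rank_rV nzi.
  by exists c.
have key v : v *m N = b -> Q b = B v b.
  rewrite app_rk1 => e; have : Q (app v h) = Q v := GO_P _ _ Gh v.
  have -> : app v h = v + b by rewrite -e addrC subrK.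
  rewrite QD -addrA => /(congr1 (fun x : 'F_2 => - Q v + x)); rewrite addNr addKr => /eqP.
  by rewrite addr_eq0 (oppc2 char2_F2) => /eqP.
have [v0 v0E] : exists v0, v0 *m N = b by exists (delta_mx 0 i); rewrite -rowE.
have Qb : Q b = 1.
  have [Qb0|//] := F2_cases (Q b); have [z Bz] := polar12_nd nzi.
  have Bv0 : B v0 b = 0 by rewrite -(key v0 v0E).
  have [c zE] := Nb z; case: (F2_cases c) zE => -> zE.
    have := key (z + v0); rewrite mulmxDl zE scale0r add0r v0E => /(_ erefl).
    by rewrite polar12Dl Bz Bv0 addr0 Qb0 => /esym/eqP; rewrite oner_eq0.
  by have := key z; rewrite zE scale1r => /(_ erefl); rewrite Bz Qb0 => /esym/eqP; rewrite oner_eq0.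
exists b => //; apply: app_eqP => v; rewrite app_refl1 //.
have [c vE] := Nb v; have : app v h = v + c *: b by rewrite -vE app_rk1 addrC subrK.
case: (F2_cases c) vE => -> vE ->; last by rewrite -(key v) ?vE ?scale1r // Qb scale1r.
have [-> //|Bv1] := F2_cases (B v b); have := key (v + v0); rewrite mulmxDl vE scale0r add0r v0E.
by move=> /(_ erefl); rewrite polar12Dl -(key v0 v0E) Qb Bv1 (addc2 char2_F2) => /eqP; rewrite oner_eq0.
Qed.

Lemma rank_two g a : g \in G -> rk1 g = 2%N -> Q a = 1 -> (a <= gmx g - 1%:M)%MS ->
  exists2 b, Q b = 1 & g = (refl Q L b * refl Q L a)%g.
Proof.
move=> Gg r2 Qa aN; set h := (g * refl Q L a)%g.
have Gh : h \in G by rewrite groupM ?refl_in_G.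
have oh : odd (rk1 h) by rewrite (rk1_refl char2_F2 q12) ?Qa ?oner_eq0 // r2.
have hN : (gmx h - 1%:M <= gmx g - 1%:M)%MS.
  apply/row_subP=> i; rewrite rowE app_rk1 appM app_refl1 //.
  rewrite addrAC addmx_sub ?scalemx_sub // -app_rk1; exact: submxMl.
have r1 : rk1 h = 1%N.
  by have := mxrankS hN; rewrite -/(rk1 h) -/(rk1 g) r2; move: (rk1 h) oh => [|[|[|k]]].
have [b Qb hE] := rank_one Gh r1; exists b => //.
by rewrite -hE /h -mulgA refl_sqr // mulg1.
Qed.

Lemma refl2_N a b v : Q a = 1 -> Q b = 1 ->
  v *m (gmx (refl Q L b * refl Q L a)%g - 1%:M) = B v b *: b + (B v a + B v b * B b a) *: a.
Proof.
move=> Qa Qb; rewrite app_rk1 appM !app_refl1 // polar12Dl (polarZl q12).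
by rewrite -!addrA addrC addrA subrK.
Qed.

(** With N = g - 1, semilinearity reads 1 = J N - N J - N, and the right-hand side has rank at most
    9. *)
Lemma Jsemi0 g : (rk1 g <= 3)%N -> Jsemi g = set0.
Proof.
move=> r3; apply/setP=> J; rewrite [RHS]inE; apply/negP=> /JsemiP[iJ cJ].
set N := gmx g - 1%:M; have gE : gmx g = N + 1%:M by rewrite subrK.
have e : 1%:M = J *m N - (N *m J + N).
  move: cJ; rewrite gE mulmxDr mulmx1 mulmxDl mul1mx => cJ.
  apply/eqP; rewrite eq_sym subr_eq; apply/eqP/(addIr J).
  by rewrite cJ; apply/matrixP=> i j; rewrite !mxE; ring.
have := mxrank1 'F_2 12; rewrite e => r12.
have : (12 <= rk1 g + (rk1 g + rk1 g))%N.
  rewrite -r12; apply: leq_trans (mxrank_add _ _) _; rewrite leq_add ?mxrankM_maxr //.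
  rewrite mxrank_opp; apply: leq_trans (mxrank_add _ _) _; by rewrite leq_add ?mxrankM_maxl.
by move: (rk1 g) r3 => r; lia.
Qed.

Lemma sep_vec u w : u != 0 -> w != u -> exists z, B z u = 1 /\ B z w = 0.
Proof.
move=> nzu nwu; have [z Bzu] := polar12_nd nzu; have [|Bzw] := F2_cases (B z w); first by exists z.
have nz : u + w != 0 by rewrite addr_eq0 (oppc2v char2_F2) eq_sym.
have [t] := polar12_nd nz; rewrite polar12Dr; case: (F2_cases (B t u)) => Btu; case: (F2_cases (B t w)) => Btw;
  rewrite Btu Btw ?addr0 ?add0r ?(addc2 char2_F2).
- by move/eqP; rewrite eq_sym oner_eq0.
- by move=> _; exists (z + t); rewrite !polar12Dl Bzu Bzw Btu Btw addr0 (addc2 char2_F2).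
- by move=> _; exists t.
- by move/eqP; rewrite eq_sym oner_eq0.
Qed.

(* [refl w * refl u] commutes with a self-adjoint X only if X acts on the plane <u, w> by a symmetric matrix. *)
Lemma refl2_comm (X : M12) u w : (forall z t, B (z *m X) t = B z (t *m X)) ->
    Q u = 1 -> Q w = 1 -> B w u = 0 -> w != u ->
    X *m gmx (refl Q L w * refl Q L u)%g = gmx (refl Q L w * refl Q L u)%g *m X ->
  exists al be de, u *m X = al *: u + be *: w /\ w *m X = be *: u + de *: w.
Proof.
move=> adjX Qu Qw Bwu nwu cX.
have nzv v : Q v = 1 -> v != 0.
  by move=> Qv; apply: contraTneq isT => v0; have := oner_neq0 'F_2; rewrite -Qv v0 (quad0 q12) eqxx.
set g := (_ * _)%g in cX; have cN z : z *m X *m (gmx g - 1%:M) = z *m (gmx g - 1%:M) *m X.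
  by rewrite -!mulmxA mulmxBr mulmxBl mulmx1 mul1mx cX.
have eqX z : B z (w *m X) *: w + B z (u *m X) *: u = B z w *: (w *m X) + B z u *: (u *m X).
  have := cN z; rewrite !refl2_N // Bwu !mulr0 !addr0 mulmxDl -!scalemxAl !adjX; exact.
have [z1 [B1u B1w]] := sep_vec (nzv u Qu) nwu.
have nuw : u != w by rewrite eq_sym.
have [z2 [B2w B2u]] := sep_vec (nzv w Qw) nuw.
have uE : u *m X = B z1 (u *m X) *: u + B z1 (w *m X) *: w.
  by have := eqX z1; rewrite B1u B1w scale0r add0r scale1r addrC => ->.
have wE : w *m X = B z2 (u *m X) *: u + B z2 (w *m X) *: w.
  by have := eqX z2; rewrite B2u B2w scale0r addr0 scale1r addrC => ->.
have bg : B z1 (w *m X) = B z2 (u *m X).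
  by rewrite {1}wE polar12Dr !(polarZr q12) B1u B1w mulr1 mulr0 addr0.
exists (B z1 (u *m X)), (B z2 (u *m X)), (B z2 (w *m X)).
by split; [rewrite {1}uE bg | exact: wE].
Qed.

Lemma refl2_commV (X : M12) u w al be de : (forall z t, B (z *m X) t = B z (t *m X)) ->
    Q u = 1 -> Q w = 1 -> B w u = 0 ->
    u *m X = al *: u + be *: w -> w *m X = be *: u + de *: w ->
  X *m gmx (refl Q L w * refl Q L u)%g = gmx (refl Q L w * refl Q L u)%g *m X.
Proof.
move=> adjX Qu Qw Bwu uX wX; set g := (_ * _)%g.
suff cN : X *m (gmx g - 1%:M) = (gmx g - 1%:M) *m X.
  by move: cN; rewrite mulmxBr mulmxBl mulmx1 mul1mx => /addIr.
apply: gmx_eqP => z; rewrite !mulmxA !refl2_N // Bwu !mulr0 !addr0 mulmxDl -!scalemxAl !adjX uX wX.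
rewrite !polar12Dr !(polarZr q12); move: (B z u) (B z w) => bu bw.
by apply/rowP=> i; rewrite !mxE; ring.
Qed.

Lemma eps_self z t : B (z *m eps) t = B z (t *m eps). Proof. exact: eps_adj. Qed.
Lemma om_self z t : B (z *m om 0) t = B z (t *m om 0). Proof. exact: isJ_adj isJ_om. Qed.

Definition UW u := (u *m eps == 0) || (u *m eps == u).

Lemma lin_indep2 (al be : 'F_2) u w : u != 0 -> w != 0 -> w != u -> al *: u + be *: w = 0 -> al = 0 /\ be = 0.
Proof.
move=> nu nw nwu; case: (F2_cases al) => ->; case: (F2_cases be) => ->; rewrite ?scale0r ?scale1r ?add0r ?addr0 //.
- by move/eqP; rewrite (negPf nw).
- by move/eqP; rewrite (negPf nu).
- by move/eqP; rewrite addr_eq0 (oppc2v char2_F2) eq_sym (negPf nwu).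
Qed.

Lemma nonsing_neq0 v : Q v = 1 -> v != 0.
Proof. by move=> Qv; apply: contraTneq isT => v0; have := oner_neq0 'F_2; rewrite -Qv v0 (quad0 q12) eqxx. Qed.

(** A symmetric idempotent 2 x 2 matrix over F_2 is diagonal, so [eps] sends each of the two vectors
    to 0 or to itself. *)
Lemma c2_centE u w : Q u = 1 -> Q w = 1 -> B w u = 0 -> w != u ->
  ((refl Q L w * refl Q L u)%g \in centE) = UW u && UW w.
Proof.
move=> Qu Qw Bwu nwu; have Gg : (refl Q L w * refl Q L u)%g \in G by rewrite groupM ?refl_in_G.
have [nu nw] := (nonsing_neq0 Qu, nonsing_neq0 Qw).
apply/centEP/andP => [[_ c] | [Uu Uw]]; last first.
  split=> //.
  have UE v : UW v -> exists c : 'F_2, v *m eps = c *: v.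
    by case/orP=> /eqP->; [exists 0; rewrite scale0r | exists 1; rewrite scale1r].
  have [[al uE] [de wE]] := (UE u Uu, UE w Uw).
  apply: (refl2_commV eps_self (al := al) (be := 0) (de := de)) => //.
    by rewrite uE scale0r addr0.
  by rewrite wE scale0r add0r.
have [al [be [de [uE wE]]]] := refl2_comm eps_self Qu Qw Bwu nwu c.
have uu : u *m eps *m eps = u *m eps by rewrite -mulmxA eps_eps.
have e0 : (al * al + be * be + al) *: u + (al * be + be * de + be) *: w = 0.
  rewrite -[RHS](addV (u *m eps)) -{1}uu uE mulmxDl -!scalemxAl uE wE.
  by apply/rowP=> i; rewrite !mxE; ring.
have [h _] := lin_indep2 nu nw nwu e0.
have be0 : be = 0.
  by move: h; case: (F2_cases al) => ->; case: (F2_cases be) => -> //; rewrite ?mul0r ?mulr1 ?add0r ?addr0 => /eqP; rewrite ?oner_eq0 // -addrA (addc2 char2_F2) addr0 oner_eq0.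
rewrite /UW uE wE be0 !scale0r addr0 add0r.
by case: (F2_cases al) => ->; case: (F2_cases de) => ->; rewrite ?scale0r ?scale1r !eqxx ?orbT.
Qed.

(** A symmetric 2 x 2 root of X^2 + X + 1 over F_2 has off-diagonal entry 1, so the two vectors lie
    on one F_4-line. The semilinear case is excluded by [Jsemi0]. *)
Lemma c2_lin u w : Q u = 1 -> Q w = 1 -> B w u = 0 -> w != u ->
  ((refl Q L w * refl Q L u)%g \in twN 0) = (w == u *m om 0) || (w == u *m om 0 + u).
Proof.
move=> Qu Qw Bwu nwu; set g := (_ * _)%g; have Gg : g \in G by rewrite groupM ?refl_in_G.
have [nu nw] := (nonsing_neq0 Qu, nonsing_neq0 Qw).
have r3 : (rk1 g <= 3)%N.
  have sN : (gmx g - 1%:M <= u + w)%MS.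
    apply/row_subP=> i; rewrite rowE refl2_N // addmx_sub ?scalemx_sub ?addsmxSr ?addsmxSl //.
  apply: leq_trans (mxrankS sN) _; apply: leq_trans (mxrank_adds_leqif u w) _.
  by rewrite !rank_rV; case: (u != 0); case: (w != 0).
apply/twNP/orP => [[_ [c tg]] | wE]; last first.
  have [al wE'] : exists al : 'F_2, w = u *m om 0 + al *: u.
    by case: wE => /eqP->; [exists 0; rewrite scale0r addr0 | exists 1; rewrite scale1r].
  split=> //; exists 0; apply: tw_comm.
  have uE : u *m om 0 = al *: u + 1 *: w.
    by rewrite scale1r wE' addrC -addrA addV addr0.
  apply: (refl2_commV om_self (al := al) (be := 1) (de := 1 + al)) => //.
  rewrite wE' mulmxDl -scalemxAl (isJ_vJJ _ isJ_om).
  move: (u *m om 0) {wE' uE wE} => t.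
  by case: (F2_cases al) => ->; apply/rowP=> i; rewrite !mxE; move: (t 0 i) (u 0 i) => x y;
     case: (F2_cases x) => ->; case: (F2_cases y) => ->; apply: val_inj.
have c0 : c = 0.
  case: (F2_cases c) tg => // -> tg; have := Jsemi0 r3 => /setP/(_ (om 0)); rewrite [RHS]inE.
  by move/negP; case; apply/JsemiP; split; [exact: isJ_om | rewrite tg scale1r].
rewrite c0 /tw scale0r addr0 in tg.
have [al [be [de [uE wE]]]] := refl2_comm om_self Qu Qw Bwu nwu tg.
have uu := isJ_vJJ u isJ_om.
have e0 : (al * al + be * be + al + 1) *: u + (al * be + be * de + be) *: w = 0.
  rewrite -[RHS](addV (u *m om 0 *m om 0)) {2}uu uE mulmxDl -!scalemxAl uE wE.
  by apply/rowP=> i; rewrite !mxE; ring.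
have [h _] := lin_indep2 nu nw nwu e0.
have be1 : be = 1.
  by move: h; case: (F2_cases al) => ->; case: (F2_cases be) => -> //; rewrite ?mul0r ?mulr1 ?add0r ?addr0 => /eqP; rewrite ?oner_eq0 // (addc2 char2_F2) add0r oner_eq0.
rewrite be1 scale1r in uE.
case: (F2_cases al) uE => ->; rewrite ?scale0r ?add0r ?scale1r => uE; first by left; rewrite uE.
by right; rewrite uE addrC addrA addV add0r.
Qed.

End Elements.

End SmallRank.

(** * Conjugates counted through orbits on pairs of vectors *)

Module PairCounting.

Import QuadraticForms WittFrames Codings IsometryGroups ModelElements PurityCertificates Derivations Purity Decomposition ThreeCycles Overgroups PlaneStabilizer FieldStructures MaximalSubgroups PermutationCharacters Pentads FieldStructureCounts SmallRank.

Local Notation Q := Q12.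
Local Notation B := (polar Q12).
Local Notation M12 := 'M['F_2]_12.
Local Notation V := 'rV['F_2]_12.

Lemma vcb_eq n a b : (vcb n a == vcb n b) = veq n a b.
Proof.
apply/eqP/idP => [e | /veqP //]; rewrite /veq lallE; apply/allP=> j; rewrite mem_iota add0n => /= ltj.
by have := congr1 (fun v : 'rV_n => v 0 (Ordinal ltj)) e; rewrite !mxE => /b2F_inj/eqP.
Qed.

Lemma card_pair_list (D P : pred (V * V)) (s : seq (seq bool * seq bool)) (p : seq bool -> seq bool -> bool) :
    (forall t, D t -> P t -> exists2 c, c \in s & (vcb 12 c.1, vcb 12 c.2) = t /\ p c.1 c.2) ->
  (#|[set t | D t && P t]| <= count (fun c => p c.1 c.2) s)%N.
Proof.
move=> cov; pose f (c : seq bool * seq bool) := (vcb 12 c.1, vcb 12 c.2).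
rewrite -size_filter -(size_map f); apply: leq_trans (card_size _).
apply: subset_leq_card; apply/subsetP=> t; rewrite inE => /andP[Dt Pt].
have [c sc [ct pc]] := cov t Dt Pt; apply/mapP; exists c; last by rewrite /f ct.
by rewrite mem_filter pc.
Qed.

Lemma card_pair_codes (P : pred (V * V)) (p1 : seq bool -> bool) (p : seq bool -> seq bool -> bool)
    (s := [seq l <- allv [:: false; true] 12 | p1 l]) :
    (forall a b, size a = 12%N -> size b = 12%N -> P (vcb 12 a, vcb 12 b) = [&& p1 a, p1 b & p a b]) ->
  #|[set t | P t]| = sumn [seq count (p a) s | a <- s].
Proof.
move=> PE; pose f (c : seq bool * seq bool) := (vcb 12 c.1, vcb 12 c.2).
pose r := [seq c <- [seq (a, b) | a <- s, b <- s] | p c.1 c.2].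
have -> : sumn [seq count (p a) s | a <- s] = size r.
  rewrite /r size_filter count_flatten -map_comp; congr sumn; apply: eq_map => a /=.
  by rewrite count_map; apply: eq_count.
have us : uniq s by rewrite filter_uniq ?(uniq_allv codingF2).
have ur : uniq (map f r).
  rewrite map_inj_in_uniq; first by rewrite filter_uniq // allpairs_uniq // => -[a b] [a' b'] _ _ [-> ->].
  have sz c : c \in r -> size c.1 = 12%N /\ size c.2 = 12%N.
    rewrite mem_filter => /andP[_ /allpairsP[[a b] [/= sa sb ->]]] /=.
    by move: sa sb; rewrite !mem_filter !(mem_allvs codingF2) => /andP[_ /eqP->] /andP[_ /eqP->].
  case=> a b [a' b'] /sz[/= sa sb] /sz[/= sa' sb'] [/vcb_inj ea /vcb_inj eb].
  by rewrite ea // eb.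
rewrite -(size_map f) -(card_uniqP ur); apply: eq_card => -[u v]; rewrite inE.
have [[a sa <-] [b sb <-]] := (vcb_surj u, vcb_surj v).
apply/idP/mapP => [|[[a' b']]].
  rewrite PE // => /and3P[pa pb pab]; exists (a, b) => //; rewrite mem_filter pab.
  by apply/allpairsP; exists (a, b); rewrite !mem_filter pa pb !mem_allvb.
rewrite mem_filter => /andP[/= pab /allpairsP[[a2 b2] [/= sa2 sb2 [e1 e2]]]] [-> ->].
rewrite e1 e2 in pab *; move: sa2 sb2; rewrite !mem_filter !(mem_allvs codingF2).
by case/andP=> pa /eqP za /andP[pb /eqP zb]; rewrite PE // pa pb.
Qed.

Section Pairs.

Variable L : GLmodel 'F_2 11.
Local Notation G := (G12 L).
Local Notation gmx := (gmx L).
Implicit Types (g h x y : L) (u v w z a b : V).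

Definition gram a b (t : V * V) :=
  [&& Q t.1 == Q a, Q t.2 == Q b, B t.1 t.2 == B a b, t.1 != 0, t.2 != 0 & t.2 != t.1].

Definition conj_pairs u v (P : pred (V * V)) := [set x in G | P (app u x^-1%g, app v x^-1%g)].

Lemma conj_pairsJ u v y P : y \in G -> #|conj_pairs u v P| = #|conj_pairs (app u y) (app v y) P|.
Proof.
move=> Gy; rewrite -[LHS](card_imset _ (mulIg y)); apply: eq_card => x; rewrite [RHS]inE.
apply/imsetP/andP => [[z /setIdP[Gz c] ->] | [Gx c]].
  by rewrite groupM // invMg -!appM !mulKVg.
exists (x * y^-1)%g; last by rewrite mulgKV.
by rewrite inE groupM ?groupV //= invMg invgK !appM.
Qed.

(** By Witt's theorem the pairs with given Gram data form a single orbit, of size n1 n2, and [k] is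
    the order of the stabiliser. *)
Lemma pair_count f1 f2 n1 n2 (a := vcb 12 f1) (b := vcb 12 f2) u v :
    witt_ok false [:: false; true] addb andb 11 (qp 6) [::] [:: f1; f2] ->
    witt_sizes false [:: false; true] addb andb 11 (qp 6) [::] [:: f1; f2] = [:: n1; n2] ->
    size f1 = 12%N -> size f2 = 12%N -> gram a b (a, b) -> gram a b (u, v) ->
  exists k, [/\ (0 < k)%N, #|G| = (n1 * n2 * k)%N
    & forall P : pred (V * V), #|conj_pairs u v P| = (#|[set t | gram a b t && P t]| * k)%N].
Proof.
move=> ok sz s1 s2 gab guv; set H := fixer_group Q12 L [:: b; a].
have surj t : gram a b t -> exists2 y, y \in G & app t.1 y = a /\ app t.2 y = b.
  by case/and5P=> /eqP q1 /eqP q2 /eqP qb n1' /andP[n2' n3']; apply: G12_pair ok q1 q2 qb n1' n2' n3'.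
exists #|H|; split; first exact: cardG_gt0.
  have al : all [in allv [:: false; true] 12] [:: f1; f2].
    exact: introT andP (conj (mem_allvb s1) (introT andP (conj (mem_allvb s2) isT))).
  have := card_fixer codingF2 char2_F2 q12 Q12E L ok al; rewrite sz /= fixer_nil => ->.
  by rewrite mulnA.
move=> P; have [y Gy [/= uy vy]] := surj _ guv; rewrite (conj_pairsJ u v P Gy) uy vy {ok sz}.
apply: (@orbit_count _ _ (G12 L) H (fun x => (app a x^-1%g, app b x^-1%g)) (gram a b) P).
- by apply/subsetP=> x /fixerP[].
- move=> x z Gx Gz; rewrite xpair_eqE; apply/andP/fixerP => [[/eqP ea /eqP eb] | [_ fx]].
    split; first by rewrite groupM ?groupV.
    move=> w; rewrite !inE => /orP[] /eqP->; rewrite appM; [rewrite eb | rewrite ea]; exact: appKV.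
  have back w : w \in [:: b; a] -> app w x^-1%g == app w z^-1%g.
    by move=> sw; rewrite -{2}(fx w sw) -appM mulgK.
  by split; apply: back; rewrite !inE eqxx ?orbT.
- move=> t /surj[x Gx [xa xb]]; exists x => //; rewrite -xa -xb !appK; by case: (t).
- move=> x Gx; rewrite /gram /= !(GO_P _ _ (groupVr Gx)) !(GO_polar _ _ (groupVr Gx)).
  have := gab; rewrite /gram /= => /and5P[-> -> -> na /andP[nb nab]].
  have inj : injective (fun w => app w x^-1%g) := @app_inj _ _ L x^-1%g.
  by rewrite -(app0 x^-1%g) !(inj_eq inj) na nb nab.
Qed.

End Pairs.

End PairCounting.

(** * The numerical counts for pairs *)

Module FrameCounts.

Import QuadraticForms WittFrames Codings IsometryGroups ModelElements PurityCertificates Derivations Purity Decomposition ThreeCycles Overgroups PlaneStabilizer FieldStructures MaximalSubgroups PermutationCharacters Pentads FieldStructureCounts SmallRank PairCounting.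

Local Notation Q := Q12.
Local Notation B := (polar Q12).
Local Notation M12 := 'M['F_2]_12.
Local Notation V := 'rV['F_2]_12.

(** The span of the pair is invariant under [eps]. *)
Definition stab (t : V * V) :=
  (t.1 *m eps \in [:: 0; t.1; t.2; t.1 + t.2]) && (t.2 *m eps \in [:: 0; t.1; t.2; t.1 + t.2]).

(** An invariant span meets U and W in complementary parts, which leaves these eight shapes of
    pairs. A pair may be listed repeatedly, as only an upper bound is derived from this list. *)
Definition cand (Ul Wl : seq (seq bool)) : seq (seq bool * seq bool) :=
  [seq (a, b) | a <- Ul, b <- Ul] ++ [seq (a, b) | a <- Wl, b <- Wl] ++
  [seq (a, b) | a <- Ul, b <- Wl] ++ [seq (b, a) | a <- Ul, b <- Wl] ++
  [seq (a, addb_l a b) | a <- Ul, b <- Wl] ++ [seq (addb_l a b, a) | a <- Ul, b <- Wl] ++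
  [seq (b, addb_l a b) | a <- Ul, b <- Wl] ++ [seq (addb_l a b, b) | a <- Ul, b <- Wl].

Lemma stab_cand Ul Wl t : (forall v, exists2 l, l \in Ul & vcb 12 l = v *m eps) ->
    (forall v, exists2 l, l \in Wl & vcb 12 l = v + v *m eps) -> stab t ->
  exists2 c, c \in cand Ul Wl & (vcb 12 c.1, vcb 12 c.2) = t.
Proof.
case: t => u w HU HW /andP[/= su sw].
have [[a Ua ue] [b Wb ud]] := (HU u, HW u); have [[c Uc we] [d Wd wd]] := (HU w, HW w).
have uE : vcb 12 (addb_l a b) = u by rewrite vcbD ue ud addrCA addV addr0.
have wE : vcb 12 (addb_l c d) = w by rewrite vcbD we wd addrCA addV addr0.
have key (f : seq bool -> seq bool -> seq bool * seq bool) X Y x y :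
    x \in X -> y \in Y -> (forall z, z \in [seq f p q | p <- X, q <- Y] -> z \in cand Ul Wl) ->
    vcb 12 (f x y).1 = u -> vcb 12 (f x y).2 = w ->
    exists2 e, e \in cand Ul Wl & (vcb 12 e.1, vcb 12 e.2) = (u, w).
  by move=> Xx Yy sub e1 e2; exists (f x y); [exact/sub/allpairs_f | rewrite e1 e2].
move: sw; rewrite !inE => /or4P[] /eqP weE; rewrite weE in we wd.
- move: su; rewrite !inE => /or4P[] /eqP ueE; rewrite ueE in ue ud.
  + apply: (key (fun p q => (p, q)) Wl Wl b d) => //=; rewrite ?ud ?wd ?addr0 //.
    by move=> z; rewrite !mem_cat => ->; rewrite !orbT.
  + apply: (key (fun p q => (p, q)) Ul Wl a d) => //=; rewrite ?ue ?wd ?addr0 //.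
    by move=> z; rewrite !mem_cat => ->; rewrite !orbT.
  + apply: (key (fun p q => (addb_l p q, p)) Ul Wl a b) => //=.
    by move=> z; rewrite !mem_cat => ->; rewrite !orbT.
  + apply: (key (fun p q => (addb_l p q, q)) Ul Wl a b) => //=; last by rewrite ud addrA addV add0r.
    by move=> z; rewrite !mem_cat => ->; rewrite !orbT.
- apply: (key (fun p q => (p, addb_l p q)) Ul Wl c d) => //=.
  by move=> z; rewrite !mem_cat => ->; rewrite !orbT.
- move: su; rewrite !inE => /or4P[] /eqP ueE; rewrite ueE in ue ud.
  + apply: (key (fun p q => (q, p)) Ul Wl c b) => //=; rewrite ?ud ?addr0 //.
    by move=> z; rewrite !mem_cat => ->; rewrite !orbT.
  + apply: (key (fun p q => (p, q)) Ul Ul a c) => //=.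
    by move=> z; rewrite !mem_cat => ->; rewrite ?orbT.
  + apply: (key (fun p q => (addb_l p q, p)) Ul Wl a b) => //=.
    by move=> z; rewrite !mem_cat => ->; rewrite !orbT.
  + apply: (key (fun p q => (addb_l p q, q)) Ul Wl a b) => //=; last by rewrite ud addrA addV add0r.
    by move=> z; rewrite !mem_cat => ->; rewrite !orbT.
- apply: (key (fun p q => (q, addb_l p q)) Ul Wl c d) => //=; last by rewrite wd addrC -addrA addV addr0.
  by move=> z; rewrite !mem_cat => ->; rewrite !orbT.
Qed.

Definition Ul := [seq l <- allv [:: false; true] 12 | veq 12 (lmul l epsr) l].
Definition Wl := [seq l <- allv [:: false; true] 12 | veq 12 (lmul l epsr) [::]].

Lemma eps_code l : vcb 12 l *m eps = vcb 12 (lmul l epsr).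
Proof. by rewrite cmx vcb_mat. Qed.

Lemma UlP v : exists2 l, l \in Ul & vcb 12 l = v *m eps.
Proof.
have [l sl lE] := vcb_surj (v *m eps); exists l; last exact: lE.
by rewrite mem_filter mem_allvb // andbT -vcb_eq -eps_code lE -mulmxA eps_eps.
Qed.

Lemma WlP v : exists2 l, l \in Wl & vcb 12 l = v + v *m eps.
Proof.
have [l sl lE] := vcb_surj (v + v *m eps); exists l; last exact: lE.
by rewrite mem_filter mem_allvb // andbT -vcb_eq -eps_code lE mulmxDl -mulmxA eps_eps addV vcb0.
Qed.

(* [gramc] is the code version of [gram]; the value of the form, [qa = Q a = Q b], and of the polarity, [c = B a b], are parameters. *)
Definition gramc (qa c : bool) (a b : seq bool) :=
  if qp 6 a == qa then if qp 6 b == qa then if bT addb (qp 6) a b == c then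
    if veq 12 a [::] then false else if veq 12 b [::] then false else ~~ veq 12 b a
  else false else false else false.

Lemma gramcP qa c a b u v : Q a = b2F qa -> Q b = b2F qa -> B a b = b2F c ->
  gram a b (vcb 12 u, vcb 12 v) = gramc qa c u v.
Proof.
move=> qa1 qa2 qa3; rewrite /gram /= qa1 qa2 qa3 !Q12E polar12E -(vcb0 12) !vcb_eq !(inj_eq b2F_inj) /gramc.
by do !case: ifP => //= _.
Qed.

Lemma cnt_nperp : count (fun c => gramc true true c.1 c.2) (cand Ul Wl) = 9852%N.
Proof. apply/eqP; vm_cast_no_check (erefl true). Qed.

Lemma cnt_ts : count (fun c => gramc false false c.1 c.2) (cand Ul Wl) = 9996%N.
Proof. apply/eqP; vm_cast_no_check (erefl true). Qed.

Definition UWc l := if veq 12 (lmul l epsr) [::] then true else veq 12 (lmul l epsr) l.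

Lemma UW_code l : UW (vcb 12 l) = UWc l.
Proof. by rewrite /UW eps_code -(vcb0 12) !vcb_eq /UWc; case: (veq _ _ [::]). Qed.

(** Both vectors in U (10 times 3), one in U and one in W (2 times 10 times 136), or both in W (136
    times 63). *)
Lemma cnt_perp (s := [seq l <- allv [:: false; true] 12 | if qp 6 l then UWc l else false]) :
  sumn [seq count (gramc true false a) s | a <- s] = 11318%N.
Proof. apply/eqP; vm_cast_no_check (erefl true). Qed.

Definition om0c l := lmul l (omr false).

Lemma om0_code l : vcb 12 l *m om 0 = vcb 12 (om0c l).
Proof. by rewrite om_code eqxx vcb_mat ?size_omr. Qed.

(** One partner on its F_4-line for each of the 2016 nonsingular vectors. *)
Lemma cnt_om : count (fun l => if qp 6 l then addb (gramc true false l (om0c l)) (gramc true false l (addb_l (om0c l) l))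
  else false) (allv [:: false; true] 12) = 2016%N.
Proof. apply/eqP; vm_cast_no_check (erefl true). Qed.

Lemma gr_perp : [/\ qp 6 (bl 12 65) = true, qp 6 (bl 12 67) = true & bT addb (qp 6) (bl 12 65) (bl 12 67) = false].
Proof. by vm_compute. Qed.
Lemma gr_nperp : [/\ qp 6 (bl 12 65) = true, qp 6 (bl 12 131) = true & bT addb (qp 6) (bl 12 65) (bl 12 131) = true].
Proof. by vm_compute. Qed.
Lemma gr_ts : [/\ qp 6 (bl 12 1) = false, qp 6 (bl 12 2) = false & bT addb (qp 6) (bl 12 1) (bl 12 2) = false].
Proof. by vm_compute. Qed.
Lemma gc_perp : gramc true false (bl 12 65) (bl 12 67). Proof. by vm_compute. Qed.
Lemma gc_nperp : gramc true true (bl 12 65) (bl 12 131). Proof. by vm_compute. Qed.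
Lemma gc_ts : gramc false false (bl 12 1) (bl 12 2). Proof. by vm_compute. Qed.

Lemma stab_bound qa c n u v : count (fun e => gramc qa c e.1 e.2) (cand Ul Wl) = n ->
  Q u = b2F qa -> Q v = b2F qa -> B u v = b2F c -> (#|[set t | gram u v t && stab t]| <= n)%N.
Proof.
move=> <- Qu Qv Buv; apply: (@card_pair_list _ _ (cand Ul Wl) (gramc qa c)) => t gt st.
have [e ce et] := stab_cand UlP WlP st; exists e; first exact: ce.
split; first exact: et.
by rewrite -(gramcP _ _ Qu Qv Buv) et.
Qed.

Lemma le_frame c n N k : (c <= n -> c * k * N <= n * (N * k))%N.
Proof. by move=> cn; rewrite -mulnA [(k * N)%N]mulnC leq_mul2r cn orbT. Qed.

Definition om_pair (t : V * V) := (t.2 == t.1 *m om 0) || (t.2 == t.1 *m om 0 + t.1).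
Definition UW_pair (t : V * V) := UW t.1 && UW t.2.

Section Pairs.

Variable L : GLmodel 'F_2 11.
Local Notation G := (G12 L).

Lemma frame_count f1 f2 n1 n2 qa c u v :
    [/\ qp 6 f1 = qa, qp 6 f2 = qa & bT addb (qp 6) f1 f2 = c] -> gramc qa c f1 f2 ->
    witt_ok false [:: false; true] addb andb 11 (qp 6) [::] [:: f1; f2] ->
    witt_sizes false [:: false; true] addb andb 11 (qp 6) [::] [:: f1; f2] = [:: n1; n2] ->
    size f1 = 12%N -> size f2 = 12%N ->
    Q u = b2F qa -> Q v = b2F qa -> B u v = b2F c -> u != 0 -> v != 0 -> v != u ->
  exists k, [/\ (0 < k)%N, #|G| = (n1 * n2 * k)%N
    & forall P : pred (V * V), #|conj_pairs L u v P| = (#|[set t | gram u v t && P t]| * k)%N].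
Proof.
case=> q1 q2 b12 gc ok sz s1 s2 Qu Qv Buv nu nv nuv.
have E w t : gram (vcb 12 f1) (vcb 12 f2) (w, t) = gram u v (w, t).
  by rewrite /gram !Q12E polar12E q1 q2 b12 Qu Qv Buv.
have [||k [k0 Gk cP]] := @pair_count L f1 f2 n1 n2 u v ok sz s1 s2.
- by rewrite (gramcP (qa := qa) (c := c)) ?Q12E ?polar12E ?q1 ?q2 ?b12.
- by rewrite E /gram /= !eqxx nu nv nuv.
exists k; split=> // P; rewrite cP; congr (_ * _)%N; apply: eq_card => -[w t].
by rewrite !inE E.
Qed.

Lemma nperp_count u v : Q u = 1 -> Q v = 1 -> B u v = 1 ->
  (#|conj_pairs L u v stab| * (2016 * 992) <= 9852 * #|G|)%N.
Proof.
move=> Qu Qv Buv; have nu := nonsing_neq0 Qu; have nv := nonsing_neq0 Qv.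
have nuv : v != u by apply: contraTneq isT => e; move: Buv; rewrite e (polarvv char2_F2 q12) => /esym/eqP; rewrite oner_eq0.
have [k [_ -> ->]] := frame_count gr_nperp gc_nperp witt_nperp sizes_nperp erefl erefl Qu Qv Buv nu nv nuv.
apply: le_frame; exact: stab_bound cnt_nperp Qu Qv Buv.
Qed.

Lemma ts_count u v : Q u = 0 -> Q v = 0 -> B u v = 0 -> u != 0 -> v != 0 -> v != u ->
  (#|conj_pairs L u v stab| * (2079 * 1054) <= 9996 * #|G|)%N.
Proof.
move=> Qu Qv Buv nu nv nuv.
have [k [_ -> ->]] := frame_count gr_ts gc_ts witt_ts sizes_ts erefl erefl Qu Qv Buv nu nv nuv.
apply: le_frame; exact: stab_bound cnt_ts Qu Qv Buv.
Qed.

Lemma perp_count u v : Q u = 1 -> Q v = 1 -> B u v = 0 -> v != u ->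
  (#|conj_pairs L u v UW_pair| * (2016 * 1023) = 11318 * #|G|)%N /\
  (#|conj_pairs L u v om_pair| * (2016 * 1023) = 2016 * #|G|)%N.
Proof.
move=> Qu Qv Buv nuv; have nu := nonsing_neq0 Qu; have nv := nonsing_neq0 Qv.
have [k [_ -> cP]] := frame_count gr_perp gc_perp witt_perp sizes_perp erefl erefl Qu Qv Buv nu nv nuv.
rewrite !cP; have eqf c n N : c = n -> (c * k * N = n * (N * k))%N by move=> ->; rewrite -mulnA [(k * N)%N]mulnC.
split; apply: eqf.
  rewrite -cnt_perp; apply: card_pair_codes => a b sa sb; rewrite /UW_pair /= !UW_code (gramcP (qa := true) (c := false)) //.
  rewrite /gramc; case: (qp 6 a); case: (qp 6 b) => //=; rewrite ?andbF //.
  by case: (UWc a); case: (UWc b) => /=; rewrite ?andbF ?andbT.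
rewrite -cnt_om -(card_codes (P := fun w => gram u v (w, w *m om 0) (+) gram u v (w, w *m om 0 + w))); last first.
  move=> l sl; rewrite om0_code -vcbD !(gramcP (qa := true) (c := false)) //.
  by case Ql: (qp 6 l) => //; rewrite /gramc Ql.
(* As [w] is nonsingular and orthogonal to its image under [om 0], the two candidates for the
   partner have different values of Q. *)
have no2 w : gram u v (w, w *m om 0) -> gram u v (w, w *m om 0 + w) -> False.
  rewrite /gram /= Qu => /and4P[/eqP Qw /eqP Qt Bt _] /and3P[_ /eqP].
  by rewrite QD Qw Qt (isJ_alt _ isJ_om) Qv addr0 (addc2 char2_F2) => /esym/eqP; rewrite oner_eq0.
have inj : {in [set t | gram u v t && om_pair t] &, injective (fst : V * V -> V)}.
  move=> [w t] [w' t'] /setIdP[+ g1] /setIdP[+ g2] /= e; rewrite -e in g2 *; move: g1 g2.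
  rewrite /om_pair /= => /orP[] /eqP-> /orP[] /eqP-> // g1 g2; [case: (no2 _ g1 g2) | case: (no2 _ g2 g1)].
rewrite -(card_in_imset inj); apply: eq_card => w; rewrite [RHS]inE; apply/imsetP/idP => [[[w' t]] | g].
  rewrite inE /om_pair /= => /andP[g /orP[] /eqP tE] ->; rewrite tE in g; rewrite g.
    by apply/negP=> g'; apply: no2 g g'.
  by rewrite addbT; apply/negP=> g'; apply: no2 g' g.
case g1: (gram u v (w, w *m om 0)) g => /= g2.
  by exists (w, w *m om 0); rewrite // inE g1 /om_pair eqxx.
by exists (w, w *m om 0 + w); rewrite // inE g2 /om_pair /= eqxx orbT.
Qed.

End Pairs.

End FrameCounts.

(** * The maxima of the fixed point ratios *)

Module RatioBounds.

Import QuadraticForms WittFrames Codings IsometryGroups ModelElements PurityCertificates Derivations Purity Decomposition ThreeCycles Overgroups PlaneStabilizer FieldStructures MaximalSubgroups PermutationCharacters Pentads FieldStructureCounts SmallRank PairCounting FrameCounts.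

Local Notation Q := Q12.
Local Notation B := (polar Q12).
Local Notation M12 := 'M['F_2]_12.
Local Notation V := 'rV['F_2]_12.

(* [lia] does not see through decimal literals above 5000. *)
Lemma bigE2 : 11318%N = (4 * 2829 + 2)%N. Proof. apply/eqP; vm_cast_no_check (erefl true). Qed.
Lemma bigE3 : 9852%N = (4 * 2463)%N. Proof. apply/eqP; vm_cast_no_check (erefl true). Qed.
Lemma bigE4 : 9996%N = (4 * 2499)%N. Proof. apply/eqP; vm_cast_no_check (erefl true). Qed.
Lemma bigE5 : 7675%N = (25 * 307)%N. Proof. apply/eqP; vm_cast_no_check (erefl true). Qed.

Section Planes.

Variable L : GLmodel 'F_2 11.
Variable L6 : GLmodel Defs.F4 5.
Local Notation G := (G12 L).
Local Notation gmx := (gmx L).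
Local Notation centE := (centE L).
Local Notation twN := (twN L).
Implicit Types (g h x y : L) (u v w z a b : V).

Definition plane g a b := [/\ exists v, v *m (gmx g - 1%:M) = a, exists v, v *m (gmx g - 1%:M) = b
  & forall z, exists al be : 'F_2, z *m (gmx g - 1%:M) = al *: a + be *: b].

Lemma appB u v g : app (u - v) g = app u g - app v g.
Proof. by rewrite !appE mulmxBl. Qed.

Lemma comm_sub1 g (X : M12) : X *m gmx g = gmx g *m X -> X *m (gmx g - 1%:M) = (gmx g - 1%:M) *m X.
Proof. by rewrite mulmxBl mulmxBr mul1mx mulmx1 => ->. Qed.

Lemma comb_mem (al be : 'F_2) a b : al *: a + be *: b \in [:: 0; a; b; a + b].
Proof.
by case: (F2_cases al) => ->; case: (F2_cases be) => ->;
  rewrite ?scale0r ?scale1r ?add0r ?addr0 !inE eqxx ?orbT.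
Qed.

(** The image of h - 1 is invariant under everything that commutes with h. *)
Lemma plane_stab g a b x : plane g a b -> (g ^ x^-1)%g \in centE -> stab (app a x^-1%g, app b x^-1%g).
Proof.
case=> -[v va] [w wb] im /centEP[_ c].
have NE z : z *m (gmx (g ^ x^-1)%g - 1%:M) = app (app z x *m (gmx g - 1%:M)) x^-1%g.
  by rewrite !app_rk1 conjgE invgK !appM appB appK.
have cN z : z *m (gmx (g ^ x^-1)%g - 1%:M) *m eps = z *m eps *m (gmx (g ^ x^-1)%g - 1%:M).
  by rewrite -!mulmxA (comm_sub1 c).
have key z0 a0 : z0 *m (gmx g - 1%:M) = a0 ->
    app a0 x^-1%g *m eps \in [:: 0; app a x^-1%g; app b x^-1%g; app a x^-1%g + app b x^-1%g].
  move=> za; have e1 : app z0 x^-1%g *m (gmx (g ^ x^-1)%g - 1%:M) = app a0 x^-1%g by rewrite NE appKV za.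
  rewrite -e1 cN NE; have [al [be ->]] := im (app (app z0 x^-1%g *m eps) x).
  by rewrite appD !appZ comb_mem.
by apply/andP; split; [exact: key va | exact: key wb].
Qed.

Lemma NE_plane g a b : plane g a b -> (NE g <= #|conj_pairs L a b stab|)%N.
Proof.
move=> pl; apply: subset_leq_card; apply/subsetP=> x; rewrite !inE => /andP[-> c] /=.
exact: plane_stab pl c.
Qed.

(** J preserves the image plane of g - 1 and sends a nonzero vector neither to 0 nor to itself. *)
Lemma plane_J g a b J : plane g a b -> a != 0 -> J \in Jlin g -> a *m J = b \/ a *m J = a + b.
Proof.
case=> -[v va] _ im na /JlinP[iJ cJ].
have cN : a *m J = v *m J *m (gmx g - 1%:M).
  by rewrite -va -!mulmxA (comm_sub1 cJ).
have [al [be]] := im (v *m J); rewrite -cN => aJ; have aJJ := isJ_vJJ a iJ.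
have := comb_mem al be a b; rewrite -aJ !inE => /or4P[] /eqP e; [| |by left|by right].
  by move: aJJ; rewrite e mul0mx add0r => /esym/eqP; rewrite (negPf na).
by move: aJJ; rewrite !e addV => /eqP; rewrite (negPf na).
Qed.

(** By [plane_J] the image of [a] under J would have product 1 with [a], but the two are
    orthogonal. *)
Lemma Jlin_nperp g a b : plane g a b -> Q a = 1 -> B a b = 1 -> Jlin g = set0.
Proof.
move=> pl Qa Bab; apply/setP=> J; rewrite [RHS]inE; apply/negP=> JJ; have [iJ _] := JlinP _ _ JJ.
have := isJ_alt a iJ; case: (plane_J pl (nonsing_neq0 Qa) JJ) => ->.
  by rewrite polar12C Bab => /eqP; rewrite oner_eq0.
by rewrite polar12Dl (polarvv char2_F2 q12) add0r polar12C Bab => /eqP; rewrite oner_eq0.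
Qed.

(* On a totally singular image the form [B u (v N)] is symmetric, so a semiregular J would make the plane orthogonal to everything. *)
Lemma Jlin_ts g a b : g \in G -> plane g a b -> Q a = 0 -> Q b = 0 -> B a b = 0 -> a != 0 -> Jlin g = set0.
Proof.
move=> Gg pl Qa Qb Bab na; apply/setP=> J; rewrite [RHS]inE; apply/negP=> JJ; have [iJ cJ] := JlinP _ _ JJ.
have aJ := plane_J pl na JJ; case: (pl) => -[v va] _ im; set N := gmx g - 1%:M in va im.
have Qim z : Q (z *m N) = 0.
  have [al [be ->]] := im z; rewrite QD (polarZl q12) (polarZr q12) Bab !mulr0 addr0.
  by case: (F2_cases al) => ->; case: (F2_cases be) => ->; rewrite ?scale0r ?scale1r ?Qa ?Qb ?(quad0 q12) ?addr0.
have sym u w : B (u *m N) w = B u (w *m N).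
  have e z : app z g = z + z *m N by rewrite app_rk1 addrC subrK.
  have := GO_polar u w Gg; rewrite !e !polar12Dl !polar12Dr => h.
  have B0 : B (u *m N) (w *m N) = 0.
    have := Qim (u + w); rewrite mulmxDl QD !Qim !add0r; exact.
  move: h; rewrite B0 addr0; move: (B u w) (B u (w *m N)) (B (u *m N) w) => p q r.
  by case: (F2_cases p) => ->; case: (F2_cases q) => ->; case: (F2_cases r) => ->.
have diag z : B z (z *m N) = 0.
  have := GO_P _ _ Gg z; have -> : app z g = z + z *m N by rewrite app_rk1 addrC subrK.
  by rewrite QD Qim addr0 => /(canRL (addKr _)); rewrite addNr.
have Bva : B v a = 0 by rewrite -{1}va diag.
have cN z : z *m J *m N = z *m N *m J by rewrite -!mulmxA (comm_sub1 cJ).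
have BvaJ : B v (a *m J) = 0.
  by have := diag (v *m J); rewrite cN va (isJ_adj _ _ iJ) isJ_vJJ // polar12Dr Bva addr0.
have Bvb : B v b = 0 by move: BvaJ; case: aJ => ->; rewrite ?polar12Dr ?Bva ?add0r.
have [z Bz] := polar12_nd na; have := Bz; rewrite -va -sym; have [al [be ->]] := im z.
rewrite polar12Dl !(polarZl q12) [B a v]polar12C [B b v]polar12C Bva Bvb !mulr0 addr0.
by move/esym/eqP; rewrite oner_eq0.
Qed.

Lemma NW_rank2 g : (rk1 g <= 3)%N -> Jlin g = set0 -> NW g = 0%N.
Proof.
move=> r3 J0; have := NW_le L6 g; rewrite J0 (Jsemi0 r3) !cards0 mul0n leqn0 => /eqP; exact.
Qed.

(** If the image of g - 1 contains a nonsingular vector, splitting off its transvection leaves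
    another transvection. Otherwise the image is a totally singular plane. *)
Lemma rank2_cases g : g \in G -> rk1 g = 2%N ->
  [\/ exists a b, [/\ Q a = 1, Q b = 1, B a b = 0, b != a & g = (refl Q L b * refl Q L a)%g],
      exists a b, [/\ plane g a b, Q a = 1, Q b = 1 & B a b = 1]
    | exists a b, [/\ plane g a b, Q a = 0, Q b = 0 & [/\ B a b = 0, a != 0, b != 0 & b != a]]].
Proof.
move=> Gg r2; set N := gmx g - 1%:M.
case: (pickP [pred z | Q (z *m N) == 1]) => [z /eqP Qz | noQ].
  have [b Qb gE] := rank_two Gg r2 Qz (submxMl z N); set a := z *m N in Qz gE.
  have nab : b != a.
    by apply: contra_eq_neq r2 => e; rewrite gE e refl_sqr // /rk1 gmx1 subrr mxrank0.
  have [Bab|Bab] := F2_cases (B a b); [apply: Or31 | apply: Or32]; exists a, b; split=> //.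
  have nb := nonsing_neq0 Qb; have na := nonsing_neq0 Qz.
  have [z1 [Ba1 Bb1]] := sep_vec na nab.
  have [|z2 [Bb2 Ba2]] := @sep_vec b a nb; first by rewrite eq_sym.
  split.
  - by exists z1; rewrite gE refl2_N // Ba1 Bb1 mul0r addr0 scale0r scale1r add0r.
  - by exists (z1 + z2); rewrite gE refl2_N // !polar12Dl Ba1 Bb1 Ba2 Bb2 [B b a]polar12C Bab addr0 add0r mulr1 (addc2 char2_F2) scale0r scale1r addr0.
  - move=> w; exists (B w a + B w b * B b a), (B w b); by rewrite gE refl2_N // addrC.
have Q0 z : Q (z *m N) = 0 by have [//|e] := F2_cases (Q (z *m N)); have := noQ z; rewrite /= e eqxx.
have [i nzi] : exists i, row i N != 0.
  have : N != 0 by rewrite -mxrank_eq0 [\rank N]r2.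
  by case/matrix0Pn=> i [j Nij]; exists i; apply: contraNneq Nij => /rowP/(_ j); rewrite !mxE => ->.
have [j nj] : exists j, ~~ (row j N <= row i N)%MS.
  apply/existsP; apply: contraT; rewrite negb_exists => /forallP h.
  have /mxrankS : (N <= row i N)%MS by apply/row_subP=> j; have := h j; rewrite negbK.
  by rewrite [\rank N]r2 rank_rV nzi.
apply: Or33; exists (row i N), (row j N); rewrite !rowE; set a := _ *m N; set b := delta_mx 0 j *m N.
have nja : ~~ (b <= a)%MS by rewrite /a /b -!rowE.
have nb : b != 0 by apply: contraNneq nja => ->; exact: sub0mx.
have nab : b != a by apply: contraNneq nja => ->.
have na : a != 0 by rewrite /a -rowE.
have Bab : B a b = 0.
  by have := Q0 (delta_mx 0 i + delta_mx 0 j); rewrite mulmxDl QD !Q0 !add0r.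
split; [split | exact: Q0 | exact: Q0 | exact: And4 Bab na nb nab]; [by exists (delta_mx 0 i) | by exists (delta_mx 0 j) | move=> z].
have sab : (a + b <= N)%MS by rewrite addsmx_sub !submxMl.
have rab : \rank (a + b)%MS = 2%N.
  have := mxrankS sab; rewrite [\rank N]r2 => le2; apply/eqP; rewrite eqn_leq le2 /=.
  have : (\rank a < \rank (a + b)%MS)%N.
    rewrite ltn_neqAle mxrankS ?addsmxSl // andbT (mxrank_leqif_eq (addsmxSl a b)).
    by apply: contra nja => /eqmxP e; rewrite e addsmxSr.
  by rewrite {1}rank_rV na.
have sN : (N <= a + b)%MS by rewrite -(geq_leqif (mxrank_leqif_sup sab)) rab [\rank N]r2.
have /sub_addsmxP[[p q] /= e] : (z *m N <= a + b)%MS by apply: submx_trans sN; apply: submxMl.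
by exists (p 0 0), (q 0 0); rewrite e [p]mx11_scalar [q]mx11_scalar !mul_scalar_mx !mxE !eqxx !mulr1n.
Qed.

Lemma c2_conj a b x : x \in G -> Q a = 1 -> Q b = 1 ->
  ((refl Q L b * refl Q L a) ^ x^-1)%g = (refl Q L (app b x^-1%g) * refl Q L (app a x^-1%g))%g.
Proof.
by move=> Gx Qa Qb; rewrite conjMg !(refl_conj char2_F2 q12) ?groupV ?Qa ?Qb ?oner_eq0.
Qed.

Lemma c2_values a b : Q a = 1 -> Q b = 1 -> B a b = 0 -> b != a ->
  (NE (refl Q L b * refl Q L a)%g * (2016 * 1023) = 11318 * #|G|)%N /\
  (NW (refl Q L b * refl Q L a)%g * (2016 * 1023) = 2016 * #|G|)%N.
Proof.
move=> Qa Qb Bab nab; have [<- <-] := perp_count L Qa Qb Bab nab.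
have aux x : x \in G -> [/\ Q (app a x^-1%g) = 1, Q (app b x^-1%g) = 1, B (app b x^-1%g) (app a x^-1%g) = 0
    & app b x^-1%g != app a x^-1%g].
  move=> Gx; rewrite !(GO_P _ _ (groupVr Gx)) (GO_polar _ _ (groupVr Gx)) polar12C; split=> //.
  by apply: contra nab => /eqP/app_inj->.
split; congr (_ * _)%N; apply: eq_card => x; rewrite [LHS]inE [RHS]inE; apply: andb_id2l => Gx;
  have [Q1 Q2 B0 n] := aux x Gx; rewrite c2_conj //; first [exact: c2_centE | exact: c2_lin].
Qed.

Lemma rank2_bound g : g \in G -> rk1 g = 2%N -> ((NE g + 2 * NW g) * (1008 * 1023) <= 7675 * #|G|)%N.
Proof.
move=> Gg r2; have r3 : (rk1 g <= 3)%N by rewrite r2.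
case: (rank2_cases Gg r2) => -[a [b]].
- case=> Qa Qb Bab nab gE; have [] := c2_values Qa Qb Bab nab; rewrite -gE bigE2 bigE5.
  move: (NE g) (NW g) #|G| => p q r; lia.
- case=> pl Qa Qb Bab; have := NE_plane pl; have := nperp_count L Qa Qb Bab.
  rewrite (NW_rank2 r3 (Jlin_nperp pl Qa Bab)).
  rewrite bigE5 ?bigE3 ?bigE4.
  by move: (NE g) #|conj_pairs L a b stab| #|G| => p q r; lia.
- case=> pl Qa Qb [Bab na nb nab]; have := NE_plane pl; have := ts_count L Qa Qb Bab na nb nab.
  rewrite (NW_rank2 r3 (Jlin_ts Gg pl Qa Qb Bab na)).
  rewrite bigE5 ?bigE3 ?bigE4.
  by move: (NE g) #|conj_pairs L a b stab| #|G| => p q r; lia.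
Qed.

Lemma card_fixV g : #|fixV g| = (2 ^ (12 - rk1 g))%N.
Proof.
have -> : fixV g = rowg (kermx (gmx g - 1%:M)).
  apply/setP=> v; rewrite inE mem_rowg; apply/eqP/sub_kermxP; rewrite app_rk1; first by move=> ->; rewrite subrr.
  by move/eqP; rewrite subr_eq0 => /eqP.
by rewrite card_rowg card_Fp // mxrank_ker.
Qed.

Lemma pow27 : (2 ^ 27 + 2 ^ 21 = 1024 * 1024 * 130)%N.
Proof. by rewrite (expnD 2 20 7) (expnD 2 20 1) (expnD 2 10 10) -mulnDr. Qed.

Lemma pent4 : (2 ^ 5.+3 * (2 ^ 5.+2 * (2 ^ 5.+1 * 2 ^ 5)) + 10 * (2079 * (2 ^ 5.+2 * 2 ^ 5.+1)) + 109 * (2079 * 1024)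
  = 256 * (128 * (64 * 32)) + 10 * (2079 * (128 * 64)) + 109 * (2079 * 1024))%N.
Proof. exact: erefl. Qed.

Lemma pent3 : (2 ^ 6.+3 * (2 ^ 6.+2 * (2 ^ 6.+1 * 2 ^ 6)) + 10 * (2079 * (2 ^ 6.+2 * 2 ^ 6.+1)) + 109 * (2079 * 1024)
  = 512 * (256 * (128 * 64)) + 10 * (2079 * (256 * 128)) + 109 * (2079 * 1024))%N.
Proof. exact: erefl. Qed.

Lemma foldr6 (a b c d e f : nat) : foldr muln 1%N [:: a; b; c; d; e; f] = (a * (b * (c * (d * (e * (f * 1))))))%N.
Proof. by []. Qed.
Lemma foldr12 (a b c d e f a' b' c' d' e' f' : nat) : foldr muln 1%N [:: a; b; c; d; e; f; a'; b'; c'; d'; e'; f'] =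
  (a * (b * (c * (d * (e * (f * (a' * (b' * (c' * (d' * (e' * (f' * 1))))))))))))%N.
Proof. by []. Qed.

(** With at most 2^8 fixed vectors the pentads give NE at most 2/1000 of |G|, and the counts of
    structures give NW at most 27/10000 of |G|. The sum NE + 2 NW is then at most 0.0074 |G|, just
    below 7675 / 1031184 = 0.00744... times |G|. *)
Lemma rank4_bound g : g \in G -> prime #[g]%g -> (4 <= rk1 g)%N ->
  ((NE g + 2 * NW g) * (1008 * 1023) <= 7675 * #|G|)%N.
Proof.
move=> Gg prg r4; have ng : g != 1%g by apply: contraTneq prg => ->; rewrite order1.
have hE : (NE g * 1000 <= 2 * #|G|)%N.
  have : (#|fixV g| <= 2 ^ 5.+3)%N by rewrite card_fixV leq_exp2l // leq_subLR addnC -leq_subLR.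
  move/NE_pent; rewrite pent4 card_stabE; move: (NE g) #|stabE L| => p q; clear; lia.
have hW : (NW g * (10 * 1000) <= 27 * #|G|)%N.
  have : (NW g <= (2 ^ 27 + 2 ^ 21) * #|G6 L6|)%N.
    by apply: leq_trans (NW_le L6 g) _; rewrite leq_mul2r leq_add ?orbT // ?card_Jlin ?card_Jsemi.
  rewrite pow27 card_G6 card_G12 foldr6 foldr12; move: (NW g) => p; clear; lia.
rewrite bigE5; move: (NE g) (NW g) #|G| hE hW => p q r; clear; lia.
Qed.

(** A power of prime order has ratios at least as large, and the even rank of an element of S
    separates ranks 2 and at least 4. *)
Lemma sigma_bound g : g \in (G^`(1))%g -> g != 1%g -> ((NE g + 2 * NW g) * (1008 * 1023) <= 7675 * #|G|)%N.
Proof.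
move=> Sg ng; pose p := pdiv #[g]%g; pose h := (g ^+ (#[g] %/ p))%g.
have prp : prime p by rewrite pdiv_prime // order_gt1.
have oh : #[h]%g = p by rewrite orderXdiv ?dvdn_div ?pdiv_dvd // divnA ?pdiv_dvd // mulKn.
have Sh : h \in (G^`(1))%g by rewrite groupX.
have Gh : h \in G by apply: subsetP (der_sub 1 G) _ Sh.
have nh : h != 1%g by rewrite -order_gt1 oh prime_gt1.
apply: (@leq_trans ((NE h + 2 * NW h) * (1008 * 1023))).
  by rewrite leq_mul2r; apply/orP; right; rewrite leq_add ?leq_mul ?NE_pow ?NW_pow.
have even : ~~ odd (rk1 h) by move: Sh; rewrite der12 inE => /andP[].
have [r3 | r4] := leqP (rk1 h) 3; last by apply: rank4_bound; rewrite ?oh.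
have r0 : rk1 h != 0%N.
  rewrite mxrank_eq0 subr_eq0; apply: contra nh => /eqP e; apply/eqP/app_eqP => v.
  by rewrite app1 appE e mulmx1.
by apply: rank2_bound => //; move: (rk1 h) even r3 r0 => [|[|[|[|k]]]].
Qed.

Lemma sigma_attained : exists g, [/\ g \in (G^`(1))%g, g != 1%g & ((NE g + 2 * NW g) * (1008 * 1023) = 7675 * #|G|)%N].
Proof.
pose a := vcb 12 (bl 12 65); pose b := vcb 12 (bl 12 67); have [q1 q2 q3] := gr_perp.
have Qa : Q a = 1 by rewrite Q12E q1.
have Qb : Q b = 1 by rewrite Q12E q2.
have Bab : B a b = 0 by rewrite polar12E q3.
have nab : b != a by rewrite vcb_eq; vm_compute.
exists (refl Q L b * refl Q L a)%g; split; first exact: reflS.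
  have [z [Bzb Bza]] := sep_vec (nonsing_neq0 Qb) (etrans (congr1 negb (eq_sym a b)) nab).
  apply/eqP=> e; have := congr1 (app z) e; rewrite app1 appM !app_refl1 // polar12Dl (polarZl q12).
  rewrite Bza Bzb [B b a]polar12C Bab mulr0 addr0 scale0r scale1r addr0 -[RHS]addr0 => /addrI b0.
  by have := nonsing_neq0 Qb; rewrite b0 eqxx.
have [] := c2_values Qa Qb Bab nab; rewrite bigE2 bigE5.
move: (NE _) (NW _) #|G| => p q r; clear; lia.
Qed.

Lemma odd_bound g : g \in G -> odd (rk1 g) -> (1 < rk1 g)%N -> (NE g * 1008 <= 73 * #|G|)%N.
Proof.
move=> Gg og r1; have r3 : (2 < rk1 g)%N by move: (rk1 g) og r1 => [|[|[|k]]].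
have : (#|fixV g| <= 2 ^ 6.+3)%N by rewrite card_fixV leq_exp2l // leq_subLR addnC -leq_subLR.
move/NE_pent; rewrite pent3 card_stabE; move: (NE g) #|stabE L| => p q; clear; lia.
Qed.

Lemma refl_centE u : Q u = 1 -> (refl Q L u \in centE) = UW u.
Proof.
move=> Qu; have cN z : z *m (gmx (refl Q L u) - 1%:M) = B z u *: u.
  by rewrite app_rk1 app_refl1 // addrC addKr.
apply/centEP/orP => [[_ c] | Uu].
  have [z Bz] := polar12_nd (nonsing_neq0 Qu).
  have := congr1 (mulmx z) (comm_sub1 c); rewrite !mulmxA !cN -scalemxAl Bz scale1r => <-.
  by case: (F2_cases (B (z *m eps) u)) => ->; rewrite ?scale0r ?scale1r; [left | right].
have [al uE] : exists al : 'F_2, u *m eps = al *: u.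
  by case: Uu => /eqP->; [exists 0; rewrite scale0r | exists 1; rewrite scale1r].
split; first exact: refl_in_G.
suff cE : eps *m (gmx (refl Q L u) - 1%:M) = (gmx (refl Q L u) - 1%:M) *m eps.
  by move: cE; rewrite mulmxBr mulmxBl mulmx1 mul1mx => /addIr.
apply: gmx_eqP => z; rewrite !mulmxA !cN -scalemxAl eps_adj uE (polarZr q12) scalerA mulrC; exact: erefl.
Qed.

Lemma witt_one : witt_ok false [:: false; true] addb andb 11 (qp 6) [::] [:: bl 12 65].
Proof. vm_cast_no_check (erefl true). Qed.
Lemma size_one : witt_sizes false [:: false; true] addb andb 11 (qp 6) [::] [:: bl 12 65] = [:: 2016]%N.
Proof. apply/eqP; vm_cast_no_check (erefl true). Qed.
Lemma q_one : qp 6 (bl 12 65) = true. Proof. by []. Qed.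
Lemma cnt_one : count (fun l => if qp 6 l then UWc l else false) (allv [:: false; true] 12) = 146%N.
Proof. apply/eqP; vm_cast_no_check (erefl true). Qed.

(** The transvection stabilises U exactly when its vector lies in U or in W, which holds for 10 +
    136 of the 2016 nonsingular vectors. *)
Lemma refl_value u : Q u = 1 -> (NE (refl Q L u) * 1008 = 73 * #|G|)%N.
Proof.
move=> Qu; pose a := vcb 12 (bl 12 65); have Qa : Q a = 1 by rewrite Q12E q_one.
have surj v : Q v = 1 -> exists2 y, y \in G & app v y = a.
  move=> Qv; have [|||y Ry [_ [ya]]] := @witt_tuple _ _ _ _ _ _ _ _ codingF2 _ _ _ char2_F2 q12 Q12E L [::] [:: bl 12 65] [:: v] witt_one.
  - by rewrite /= Qv Qa !eqxx.
  - by rewrite /= andbT nonsing_neq0.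
  - by [].
  by exists y => //; apply: subsetP (refl_group_sub char2_F2 q12 L) _ Ry.
have [y Gy uy] := surj u Qu.
have -> : NE (refl Q L u) = NE (refl Q L a).
  by rewrite -uy -(refl_conj char2_F2 q12) ?Qu ?oner_eq0 // /NE conj_inJ.
set H := fixer_group Q12 L [:: a].
have cG : #|G| = (2016 * #|H|)%N.
  have al : all [in allv [:: false; true] 12] [:: bl 12 65] := introT andP (conj (mem_allvb (erefl : size (bl 12 65) = 12%N)) isT).
  by have := card_fixer codingF2 char2_F2 q12 Q12E L witt_one al; rewrite size_one /= fixer_nil => ->.
have : NE (refl Q L a) = (#|[set v | (Q v == 1%R) && UW v]| * #|H|)%N.
  rewrite -(@orbit_count _ _ (G12 L) H (fun x => app a x^-1%g) (fun v => Q v == 1) UW).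
  - apply: eq_card => x; rewrite [LHS]inE [RHS]inE; apply: andb_id2l => Gx.
    by rewrite (refl_conj char2_F2 q12) ?groupV ?Qa ?oner_eq0 // refl_centE // (GO_P _ _ (groupVr Gx)).
  - by apply/subsetP=> x /fixerP[].
  - move=> x z Gx Gz; apply/eqP/fixerP => [e | [_ fx]].
      split; first by rewrite groupM ?groupV.
      by move=> w; rewrite inE => /eqP->; rewrite appM e appKV.
    by rewrite -{2}(fx a (mem_head _ _)) -appM mulgK.
  - by move=> v /eqP/surj[x Gx xa]; exists x; rewrite // -xa appK.
  - by move=> x Gx; rewrite (GO_P _ _ (groupVr Gx)) Qa.
rewrite (card_codes (p := fun l => if qp 6 l then UWc l else false)).
  by rewrite cnt_one cG => ->; move: #|H| => k; clear; lia.
by move=> l sl; rewrite UW_code Q12E; case: (qp 6 l); rewrite ?eqxx // eq_sym oner_eq0.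
Qed.

Lemma sigma'_bound g : g \in G -> odd (rk1 g) -> (NE g * 1008 <= 73 * #|G|)%N.
Proof.
move=> Gg og; have [r1 | r1] := leqP (rk1 g) 1; last exact: odd_bound.
have r1' : rk1 g = 1%N by move: (rk1 g) og r1 => [|[|k]].
by have [a Qa ->] := rank_one Gg r1'; rewrite refl_value.
Qed.

Lemma sigma'_attained : exists g, [/\ g \in G, odd (rk1 g), #[g]%g = 2%N & (NE g * 1008 = 73 * #|G|)%N].
Proof.
pose a := vcb 12 (bl 12 65); have Qa : Q a = 1 by rewrite Q12E q_one.
have o : odd (rk1 (refl Q L a)) by rewrite (rk1_refl1 char2_F2 q12) ?Qa ?oner_eq0.
exists (refl Q L a); split; [exact: refl_in_G | exact: o | | exact: refl_value].
apply: nt_prime_order => //; first by rewrite expgS expg1 refl_sqr.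
by apply: contraTneq o => ->; rewrite rk1_1.
Qed.

End Planes.

End RatioBounds.

(** * Conjugation back from the model pair to s *)

Module Transport.

Import QuadraticForms WittFrames Codings IsometryGroups ModelElements PurityCertificates Derivations Purity Decomposition ThreeCycles Overgroups Reduction PlaneStabilizer FieldStructures Wedge MaximalSubgroups PermutationCharacters Pentads FieldStructureCounts SmallRank PairCounting FrameCounts RatioBounds.

Section Conjugation.

Variable gT : finGroupType.
Implicit Types (H K M N : {group gT}) (g x z : gT).

Lemma card_conj_inJ H M g z : z \in 'N(H)%g ->
  #|conj_in H (M :^ z^-1)%G g| = #|conj_in H M (g ^ z)%g|.
Proof.
move=> Nz; rewrite -[LHS](card_imset _ (conjg_inj z)); apply: eq_card => x; rewrite [RHS]inE.
apply/imsetP/andP => [[y /setIdP[Hy c] ->] | [Hx c]].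
  by rewrite memJ_norm // -conjVg -conjgM -conjgC conjgM -mem_conjgV.
exists (x ^ z^-1)%g; last by rewrite conjgKV.
rewrite inE memJ_norm ?groupV // Hx /= mem_conjgV -conjVg -conjgM.
by rewrite -conjgCV conjgM.
Qed.

Lemma permchar_ratioJ H M g z : M \subset H -> z \in 'N(H)%g -> g \in H ->
  (permchar H (M :^ z^-1)%G g)%:R / (permchar H (M :^ z^-1)%G 1%g)%:R =
  (permchar H M (g ^ z)%g)%:R / (permchar H M 1%g)%:R :> rat.
Proof.
move=> sMH Nz Hg; have NzV : z^-1%g \in 'N(H)%g by rewrite groupV.
rewrite !permchar_ratio ?memJ_norm //; first by rewrite card_conj_inJ.
by rewrite -(normP NzV) conjSg.
Qed.

Lemma conj_quotient M N z : (N <| M)%g -> (M / N \isog (M :^ z) / (N :^ z))%g.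
Proof.
move=> nNM; have inj := injm_conj M z; have q := injm_quotm nNM inj.
have := sub_isog (subxx _) q; rewrite morphim_quotm.
have -> : (conjgm_morphism M z @* N)%g = (N :^ z)%g by rewrite morphim_conj (setIidPr (normal_sub nNM)).
by rewrite morphim_conj setIid.
Qed.

Lemma conj_index2_type (X : finGroupType) (Y : {group X}) M z :
  (exists N : {group gT}, [/\ N <| M, N \isog Y & #|M / N| = 2])%g ->
  exists N : {group gT}, [/\ (N <| (M :^ z)%G)%g, (N \isog Y)%g & #|(M :^ z)%G / N|%g = 2%N].
Proof.
case=> N [nN iN cN]; exists (N :^ z)%G; split; first by rewrite /= normalJ.
  by rewrite -(isog_transl _ (conj_isog N z)).
exact: etrans (esym (card_isog (conj_quotient z nN))) cN.
Qed.

Lemma conj_klein_type (X X' : finGroupType) (Y : {group X}) (Y' : {group X'}) M z :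
  (exists N : {group gT}, [/\ N <| M, N \isog Y', N \isog Y & M / N \isog [set: 'Z_2 * 'Z_2]])%g ->
  exists N : {group gT}, [/\ (N <| (M :^ z)%G)%g, (N \isog Y')%g, (N \isog Y)%g & ((M :^ z)%G / N \isog [set: 'Z_2 * 'Z_2])%g].
Proof.
case=> N [nN iN' iN cN]; exists (N :^ z)%G; split; first by rewrite /= normalJ.
- by rewrite -(isog_transl _ (conj_isog N z)).
- by rewrite -(isog_transl _ (conj_isog N z)).
by apply: isog_trans cN; rewrite isog_sym; exact: conj_quotient.
Qed.

End Conjugation.

Section Transport.

Variable L : GLmodel 'F_2 11.
Variable L4 : GLmodel 'F_2 3.
Variable L8 : GLmodel 'F_2 7.
Variable L6 : GLmodel Defs.F4 5.
Variable K4 : GLmodel Defs.F4 3.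
Hypothesis cardK4 : #|[set: K4]| = #|'GL_4[Defs.F4]|%g.
Local Notation G := (G12 L).
Local Notation S := (G^`(1))%g.
Local Notation gx := (gx L).
Local Notation gy := (gy L).
Local Notation gf := (gf L).
Local Notation centE := (centE L).
Local Notation twN := (twN L).
Local Notation M1 := (M1 L).

Variables (s A : L).
Hypothesis GA : A \in G.
Hypothesis sA : forall M : {group L}, ((s ^ A)%g \in M) = (gx \in M) && (gy \in M).

Definition cj (M : {group L}) : {group L} := (M :^ A^-1)%G.

Lemma cj_inj : injective cj.
Proof. by move=> M N /(congr1 val) e; apply: val_inj; exact: conjsg_inj e. Qed.

Lemma S_conjA : (S :^ A = S)%g. Proof. exact: normP (subsetP (der_norm 1 G) _ GA). Qed.
Lemma S_normA : A \in 'N(S)%g. Proof. exact: (subsetP (der_norm 1 G) _ GA). Qed.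
Lemma G_normA : A \in 'N(G)%g. Proof. exact: (subsetP (normG G) _ GA). Qed.

Lemma maxsubs_conj (H : {group L}) (D : {set {group L}}) : A \in 'N(H)%g ->
  [set M : {group L} | maximal M H & (gx \in M) && (gy \in M)] = D -> maxsubs H s = cj @: D.
Proof.
move=> NA <-; apply/setP=> M; rewrite inE; apply/andP/imsetP => [[mM sM] | [N + ->]].
  exists (M :^ A)%G; last by apply: val_inj; rewrite /= conjsgK.
  by rewrite inE -{1}(normP NA) maximalJ mM -sA /= memJ_conjg.
rewrite inE => /andP[mN]; rewrite -sA => sN; split.
  by rewrite -(normP (groupVr NA)) /= maximalJ.
by rewrite /= mem_conjgV.
Qed.

Lemma maxsubs_S : maxsubs S s = [set cj M1; cj (twN 0); cj (twN 1)].
Proof.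
by rewrite (maxsubs_conj (H := [group of S]) S_normA (maxsubs_model L L6)) !imsetU !imset_set1.
Qed.

Lemma maxsubs'_G : maxsubs' G S s = [set cj centE].
Proof.
have e := maxsubs_conj (H := G) G_normA (erefl _); rewrite -imset_set1 -(maxsubs'_model L L6).
apply/setP=> M; rewrite [LHS]inE e; apply/andP/imsetP => [[/imsetP[N + ->] nS] | [N + ->]].
  rewrite inE => h; exists N => //; rewrite inE h /=; apply: contra nS => /eqP e1.
  by rewrite /= e1 -{1}S_conjA conjsgK.
rewrite inE => /andP[h nS]; split; first by apply/imsetP; exists N; rewrite ?inE.
by apply: contra nS => /eqP/= e1; rewrite -S_conjA -e1 conjsgKV.
Qed.

Lemma sigma_at_S g : g \in S -> sigma_at S s g = (NE (g ^ A)%g + 2 * NW (g ^ A)%g)%:R / #|G|%:R.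
Proof.
move=> Sg; rewrite /sigma_at (maxsubs_conj (H := [group of S]) S_normA (maxsubs_model L L6)).
rewrite big_imset => [|M N _ _ /cj_inj //]; rewrite -model_sigma ?memJ_norm ?S_normA //.
apply: eq_bigr => M MM; apply: (@permchar_ratioJ _ [group of S]) => //; last exact: S_normA.
by move: MM; rewrite !inE -orbA => /or3P[] /eqP->; rewrite ?M1S ?twNS.
Qed.

Lemma sigma'_at_G g : g \in G -> sigma'_at G S s g = (NE (g ^ A)%g)%:R / #|G|%:R.
Proof.
move=> Gg; rewrite /sigma'_at maxsubs'_G -model_sigma' ?groupJ // !big_set1.
apply: permchar_ratioJ => //; last exact: G_normA.
by apply/subsetP=> x /centEP[].
Qed.

Lemma ratio_le (p n m k : nat) : (0 < k)%N -> (0 < m)%N -> (p * m <= n * k)%N ->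
  p%:R / k%:R <= n%:R / m%:R :> rat.
Proof.
move=> k0 m0 h; rewrite ler_pdivrMr ?ltr0n // mulrAC ler_pdivlMr ?ltr0n //.
by rewrite -!natrM ler_nat.
Qed.

Lemma ratio_eq (p n m k : nat) : (0 < k)%N -> (0 < m)%N -> (p * m = n * k)%N ->
  p%:R / k%:R = n%:R / m%:R :> rat.
Proof.
move=> k0 m0 h; apply/eqP; rewrite eqr_div ?pnatr_eq0 -?lt0n //.
by rewrite -!natrM h.
Qed.

Lemma sigma_S : sigma S s = 7675%:R / (1008 * 1023)%:R.
Proof.
have G0 : (0 < #|G|)%N := cardG_gt0 G; have m0 : (0 < 1008 * 1023)%N by rewrite muln_gt0.
apply/le_anti/andP; split.
  apply: bigmax_le => [|g /setD1P[ng Sg]]; first by rewrite divr_ge0 ?ler0n.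
  have Sg' : (g ^ A)%g \in S by rewrite memJ_norm ?S_normA.
  have ng' : (g ^ A)%g != 1%g by rewrite conjg_eq1.
  rewrite (sigma_at_S Sg); exact: (ratio_le G0 m0 (sigma_bound L6 Sg' ng')).
have [g [Sg ng e]] := sigma_attained L; pose h := (g ^ A^-1)%g.
have Sh : h \in S by rewrite memJ_norm ?groupV ?S_normA.
apply: le_trans (le_bigmax_cond _ _ (j := h) _); last by rewrite !inE conjg_eq1 ng.
by rewrite (sigma_at_S Sh) conjgKV (ratio_eq G0 m0 e); exact: lexx.
Qed.

Lemma sigma'_G : sigma' G S s = 73%:R / 1008%:R.
Proof.
have G0 : (0 < #|G|)%N := cardG_gt0 G.
have m0' : (0 < 1008)%N by [].
have odd_out g : g \in G -> (g \notin S) = odd (rk1 g) by move=> Gg; rewrite der12 inE Gg /= negbK.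
apply/le_anti/andP; split.
  apply: bigmax_le => [|g /andP[/setDP[Gg nSg] _]]; first by rewrite divr_ge0 ?ler0n.
  have Gg' : (g ^ A)%g \in G by rewrite groupJ.
  have og : odd (rk1 (g ^ A)%g) by rewrite -odd_out // memJ_norm ?S_normA.
  rewrite (sigma'_at_G Gg); exact: (ratio_le G0 m0' (sigma'_bound Gg' og)).
have [g [Gg og g2 e]] := sigma'_attained L; pose h := (g ^ A^-1)%g.
have Gh : h \in G by rewrite groupJ ?groupV.
have i2 : #|G : S|%g = 2%N := index12 L.
apply: le_trans (le_bigmax_cond _ _ (j := h) _); last first.
  rewrite inE Gh andbT orderJ g2 i2 eqxx andbT memJ_norm ?groupV ?S_normA //.
  by rewrite odd_out.
by rewrite (sigma'_at_G Gh) conjgKV (ratio_eq G0 m0' e); exact: lexx.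
Qed.

Theorem transported :
  [/\ exists M1 M2 M3 : {group L},
        [/\ maxsubs S s = [set M1; M2; M3],
            uniq [:: M1; M2; M3],
            exists N : {group L},
              [/\ (N <| M1)%g, (N \isog setX (G4 L4)^`(1) (G8 L8)^`(1))%g & #|M1 / N|%g = 2%N],
            (exists N : {group L}, [/\ (N <| M2)%g, (N \isog SLg K4 / 'Z(SLg K4))%g, (N \isog (G6 L6)^`(1))%g
               & (M2 / N \isog [set: 'Z_2 * 'Z_2])%g]) /\
            (exists N : {group L}, [/\ (N <| M3)%g, (N \isog SLg K4 / 'Z(SLg K4))%g, (N \isog (G6 L6)^`(1))%g
               & (M3 / N \isog [set: 'Z_2 * 'Z_2])%g])
          & (exists2 x, x \in G & M3 :=: M2 :^ x)%g /\
            ~ (exists2 x, x \in S & M3 :=: M2 :^ x)%g],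
      sigma S s = 7675%:R / (1008 * 1023)%:R
    & sigma' G S s = 73%:R / 1008%:R].
Proof.
split; [| exact: sigma_S | exact: sigma'_G]; exists (cj M1), (cj (twN 0)), (cj (twN 1)).
have tw1 : twN 1 :=: (twN 0 :^ gf)%g by rewrite -(twN_conj L 0) addr0.
have t0 : exists N : {group L}, [/\ (N <| twN 0%R)%g, (N \isog SLg K4 / 'Z(SLg K4))%g, (N \isog (G6 L6)^`(1))%g
               & (twN 0%R / N \isog [set: 'Z_2 * 'Z_2])%g].
  have [N [nN iN qN]] := twN_type L L6; exists N; split=> //.
  by rewrite (isog_transl _ iN) isog_sym; apply: PSL_isog.
split.
- exact: maxsubs_S.
- rewrite /= !inE !(inj_eq cj_inj) negb_or andbT; apply/andP; split; [apply/andP; split|].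
  + by apply/eqP=> e1; have := g3_twN L 0; rewrite -e1 g3_M1.
  + by apply/eqP=> e1; have := g3_twN L 1; rewrite -e1 g3_M1.
  + apply/eqP=> e1; have := gw_twN L 1; rewrite -e1 gw_twN eqxx.
    by move/esym; rewrite oner_eq0.
- exact/conj_index2_type/M1_type.
- split; first exact: conj_klein_type.
  have -> : cj (twN 1) = (twN 0 :^ (gf * A^-1))%G by apply: val_inj; rewrite /= conjsgM -tw1.
  exact: conj_klein_type.
- split.
    exists (gf ^ A^-1)%g; first by rewrite groupJ ?groupV ?gfG.
    by rewrite /= tw1 -!conjsgM -conjgC.
  case=> x Sx /= e; apply: (@twN_not_conj L L6 (x ^ A)%g); first by rewrite memJ_norm ?S_normA.
  apply: (@conjsg_inj _ A^-1%g); rewrite e -!conjsgM; congr (_ :^ _)%g.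
  by rewrite conjgCV invgK.
Qed.

End Transport.

End Transport.

(** * The concrete matrix groups and the theorem *)

Import QuadraticForms WittFrames Codings IsometryGroups ModelElements PurityCertificates Derivations Purity Decomposition ThreeCycles Overgroups Reduction PlaneStabilizer FieldStructures Wedge MaximalSubgroups PermutationCharacters Pentads FieldStructureCounts SmallRank PairCounting FrameCounts RatioBounds Transport.

(** One step of the decimal parser for each digit occurring in 1031184, with the tail-recursive
    product replaced by the ordinary one. *)
Lemma of_uint_acc0 d a : Nat.of_uint_acc (Decimal.D0 d) a = Nat.of_uint_acc d (10 * a)%N.
Proof. by rewrite -[(10 * a)%N]PeanoNat.Nat.tail_mul_spec. Qed.
Lemma of_uint_acc1 d a : Nat.of_uint_acc (Decimal.D1 d) a = Nat.of_uint_acc d (10 * a).+1.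
Proof. by rewrite -[(10 * a)%N]PeanoNat.Nat.tail_mul_spec. Qed.
Lemma of_uint_acc3 d a : Nat.of_uint_acc (Decimal.D3 d) a = Nat.of_uint_acc d (10 * a).+3.
Proof. by rewrite -[(10 * a)%N]PeanoNat.Nat.tail_mul_spec. Qed.
Lemma of_uint_acc4 d a : Nat.of_uint_acc (Decimal.D4 d) a = Nat.of_uint_acc d (10 * a).+4.
Proof. by rewrite -[(10 * a)%N]PeanoNat.Nat.tail_mul_spec. Qed.
Lemma of_uint_acc8 d a : Nat.of_uint_acc (Decimal.D8 d) a = Nat.of_uint_acc d (10 * a).+4.+4.
Proof. by rewrite -[(10 * a)%N]PeanoNat.Nat.tail_mul_spec. Qed.

(* The literal is unary once evaluated, which overflows the stack, so its decimal digits are read off one by one. *)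
Lemma denominatorE : 1031184%N = (1008 * 1023)%N.
Proof.
rewrite /Nat.of_num_uint /Nat.of_uint.
rewrite of_uint_acc1 of_uint_acc0 of_uint_acc3 !of_uint_acc1 of_uint_acc8 of_uint_acc4.
rewrite [LHS]/Nat.of_uint_acc; lia.
Qed.

Section Concrete.

Variables (F : finFieldType) (m : nat).

(** Singular matrices are sent to the identity as a default. *)
Definition GLinsub (A : 'M[F]_m.+1) : {'GL_m.+1[F]} := insubd (1%g : {'GL_m.+1[F]}) A.

Lemma GLinsubE A : A \in unitmx -> GLval (GLinsub A) = A.
Proof. by move=> uA; apply: insubdK. Qed.

Definition GLconcrete : GLmodel F m := @MakeGLmodel F m {'GL_m.+1[F]} (@GLval m.+1 F) erefl
  (fun _ _ => erefl) val_inj GLinsub GLinsubE.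

Lemma GO_iso (Q : 'rV[F]_m.+1 -> F) : GO m.+1 Q = iso Q GLconcrete.
Proof.
apply/setP=> g; rewrite [LHS]inE; apply/forallP/(@GO_P _ _ Q GLconcrete g) => [h v | h v].
  by rewrite appE; apply/eqP/h.
by apply/eqP; have := h v; rewrite appE.
Qed.

Lemma Omega_iso (Q : 'rV[F]_m.+1 -> F) : Omega m.+1 Q = ((iso Q GLconcrete)^`(1))%g.
Proof. by rewrite /Omega GO_iso. Qed.

End Concrete.

Local Notation L12 := (GLconcrete 'F_2 11).
Local Notation L4 := (GLconcrete 'F_2 3).
Local Notation L8 := (GLconcrete 'F_2 7).
Local Notation L6 := (GLconcrete Defs.F4 5).
Local Notation K4 := (GLconcrete Defs.F4 3).

Lemma GOp12_model : GOp12 = G12 L12.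
Proof. by rewrite /GOp12 GO_iso /G12 Q12_plus. Qed.
Lemma Op12_model : Op12 = ((G12 L12)^`(1))%g.
Proof. by rewrite /Op12 Omega_iso /G12 Q12_plus. Qed.
Lemma Om4_model : Om4 = ((G4 L4)^`(1))%g. Proof. exact: Omega_iso. Qed.
Lemma Om8_model : Om8 = ((G8 L8)^`(1))%g. Proof. exact: Omega_iso. Qed.
Lemma Op6_4_model : Op6_4 = ((G6 L6)^`(1))%g. Proof. exact: Omega_iso. Qed.

Lemma SL_model : SL Defs.F4 4 = SLg K4.
Proof. apply/setP=> g; rewrite [LHS]inE; exact: esym (@SLgP K4 g). Qed.

Lemma L4_4_model (N : {group L12}) : (N \isog SLg K4 / 'Z(SLg K4))%g -> (N \isog L4_4)%g.
Proof. by rewrite /L4_4 /PSL SL_model. Qed.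

Lemma cardK4 : #|[set: K4]| = #|'GL_4[Defs.F4]|%g.
Proof. by []. Qed.

Lemma stable_module (s : L12) (X : 'M['F_2]_12) :
  mxmodule (natural_repr s) X = (X *m gmx L12 s <= X)%MS.
Proof.
apply/mxmoduleP/idP => [h | sX _ /cycleP[n ->]]; first exact: h _ (cycle_id s).
apply/row_subP=> i; rewrite row_mul; have := stab_pow n sX (row_sub i X); rewrite appE; exact.
Qed.

Lemma type_Om_model (M : {group L12}) : (exists N : {group L12},
    [/\ (N <| M)%g, (N \isog setX (G4 L4)^`(1) (G8 L8)^`(1))%g & #|M / N|%g = 2%N]) -> type_Om4xOm8_2 M.
Proof.
by case=> N [n1 n2 n3]; exists N; split; [exact: n1 | rewrite Om4_model Om8_model; exact: n2 | exact: n3].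
Qed.

Lemma type_L44_model (M : {group L12}) : (exists N : {group L12},
    [/\ (N <| M)%g, (N \isog SLg K4 / 'Z(SLg K4))%g, (N \isog (G6 L6)^`(1))%g
      & (M / N \isog [set: 'Z_2 * 'Z_2])%g]) -> type_L44_2_2 M.
Proof.
case=> N [n1 n2 n3 n4]; exists N; split; [exact: n1 | exact: L4_4_model n2 | | exact: n4].
rewrite Op6_4_model; exact: n3.
Qed.

Theorem mainTheorem19 (s : {'GL_12['F_2]}) (sS : s \in Op12)
    (s_type : type_4m_8m s) (s_order : #[s]%g = 85%N) :
  [/\ exists M1 M2 M3 : {group {'GL_12['F_2]}},
        [/\ maxsubs Op12 s = [set M1; M2; M3],
            uniq [:: M1; M2; M3],
            type_Om4xOm8_2 M1,
            type_L44_2_2 M2 /\ type_L44_2_2 M3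
          & (exists2 x, x \in GOp12 & M3 :=: M2 :^ x)%g /\
            ~ (exists2 x, x \in Op12 & M3 :=: M2 :^ x)%g],
      sigma Op12 s = 7675%:R / 1031184%:R
    & sigma' GOp12 Op12 s = 73%:R / 1008%:R].
Proof.
case: s_type => U [W [[rU [mU _ irU] _] [rW [mW _ irW] _] perp _ sumUW]].
have Gs : s \in G12 L12 by apply: subsetP (der_sub 1 (G12 L12)) _ _; rewrite -Op12_model.
rewrite stable_module in mU; rewrite stable_module in mW.
have irrU (X : 'M_12) : (X *m gmx L12 s <= X)%MS -> (X <= U)%MS -> X != 0 -> (U <= X)%MS.
  by rewrite -stable_module; apply: irU.
have irrW (X : 'M_12) : (X *m gmx L12 s <= X)%MS -> (X <= W)%MS -> X != 0 -> (W <= X)%MS.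
  by rewrite -stable_module; apply: irW.
have perpUW (u w : 'rV_12) : (u <= U)%MS -> (w <= W)%MS -> polar Q12 u w = 0.
  by rewrite Q12_plus; apply: perp.
have UW1 : (1%:M <= U + W)%MS by rewrite sumUW.
have [A GA sA] := reduction Gs s_order rU rW mU mW irrU irrW perpUW UW1.
have [[M1 [M2 [M3 [mE uM t1 [t2 t3] [cG cS]]]]] sE s'E] := transported L4 L8 L6 cardK4 GA sA.
rewrite Op12_model GOp12_model; split.
- exists M1, M2, M3; split; [exact: mE | exact: uM | exact: type_Om_model t1 | | exact: conj cG cS].
  exact: conj (type_L44_model t2) (type_L44_model t3).
- rewrite [LHS]sE -denominatorE; exact: erefl.
- exact: s'E.
Qed.
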